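(* (i) It is true in the Basic Fraenkel Model $\mathcal{N}1$ that every first-countable limit point compact $T_1$-space is well-orderable. (ii) The sentence ''every infinite first-countable Hausdorff compact space contains a copy of $\mathbb{N}(\infty)$'' is true in $\mathcal{N}1$ and in the Mostowski Linearly Ordered Model $\mathcal{N}3$. (iii) The sentence ''every infinite first-countable Hausdorff compact space contains an infinite metrizable compact scattered subspace'' is true in the Second Fraenkel Model $\mathcal{N}2$. (iv) The sentence ''every infinite first-countable Hausdorff compact space contains an infinite metrizable compact scattered subspace'' implies neither $\mathbf{CAC}_{fin}$ nor $\mathbf{IQDI}$, nor $\mathbf{CMC}$ in $\mathbf{ZFA}$.
   Context: $\mathbf{ZFA}$ is Zermelo-Fraenkel set theory (without choice) with atoms. ''$\Phi$ does not imply $\Psi$ in $\mathbf{ZFA}$'' means that $\Phi\rightarrow\Psi$ is not provable in $\mathbf{ZFA}$ (relative to consistency, as usual). Permutation models are built from a ground model of $\mathbf{ZFA}+\mathbf{AC}$ with set of atoms $A$, a group $G$ of permutations of $A$, and the normal filter of subgroups generated by the pointwise stabilizers of finite subsets of $A$ (finite supports); the model consists of the hereditarily symmetric elements. - $\mathcal{N}1$ (Basic Fraenkel Model): $A$ is denumerable and $G$ is the group of all permutations of $A$. - $\mathcal{N}2$ (Second Fraenkel Model): $A=\bigcup_{n\in\omega}A_n$ is a denumerable disjoint union of pairs $A_n=\{a_n,b_n\}$ and $G$ is the group of all permutations of $A$ that map each $A_n$ onto itself. - $\mathcal{N}3$ (Mostowski Linearly Ordered Model): $A$ is denumerable with a linear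 order isomorphic to that of the rationals, and $G$ is the group of all order-automorphisms of $A$. Topological notions: limit point compact means every infinite subset has an accumulation point in the space; compact means every open cover has a finite subcover; first-countable means every point has a countable base of open neighborhoods; a space is scattered if every non-empty subspace has an isolated point; a space is well-orderable if its underlying set is; $\mathbb{N}(\infty)$ is the one-point (Alexandroff) compactification of the discrete space $\mathbb{N}$; ''contains a copy'' means has a homeomorphic subspace. Principles: $\mathbf{CAC}_{fin}$: every denumerable family of non-empty finite sets has a choice function. $\mathbf{IQDI}$: for every infinite set $X$, $\omega$ injects into the set $[X]^{<\omega}$ of finite subsets of $X$. $\mathbf{CMC}$: for every denumerable family $\mathcal{A}$ of non-empty sets there is a function assigning to each $x\in\mathcal{A}$ a non-empty finite subset of $x$. *)

(* Defs.v *)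
From Stdlib Require Import List.
Import ListNotations.

(** * First-order formulas over the signature (membership, equality, atom) *)

(** [fm V] is the higher-order (PHOAS) syntax in which concrete formulas are
    written; [V] is the type of variables.  Taking [V] to be the carrier of a
    structure gives formulas with parameters in that structure. *)
Inductive fm (V : Type) : Type :=
| FMem (x y : V)
| FEq (x y : V)
| FAtom (x : V)
| FFalse
| FImp (p q : fm V)
| FAnd (p q : fm V)
| FOr (p q : fm V)
| FAll (p : V -> fm V)
| FEx (p : V -> fm V).
Arguments FMem {V}. Arguments FEq {V}. Arguments FAtom {V}.
Arguments FFalse {V}. Arguments FImp {V}. Arguments FAnd {V}.
Arguments FOr {V}. Arguments FAll {V}. Arguments FEx {V}.

(** Formulas whose free variables are numbered by [nat], and sentences. *)
Definition open_formula : Type := forall V : Type, (nat -> V) -> fm V.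
Definition sentence : Type := forall V : Type, fm V.
Definition as_open (p : sentence) : open_formula := fun V _ => p V.

Declare Scope fo_scope.
Delimit Scope fo_scope with fo.
Bind Scope fo_scope with fm.

Notation "x ∈ y" := (FMem x y) (at level 70, no associativity) : fo_scope.
Notation "x ≐ y" := (FEq x y) (at level 70, no associativity) : fo_scope.
Notation "¬ p" := (FImp p%fo FFalse) (at level 75, right associativity) : fo_scope.
Notation "p ∧ q" := (FAnd p%fo q%fo) (at level 80, right associativity) : fo_scope.
Notation "p ∨ q" := (FOr p%fo q%fo) (at level 85, right associativity) : fo_scope.
Notation "p → q" := (FImp p%fo q%fo)
  (at level 99, q at level 200, right associativity) : fo_scope.
Notation "p ↔ q" := (FAnd (FImp p%fo q%fo) (FImp q%fo p%fo))
  (at level 95, no associativity) : fo_scope.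
Notation "∀ x .. y , p" := (FAll (fun x => .. (FAll (fun y => p%fo)) ..))
  (at level 200, x binder, y binder, right associativity) : fo_scope.
Notation "∃ x .. y , p" := (FEx (fun x => .. (FEx (fun y => p%fo)) ..))
  (at level 200, x binder, y binder, right associativity) : fo_scope.
Notation "∀' x ∈ a , p" := (FAll (fun x => FImp (FMem x a) p%fo))
  (at level 200, x name, a at level 69, right associativity) : fo_scope.
Notation "∃' x ∈ a , p" := (FEx (fun x => FAnd (FMem x a) p%fo))
  (at level 200, x name, a at level 69, right associativity) : fo_scope.
Local Open Scope fo_scope.

(** De Bruijn formulas, used for the proof system and for the formulas ranged
    over by the axiom schemata.  All terms are variables, so substitution is
    renaming. *)
Inductive form : Type :=
| Mem (i j : nat)
| Eq (i j : nat)
| Atom (i : nat)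
| Fal
| Imp (p q : form)
| And (p q : form)
| Or (p q : form)
| All (p : form)
| Ex (p : form).

Definition scons {X : Type} (x : X) (env : nat -> X) (i : nat) : X :=
  match i with O => x | S j => env j end.

Fixpoint ren (r : nat -> nat) (p : form) : form :=
  match p with
  | Mem i j => Mem (r i) (r j)
  | Eq i j => Eq (r i) (r j)
  | Atom i => Atom (r i)
  | Fal => Fal
  | Imp p q => Imp (ren r p) (ren r q)
  | And p q => And (ren r p) (ren r q)
  | Or p q => Or (ren r p) (ren r q)
  | All p => All (ren (scons 0 (fun i => S (r i))) p)
  | Ex p => Ex (ren (scons 0 (fun i => S (r i))) p)
  end.

Definition shift : form -> form := ren S.
(** [inst i p] replaces variable 0 of [p] by variable [i]. *)
Definition inst (i : nat) : form -> form := ren (scons i (fun j => j)).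

Fixpoint embed {V : Type} (p : form) (env : nat -> V) : fm V :=
  match p with
  | Mem i j => FMem (env i) (env j)
  | Eq i j => FEq (env i) (env j)
  | Atom i => FAtom (env i)
  | Fal => FFalse
  | Imp p q => FImp (embed p env) (embed q env)
  | And p q => FAnd (embed p env) (embed q env)
  | Or p q => FOr (embed p env) (embed q env)
  | All p => FAll (fun x => embed p (scons x env))
  | Ex p => FEx (fun x => embed p (scons x env))
  end.

(** Translation of [fm] to de Bruijn syntax: a variable is represented by the
    function giving its index as a function of the current binding depth [d]. *)
Fixpoint compile (d : nat) (p : fm (nat -> nat)) : form :=
  match p with
  | FMem x y => Mem (x d) (y d)
  | FEq x y => Eq (x d) (y d)
  | FAtom x => Atom (x d)
  | FFalse => Fal
  | FImp p q => Imp (compile d p) (compile d q)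
  | FAnd p q => And (compile d p) (compile d q)
  | FOr p q => Or (compile d p) (compile d q)
  | FAll p => All (compile (S d) (p (fun m => m - S d)))
  | FEx p => Ex (compile (S d) (p (fun m => m - S d)))
  end.

Definition quote_open (p : open_formula) : form :=
  compile 0 (p (nat -> nat) (fun i m => m + i)).
Definition quote (p : sentence) : form := quote_open (as_open p).

(** Classical natural deduction with equality.  Axioms may be open formulas;
    since they are not shifted in [pr_allI], they act as their universal
    closures. *)
Inductive proves (T : form -> Prop) : list form -> form -> Prop :=
| pr_ax G p : T p -> proves T G p
| pr_hyp G p : In p G -> proves T G p
| pr_impI G p q : proves T (p :: G) q -> proves T G (Imp p q)
| pr_impE G p q : proves T G (Imp p q) -> proves T G p -> proves T G q
| pr_andI G p q : proves T G p -> proves T G q -> proves T G (And p q)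
| pr_andE1 G p q : proves T G (And p q) -> proves T G p
| pr_andE2 G p q : proves T G (And p q) -> proves T G q
| pr_orI1 G p q : proves T G p -> proves T G (Or p q)
| pr_orI2 G p q : proves T G q -> proves T G (Or p q)
| pr_orE G p q r : proves T G (Or p q) ->
    proves T (p :: G) r -> proves T (q :: G) r -> proves T G r
| pr_dne G p : proves T G (Imp (Imp p Fal) Fal) -> proves T G p
| pr_allI G p : proves T (map shift G) p -> proves T G (All p)
| pr_allE G p i : proves T G (All p) -> proves T G (inst i p)
| pr_exI G p i : proves T G (inst i p) -> proves T G (Ex p)
| pr_exE G p q : proves T G (Ex p) ->
    proves T (p :: map shift G) (shift q) -> proves T G q
| pr_eqI G i : proves T G (Eq i i)
| pr_eqE G i j p : proves T G (Eq i j) ->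
    proves T G (inst i p) -> proves T G (inst j p).

(** * Structures and satisfaction *)

Record structure : Type := Structure {
  carrier :> Type;
  mem : carrier -> carrier -> Prop;
  atom : carrier -> Prop }.

Fixpoint sat (M : structure) (p : fm M) : Prop :=
  match p with
  | FMem x y => mem M x y
  | FEq x y => x = y
  | FAtom x => atom M x
  | FFalse => False
  | FImp p q => sat M p -> sat M q
  | FAnd p q => sat M p /\ sat M q
  | FOr p q => sat M p \/ sat M q
  | FAll p => forall x : M, sat M (p x)
  | FEx p => exists x : M, sat M (p x)
  end.

Definition models (M : structure) (p : sentence) : Prop := sat M (p M).
Notation "M ⊨ p" := (models M p) (at level 70, no associativity) : type_scope.

(** * Basic set-theoretic vocabulary *)

(** Atoms have no elements, so "[x] is a set" has to be said explicitly
    wherever an atom could be mistaken for the empty set. *)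
Section Vocabulary.
Context {V : Type}.
Implicit Types a b c d e f g p s t u v w x y z A B E F G K P Q R S T X Y Z : V.

Definition is_set x : fm V := ¬ FAtom x.
Definition subset x y : fm V := is_set x ∧ ∀ z, z ∈ x → z ∈ y.
Definition nonempty x : fm V := ∃ y, y ∈ x.
Definition is_empty x : fm V := is_set x ∧ ∀ y, ¬ y ∈ x.
Definition is_upair p x y : fm V := is_set p ∧ ∀ z, z ∈ p ↔ (z ≐ x ∨ z ≐ y).
Definition is_opair p x y : fm V :=
  ∃ u v, is_upair u x x ∧ is_upair v x y ∧ is_upair p u v.
Definition is_union u s : fm V := is_set u ∧ ∀ x, x ∈ u ↔ ∃' y ∈ s, x ∈ y.
Definition is_inter w u v : fm V := is_set w ∧ ∀ x, x ∈ w ↔ (x ∈ u ∧ x ∈ v).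
Definition is_diff w u v : fm V := is_set w ∧ ∀ x, x ∈ w ↔ (x ∈ u ∧ ¬ x ∈ v).
Definition is_power p x : fm V := is_set p ∧ ∀ y, y ∈ p ↔ subset y x.
Definition is_prod p a b : fm V :=
  is_set p ∧ ∀ z, z ∈ p ↔ ∃' x ∈ a, ∃' y ∈ b, is_opair z x y.
Definition is_atom_set A : fm V := is_set A ∧ ∀ x, x ∈ A ↔ FAtom x.

(** [app f x y]: the ordered pair (x, y) belongs to [f]. *)
Definition app f x y : fm V := ∃' p ∈ f, is_opair p x y.
Definition is_fun f a b : fm V :=
  is_set f ∧ (∀' p ∈ f, ∃' x ∈ a, ∃' y ∈ b, is_opair p x y) ∧
  (∀' x ∈ a, ∃ y, app f x y ∧ ∀ z, app f x z → z ≐ y).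
Definition is_fun_on f a : fm V := ∃ b, is_fun f a b.
Definition is_inj f a b : fm V :=
  is_fun f a b ∧ ∀ x y z, app f x z → app f y z → x ≐ y.
Definition is_bij f a b : fm V := is_inj f a b ∧ ∀' y ∈ b, ∃' x ∈ a, app f x y.
Definition equipotent a b : fm V := ∃ f, is_bij f a b.
Definition is_image f u v : fm V :=
  is_set v ∧ ∀ y, y ∈ v ↔ ∃' x ∈ u, app f x y.

Definition is_succ s n : fm V := is_set s ∧ ∀ z, z ∈ s ↔ (z ∈ n ∨ z ≐ n).
Definition is_inductive w : fm V :=
  (∃' e ∈ w, is_empty e) ∧ ∀' n ∈ w, ∃' s ∈ w, is_succ s n.
Definition is_omega w : fm V :=
  is_inductive w ∧ ∀ v, is_inductive v → subset w v.

Definition finite x : fm V := ∃ w, is_omega w ∧ ∃' n ∈ w, equipotent x n.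
Definition infinite x : fm V := ¬ finite x.
Definition denumerable x : fm V := ∃ w, is_omega w ∧ equipotent x w.
Definition countable x : fm V := ∃ w f, is_omega w ∧ is_inj f x w.

Definition strict_linear_order R X : fm V :=
  (∀' x ∈ X, ¬ app R x x) ∧
  (∀' x ∈ X, ∀' y ∈ X, ∀' z ∈ X, app R x y → app R y z → app R x z) ∧
  (∀' x ∈ X, ∀' y ∈ X, x ≐ y ∨ app R x y ∨ app R y x).
Definition well_order R X : fm V :=
  strict_linear_order R X ∧
  ∀ Y, subset Y X → nonempty Y → ∃' m ∈ Y, ∀' y ∈ Y, m ≐ y ∨ app R m y.
Definition well_orderable X : fm V := ∃ R, well_order R X.
Definition order_iso f X R Y Q : fm V :=
  is_bij f X Y ∧
  ∀' x ∈ X, ∀' y ∈ X, ∀ u v, app f x u → app f y v → (app R x y ↔ app Q u v).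

(** * The ordered fields of real and of rational numbers *)

(** [is_fun2 g a b c]: g is a function from a × b to c;
    [app2 g x y z]: g(x, y) = z. *)
Definition is_fun2 g a b c : fm V := ∃ p, is_prod p a b ∧ is_fun g p c.
Definition app2 g x y z : fm V := ∃ p, is_opair p x y ∧ app g p z.

Definition field_axioms F add mul o i : fm V :=
  is_fun2 add F F F ∧ is_fun2 mul F F F ∧ o ∈ F ∧ i ∈ F ∧ ¬ o ≐ i ∧
  (∀ x y z r s t, app2 add x y r → app2 add y z s → app2 add r z t →
     app2 add x s t) ∧
  (∀ x y r, app2 add x y r → app2 add y x r) ∧
  (∀' x ∈ F, app2 add x o x) ∧
  (∀' x ∈ F, ∃' y ∈ F, app2 add x y o) ∧
  (∀ x y z r s t, app2 mul x y r → app2 mul y z s → app2 mul r z t →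
     app2 mul x s t) ∧
  (∀ x y r, app2 mul x y r → app2 mul y x r) ∧
  (∀' x ∈ F, app2 mul x i x) ∧
  (∀' x ∈ F, ¬ x ≐ o → ∃' y ∈ F, app2 mul x y i) ∧
  (∀ x y z s r t w, app2 add y z s → app2 mul x y r → app2 mul x z t →
     app2 mul x s w → app2 add r t w).

Definition ordered_field F add mul lt o i : fm V :=
  field_axioms F add mul o i ∧ strict_linear_order lt F ∧
  (∀' x ∈ F, ∀' y ∈ F, ∀' z ∈ F, ∀ r s, app lt x y →
     app2 add x z r → app2 add y z s → app lt r s) ∧
  (∀' x ∈ F, ∀' y ∈ F, ∀ r, app lt o x → app lt o y → app2 mul x y r →
     app lt o r).

Definition upper_bound lt s b : fm V := ∀' x ∈ s, x ≐ b ∨ app lt x b.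

(** The real line is taken up to isomorphism: a Dedekind complete ordered
    field. *)
Definition is_reals F add mul lt o i : fm V :=
  ordered_field F add mul lt o i ∧
  ∀ s, subset s F → nonempty s → (∃' b ∈ F, upper_bound lt s b) →
    ∃' b ∈ F, upper_bound lt s b ∧
      ∀' c ∈ F, upper_bound lt s c → b ≐ c ∨ app lt b c.

Definition subfield K F add mul o i : fm V :=
  subset K F ∧ o ∈ K ∧ i ∈ K ∧
  (∀' x ∈ K, ∀' y ∈ K, ∀ z, app2 add x y z → z ∈ K) ∧
  (∀' x ∈ K, ∀' y ∈ K, ∀ z, app2 mul x y z → z ∈ K) ∧
  (∀' x ∈ K, ∀ y, app2 add x y o → y ∈ K) ∧
  (∀' x ∈ K, ∀ y, app2 mul x y i → y ∈ K).

(** The field of rationals is taken up to isomorphism: an ordered field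
    without proper subfields. *)
Definition is_rationals F add mul lt o i : fm V :=
  ordered_field F add mul lt o i ∧
  ∀ K, subfield K F add mul o i → subset F K.

(** * Topology; a space is a pair [X], [T] with [T] the set of open sets *)

Definition is_topology X T : fm V :=
  is_set X ∧ is_set T ∧ (∀' u ∈ T, subset u X) ∧ X ∈ T ∧
  (∀ s u, subset s T → is_union u s → u ∈ T) ∧
  (∀' u ∈ T, ∀' v ∈ T, ∀ w, is_inter w u v → w ∈ T).

(** [S] is the subspace topology on the subset [Y] of the space [X], [T]. *)
Definition is_subspace Y S X T : fm V :=
  subset Y X ∧ is_set S ∧ ∀ v, v ∈ S ↔ ∃' u ∈ T, is_inter v u Y.

Definition T1_space X T : fm V :=
  ∀' x ∈ X, ∀' y ∈ X, ¬ x ≐ y → ∃' u ∈ T, x ∈ u ∧ ¬ y ∈ u.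
Definition hausdorff X T : fm V :=
  ∀' x ∈ X, ∀' y ∈ X, ¬ x ≐ y →
    ∃' u ∈ T, ∃' v ∈ T, x ∈ u ∧ y ∈ v ∧ ¬ (∃ z, z ∈ u ∧ z ∈ v).
Definition covers s X : fm V := ∀' x ∈ X, ∃' u ∈ s, x ∈ u.
Definition compact X T : fm V :=
  ∀ s, subset s T → covers s X → ∃ t, subset t s ∧ finite t ∧ covers t X.
Definition first_countable X T : fm V :=
  ∀' x ∈ X, ∃ B, subset B T ∧ countable B ∧ (∀' u ∈ B, x ∈ u) ∧
    ∀' u ∈ T, x ∈ u → ∃' v ∈ B, subset v u.
Definition accumulation_point x Y T : fm V :=
  ∀' u ∈ T, x ∈ u → ∃' y ∈ Y, y ∈ u ∧ ¬ y ≐ x.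
Definition limit_point_compact X T : fm V :=
  ∀ Y, subset Y X → infinite Y → ∃' x ∈ X, accumulation_point x Y T.
(** [z] is isolated in the subspace [Z]: some open set meets [Z] in [z] only. *)
Definition scattered X T : fm V :=
  ∀ Z, subset Z X → nonempty Z →
    ∃' z ∈ Z, ∃' u ∈ T, z ∈ u ∧ ∀' y ∈ Z, y ∈ u → y ≐ z.

Definition is_metric d X F add lt o : fm V :=
  is_fun2 d X X F ∧
  (∀' x ∈ X, ∀' y ∈ X, ∀ r, app2 d x y r → (r ≐ o ∨ app lt o r)) ∧
  (∀' x ∈ X, ∀' y ∈ X, app2 d x y o ↔ x ≐ y) ∧
  (∀' x ∈ X, ∀' y ∈ X, ∀ r, app2 d x y r → app2 d y x r) ∧
  (∀' x ∈ X, ∀' y ∈ X, ∀' z ∈ X, ∀ r s t q, app2 d x y r → app2 d y z s →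
     app2 d x z t → app2 add r s q → (t ≐ q ∨ app lt t q)).
Definition metric_topology d X F lt o T : fm V :=
  is_set T ∧ ∀ u, u ∈ T ↔
    (subset u X ∧ ∀' x ∈ u, ∃' e ∈ F, app lt o e ∧
       ∀' y ∈ X, ∀ r, app2 d x y r → app lt r e → y ∈ u).
Definition metrizable X T : fm V :=
  ∃ F add mul lt o i d, is_reals F add mul lt o i ∧
    is_metric d X F add lt o ∧ metric_topology d X F lt o T.

Definition homeomorphism h X T Y S : fm V :=
  is_bij h X Y ∧ ∀ u v, subset u X → is_image h u v → (u ∈ T ↔ v ∈ S).
Definition homeomorphic X T Y S : fm V := ∃ h, homeomorphism h X T Y S.

(** [X], [T] is the Alexandroff one-point compactification of [Y], [S]. *)
Definition is_alexandroff X T Y S : fm V :=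
  ∃ p, ¬ p ∈ Y ∧ is_set X ∧ (∀ x, x ∈ X ↔ (x ∈ Y ∨ x ≐ p)) ∧
  is_set T ∧ ∀ u, u ∈ T ↔
    (u ∈ S ∨
     ∃ K R v, is_subspace K R Y S ∧ compact K R ∧
       is_diff v Y K ∧ v ∈ S ∧ is_diff u X K).

(** The space ℕ(∞): the one-point compactification of discrete ω. *)
Definition is_N_infty X T : fm V :=
  ∃ w P, is_omega w ∧ is_power P w ∧ is_alexandroff X T w P.
Definition contains_copy_of_N_infty X T : fm V :=
  ∃ Y S N U, is_subspace Y S X T ∧ is_N_infty N U ∧ homeomorphic Y S N U.

(** * Permutations of atoms and symmetric sets *)

Definition atom_permutation f : fm V := ∃ A, is_atom_set A ∧ is_bij f A A.
Definition transitive t : fm V := ∀' u ∈ t, ∀' v ∈ u, v ∈ t.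
Definition in_transitive_closure y x : fm V :=
  ∀ t, transitive t → x ∈ t → y ∈ t.

(** [acts f x y]: y = f·x, where the permutation [f] of the atoms acts on the
    universe by f·a = f(a) for atoms and f·x = {f·z : z ∈ x} for sets.  The
    witness [g] is the restriction of this action to a transitive set [t]. *)
Definition acts f x y : fm V :=
  ∃ t g, transitive t ∧ x ∈ t ∧ is_fun_on g t ∧
  (∀' u ∈ t, ∀ v, app g u v →
     ((FAtom u → app f u v) ∧ (is_set u → is_image g u v))) ∧
  app g x y.

(** [G] is a (definable) group of permutations of the atoms; [x] is symmetric
    when its stabilizer contains the pointwise stabilizer in [G] of some finite
    set [E] of atoms, that is, when the stabilizer belongs to the filter
    generated by these subgroups. *)
Definition symmetric (G : V -> fm V) x : fm V :=
  ∃ E, is_set E ∧ (∀' e ∈ E, FAtom e) ∧ finite E ∧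
  ∀ f, G f → (∀' e ∈ E, app f e e) → acts f x x.
Definition hereditarily_symmetric (G : V -> fm V) x : fm V :=
  ∀ y, in_transitive_closure y x → symmetric G y.

(** [P] enumerates along ω a partition of the atoms into pairs. *)
Definition pair_partition P : fm V :=
  ∃ w A, is_omega w ∧ is_atom_set A ∧ is_fun_on P w ∧
  (∀' n ∈ w, ∀ u, app P n u → ∃' a ∈ A, ∃' b ∈ A, ¬ a ≐ b ∧ is_upair u a b) ∧
  (∀ m n u v x, app P m u → app P n v → x ∈ u → x ∈ v → m ≐ n) ∧
  (∀' a ∈ A, ∃ n u, app P n u ∧ a ∈ u).

(** [R] orders the atoms in the order type of the rationals. *)
Definition rational_order R : fm V :=
  ∃ A, is_atom_set A ∧ denumerable A ∧ strict_linear_order R A ∧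
  ∃ Q add mul lt o i f, is_rationals Q add mul lt o i ∧ order_iso f A R Q lt.

Definition pair_preserving P f : fm V :=
  atom_permutation f ∧ ∀ n u, app P n u → is_image f u u.
Definition order_automorphism R f : fm V :=
  ∃ A, is_atom_set A ∧ order_iso f A R A R.

(** * Choice functions *)

Definition choice_function f F : fm V :=
  is_fun_on f F ∧ ∀' x ∈ F, ∀ y, app f x y → y ∈ x.
Definition multiple_choice_function f F : fm V :=
  is_fun_on f F ∧
  ∀' x ∈ F, ∀ y, app f x y → (subset y x ∧ nonempty y ∧ finite y).

End Vocabulary.

(** * The theory ZFA *)

Definition ax_extensionality : sentence := fun V =>
  ∀ x y, is_set x → is_set y → (∀ z, z ∈ x ↔ z ∈ y) → x ≐ y.
Definition ax_atoms : sentence := fun V => ∀ a, FAtom a → ∀ x, ¬ x ∈ a.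
Definition ax_set_of_atoms : sentence := fun V => ∃ A, is_atom_set A.
Definition ax_empty : sentence := fun V => ∃ x, is_empty x.
Definition ax_pairing : sentence := fun V => ∀ x y, ∃ p, is_upair p x y.
Definition ax_union : sentence := fun V => ∀ s, ∃ u, is_union u s.
Definition ax_power : sentence := fun V => ∀ x, ∃ p, is_power p x.
Definition ax_infinity : sentence := fun V => ∃ w, is_inductive w.
Definition ax_foundation : sentence := fun V =>
  ∀ x, nonempty x → ∃' y ∈ x, ¬ (∃ z, z ∈ x ∧ z ∈ y).
(** In the schemata the parameters are the free variables of the axiom.  In
    separation [phi] has the element as variable 0; in replacement it has the
    value as variable 0 and the argument as variable 1. *)
Definition ax_separation (phi : form) : open_formula := fun V env =>
  ∀ a, ∃ b, is_set b ∧ ∀ x, x ∈ b ↔ (x ∈ a ∧ embed phi (scons x env)).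
Definition ax_replacement (phi : form) : open_formula := fun V env =>
  (∀ x y z, embed phi (scons y (scons x env)) →
            embed phi (scons z (scons x env)) → y ≐ z) →
  ∀ a, ∃ b, is_set b ∧
    ∀ y, y ∈ b ↔ ∃' x ∈ a, embed phi (scons y (scons x env)).

Inductive ZFA : open_formula -> Prop :=
| ZFA_extensionality : ZFA (as_open ax_extensionality)
| ZFA_atoms : ZFA (as_open ax_atoms)
| ZFA_set_of_atoms : ZFA (as_open ax_set_of_atoms)
| ZFA_empty : ZFA (as_open ax_empty)
| ZFA_pairing : ZFA (as_open ax_pairing)
| ZFA_union : ZFA (as_open ax_union)
| ZFA_power : ZFA (as_open ax_power)
| ZFA_infinity : ZFA (as_open ax_infinity)
| ZFA_foundation : ZFA (as_open ax_foundation)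
| ZFA_separation phi : ZFA (ax_separation phi)
| ZFA_replacement phi : ZFA (ax_replacement phi).

Definition ZFA_axiom (p : form) : Prop :=
  exists q : open_formula, ZFA q /\ p = quote_open q.
Definition ZFA_proves (p : sentence) : Prop := proves ZFA_axiom [] (quote p).
Definition ZFA_consistent : Prop := ~ proves ZFA_axiom [] Fal.
Definition implies (p q : sentence) : sentence := fun V => FImp (p V) (q V).

Definition AC : sentence := fun V =>
  ∀ F, is_set F → (∀' x ∈ F, nonempty x) → ∃ f, choice_function f F.

(** * Permutation models *)

Definition ground_model (M : structure) : Prop :=
  (forall q : open_formula, ZFA q -> forall env : nat -> M, sat M (q M env)) /\
  M ⊨ AC.

Definition permutation_model (M : structure) (G : M -> fm M) : structure :=
  {| carrier := {x : M | sat M (hereditarily_symmetric G x)};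
     mem := fun x y => mem M (proj1_sig x) (proj1_sig y);
     atom := fun x => atom M (proj1_sig x) |}.

Definition denumerably_many_atoms : sentence := fun V =>
  ∃ A, is_atom_set A ∧ denumerable A.

(** A sentence is true in N1, N2 or N3 when it holds in the corresponding
    permutation submodel of every ground model of the required kind. *)
Definition true_in_N1 (p : sentence) : Prop :=
  forall M : structure, ground_model M -> M ⊨ denumerably_many_atoms ->
    permutation_model M atom_permutation ⊨ p.
Definition true_in_N2 (p : sentence) : Prop :=
  forall M : structure, ground_model M ->
    forall P : M, sat M (pair_partition P) ->
      permutation_model M (pair_preserving P) ⊨ p.
Definition true_in_N3 (p : sentence) : Prop :=
  forall M : structure, ground_model M ->
    forall R : M, sat M (rational_order R) ->
      permutation_model M (order_automorphism R) ⊨ p.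

(** * The sentences *)

Definition limit_point_compact_T1_well_orderable : sentence := fun V =>
  ∀ X T, is_topology X T → first_countable X T → limit_point_compact X T →
    T1_space X T → well_orderable X.

Definition compact_hausdorff_contains_N_infty : sentence := fun V =>
  ∀ X T, is_topology X T → infinite X → first_countable X T →
    hausdorff X T → compact X T → contains_copy_of_N_infty X T.

Definition compact_hausdorff_contains_metrizable_scattered : sentence := fun V =>
  ∀ X T, is_topology X T → infinite X → first_countable X T →
    hausdorff X T → compact X T →
    ∃ Y S, is_subspace Y S X T ∧ infinite Y ∧ metrizable Y S ∧
      compact Y S ∧ scattered Y S.

Definition CAC_fin : sentence := fun V =>
  ∀ F, denumerable F → (∀' x ∈ F, nonempty x ∧ finite x) →
    ∃ f, choice_function f F.

Definition IQDI : sentence := fun V =>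
  ∀ X, is_set X → infinite X →
    ∃ w P f, is_omega w ∧ is_set P ∧
      (∀ u, u ∈ P ↔ (subset u X ∧ finite u)) ∧ is_inj f w P.

Definition CMC : sentence := fun V =>
  ∀ F, denumerable F → (∀' x ∈ F, nonempty x) →
    ∃ f, multiple_choice_function f F.

(* Main.v *)
(** A first-countable limit point compact T1 space X in N1 or N3 is fixed pointwise by
    the permutations fixing a support E of X: a point x that is not so fixed has, over a
    larger support, an infinite orbit indexed by atoms; the members of a countable base at
    an accumulation point of this orbit share one finite support, and finitely many atoms
    cut the orbit into finitely many homogeneous pieces, so that some member of the base
    meets the orbit at most in the accumulation point.  Hence the well-orderings of X in
    the ground model belong to the permutation model.

    In a compact Hausdorff space let p be an accumulation point with countable base (u_n),
    and let r(x) be the least n such that x is not in u_n.  The ground model chooses one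
    orbit under a suitable finite support on each attained level of r; when orbits are
    finite, these together with p form a set W of the permutation model whose points
    converge to p at rate r.  It is compact, scattered, metrized by
    d(x, y) = max (1 / (r(x) + 1), 1 / (r(y) + 1)) for distinct x and y (with 1 / (r(p) + 1)
    read as 0), and a copy of N(oo) when the orbits are singletons.  In N2 every orbit is
    finite, because an element of the group acts on a point through its restriction to a
    finite support, which it maps to a finite union of pairs.

    For the unprovability results the ground model consists of well-founded trees with
    countably many atoms, modulo bisimulation.  Over it CAC_fin fails in N2 and both IQDI
    and CMC fail in N1, since a finite set of atoms supported by E is contained in E. *)

From HB Require Import structures.
From mathcomp Require Import all_boot all_order all_algebra ring lra.
From mathcomp Require Import boolp.
Require Import Defs.

Set Implicit Arguments.
Unset Strict Implicit.
Unset Printing Implicit Defensive.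

(** * First-order definability *)

Notation "x ∊ y" := (mem _ x y) (at level 70, no associativity).

(** The claims concern every ground model, so [omega], finiteness and induction are those of a
    possibly nonstandard structure, and each separation, replacement or induction needs an actual
    formula. This is why [Df B P] records that [P] is definable with parameters from [B]. It serves
    twice: with all parameters allowed it licenses comprehension, and with parameters fixed by [f]
    it gives invariance under [f], because permutations of the atoms act as automorphisms of the
    structure. One syntax-directed tactic, [dfn], thus helps to prove both that sets exist and that
    they are symmetric. A permutation model is again a [zfa] structure, so whatever is proved for
    arbitrary [zfa] structures holds inside it, and [val] compares the two levels. Metrizability
    asks for a complete ordered field in the model itself, so integers, fractions and Cauchy reals
    are built in an arbitrary [zfa] structure. The axiom of choice is applied in the ground model
    only; topological arguments inside a model take all suitable open sets at once instead of
    choosing one for each point. *)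

Section Definability.
Variable M : structure.
Implicit Types (e : nat -> M) (B : M -> Prop).

Lemma embed_ren (V : Type) (p : form) (r : nat -> nat) (e : nat -> V) :
  embed (ren r p) e = embed p (fun i => e (r i)).
Proof.
elim: p r e => //= [p IHp q IHq|p IHp q IHq|p IHp q IHq|p IH|p IH] r e.
1-3: by rewrite IHp IHq.
all: congr (_ _); apply: funext => x; rewrite IH; congr embed;
  by apply: funext => -[].
Qed.

Lemma sat_embed_ext (p : form) e e' :
  (forall i, e i = e' i) -> sat M (embed p e) <-> sat M (embed p e').
Proof. by move=> /funext ->. Qed.

(** A free variable of a formula is filled either from the environment ([inl]) or with a parameter
    ([inr]); keeping the two apart lets [Df] restrict the parameters alone. *)
Definition slot (s : nat + M) e := match s with inl k => e k | inr m => m end.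

(** First-order definability of a predicate on environments, with parameters
    restricted to the class [B]. *)
Definition Df B (P : (nat -> M) -> Prop) : Prop :=
  exists (phi : form) (s : nat -> nat + M),
    (forall i m, s i = inr m -> B m) /\
    forall e, P e <-> sat M (embed phi (fun i => slot (s i) e)).
Definition Tm B (t : (nat -> M) -> M) : Prop :=
  Df B (fun e => e 0 = t (fun i => e (S i))).

Lemma Df_ext B (P Q : (nat -> M) -> Prop) :
  (forall e, Q e <-> P e) -> Df B P -> Df B Q.
Proof.
move=> PQ [phi [s [sB H]]]; exists phi, s; split=> // e.
exact: iff_trans (PQ e) (H e).
Qed.

Lemma Df_mono (B B' : M -> Prop) (P : (nat -> M) -> Prop) :
  (forall m, B m -> B' m) -> Df B P -> Df B' P.
Proof.
move=> BB [phi [s [sB H]]]; exists phi, s; split=> // i m /sB; exact: BB.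
Qed.

Lemma Df_ren B (P : (nat -> M) -> Prop) (r : nat -> nat) :
  Df B P -> Df B (fun e => P (fun i => e (r i))).
Proof.
move=> [phi [s [sB H]]].
exists phi, (fun i => match s i with inl k => inl (r k) | inr m => inr m end).
split=> [i m|e].
  by move: (sB i m); case: (s i) => // x H1 [<-]; exact: H1.
apply: iff_trans (H _) _; apply: sat_embed_ext => i; by case: (s i).
Qed.

(** Two formulas are joined after renaming their variables apart: even variables keep the slots of
    the first formula, odd ones those of the second. *)
Let merge (s1 s2 : nat -> nat + M) (i : nat) : nat + M :=
  if odd i then s2 i./2 else s1 i./2.

Lemma Df_bin B (op : forall V, fm V -> fm V -> fm V) (opf : form -> form -> form)
  (opP : Prop -> Prop -> Prop) (P Q : (nat -> M) -> Prop) :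
  (forall p q (e : nat -> M), embed (opf p q) e = op M (embed p e) (embed q e)) ->
  (forall p q, sat M (op M p q) = opP (sat M p) (sat M q)) ->
  Df B P -> Df B Q -> Df B (fun e => opP (P e) (Q e)).
Proof.
move=> Hf HP [p1 [s1 [B1 H1]]] [p2 [s2 [B2 H2]]].
exists (opf (ren (fun i => i.*2) p1) (ren (fun i => i.*2.+1) p2)), (merge s1 s2).
split=> [i m|e].
  by rewrite /merge; case: odd => ?; [apply: B2 | apply: B1]; eassumption.
rewrite Hf HP !embed_ren.
have -> : P e = sat M (embed p1 (fun i => slot (merge s1 s2 i.*2) e)).
  apply: propext; apply: iff_trans (H1 _) _; apply: sat_embed_ext => i.
  by rewrite /merge odd_double doubleK.
have -> // : Q e = sat M (embed p2 (fun i => slot (merge s1 s2 i.*2.+1) e)).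
apply: propext; apply: iff_trans (H2 _) _; apply: sat_embed_ext => i.
by rewrite /merge /= odd_double uphalf_double.
Qed.

Lemma Df_and B (P Q : (nat -> M) -> Prop) : Df B P -> Df B Q -> Df B (fun e => P e /\ Q e).
Proof. exact: (@Df_bin B (@FAnd) And and P Q (fun=> fun=> fun=> erefl) (fun=> fun=> erefl)). Qed.
Lemma Df_or B (P Q : (nat -> M) -> Prop) : Df B P -> Df B Q -> Df B (fun e => P e \/ Q e).
Proof. exact: (@Df_bin B (@FOr) Or or P Q (fun=> fun=> fun=> erefl) (fun=> fun=> erefl)). Qed.
Lemma Df_imp B (P Q : (nat -> M) -> Prop) : Df B P -> Df B Q -> Df B (fun e => P e -> Q e).
Proof.
exact: (@Df_bin B (@FImp) Imp (fun p q => p -> q) P Q (fun=> fun=> fun=> erefl)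
  (fun=> fun=> erefl)).
Qed.
Lemma Df_False B : Df B (fun=> False).
Proof. exists Fal, inl; split=> [//|e]; exact: iff_refl. Qed.
Lemma Df_True B : Df B (fun=> True).
Proof. exists (Imp Fal Fal), inl; split=> [//|e]; split=> //= _ H; exact: H. Qed.
Lemma Df_not B (P : (nat -> M) -> Prop) : Df B P -> Df B (fun e => ~ P e).
Proof. by move=> H; apply: Df_imp H (Df_False _). Qed.
Lemma Df_iff B (P Q : (nat -> M) -> Prop) : Df B P -> Df B Q -> Df B (fun e => P e <-> Q e).
Proof. by move=> HP HQ; apply: Df_and; apply: Df_imp. Qed.

(** Several variables of a formula may be filled with environment variable 0, and a quantifier has
    to bind them all: [qren] identifies them with the bound variable, while [qslot] lowers the
    remaining environment indices by one. *)
Let qslot (s : nat -> nat + M) (i : nat) : nat + M :=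
  match i with 0 => inl 0 | S j =>
    match s j with inl (S k) => inl k | x => x end end.
Let qren (s : nat -> nat + M) (i : nat) : nat :=
  match s i with inl 0 => 0 | _ => S i end.

Lemma slot_quant s x e i :
  scons x (fun j => slot (qslot s (S j)) e) (qren s i) = slot (s i) (scons x e).
Proof. by rewrite /qren; case E: (s i) => [[|k]|m] //=; rewrite E. Qed.

Lemma Df_quant B (P : (nat -> M) -> Prop) :
  Df B P -> exists (phi : form) s,
   (forall i m, s i = inr m -> B m) /\
   forall e x, P (scons x e) <-> sat M (embed phi (scons x (fun i => slot (s i) e))).
Proof.
move=> [phi [s [sB H]]].
exists (ren (qren s) phi), (fun i => qslot s (S i)); split=> [i m|e x].
  by move: (sB i m) => /=; case: (s i) => [[|k]|m'].
rewrite embed_ren; apply: iff_trans (H _) _; apply: sat_embed_ext => i.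
by rewrite slot_quant.
Qed.

Lemma Df_all B (P : (nat -> M) -> M -> Prop) :
  Df B (fun e => P (fun i => e (S i)) (e 0)) -> Df B (fun e => forall x, P e x).
Proof.
case/Df_quant => phi [s [sB H]]; exists (All phi), s; split=> // e /=.
by split=> K x; apply/H/K.
Qed.

Lemma Df_ex B (P : (nat -> M) -> M -> Prop) :
  Df B (fun e => P (fun i => e (S i)) (e 0)) -> Df B (fun e => exists x, P e x).
Proof.
case/Df_quant => phi [s [sB H]]; exists (Ex phi), s; split=> // e /=.
by split=> -[x K]; exists x; apply/H/K.
Qed.

Lemma Df_ex2 B (P Q : (nat -> M) -> M -> Prop) :
  Df B (fun e => P (fun i => e (S i)) (e 0)) ->
  Df B (fun e => Q (fun i => e (S i)) (e 0)) ->
  Df B (fun e => exists2 x, P e x & Q e x).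
Proof.
move=> HP HQ; apply: (@Df_ext _ (fun e => exists x, P e x /\ Q e x)).
  by move=> e; split=> [[x ? ?]|[x [? ?]]]; exists x.
by apply: Df_ex; apply: Df_and.
Qed.

(** The language has no terms besides variables, so a definable term is substituted through a
    quantifier, as in [exists x, x = t e /\ P e x]. *)
Lemma Df_subst B (P : (nat -> M) -> M -> Prop) t :
  Df B (fun e => P (fun i => e (S i)) (e 0)) -> Tm B t -> Df B (fun e => P e (t e)).
Proof.
move=> HP Ht; apply: (@Df_ext _ (fun e => exists x, x = t e /\ P e x)).
  by move=> e; split=> [H|[x [-> //]]]; exists (t e).
by apply: Df_ex; apply: Df_and.
Qed.

Lemma Df_pred1 B (P : M -> Prop) t :
  Df B (fun e => P (e 0)) -> Tm B t -> Df B (fun e => P (t e)).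
Proof. by move=> HP; apply: (@Df_subst _ (fun e => P)). Qed.

Lemma Tm_ren B (t : (nat -> M) -> M) (r : nat -> nat) :
  Tm B t -> Tm B (fun e => t (fun i => e (r i))).
Proof.
by move=> /(@Df_ren _ _ (fun i => match i with 0 => 0 | S j => S (r j) end)).
Qed.

Lemma Df_pred2 B (P : M -> M -> Prop) s t :
  Df B (fun e => P (e 0) (e 1)) -> Tm B s -> Tm B t -> Df B (fun e => P (s e) (t e)).
Proof.
move=> HP Hs Ht; apply: (@Df_subst _ (fun e x => P x (t e))) => //.
apply: (@Df_subst _ (fun e y => P (e 0) y)); last exact: Tm_ren.
exact: (Df_ren (fun i => match i with 0 => 1 | _ => 0 end) HP).
Qed.

Lemma Df_pred3 B (P : M -> M -> M -> Prop) s t u :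
  Df B (fun e => P (e 0) (e 1) (e 2)) -> Tm B s -> Tm B t -> Tm B u ->
  Df B (fun e => P (s e) (t e) (u e)).
Proof.
move=> HP Hs Ht Hu; apply: (@Df_subst _ (fun e x => P x (t e) (u e))) => //.
apply: (@Df_subst _ (fun e y => P (e 0) y (u (fun i => e (S i)))));
  last exact: Tm_ren.
apply: (@Df_subst _ (fun e y => P (e 1) (e 0) y)); last exact: (Tm_ren _ Hu).
exact: (Df_ren (fun i => match i with 0 => 2 | 1 => 1 | _ => 0 end) HP).
Qed.

Lemma Tm_var B k : Tm B (fun e => e k).
Proof.
by exists (Eq 0 1), (fun i => inl (if i is 0 then 0 else S k)); split=> // -[].
Qed.
Lemma Tm_const B m : B m -> Tm B (fun=> m).
Proof.
move=> Bm; exists (Eq 0 1), (fun i => if i is 0 then inl 0 else inr m).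
by split=> // -[|i] // ? [<-].
Qed.

Lemma Tm_comp1 B (F : M -> M) t :
  Tm B (fun e => F (e 0)) -> Tm B t -> Tm B (fun e => F (t e)).
Proof.
move=> HF Ht; apply: (@Df_subst _ (fun e x => e 0 = F x)); last exact: Tm_ren.
exact: (Df_ren (fun i => match i with 0 => 1 | _ => 0 end) HF).
Qed.
Lemma Tm_comp2 B (F : M -> M -> M) s t :
  Tm B (fun e => F (e 0) (e 1)) -> Tm B s -> Tm B t -> Tm B (fun e => F (s e) (t e)).
Proof.
move=> HF Hs Ht.
apply: (@Df_subst _ (fun e x => e 0 = F x (t (fun i => e (S i))))); last exact: Tm_ren.
apply: (@Df_subst _ (fun e y => e 1 = F (e 0) y)); last exact: (Tm_ren _ Ht).
exact: (Df_ren (fun i => match i with 0 => 2 | 1 => 1 | _ => 0 end) HF).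
Qed.

Lemma Df_eq B s t : Tm B s -> Tm B t -> Df B (fun e => s e = t e).
Proof. by apply: Df_pred2; exists (Eq 0 1), inl; split. Qed.
Lemma Df_mem B s t : Tm B s -> Tm B t -> Df B (fun e => s e ∊ t e).
Proof. by apply: Df_pred2; exists (Mem 0 1), inl; split. Qed.
Lemma Df_atom B t : Tm B t -> Df B (fun e => atom M (t e)).
Proof. by apply: Df_pred1; exists (Atom 0), inl; split. Qed.

End Definability.

(** Redefined whenever a new definable operation is introduced. *)
Ltac dfn_user := fail.

Ltac dfn_env :=
  match goal with
  | H : Tm _ ?s |- Tm _ _ => first [exact H | exact (Tm_ren _ H)]
  | H : Df _ ?s |- Df _ _ => first [exact H | exact (Df_ren _ H)]
  | H : Tm _ (fun e => ?F (e 0)) |- Tm _ (fun e => ?F _) =>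
      apply: (Tm_comp1 H)
  | H : Tm _ (fun e => ?F (e 0) (e 1)) |- Tm _ (fun e => ?F _ _) =>
      apply: (Tm_comp2 H)
  | H : Df _ (fun e => ?F (e 0)) |- Df _ (fun e => ?F _) =>
      apply: (Df_pred1 H)
  | H : Df _ (fun e => ?F (e 0) (e 1)) |- Df _ (fun e => ?F _ _) =>
      apply: (Df_pred2 H)
  | H : Df _ (fun e => ?F (e 0) (e 1) (e 2)) |- Df _ (fun e => ?F _ _ _) =>
      apply: (Df_pred3 H)
  end.

(** The goal is decomposed along the shape of the formula. Implications and universal quantifiers
    have the same shape in Rocq, so [Df_imp] is tried before [Df_all]. *)
Ltac dfn_step :=
  cbv beta;
  lazymatch goal with
  | |- Tm _ (fun e => e _) => exact: Tm_var
  | |- Tm _ (fun _ => ?m) => first [apply: Tm_const; first [exact: Logic.I|assumption] | dfn_user | apply: Tm_const; done]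
  | |- Df _ (fun e => _ /\ _) => apply: Df_and
  | |- Df _ (fun e => _ \/ _) => apply: Df_or
  | |- Df _ (fun e => _ <-> _) => apply: Df_iff
  | |- Df _ (fun e => ~ _) => apply: Df_not
  | |- Df _ (fun e => False) => apply: Df_False
  | |- Df _ (fun e => True) => apply: Df_True
  | |- Df _ (fun e => ex2 _ _) => apply: Df_ex2
  | |- Df _ (fun e => exists x, _) => apply: Df_ex
  | |- Df _ (fun e => mem _ _ _) => apply: Df_mem
  | |- Df _ (fun e => _ = _) => apply: Df_eq
  | |- Df _ (fun e => atom _ _) => apply: Df_atom
  | |- Df _ (fun e => forall x, _) => first [apply: Df_imp | apply: Df_all]
  | |- _ => first [dfn_env | dfn_user]
  end.
Ltac dfn := repeat dfn_step.

(** * Sets in a model of ZFA *)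

Class zfa (M : structure) : Prop := Zfa {
  zfa_inhabited : inhabited M;
  zfa_axiom : forall q, ZFA q -> forall env : nat -> M, sat M (q M env) }.

Notation anyp := (fun _ => True).

Section Comprehension.
Context {M : structure} {HM : zfa M}.
Implicit Types (x y z a b c p : M) (e : nat -> M) (B : M -> Prop).

Definition isset x : Prop := ~ atom M x.
Definition sub x y : Prop := isset x /\ forall z, z ∊ x -> z ∊ y.

Lemma zfa_sentence q : ZFA (as_open q) -> M ⊨ q.
Proof. by case: zfa_inhabited => m /zfa_axiom /(_ (fun=> m)). Qed.

Lemma set_ext x y : isset x -> isset y -> (forall z, z ∊ x <-> z ∊ y) -> x = y.
Proof. exact: (zfa_sentence ZFA_extensionality). Qed.

Lemma isset_mem x y : x ∊ y -> isset y.
Proof. by move=> xy ya; exact: (zfa_sentence ZFA_atoms y ya x xy). Qed.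

Let emp : M := projT1 (cid (zfa_sentence ZFA_empty)).

(** The junk value is the empty set. *)
Definition the (Q : M -> Prop) : M :=
  if pselect (exists y, Q y /\ forall z, Q z -> z = y) is left H
  then projT1 (cid H) else emp.

Lemma theP (Q : M -> Prop) :
  (exists y, Q y) -> (forall y z, Q y -> Q z -> z = y) -> Q (the Q).
Proof.
move=> [y Qy] uQ; rewrite /the; case: pselect => [H|[]].
  by case: (projT2 (cid H)).
by exists y; split=> // z; exact: uQ.
Qed.

Lemma the_eq (Q : M -> Prop) y : Q y -> (forall z, Q z -> z = y) -> the Q = y.
Proof.
move=> Qy uQ; apply: (uQ); apply: theP => [|z w /uQ -> /uQ //]; by exists y.
Qed.

(** The default must be definable along with the described value: the graph holds at the unique
    object satisfying [Q e], or at the empty set when there is no such object. *)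
Lemma Tm_the B (Q : (nat -> M) -> M -> Prop) :
  Df B (fun e => Q (fun i => e (S i)) (e 0)) -> Tm B (fun e => the (Q e)).
Proof.
move=> HQ; apply: (@Df_ext _ _ (fun e =>
  let Qe := Q (fun i => e (S i)) in
  (Qe (e 0) /\ (forall z, Qe z -> z = e 0)) \/
  (~ (exists y, Qe y /\ forall z, Qe z -> z = y) /\
   (isset (e 0) /\ forall z, ~ z ∊ e 0)))).
  move=> e /=; set Qe := Q _; rewrite /the; case: pselect => [H|nH].
    case: (projT2 (cid H)) => H1 H2; split=> [->|[[Q0 _]|[[]//]]]; first by left.
    exact: H2.
  have [e1 e2] : is_true true /\ isset emp /\ forall z, ~ z ∊ emp.
    by split=> //; exact: (projT2 (cid (zfa_sentence ZFA_empty))).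
  split=> [->|[[Q0 u]|[_ [h1 h2]]]]; first by right.
    by case: nH; exists (e 0).
  by apply: set_ext => //; [case: e2|move=> z; split=> [/h2|/(proj2 e2)]].
rewrite /isset /=.
have H1 := Df_ren (fun i => if i is S j then S (S j) else 0) HQ.
have H2 := Df_ren (fun i => if i is S j then S (S (S j)) else 0) HQ.
apply: Df_or; first (apply: Df_and; first exact: HQ);
   first by apply: Df_all; apply: Df_imp; [exact: H1|dfn].
apply: Df_and; last by dfn.
apply: Df_not; apply: Df_ex; apply: Df_and; first exact: H1.
by apply: Df_all; apply: Df_imp; [exact: H2|dfn].
Qed.

Lemma Df_isset B t : Tm B t -> Df B (fun e => isset (t e)).
Proof. by move=> ?; rewrite /isset; dfn. Qed.
Lemma Df_sub B s t : Tm B s -> Tm B t -> Df B (fun e => sub (s e) (t e)).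
Proof. by move=> ? ?; rewrite /sub /isset; dfn. Qed.

(** Only variable 0 matters to [P], so every variable filled from the environment may be given the
    value [x] itself; what remains are parameters, as the separation schema expects. *)
Lemma Df1_form (P : M -> Prop) : Df anyp (fun e => P (e 0)) ->
  exists (phi : form) env, forall x, P x <-> sat M (embed phi (scons x env)).
Proof.
move=> [phi [s [_ H]]]; case: zfa_inhabited => m.
exists (ren (fun i => if s i is inr _ then S i else 0) phi),
  (fun i => if s i is inr m then m else m) => x.
rewrite embed_ren; apply: iff_trans (H (fun=> x)) _; apply: sat_embed_ext => i.
by case E: (s i) => [k|k] //=; rewrite E.
Qed.

Lemma Df2_form (P : M -> M -> Prop) : Df anyp (fun e => P (e 0) (e 1)) ->
  exists (phi : form) env, forall x y,
    P y x <-> sat M (embed phi (scons y (scons x env))).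
Proof.
move=> [phi [s [_ H]]]; case: zfa_inhabited => m.
exists (ren (fun i => match s i with inr _ => S (S i) | inl 0 => 0 | _ => 1 end) phi),
  (fun i => if s i is inr m then m else m) => x y.
rewrite embed_ren; apply: iff_trans (H (fun i => if i is 0 then y else x)) _.
by apply: sat_embed_ext => i; case E: (s i) => [[|k]|k] //=; rewrite E.
Qed.

Definition small (P : M -> Prop) : Prop := exists b, forall x, P x -> x ∊ b.
Definition mkset (P : M -> Prop) : M :=
  the (fun b => isset b /\ forall x, x ∊ b <-> P x).

(** Smallness does not enter: for a class too large to be a set, [mkset] takes the default value of
    [the], which is definable too. *)
Lemma Tm_mkset B (P : (nat -> M) -> M -> Prop) :
  Df B (fun e => P (fun i => e (S i)) (e 0)) -> Tm B (fun e => mkset (P e)).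
Proof.
move=> HP; apply: Tm_the; rewrite /isset; apply: Df_and; first by dfn.
apply: Df_all; apply: Df_iff; first by dfn.
exact: (@Df_ren _ _ _ (fun i => if i is S j then S (S j) else 0) HP).
Qed.

Lemma mkset_spec (P : M -> Prop) : small P -> Df anyp (fun e => P (e 0)) ->
  isset (mkset P) /\ forall x, x ∊ mkset P <-> P x.
Proof.
move=> [a Ha] HP; apply: (theP (Q := fun b => isset b /\ forall x, x ∊ b <-> P x)).
  case: (Df1_form HP) => phi [env H].
  case: (zfa_axiom (ZFA_separation phi) env a) => b [sb Hb].
  exists b; split=> // x; move: (Hb x) (H x) (Ha x) => /= [h1 h2] [h3 h4] h5.
  by split=> [/h1[_ /h4] //|Px]; apply: h2; split; [exact: h5|exact: h3].
move=> y z [sy Hy] [sz Hz]; apply: set_ext => // x.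
by apply: iff_trans (Hz x) (iff_sym _).
Qed.

Lemma in_mkset (P : M -> Prop) x : small P -> Df anyp (fun e => P (e 0)) ->
  x ∊ mkset P <-> P x.
Proof. by move=> sP /(mkset_spec sP) [_]; apply. Qed.
Lemma isset_mkset (P : M -> Prop) : isset (mkset P).
Proof.
rewrite /mkset /the; case: pselect => [H|_]; first by case: (projT2 (cid H)) => -[].
by case: (projT2 (cid (zfa_sentence ZFA_empty))).
Qed.

Lemma small_repl a (F : M -> M) : Tm anyp (fun e => F (e 0)) ->
  small (fun y => exists2 x, x ∊ a & y = F x).
Proof.
move=> /(@Df2_form (fun y x => y = F x)) [phi [env H]].
have fn : forall x y z, sat M (embed phi (scons y (scons x env))) ->
    sat M (embed phi (scons z (scons x env))) -> y = z by move=> x y z /H -> /H ->.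
case: (zfa_axiom (ZFA_replacement phi) env fn a) => b [_ Hb].
by exists b => y [x xa yx]; apply/Hb; exists x; split=> //; apply/H.
Qed.

End Comprehension.
Ltac dfn_user1 :=
  first [simple apply Tm_mkset | simple apply Tm_the | simple apply Df_isset | simple apply Df_sub].
Ltac dfn_user ::= dfn_user1.

Ltac mk := apply: propext; apply: in_mkset; [|solve [dfn]].

Section BasicSets.
Context {M : structure} {HM : zfa M}.
Implicit Types (x y z a b c p f g u v w : M) (e : nat -> M) (B : M -> Prop).

Lemma small_sub (P Q : M -> Prop) : small Q -> (forall x, P x -> Q x) -> small P.
Proof. by move=> [b Hb] PQ; exists b => x /PQ/Hb. Qed.
Lemma small_mem a : small (fun x => x ∊ a).
Proof. by exists a. Qed.
Lemma small_sep a (P : M -> Prop) : small (fun x => x ∊ a /\ P x).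
Proof. by exists a => x []. Qed.

Definition emp : M := mkset (fun=> False).
Definition upair x y : M := mkset (fun z => z = x \/ z = y).
Definition sing x : M := mkset (fun z => z = x).
Definition bigcup s : M := mkset (fun x => exists2 y, y ∊ s & x ∊ y).
Definition cup x y : M := mkset (fun z => z ∊ x \/ z ∊ y).
Definition cap x y : M := mkset (fun z => z ∊ x /\ z ∊ y).
Definition diff x y : M := mkset (fun z => z ∊ x /\ ~ z ∊ y).
Definition adj s x : M := mkset (fun z => z ∊ s \/ z = x).
Definition pow x : M := mkset (fun y => sub y x).
Definition sep a (P : M -> Prop) : M := mkset (fun x => x ∊ a /\ P x).
Definition repl a (F : M -> M) : M := mkset (fun y => exists2 x, x ∊ a & y = F x).
Definition opair x y : M := upair (sing x) (upair x y).
Definition prod a b : M :=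
  mkset (fun z => exists x y, x ∊ a /\ y ∊ b /\ z = opair x y).

Lemma in_emp x : (x ∊ emp) = False.
Proof. by mk; exists x. Qed.
Lemma small_upair x y : small (fun z => z = x \/ z = y).
Proof.
case: (zfa_sentence ZFA_pairing x y) => p [_ Hp]; by exists p => z /Hp.
Qed.
Lemma in_upair x y z : (z ∊ upair x y) = (z = x \/ z = y).
Proof. by mk; exact: small_upair. Qed.
Lemma in_sing x z : (z ∊ sing x) = (z = x).
Proof. by mk; apply: small_sub (small_upair x x) _; left. Qed.
Lemma in_bigcup s x : (x ∊ bigcup s) = (exists2 y, y ∊ s & x ∊ y).
Proof.
mk; case: (zfa_sentence ZFA_union s) => u [_ Hu]; exists u => z [y ys zy].
by apply/Hu; exists y.
Qed.
Lemma small_or (P Q : M -> Prop) : small P -> small Q -> small (fun x => P x \/ Q x).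
Proof.
move=> [a Ha] [b Hb]; exists (bigcup (upair a b)) => x H; rewrite in_bigcup.
by case: H => [/Ha|/Hb] ?; [exists a|exists b] => //; rewrite in_upair; auto.
Qed.
Lemma in_cup x y z : (z ∊ cup x y) = (z ∊ x \/ z ∊ y).
Proof. by mk; apply: small_or; exact: small_mem. Qed.
Lemma in_cap x y z : (z ∊ cap x y) = (z ∊ x /\ z ∊ y).
Proof. by mk; exact: small_sep. Qed.
Lemma in_diff x y z : (z ∊ diff x y) = (z ∊ x /\ ~ z ∊ y).
Proof. by mk; exact: small_sep. Qed.
Lemma in_adj s x z : (z ∊ adj s x) = (z ∊ s \/ z = x).
Proof.
mk; apply: small_or; first exact: small_mem.
by exists (sing x) => y ->; rewrite in_sing.
Qed.
Lemma in_pow x y : (y ∊ pow x) = sub y x.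
Proof.
mk; case: (zfa_sentence ZFA_power x) => p [_ Hp]; by exists p => z /Hp.
Qed.
Lemma in_sep a (P : M -> Prop) x : Df anyp (fun e => P (e 0)) ->
  (x ∊ sep a P) = (x ∊ a /\ P x).
Proof. by move=> ?; mk; exact: small_sep. Qed.
Lemma in_repl a (F : M -> M) y : Tm anyp (fun e => F (e 0)) ->
  (y ∊ repl a F) = (exists2 x, x ∊ a & y = F x).
Proof. by move=> ?; mk; exact: small_repl. Qed.

Lemma isset_emp : isset emp. Proof. exact: isset_mkset. Qed.
Lemma isset_upair x y : isset (upair x y). Proof. exact: isset_mkset. Qed.
Lemma isset_sing x : isset (sing x). Proof. exact: isset_mkset. Qed.
Lemma isset_bigcup x : isset (bigcup x). Proof. exact: isset_mkset. Qed.
Lemma isset_cup x y : isset (cup x y). Proof. exact: isset_mkset. Qed.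
Lemma isset_cap x y : isset (cap x y). Proof. exact: isset_mkset. Qed.
Lemma isset_diff x y : isset (diff x y). Proof. exact: isset_mkset. Qed.
Lemma isset_adj x y : isset (adj x y). Proof. exact: isset_mkset. Qed.
Lemma isset_pow x : isset (pow x). Proof. exact: isset_mkset. Qed.
Lemma isset_sep a P : isset (sep a P). Proof. exact: isset_mkset. Qed.
Lemma isset_repl a F : isset (repl a F). Proof. exact: isset_mkset. Qed.
Lemma isset_opair x y : isset (opair x y). Proof. exact: isset_mkset. Qed.
Lemma isset_prod x y : isset (prod x y). Proof. exact: isset_mkset. Qed.

Lemma set_eqP x y : isset x -> isset y -> (forall z, (z ∊ x) = (z ∊ y)) -> x = y.
Proof. by move=> sx sy H; apply: set_ext => // z; rewrite H. Qed.

Lemma empP x : isset x -> (forall y, ~ y ∊ x) -> x = emp.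
Proof.
move=> sx H; apply: set_ext => //; first exact: isset_emp.
by move=> z; rewrite in_emp; split=> // /H.
Qed.

Lemma sing_inj x y : sing x = sing y -> x = y.
Proof. by move=> E; have := in_sing y x; rewrite -E in_sing => <-. Qed.

Lemma opair_inj x y x' y' : opair x y = opair x' y' -> x = x' /\ y = y'.
Proof.
move=> E.
have xx : x = x'.
  have: sing x' ∊ opair x y by rewrite E /opair in_upair; left.
  rewrite /opair in_upair => -[/sing_inj //|E2].
  have : x ∊ sing x' by rewrite E2 in_upair; left.
  by rewrite in_sing.
split=> //; rewrite -{}xx in E.
have h1 : forall u v, upair x u = upair x v -> u = v \/ u = x.
  move=> u v H; have : u ∊ upair x v by rewrite -H in_upair; right.
  by rewrite in_upair; tauto.
have : upair x y ∊ opair x y' by rewrite -E /opair in_upair; right.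
have : upair x y' ∊ opair x y by rewrite E /opair in_upair; right.
have xx : sing x = upair x x.
  apply: set_eqP => [||z]; [exact: isset_mkset|exact: isset_mkset|].
  by rewrite in_sing in_upair; apply: propext; tauto.
rewrite /opair !in_upair xx => -[/h1|/h1] A [/h1|/h1] C; intuition congruence.
Qed.

Lemma Tm_emp B : Tm B (fun=> emp). Proof. by rewrite /emp; dfn. Qed.
Lemma Tm_upair B s t : Tm B s -> Tm B t -> Tm B (fun e => upair (s e) (t e)).
Proof. by move=> ? ?; rewrite /upair; dfn. Qed.
Lemma Tm_sing B s : Tm B s -> Tm B (fun e => sing (s e)).
Proof. by move=> ?; rewrite /sing; dfn. Qed.
Lemma Tm_bigcup B s : Tm B s -> Tm B (fun e => bigcup (s e)).
Proof. by move=> ?; rewrite /bigcup; dfn. Qed.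
Lemma Tm_cup B s t : Tm B s -> Tm B t -> Tm B (fun e => cup (s e) (t e)).
Proof. by move=> ? ?; rewrite /cup; dfn. Qed.
Lemma Tm_cap B s t : Tm B s -> Tm B t -> Tm B (fun e => cap (s e) (t e)).
Proof. by move=> ? ?; rewrite /cap; dfn. Qed.
Lemma Tm_diff B s t : Tm B s -> Tm B t -> Tm B (fun e => diff (s e) (t e)).
Proof. by move=> ? ?; rewrite /diff; dfn. Qed.
Lemma Tm_adj B s t : Tm B s -> Tm B t -> Tm B (fun e => adj (s e) (t e)).
Proof. by move=> ? ?; rewrite /adj; dfn. Qed.
Lemma Tm_pow B s : Tm B s -> Tm B (fun e => pow (s e)).
Proof. by move=> ?; rewrite /pow; apply: Tm_mkset; apply: Df_sub; dfn. Qed.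
Lemma Tm_sep B t (P : (nat -> M) -> M -> Prop) : Tm B t ->
  Df B (fun e => P (fun i => e (S i)) (e 0)) -> Tm B (fun e => sep (t e) (P e)).
Proof. by move=> ? ?; rewrite /sep; apply: Tm_mkset; apply: Df_and => //; dfn. Qed.
Lemma Tm_repl B t (F : (nat -> M) -> M -> M) : Tm B t ->
  Tm B (fun e => F (fun i => e (S i)) (e 0)) -> Tm B (fun e => repl (t e) (F e)).
Proof.
move=> ? HF; rewrite /repl; apply: Tm_mkset; apply: Df_ex2; first by dfn.
exact: (Df_ren (fun i => match i with 0 => 1 | 1 => 0 | S (S j) => S (S j) end) HF).
Qed.
Lemma Tm_opair B s t : Tm B s -> Tm B t -> Tm B (fun e => opair (s e) (t e)).
Proof. by move=> ? ?; rewrite /opair; apply: Tm_upair; [apply: Tm_sing|apply: Tm_upair]. Qed.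
Lemma Tm_prod B s t : Tm B s -> Tm B t -> Tm B (fun e => prod (s e) (t e)).
Proof.
move=> ? ?; rewrite /prod; apply: Tm_mkset; dfn; apply: Tm_opair; dfn.
Qed.

End BasicSets.

Ltac dfn_user2 := first [ simple apply Tm_emp | simple apply Tm_opair
  | simple apply Tm_upair | simple apply Tm_sing | simple apply Tm_bigcup
  | simple apply Tm_cup | simple apply Tm_cap | simple apply Tm_diff
  | simple apply Tm_adj | simple apply Tm_pow | simple apply Tm_prod
  | simple apply Tm_sep | simple apply Tm_repl | dfn_user1].
Ltac dfn_user ::= dfn_user2.
#[export] Hint Resolve isset_emp isset_upair isset_sing isset_bigcup isset_cup isset_cap
  isset_diff isset_adj isset_pow isset_sep isset_repl isset_opair isset_prod
  isset_mkset : core.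

(** * Natural numbers, recursion and transitive closure *)

Ltac ins := rewrite ?(in_emp, in_upair, in_sing, in_cup, in_cap, in_diff, in_adj,
  in_pow, in_bigcup).
Notation succ n := (adj n n).

Section Omega.
Context {M : structure} {HM : zfa M}.
Implicit Types (x y z a b c p f g u v w m n k : M) (e : nat -> M) (B : M -> Prop).

Lemma foundation x : (exists y, y ∊ x) ->
  exists2 y, y ∊ x & forall z, z ∊ x -> ~ z ∊ y.
Proof.
case/(zfa_sentence ZFA_foundation x) => y [yx H]; exists y => // z zx zy.
by apply: H; exists z.
Qed.
Lemma mem_irrefl x : ~ x ∊ x.
Proof.
move=> xx; have [|y] := @foundation (sing x); first by exists x; ins.
by ins => -> /(_ x); ins => /(_ erefl).
Qed.
Lemma mem_asym x y : x ∊ y -> ~ y ∊ x.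
Proof.
move=> xy yx; have [|z] := @foundation (upair x y); first by exists x; ins; left.
by ins => -[] -> H; [apply: (H y) | apply: (H x)]; ins; auto.
Qed.

Definition inductive w : Prop := emp ∊ w /\ forall n, n ∊ w -> succ n ∊ w.
Definition omega : M := mkset (fun n => forall w, inductive w -> n ∊ w).

Lemma sat_is_empty x : sat M (is_empty x) <-> x = emp.
Proof.
split=> [[sx H]|->]; first exact: empP.
by split=> [|y]; [exact: isset_emp|rewrite in_emp].
Qed.
Lemma sat_is_succ x n : sat M (is_succ x n) <-> x = succ n.
Proof.
split=> [[sx H]|->]; last by split=> [|y]; [exact: isset_adj|rewrite in_adj].
by apply: set_eqP => // z; ins; apply: propext; apply: H.
Qed.
Lemma sat_is_inductive w : sat M (is_inductive w) <-> inductive w.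
Proof.
split=> [[[e [ew /sat_is_empty Ee]] H]|[ew H]].
  rewrite Ee in ew; split=> // n /H [s [sw /sat_is_succ Es]]; by rewrite -Es.
split=> [|n nw]; first by exists emp; split=> //; apply/sat_is_empty.
by exists (succ n); split; [exact: H|apply/sat_is_succ].
Qed.

Lemma in_omega n : (n ∊ omega) = (forall w, inductive w -> n ∊ w).
Proof.
apply: propext; apply: in_mkset; last by rewrite /inductive; dfn.
case: (zfa_sentence ZFA_infinity) => w /sat_is_inductive iw.
by exists w => k /(_ w iw).
Qed.
Lemma isset_omega : isset omega. Proof. exact: isset_mkset. Qed.
Lemma omega0 : emp ∊ omega.
Proof. by rewrite in_omega => w []. Qed.
Lemma omegaS n : n ∊ omega -> succ n ∊ omega.
Proof. by rewrite !in_omega => H w iw; case: (iw) => _; apply; apply: H. Qed.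
Lemma Tm_omega B : Tm B (fun=> omega).
Proof. by rewrite /omega /inductive; dfn. Qed.

Lemma omega_ind (P : M -> Prop) : Df anyp (fun e => P (e 0)) -> P emp ->
  (forall n, n ∊ omega -> P n -> P (succ n)) -> forall n, n ∊ omega -> P n.
Proof.
move=> dP P0 PS n; rewrite in_omega => /(_ (sep omega P)); rewrite in_sep //.
case=> //; split; first by rewrite in_sep //; split=> //; exact: omega0.
by move=> k; rewrite !in_sep // => -[ko Pk]; split; [exact: omegaS|exact: PS].
Qed.

Lemma sat_is_omega w : sat M (is_omega w) <-> w = omega.
Proof.
split=> [[/sat_is_inductive [w0 wS] H]|->].
  have sw : isset w by exact: (isset_mem w0).
  apply: set_ext => // [|z]; first exact: isset_omega.
  split=> [zw|].
    have /H [_] : sat M (is_inductive omega).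
      by apply/sat_is_inductive; split; [exact: omega0|exact: omegaS].
    exact.
  by rewrite in_omega; apply.
split=> [|v /sat_is_inductive iv].
  by apply/sat_is_inductive; split; [exact: omega0|exact: omegaS].
by split=> [|z]; [exact: isset_omega|rewrite /= in_omega; apply].
Qed.

Lemma isset_nat n : n ∊ omega -> isset n.
Proof. by move: n; apply: omega_ind => [||n _ _]; [dfn|exact: isset_emp|exact: isset_adj]. Qed.
Lemma nat_trans n : n ∊ omega -> forall m, m ∊ n -> forall k, k ∊ m -> k ∊ n.
Proof.
move: n; apply: omega_ind => [|m|n no IH m]; first by dfn.
  by ins.
by rewrite in_adj => -[/IH H|->] k km; ins; left => //; exact: H.
Qed.
Lemma omega_trans n m : n ∊ omega -> m ∊ n -> m ∊ omega.
Proof.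
move=> no; move: n no m; apply: omega_ind => [|m|n no IH m]; first by dfn.
  by ins.
by ins => -[/IH|->].
Qed.
Lemma nat_case n : n ∊ omega -> n = emp \/ exists2 m, m ∊ omega & n = succ m.
Proof.
by move: n; apply: omega_ind => [||n no _]; [dfn|left|right; exists n].
Qed.
Lemma succ_neq0 n : succ n <> emp.
Proof. by move=> E; have : n ∊ emp by [rewrite -E; ins; right]; rewrite in_emp. Qed.
Lemma lt0S n : n ∊ omega -> emp ∊ succ n.
Proof.
move: n; apply: omega_ind => [||n no]; [dfn|by ins; right|].
by rewrite [in X in _ -> X]in_adj => H; left.
Qed.
Lemma ltSS m n : n ∊ omega -> m ∊ n -> succ m ∊ succ n.
Proof.
move=> no; move: n no m; apply: omega_ind => [|m|n no IH m]; first by dfn.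
  by ins.
by ins => -[/IH|->]; [ins => H; left|right].
Qed.
Lemma nat_lt_total m n : m ∊ omega -> n ∊ omega -> m ∊ n \/ m = n \/ n ∊ m.
Proof.
move=> mo no; move: n no m mo; apply: omega_ind => [|m mo|n no IH m mo].
- by dfn; exact: Tm_omega.
- case: (nat_case mo) => [|[k ko ->]]; first by right; left.
  by right; right; exact: lt0S.
- case: (IH m mo) => [H|[->|H]]; ins; [by left; left|by left; right|].
  have : succ n ∊ succ m by exact: ltSS.
  by ins => -[?|<-]; [right; right|right; left].
Qed.
Lemma ltS_inv m n : m ∊ omega -> n ∊ omega -> succ m ∊ succ n -> m ∊ n.
Proof.
move=> mo no; ins => -[H|<-]; last by ins; right.
by apply: (nat_trans no H); ins; right.
Qed.
Lemma succ_inj m n : succ m = succ n -> m = n.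
Proof.
move=> E; have : m ∊ succ n by rewrite -E; ins; right.
have : n ∊ succ m by rewrite E; ins; right.
by ins => -[h1|-> //] [h2|//]; case: (mem_asym h1).
Qed.
Lemma nat_strong_ind (P : M -> Prop) : Df anyp (fun e => P (e 0)) ->
  (forall n, n ∊ omega -> (forall m, m ∊ n -> P m) -> P n) ->
  forall n, n ∊ omega -> P n.
Proof.
move=> dP H n no; apply: (H) => //.
move: n no; apply: omega_ind => [|m|n no IH m]; first by dfn.
  by ins.
by ins => -[/IH //|->]; apply: (H).
Qed.
Lemma nat_least (P : M -> Prop) : Df anyp (fun e => P (e 0)) ->
  (exists2 n, n ∊ omega & P n) ->
  exists2 n, n ∊ omega & P n /\ forall m, m ∊ omega -> P m -> n ∊ succ m.
Proof.
move=> dP [n0 no0 Pn0]; apply: contrapT => H.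
suff: forall n, n ∊ omega -> ~ P n by move/(_ _ no0).
move=> n no Pn.
apply: (@nat_strong_ind (fun n => ~ P n)) no Pn; first by dfn.
move=> {}n no IH Pn; apply: H; exists n => //; split=> // m mo Pm.
by case: (nat_lt_total mo no) => [/IH //|[->|H]]; ins; [right|left].
Qed.

End Omega.

Ltac dfn_user3 := first [simple apply Tm_omega | dfn_user2].
Ltac dfn_user ::= dfn_user3.

Section Recursion.
Context {M : structure} {HM : zfa M}.
Implicit Types (x y z p g u v w m n k : M) (e : nat -> M) (B : M -> Prop).
Variables (a : M) (F : M -> M -> M).

(** An approximation is not asked to be a function. The clauses determine its pairs with first
    component up to [n] and leave all others free, so no domain has to be computed. *)
Definition rec_approx n g : Prop :=
  (forall y, opair emp y ∊ g <-> y = a) /\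
  forall k, k ∊ n -> forall y,
    opair (succ k) y ∊ g <-> exists2 z, opair k z ∊ g & y = F k z.
Definition nrec n : M := the (fun y => exists2 g, rec_approx n g & opair n y ∊ g).

Hypothesis dF : Tm anyp (fun e => F (e 0) (e 1)).

Lemma rec_approx_fun n g g' : n ∊ omega -> rec_approx n g -> rec_approx n g' ->
  forall k, k ∊ omega -> k ∊ succ n ->
  exists y, forall z, (opair k z ∊ g <-> z = y) /\ (opair k z ∊ g' <-> z = y).
Proof.
move=> no [g0 gS] [g0' gS']; apply: omega_ind => [|_|k ko IH /ltS_inv H].
- by dfn.
- by exists a.
have {H}kn := H ko no; have [|y Hy] := IH; first by ins; left.
exists (F k y) => z; have [G1 G2] := (gS k kn z, gS' k kn z).
split; [apply: iff_trans G1 _|apply: iff_trans G2 _].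
- by split=> [[w /(proj1 (Hy w)) -> //]|->]; exists y => //; apply/(proj1 (Hy y)).
- by split=> [[w /(proj2 (Hy w)) -> //]|->]; exists y => //; apply/(proj2 (Hy y)).
Qed.

Lemma nrec_uniq n g g' y y' : n ∊ omega -> rec_approx n g -> rec_approx n g' ->
  opair n y ∊ g -> opair n y' ∊ g' -> y = y'.
Proof.
move=> no G G'; have [|z Hz] := rec_approx_fun no G G' no; first by ins; right.
by move=> /(proj1 (Hz _)) -> /(proj2 (Hz _)) ->.
Qed.
Lemma nrec_eq n g y : n ∊ omega -> rec_approx n g -> opair n y ∊ g -> nrec n = y.
Proof.
move=> no G gy; apply: the_eq; first by exists g.
by move=> z [g' G' gz]; exact: (nrec_uniq no G' G gz gy).
Qed.

Lemma nrec_ex n : n ∊ omega -> exists g, rec_approx n g /\ opair n (nrec n) ∊ g.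
Proof.
have dR : Df anyp (fun e => rec_approx (e 0) (e 1)) by rewrite /rec_approx; dfn.
have dN : Tm anyp (fun e => nrec (e 0)) by rewrite /nrec; dfn.
move: n; apply: omega_ind => [||n no [g [G gn]]]; first by dfn.
  have G : rec_approx emp (sing (opair emp a)).
    split=> [y|k]; ins => //; split=> [/opair_inj[]//|-> //].
  exists (sing (opair emp a)); split=> //; ins.
  by congr opair; apply: (nrec_eq omega0 G); ins.
(* The old approximation may contain stray pairs at [succ n]; it is first cut down to arguments in
   [succ n], and then the one correct pair is added. *)
set z := nrec n in gn; pose (Q p := exists k y, k ∊ succ n /\ p = opair k y).
have dQ : Df anyp (fun e => Q (e 0)) by rewrite /Q; dfn.
pose (g' := adj (sep g Q) (opair (succ n) (F n z))).
have g'old k y : k ∊ succ n -> opair k y ∊ g' <-> opair k y ∊ g.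
  move=> kn; rewrite /g' in_adj in_sep //; split=> [[[]//|/opair_inj[E _]]|H].
    by case: (@mem_irrefl _ _ (succ n)); rewrite -{1}E.
  by left; split=> //; exists k, y.
have g'new y : opair (succ n) y ∊ g' <-> y = F n z.
  rewrite /g' in_adj in_sep //; split=> [[[_ [k [w [kn /opair_inj[E _]]]]]|]|->].
  - by case: (@mem_irrefl _ _ (succ n)); rewrite {1}E.
  - by case/opair_inj.
  - by right.
have G' : rec_approx (succ n) g'.
  split=> [y|k].
    by apply: iff_trans (g'old _ _ (lt0S no)) _; case: G => G0 _; exact: G0.
  case: G => G0 GS; rewrite {1}in_adj => -[kn|->] y.
    apply: iff_trans (g'old _ _ (ltSS no kn)) _; apply: iff_trans (GS _ kn _) _.
    have kn' : k ∊ succ n by ins; left.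
    by split=> -[w ? ?]; exists w => //; apply/(g'old _ _ kn').
  apply: iff_trans (g'new _) _.
  have nn : n ∊ succ n by ins; right.
  split=> [->|[w]]; first by exists z => //; apply/(g'old _ _ nn).
  by move=> /(g'old _ _ nn) gw ->; rewrite (nrec_uniq no (conj G0 GS) (conj G0 GS) gw gn).
have E : nrec (succ n) = F n z.
  by apply: (nrec_eq (omegaS no) G'); apply/g'new.
by exists g'; split=> //; apply/g'new.
Qed.

Lemma nrec0 : nrec emp = a.
Proof. by have [g [G ge]] := nrec_ex omega0; apply/(proj1 G). Qed.
Lemma nrecS n : n ∊ omega -> nrec (succ n) = F n (nrec n).
Proof.
move=> no; have [g [G gn]] := nrec_ex (omegaS no).
have nn : n ∊ succ n by ins; right.
case: (G) => G0 GS; case/(GS _ nn): gn => z gz ->; congr F; apply: esym.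
apply: (nrec_eq no _ gz); split=> // k kn; apply: GS; ins; by left.
Qed.

End Recursion.

Lemma Tm_nrec (M : structure) (HM : zfa M) B (a : M) (F : M -> M -> M) t :
  B a -> Tm B (fun e => F (e 0) (e 1)) -> Tm B t -> Tm B (fun e => nrec a F (t e)).
Proof. by move=> Ba dF dt; rewrite /nrec /rec_approx; dfn. Qed.

Ltac dfn_user4 := first [simple apply Tm_nrec | dfn_user3].
Ltac dfn_user ::= dfn_user4.

Section TransitiveClosure.
Context {M : structure} {HM : zfa M}.
Implicit Types (x y z u : M).

Definition trans u : Prop := forall y, y ∊ u -> forall z, z ∊ y -> z ∊ u.
Definition tc x : M := mkset (fun z => forall u, trans u -> x ∊ u -> z ∊ u).

Lemma Tm_tc B t : Tm B t -> Tm B (fun e => tc (t e)).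
Proof. by move=> ?; rewrite /tc /trans; dfn. Qed.

Lemma in_tc x z : (z ∊ tc x) = (forall u, trans u -> x ∊ u -> z ∊ u).
Proof.
rewrite /tc /trans; mk.
(* The iterated unions of [sing x] form an [omega]-sequence whose union is a transitive set
   containing [x]; this set bounds the class. *)
pose (F := nrec (sing x) (fun _ u => bigcup u)).
have dF : Tm anyp (fun e => F (e 0)) by rewrite /F; dfn.
exists (bigcup (repl omega F)) => y; apply.
  move=> u; ins => -[s]; rewrite in_repl // => -[n no ->] un v vu.
  ins; exists (F (succ n)); first by rewrite in_repl //; exists (succ n) => //; apply: omegaS.
  by rewrite /F nrecS //; [ins; exists u|dfn].
ins; exists (F emp); first by rewrite in_repl //; exists emp => //; apply: omega0.
by rewrite /F nrec0; [ins|dfn].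
Qed.
Lemma tc_self x : x ∊ tc x.
Proof. by rewrite in_tc. Qed.
Lemma tc_trans x : trans (tc x).
Proof.
move=> y; rewrite in_tc => yx z zy; rewrite in_tc => u tu xu; exact: (tu y (yx _ tu xu)).
Qed.
Lemma tc_mem x y : y ∊ x -> y ∊ tc x.
Proof. by apply: tc_trans; exact: tc_self. Qed.
Lemma tc_sub x y z : y ∊ x -> z ∊ tc y -> z ∊ tc x.
Proof. by move=> yx; rewrite in_tc; apply; [exact: tc_trans|exact: tc_mem]. Qed.

Lemma eps_ind (P : M -> Prop) : Df anyp (fun e => P (e 0)) ->
  (forall x, (forall y, y ∊ x -> P y) -> P x) -> forall x, P x.
Proof.
move=> dP H x; apply: contrapT => nP.
have dN : Df anyp (fun e => ~ P (e 0)) by dfn.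
have [|y] := @foundation _ _ (sep (tc x) (fun z => ~ P z)).
  by exists x; rewrite in_sep //; split=> //; exact: tc_self.
rewrite in_sep // => -[yx nPy] Hy; apply: nPy; apply: H => z zy.
apply: contrapT => nPz; apply: (Hy z) (zy); rewrite in_sep //.
by split=> //; exact: (tc_trans yx zy).
Qed.

Lemma tc_inv x z : z ∊ tc x -> z = x \/ exists2 y, y ∊ x & z ∊ tc y.
Proof.
have dt : Df anyp (fun e => e 0 = x \/ exists2 y, y ∊ x & e 0 ∊ tc y).
  by dfn; apply: Tm_tc; dfn.
rewrite in_tc => /(_ (sep (tc x) (fun z => z = x \/ exists2 y, y ∊ x & z ∊ tc y))).
rewrite !in_sep // => -[]//; last by split; [exact: tc_self|left].
move=> y; rewrite !in_sep // => -[yx H] w wy; rewrite in_sep //.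
split; first exact: (tc_trans yx wy).
right; case: H => [E|[v vx yv]]; first by exists w; [rewrite -E|exact: tc_self].
by exists v => //; exact: (tc_trans yv wy).
Qed.

End TransitiveClosure.
Ltac dfn_user5 := first [simple apply Tm_tc | dfn_user4].
Ltac dfn_user ::= dfn_user5.
#[export] Hint Resolve isset_omega omega0 omegaS tc_self : core.

(** * Functions and finite sets *)

Section Functions.
Context {M : structure} {HM : zfa M}.
Implicit Types (x y z a b c p f g u v w m n k : M) (e : nat -> M) (B : M -> Prop).

Definition isfun f a b : Prop :=
  isset f /\ (forall p, p ∊ f -> exists x y, x ∊ a /\ y ∊ b /\ p = opair x y) /\
  forall x, x ∊ a -> exists y, opair x y ∊ f /\ forall z, opair x z ∊ f -> z = y.
Definition ap f x : M := the (fun y => opair x y ∊ f).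
Definition lam a (F : M -> M) : M := repl a (fun x => opair x (F x)).
Definition isinj f a b : Prop :=
  isfun f a b /\ forall x y, x ∊ a -> y ∊ a -> ap f x = ap f y -> x = y.
Definition isbij f a b : Prop :=
  isinj f a b /\ forall y, y ∊ b -> exists2 x, x ∊ a & ap f x = y.

Lemma Tm_ap B s t : Tm B s -> Tm B t -> Tm B (fun e => ap (s e) (t e)).
Proof. by move=> ? ?; rewrite /ap; dfn. Qed.
Lemma Tm_lam B t (F : (nat -> M) -> M -> M) : Tm B t ->
  Tm B (fun e => F (fun i => e (S i)) (e 0)) -> Tm B (fun e => lam (t e) (F e)).
Proof. by move=> ? ?; rewrite /lam; apply: Tm_repl => //; apply: Tm_opair => //; dfn. Qed.
Lemma Df_isfun B s t r : Tm B s -> Tm B t -> Tm B r ->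
  Df B (fun e => isfun (s e) (t e) (r e)).
Proof. by move=> ? ? ?; rewrite /isfun; dfn. Qed.
Lemma Df_isinj B s t r : Tm B s -> Tm B t -> Tm B r ->
  Df B (fun e => isinj (s e) (t e) (r e)).
Proof.
move=> ? ? ?; rewrite /isinj; apply: Df_and; first exact: Df_isfun.
by dfn; apply: Tm_ap; dfn.
Qed.
Lemma Df_isbij B s t r : Tm B s -> Tm B t -> Tm B r ->
  Df B (fun e => isbij (s e) (t e) (r e)).
Proof.
move=> ? ? ?; rewrite /isbij; apply: Df_and; first exact: Df_isinj.
by dfn; apply: Tm_ap; dfn.
Qed.

Lemma sat_upair p x y : sat M (is_upair p x y) <-> p = upair x y.
Proof.
split=> [[sp H]|->]; last by split=> [|z]; [exact: isset_upair|rewrite /= in_upair].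
by apply: set_eqP => // z; ins; apply: propext; apply: H.
Qed.
Lemma sat_opair p x y : sat M (is_opair p x y) <-> p = opair x y.
Proof.
have E u : upair u u = sing u.
  by apply: set_eqP => // z; ins; apply: propext; tauto.
split=> [[u [v [/sat_upair -> [/sat_upair -> /sat_upair ->]]]]|->]; first by rewrite E.
by exists (sing x), (upair x y); split; [|split]; apply/sat_upair => //; rewrite E.
Qed.
Lemma sat_app f x y : sat M (app f x y) <-> opair x y ∊ f.
Proof.
split=> [[p [pf /sat_opair <-//]]|H]; exists (opair x y); split=> //.
exact/sat_opair.
Qed.

Lemma sat_is_fun f a b : sat M (is_fun f a b) <-> isfun f a b.
Proof.
split=> -[sf [H1 H2]]; split=> //; split.
- move=> p /H1 [x [xa [y [yb /sat_opair E]]]]; by exists x, y.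
- move=> x /H2 [y [/sat_app xy H]]; exists y; split=> // z /sat_app; exact: H.
- by move=> p /H1 [x [y [xa [yb /sat_opair E]]]]; exists x; split=> //; exists y.
- move=> x /H2 [y [xy H]]; exists y; split; first exact/sat_app.
  by move=> z /sat_app; exact: H.
Qed.

Section Isfun.
Variables f a b : M.
Hypothesis Hf : isfun f a b.
Lemma ap_mem x : x ∊ a -> opair x (ap f x) ∊ f.
Proof.
case: Hf => _ [_ H] /H [y [xy u]]; apply: (theP (Q := fun y => opair x y ∊ f)).
  by exists y.
by move=> z w /u -> /u ->.
Qed.
Lemma ap_in x : x ∊ a -> ap f x ∊ b.
Proof.
move=> /ap_mem; case: Hf => _ [H _] /H [x' [y' [_ [? /opair_inj[_ -> //]]]]].
Qed.
Lemma ap_eq x y : opair x y ∊ f -> x ∊ a /\ y = ap f x.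
Proof.
case: (Hf) => _ [H1 H2] xy; have xa : x ∊ a.
  by case: (H1 _ xy) => x' [y' [xa [_ /opair_inj[-> _]]]].
by split=> //; case: (H2 _ xa) => z [_ u]; rewrite (u _ xy) (u _ (ap_mem xa)).
Qed.
Lemma ap_iff x y : x ∊ a -> (opair x y ∊ f) = (y = ap f x).
Proof.
by move=> xa; apply: propext; split=> [/ap_eq[]//|->]; exact: ap_mem.
Qed.
Lemma in_fun p : p ∊ f -> exists2 x, x ∊ a & p = opair x (ap f x).
Proof.
case: (Hf) => _ [H1 _] pf; case: (H1 _ pf) => x [y [xa [_ E]]].
by exists x => //; rewrite E in pf *; case: (ap_eq pf) => _ <-.
Qed.
End Isfun.

Lemma sat_is_inj f a b : sat M (is_inj f a b) <-> isinj f a b.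
Proof.
split=> [[/sat_is_fun Hf H]|[Hf H]]; split=> //.
- move=> x y xa ya E; apply: (H x y (ap f x)); apply/sat_app; last rewrite E; exact: (ap_mem Hf).
- exact/sat_is_fun.
- move=> x y z /sat_app xz /sat_app yz; case: (ap_eq Hf xz) => xa zx; case: (ap_eq Hf yz) => ya zy.
  by apply: H => //; rewrite -zx.
Qed.
Lemma sat_is_bij f a b : sat M (is_bij f a b) <-> isbij f a b.
Proof.
split=> [[/sat_is_inj Hf H]|[Hf H]]; split=> //.
- move=> y /H [x [xa /sat_app xy]]; exists x => //; apply: esym.
  by case: (Hf) => f' _; case: (ap_eq f' xy).
- exact/sat_is_inj.
- move=> y /H [x xa <-]; exists x; split=> //; apply/sat_app.
  by case: (Hf) => f' _; apply: (ap_mem f').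
Qed.

Lemma isfun_cod f a b c : isfun f a b -> (forall x, x ∊ a -> ap f x ∊ c) -> isfun f a c.
Proof.
move=> Hf H; case: (Hf) => sf [_ H2]; split=> //; split=> // p /(in_fun Hf) [x xa ->].
by exists x, (ap f x); split=> //; split=> //; exact: H.
Qed.

Section Lam.
Variables (a : M) (F : M -> M).
Hypothesis dF : Tm anyp (fun e => F (e 0)).
Lemma in_lam p : (p ∊ lam a F) = (exists2 x, x ∊ a & p = opair x (F x)).
Proof. by rewrite /lam in_repl //; dfn. Qed.
Lemma opair_lam x y : (opair x y ∊ lam a F) = (x ∊ a /\ y = F x).
Proof.
rewrite in_lam; apply: propext; split=> [[x' xa /opair_inj[-> ->]]//|[xa ->]].
by exists x.
Qed.
Lemma ap_lam x : x ∊ a -> ap (lam a F) x = F x.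
Proof. by move=> xa; apply: the_eq => [|z]; rewrite opair_lam // => -[]. Qed.
Lemma isfun_lam b : (forall x, x ∊ a -> F x ∊ b) -> isfun (lam a F) a b.
Proof.
move=> H; split; first exact: isset_repl; split=> [p|x xa].
  by rewrite in_lam => -[x xa ->]; exists x, (F x); split=> //; split=> //; exact: H.
exists (F x); rewrite opair_lam; split=> // z; by rewrite opair_lam => -[].
Qed.
Lemma isinj_lam b : (forall x, x ∊ a -> F x ∊ b) ->
  (forall x y, x ∊ a -> y ∊ a -> F x = F y -> x = y) -> isinj (lam a F) a b.
Proof. by move=> H I; split=> [|x y xa ya]; [exact: isfun_lam|rewrite !ap_lam//; exact: I]. Qed.
Lemma isbij_lam b : (forall x, x ∊ a -> F x ∊ b) ->
  (forall x y, x ∊ a -> y ∊ a -> F x = F y -> x = y) ->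
  (forall y, y ∊ b -> exists2 x, x ∊ a & F x = y) -> isbij (lam a F) a b.
Proof.
move=> H I S; split=> [|y /S [x xa <-]]; first exact: isinj_lam.
by exists x => //; rewrite ap_lam.
Qed.
End Lam.

End Functions.

Ltac dfn_user6 := first [simple apply Tm_ap | simple apply Tm_lam | simple apply Df_isfun
  | simple apply Df_isinj | simple apply Df_isbij | dfn_user5].
Ltac dfn_user ::= dfn_user6.

Section Finite.
Context {M : structure} {HM : zfa M}.
Implicit Types (x y z a b c p f g s u v w m n k : M) (e : nat -> M) (B : M -> Prop).

Definition fin x : Prop := isset x /\ exists2 n, n ∊ omega & exists f, isbij f x n.

Lemma Df_fin B t : Tm B t -> Df B (fun e => fin (t e)).
Proof. by move=> ?; rewrite /fin; dfn. Qed.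

Lemma sat_finite x : isset x -> sat M (finite x) <-> fin x.
Proof.
move=> sx; split=> [[w [/sat_is_omega -> [n [nw [f /sat_is_bij H]]]]]|[_ [n nw [f H]]]].
  by split=> //; exists n => //; exists f.
exists omega; split; first exact/sat_is_omega.
by exists n; split=> //; exists f; apply/sat_is_bij.
Qed.

Lemma isset_fin x : fin x -> isset x.
Proof. by case. Qed.

Lemma fin_emp : fin emp.
Proof.
split=> //; exists emp => //; exists (lam emp id).
by apply: isbij_lam; first (by dfn); move=> x; ins.
Qed.

Lemma set_adjD x a : isset x -> a ∊ x -> x = adj (diff x (sing a)) a.
Proof.
move=> sx ax; apply: set_eqP => // z; ins; apply: propext.
by split=> [zx|[[]//|->//]]; case: (pselect (z = a)); auto.
Qed.

Lemma fin_adj x a : fin x -> fin (adj x a).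
Proof.
move=> fx; case: (pselect (a ∊ x)) => ax.
  have -> : adj x a = x; last by [].
  apply: set_eqP => // [|z]; first exact: isset_fin.
  by ins; apply: propext; split=> [[//|->//]|]; left.
case: fx => sx [n no [f [[Hf If] Sf]]]; split=> //; exists (succ n); first exact: omegaS.
pose (Q y z := (y ∊ x /\ z = ap f y) \/ (~ y ∊ x /\ z = n)).
pose (F y := the (Q y)).
have dF : Tm anyp (fun e => F (e 0)) by rewrite /F /Q; dfn.
have F1 y : y ∊ x -> F y = ap f y.
  by move=> yx; apply: the_eq; [left|move=> z [[]|[]]].
have F2 : F a = n by apply: the_eq; [right|move=> z [[]|[]]].
have lt y : y ∊ x -> ap f y <> n.
  by move=> yx E; have := ap_in Hf yx; rewrite E; apply: mem_irrefl.
exists (lam (adj x a) F); apply: isbij_lam => // [y|y z|y].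
- ins => -[yx|->]; last by rewrite F2; right.
  by rewrite F1 //; left; exact: (ap_in Hf).
- ins => -[yx|->] [zx|->] //; rewrite ?F2 !F1 //; first exact: If.
    by move=> E; case: (lt y yx).
  by move=> E; case: (lt z zx).
- ins => -[/Sf[z zx <-]|->]; last by exists a => //; ins; right.
  by exists z; [ins; left|rewrite F1].
Qed.

(** Internal induction on the number of elements: the element that a bijection with [succ n] sends
    to [n] is removed. *)
Lemma fin_ind (P : M -> Prop) : Df anyp (fun e => P (e 0)) -> P emp ->
  (forall s a, fin s -> ~ a ∊ s -> P s -> P (adj s a)) -> forall s, fin s -> P s.
Proof.
move=> dP P0 PS s [ss [n no [f Hf]]].
have: forall n, n ∊ omega -> forall s, isset s -> forall f, isbij f s n -> P s; last first.
  by move/(_ n no s ss f Hf).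
move=> {s ss n no f Hf}; apply: omega_ind => [|s ss f [[Hf _] _]|n no IH s ss f [[Hf If] Sf]].
- by dfn.
- rewrite (empP ss) // => y ys; by have := ap_in Hf ys; ins.
have [|a as_ Ea] := Sf n; first by ins; right.
rewrite (set_adjD ss as_).
have bij : isbij (lam (diff s (sing a)) (ap f)) (diff s (sing a)) n.
  apply: isbij_lam => [|y|y z|y yn]; first by dfn.
  - ins => -[ys ya]; have := ap_in Hf ys; ins => -[//|E].
    by case: ya; apply: If => //; rewrite E.
  - by ins => -[? _] [? _]; apply: If.
  - have [|z zs Ey] := Sf y; first by ins; left.
    exists z => //; ins; split=> // E; rewrite E Ea in Ey.
    by rewrite -Ey in yn; exact: (mem_irrefl yn).
apply: PS; last exact: (IH _ _ _ bij).
- by split=> //; exists n => //; eexists; exact: bij.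
- by ins => -[_]; apply.
Qed.

Lemma fin_sub x s : fin x -> sub s x -> fin s.
Proof.
move=> fx; move: x fx s; apply: fin_ind => [|s [ss H]|x a fx ax IH s [ss H]].
- by dfn; apply: Df_fin; dfn.
- by rewrite (empP ss) => [|y /H]; [exact: fin_emp|ins].
have H1 : fin (diff s (sing a)).
  by apply: IH; split=> // z; ins => -[/H]; ins => -[].
case: (pselect (a ∊ s)) => as_; first by rewrite (set_adjD ss as_); exact: fin_adj.
apply: IH; split=> // z zs; move: (H z zs); ins => -[//|E]; by rewrite -E in as_.
Qed.

Lemma fin_sing x : fin (sing x).
Proof.
have -> : sing x = adj emp x; last by apply: fin_adj; exact: fin_emp.
by apply: set_eqP => // z; ins; apply: propext; tauto.
Qed.

Lemma fin_repl x (F : M -> M) : Tm anyp (fun e => F (e 0)) -> fin x -> fin (repl x F).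
Proof.
move=> dF; move: x; apply: fin_ind => [||x a fx _ IH].
- by apply: Df_fin; dfn.
- have -> : repl emp F = emp; last by exact: fin_emp.
  by apply: empP => // y; rewrite in_repl // => -[z]; ins.
have -> : repl (adj x a) F = adj (repl x F) (F a); last by exact: fin_adj.
apply: set_eqP => // z; ins; rewrite !in_repl //; apply: propext; split.
  by case=> y; ins => -[yx|->] ->; [left; exists y|right].
by case=> [[y yx ->]|->]; [exists y|exists a]; ins; auto.
Qed.

Lemma fin_cup x y : fin x -> fin y -> fin (cup x y).
Proof.
move=> fx fy; move: y fy; apply: fin_ind => [||y a fy _ IH].
- by apply: Df_fin; dfn.
- have -> : cup x emp = x; last by [].
  apply: set_eqP; [by []|exact: isset_fin|move=> z; ins].
  by apply: propext; tauto.
have -> : cup x (adj y a) = adj (cup x y) a; last by exact: fin_adj.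
by apply: set_eqP => // z; ins; apply: propext; tauto.
Qed.

Lemma fin_bigcup s : fin s -> (forall x, x ∊ s -> fin x) -> fin (bigcup s).
Proof.
move: s; apply: fin_ind => [|_|s a fs _ IH H].
- by dfn; apply: Df_fin; dfn.
- have -> : bigcup emp = emp; last by exact: fin_emp.
  by apply: empP => // z; ins => -[x]; ins.
have -> : bigcup (adj s a) = cup (bigcup s) a; last first.
  by apply: fin_cup; [apply: IH => x xs|]; apply: H; ins; auto.
apply: set_eqP => // z; ins; apply: propext; split.
  by case=> y; ins => -[ys|->] zy; [left; exists y|right].
by case=> [[y ys zy]|za]; [exists y|exists a]; ins; auto.
Qed.

Lemma fin_upair x y : fin (upair x y).
Proof.
have -> : upair x y = cup (sing x) (sing y); last by apply: fin_cup; apply: fin_sing.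
by apply: set_eqP => // z; ins.
Qed.

Lemma fin_pow x : fin x -> fin (pow x).
Proof.
move: x; apply: fin_ind => [||x a fx ax IH]; first by apply: Df_fin; dfn.
  have -> : pow emp = sing emp; last by exact: fin_sing.
  apply: set_eqP => // z; ins; apply: propext; split=> [[sz H]|->//].
  by apply: empP => // y /H; ins.
have -> : pow (adj x a) = cup (pow x) (repl (pow x) (fun u => adj u a)); last first.
  by apply: fin_cup => //; apply: fin_repl => //; dfn.
have dF : Tm anyp (fun e : nat -> M => adj (e 0) a) by dfn.
apply: set_eqP => // z; ins; rewrite in_repl //; apply: propext; split.
  move=> [sz H]; case: (pselect (a ∊ z)) => az.
    right; exists (diff z (sing a)); last exact: set_adjD.
    by ins; split=> // y; ins => -[/H]; ins => -[].
  left; split=> // y yz; move: (H y yz); ins => -[//|E]; by rewrite -E in az.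
case=> [[sz H]|[y]]; first by split=> // y /H; ins; left.
by ins => -[sy H] ->; split=> // w; ins => -[/H|->]; auto.
Qed.

(** Written as a union of images, the product exists by replacement, and its finiteness reduces to
    [fin_repl] and [fin_bigcup]. *)
Lemma prodE a b : prod a b = bigcup (repl a (fun x => repl b (opair x))).
Proof.
have d1 x : Tm anyp (fun e : nat -> M => opair x (e 0)) by dfn.
have d2 : Tm anyp (fun e : nat -> M => repl b (opair (e 0))) by dfn.
have H z : (exists2 y, y ∊ repl a (fun x => repl b (opair x)) & z ∊ y) <->
   exists x y, x ∊ a /\ y ∊ b /\ z = opair x y.
  split=> [[w]|[x [y [xa [yb ->]]]]].
    by rewrite in_repl // => -[x xa ->]; rewrite in_repl // => -[y yb ->]; exists x, y.
  by exists (repl b (opair x)); rewrite in_repl //; [exists x|exists y].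
apply: set_eqP => // z; rewrite in_bigcup; apply: propext; apply: iff_trans (iff_sym (H z)).
apply: in_mkset; last by dfn.
exists (bigcup (repl a (fun x => repl b (opair x)))) => {}z; ins; exact: (proj2 (H z)).
Qed.
Lemma in_prod a b z : (z ∊ prod a b) = (exists x y, x ∊ a /\ y ∊ b /\ z = opair x y).
Proof.
have d1 x : Tm anyp (fun e : nat -> M => opair x (e 0)) by dfn.
have d2 : Tm anyp (fun e : nat -> M => repl b (opair (e 0))) by dfn.
rewrite prodE; ins; apply: propext; split=> [[w]|[x [y [xa [yb ->]]]]].
  by rewrite in_repl // => -[x xa ->]; rewrite in_repl // => -[y yb ->]; exists x, y.
by exists (repl b (opair x)); rewrite in_repl //; [exists x|exists y].
Qed.
Lemma opair_prod a b x y : (opair x y ∊ prod a b) = (x ∊ a /\ y ∊ b).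
Proof.
rewrite in_prod; apply: propext; split; last by move=> [? ?]; exists x, y.
by move=> [x' [y' [? [? /opair_inj[-> ->]]]]].
Qed.
Lemma fin_prod a b : fin a -> fin b -> fin (prod a b).
Proof.
move=> fa fb; have d1 x : Tm anyp (fun e : nat -> M => opair x (e 0)) by dfn.
have d2 : Tm anyp (fun e : nat -> M => repl b (opair (e 0))) by dfn.
rewrite prodE; apply: fin_bigcup => [|x]; first exact: fin_repl.
by rewrite in_repl // => -[y ya ->]; exact: fin_repl.
Qed.

Lemma fin_rel a b (R : M -> M -> Prop) : Df anyp (fun e => R (e 0) (e 1)) ->
  isset b -> fin a -> (forall y, y ∊ b -> exists2 x, x ∊ a & R x y) ->
  (forall x y z, x ∊ a -> y ∊ b -> z ∊ b -> R x y -> R x z -> y = z) -> fin b.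
Proof.
move=> dR sb fa S U; pose (F x := the (fun y => y ∊ b /\ R x y)).
have dF : Tm anyp (fun e => F (e 0)) by rewrite /F; dfn.
apply: (fin_sub (fin_repl dF fa)); split=> // y yb; rewrite in_repl //.
case: (S y yb) => x xa Rxy; exists x => //; apply: esym; apply: the_eq => //.
by move=> z [zb Rxz]; apply: (U x).
Qed.

Lemma fin_nat n : n ∊ omega -> fin n.
Proof.
move: n; apply: omega_ind => [||n no IH]; [by apply: Df_fin; dfn|exact: fin_emp|exact: fin_adj].
Qed.

Lemma fin_bounded s : fin s -> (forall x, x ∊ s -> x ∊ omega) ->
  exists2 n, n ∊ omega & forall x, x ∊ s -> x ∊ n.
Proof.
move: s; apply: fin_ind => [|_|s a fs _ IH H]; first by dfn.
  by exists emp => // x; ins.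
have [|n no Hn] := IH; first by move=> x xs; apply: H; ins; left.
have ao : a ∊ omega by apply: H; ins; right.
case: (nat_lt_total ao no) => [an|E].
  by exists n => // x; ins => -[/Hn|->].
exists (succ a); first exact: omegaS.
move=> x; ins => -[/Hn xn|]; last by right.
left; case: E => [->//|na]; exact: (nat_trans ao na).
Qed.

Lemma omega_infinite : ~ fin omega.
Proof. by move/fin_bounded => [//|n no /(_ n no)]; exact: mem_irrefl. Qed.

End Finite.
Ltac dfn_user7 := first [simple apply Df_fin | dfn_user6].
Ltac dfn_user ::= dfn_user7.

(** * The action of the permutations of the atoms *)

Section Permutations.
Context {M : structure} {HM : zfa M}.
Implicit Types (x y z a b c p f g h u v w : M) (e : nat -> M) (B : M -> Prop).

Definition atoms : M := mkset (fun x => atom M x).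
Lemma in_atoms x : (x ∊ atoms) = atom M x.
Proof.
by mk; case: (zfa_sentence ZFA_set_of_atoms) => A [_ H]; exists A => y /H.
Qed.
Lemma sat_atom_set A : sat M (is_atom_set A) <-> A = atoms.
Proof.
split=> [[sA H]|->]; first by apply: set_eqP => // [|x]; [exact: isset_mkset|rewrite in_atoms; apply: propext; apply: H].
by split=> [|x]; [exact: isset_mkset|rewrite /= in_atoms].
Qed.
Lemma Tm_atoms B : Tm B (fun=> atoms).
Proof. by rewrite /atoms; dfn. Qed.

Definition perm f : Prop := isbij f atoms atoms.
Lemma sat_atom_permutation f : sat M (atom_permutation f) <-> perm f.
Proof.
split=> [[A [/sat_atom_set -> /sat_is_bij //]]|H].
by exists atoms; split; [exact/sat_atom_set|exact/sat_is_bij].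
Qed.
Lemma Df_perm B t : Tm B t -> Df B (fun e => perm (t e)).
Proof. by move=> ?; rewrite /perm; apply: Df_isbij => //; exact: Tm_atoms. Qed.

Definition act_witness f t g : Prop :=
  trans t /\ (exists b, isfun g t b) /\
  forall u, u ∊ t -> (atom M u -> opair u (ap g u) ∊ f) /\
    (isset u -> isset (ap g u) /\
      forall y, y ∊ ap g u <-> exists2 w, w ∊ u & opair w y ∊ g).
Definition act f x : M :=
  the (fun y => exists t g, act_witness f t g /\ x ∊ t /\ opair x y ∊ g).

Lemma Df_act_witness B s t r : Tm B s -> Tm B t -> Tm B r ->
  Df B (fun e => act_witness (s e) (t e) (r e)).
Proof. by move=> ? ? ?; rewrite /act_witness /trans; dfn. Qed.
Lemma Tm_act B s t : Tm B s -> Tm B t -> Tm B (fun e => act (s e) (t e)).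
Proof.
move=> ? ?; rewrite /act; apply: Tm_the; do 2 apply: Df_ex.
by apply: Df_and; [apply: Df_act_witness|]; dfn.
Qed.

End Permutations.

Ltac dfn_user8 := first [simple apply Tm_act | simple apply Tm_atoms | simple apply Df_perm
  | simple apply Df_act_witness | dfn_user7].
Ltac dfn_user ::= dfn_user8.

Section Action.
Context {M : structure} {HM : zfa M}.
Implicit Types (x y z a b c p g h t u v w : M).
Variable f : M.
Hypothesis Hf : perm f.

Let Hff : isfun f atoms atoms. Proof. by case: Hf => -[]. Qed.

Lemma act_witness_eq t g t' g' : act_witness f t g -> act_witness f t' g' ->
  forall u, u ∊ t -> u ∊ t' -> ap g u = ap g' u.
Proof.
move=> [tt [[b Hg] W]] [tt' [[b' Hg'] W']]; apply: eps_ind; first by dfn.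
move=> u IH ut ut'; have [A S] := W u ut; have [A' S'] := W' u ut'.
case: (pselect (atom M u)) => au.
  by case: (ap_eq Hff (A au)) => _ ->; case: (ap_eq Hff (A' au)).
have [s1 e1] := S au; have [s2 e2] := S' au.
apply: set_ext => // y; apply: iff_trans (e1 y) _; apply: iff_trans (iff_sym (e2 y)).
split=> -[w wu wy]; exists w => //; have wt := tt _ ut _ wu; have wt' := tt' _ ut' _ wu.
  by have [_ ->] := ap_eq Hg wy; rewrite IH //; exact: (ap_mem Hg').
by have [_ ->] := ap_eq Hg' wy; rewrite -IH //; exact: (ap_mem Hg).
Qed.

Lemma act_witnessE t g u : act_witness f t g -> u ∊ t -> act f u = ap g u.
Proof.
move=> W ut; have [_ [[b Hg] _]] := W; apply: the_eq.
  by exists t, g; split=> //; split=> //; exact: (ap_mem Hg).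
move=> z [t' [g' [W' [ut' uz]]]]; have [_ [[b' Hg'] _]] := W'.
by have [_ ->] := ap_eq Hg' uz; rewrite (act_witness_eq W W' ut ut').
Qed.

Let acted x := exists t g, act_witness f t g /\ x ∊ t.
Let actF u := the (fun y => (atom M u /\ y = ap f u) \/ (isset u /\ y = repl u (act f))).
Let dF : Tm anyp (fun e => actF (e 0)).
Proof. by rewrite /actF; dfn. Qed.
Let da : Tm anyp (fun e => act f (e 0)). Proof. by dfn. Qed.

Let actF_atom u : atom M u -> actF u = ap f u.
Proof. by move=> au; apply: the_eq; [left|move=> z [[]|[]]]. Qed.
Let actF_set u : isset u -> actF u = repl u (act f).
Proof. by move=> su; apply: the_eq; [right|move=> z [[]|[]]]. Qed.

Let acted_F u : acted u -> act f u = actF u.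
Proof.
case=> t [g [W ut]]; rewrite (act_witnessE W ut).
have [tt [[b Hg] /(_ u ut) [A S]]] := W.
case: (pselect (atom M u)) => au.
  by rewrite actF_atom //; case: (ap_eq Hff (A au)).
rewrite actF_set //; have [s1 H] := S au.
apply: set_ext => // y; apply: iff_trans (H y) _; rewrite in_repl //.
split=> -[w wu].
  move=> wy; exists w => //; have [_ ->] := ap_eq Hg wy.
  by rewrite (act_witnessE W) //; exact: tt wu.
rewrite (act_witnessE W (tt _ ut _ wu)) => ->; exists w => //.
by apply: (ap_mem Hg); exact: tt wu.
Qed.

(** A witness for [x] is built on [tc x], its values being given by one step of the recursion over
    [act f]. By induction the elements of [tc x] other than [x] have witnesses already, so these
    values fit together. *)
Let all_acted x : acted x.
Proof.
move: x; apply: eps_ind => [|x IH]; first by rewrite /acted; dfn.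
case: (pselect (acted x)) => // nx.
have IH2 w : w ∊ tc x -> w <> x -> acted w.
  move=> /tc_inv [//|[z zx wz] _]; have [t [g [W zt]]] := IH z zx.
  by exists t, g; split=> //; move: wz; rewrite in_tc; apply; case: W.
exists (tc x), (lam (tc x) actF); split=> //; split; first exact: tc_trans.
have Hl : isfun (lam (tc x) actF) (tc x) (repl (tc x) actF).
  by apply: isfun_lam => // u ux; rewrite in_repl //; exists u.
split; first by eexists; exact: Hl.
move=> u ux; rewrite ap_lam //; split=> [au|su].
  by rewrite actF_atom //; apply: (ap_mem Hff); rewrite in_atoms.
rewrite actF_set //; split=> // y; rewrite in_repl //.
have Hw w : w ∊ u -> act f w = actF w.
  move=> wu; apply: acted_F; apply: IH2; first exact: (tc_trans ux wu).
  (* If [w] were [x], then [x] would be a member of itself or lie below one of its members [z]; in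
     the latter case the transitive witness for [z] would already cover [x]. *)
  move=> E; rewrite E in wu; case/tc_inv: (ux) => [Eu|[z zx uz]].
    by rewrite Eu in wu; exact: mem_irrefl wu.
  apply: nx; have [t [g [W zt]]] := IH z zx.
  exists t, g; split=> //; have [tt _] := W.
  have ut : u ∊ t by move: uz; rewrite in_tc; apply.
  exact: tt wu.
split=> -[w wu]; first by rewrite Hw // => ->; exists w; rewrite ?opair_lam //; split=> //; exact: tc_trans wu.
by rewrite opair_lam // => -[_ ->]; exists w => //; rewrite Hw.
Qed.

Lemma act_atom u : atom M u -> act f u = ap f u.
Proof. by move=> au; rewrite acted_F // actF_atom. Qed.
Lemma act_set u : isset u -> act f u = repl u (act f).
Proof. by move=> su; rewrite acted_F // actF_set. Qed.
Lemma sat_acts x y : sat M (acts f x y) <-> y = act f x.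
Proof.
have [t [g [W xt]]] := all_acted x; have [tt [[b Hg] S]] := W.
split=> [[t' [g' [T' [xt' [[b' /sat_is_fun Hg'] [S' /sat_app xy]]]]]]|->].
  have W' : act_witness f t' g'.
    split=> [u ut v|]; first exact: T'.
    split=> [|u ut]; first by exists b'.
    have [|A1 A2] := S' u ut (ap g' u); first by apply/sat_app; apply: (ap_mem Hg').
    split=> [/A1/sat_app//|/A2 [? H]]; split=> // z; split.
      by move=> /H [w [wu /sat_app ?]]; exists w.
    by move=> [w wu wz]; apply/H; exists w; split=> //; apply/sat_app.
  by rewrite (act_witnessE W' xt'); case: (ap_eq Hg' xy).
exists t, g; split; [exact: tt|split=> //; split; [by exists b; exact/sat_is_fun|split]].
  move=> u ut v /sat_app /(ap_eq Hg) [_ ->]; have [A1 A2] := S u ut.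
  split=> [/A1 ?|/A2 [? H]]; first exact/sat_app.
  split=> // z; split; first by move=> /H [w wu wz]; exists w; split=> //; apply/sat_app.
  by move=> [w [wu /sat_app wz]]; apply/H; exists w.
by apply/sat_app; rewrite (act_witnessE W xt); apply: (ap_mem Hg).
Qed.

Lemma act_isset x : isset x -> isset (act f x).
Proof. by move=> sx; rewrite act_set. Qed.
Lemma act_isatom x : atom M x -> atom M (act f x).
Proof. by move=> ax; rewrite act_atom // -in_atoms; apply: (ap_in Hff); rewrite in_atoms. Qed.
Lemma in_act x y : isset x -> (y ∊ act f x) = exists2 z, z ∊ x & y = act f z.
Proof. by move=> sx; rewrite act_set // in_repl. Qed.
Lemma act_mem x y : x ∊ y -> act f x ∊ act f y.
Proof. by move=> xy; rewrite in_act; [exists x|exact: isset_mem xy]. Qed.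

End Action.

Section Group.
Context {M : structure} {HM : zfa M}.
Implicit Types (x y z a b c p f g h t u v w : M).

Definition pcomp f g : M := lam atoms (fun a => ap f (ap g a)).
Definition pinv f : M := lam atoms (fun b => the (fun a => a ∊ atoms /\ ap f a = b)).

Lemma ap_pcomp f g a : a ∊ atoms -> ap (pcomp f g) a = ap f (ap g a).
Proof. by move=> aA; rewrite ap_lam //; dfn. Qed.
Lemma perm_comp f g : perm f -> perm g -> perm (pcomp f g).
Proof.
move=> [[Hf If] Sf] [[Hg Ig] Sg].
have gin x : x ∊ atoms -> ap g x ∊ atoms by exact: (ap_in Hg).
apply: isbij_lam; [by dfn|by move=> x /gin; exact: (ap_in Hf)| |].
  by move=> x y xa ya /(If _ _ (gin _ xa) (gin _ ya)); exact: Ig.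
by move=> y /Sf [z /Sg[x xa <-] <-]; exists x.
Qed.
Lemma ap_pinv f a : perm f -> a ∊ atoms -> ap (pinv f) (ap f a) = a.
Proof.
move=> [[Hf If] Sf] aA; rewrite ap_lam; [|by dfn|exact: (ap_in Hf aA)].
by apply: the_eq => // z [zA /If]; apply.
Qed.
Lemma pinv_in f b : perm f -> b ∊ atoms -> ap (pinv f) b ∊ atoms.
Proof. by move=> Hf; case: (Hf) => -[_ _] S /S [a aA <-]; rewrite ap_pinv. Qed.
Lemma ap_pinvK f b : perm f -> b ∊ atoms -> ap f (ap (pinv f) b) = b.
Proof. by move=> Hf; case: (Hf) => -[_ _] S /S [a aA <-]; rewrite ap_pinv. Qed.
Lemma perm_inv f : perm f -> perm (pinv f).
Proof.
move=> Hf; apply: isbij_lam; first by dfn.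
- move=> b bA; have := pinv_in Hf bA; rewrite ap_lam //; dfn.
- move=> b c bA cA E; rewrite -(ap_pinvK Hf bA) -(ap_pinvK Hf cA) !ap_lam ?E //; dfn.
- move=> a aA; have H : ap f a ∊ atoms by case: Hf => -[F _] _; exact: (ap_in F aA).
  by exists (ap f a) => //; have := ap_pinv Hf aA; rewrite ap_lam //; dfn.
Qed.

Lemma act_fix_atoms f x : perm f -> (forall a, a ∊ atoms -> ap f a = a) -> act f x = x.
Proof.
move=> Hf H; move: x; apply: eps_ind => [|x IH]; first by dfn.
case: (pselect (atom M x)) => ax; first by rewrite act_atom // H // in_atoms.
apply: set_ext => // [|z]; first exact: act_isset.
by rewrite in_act //; split=> [[y yx ->]|zx]; [rewrite IH|exists z => //; rewrite IH].
Qed.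
Lemma act_comp f g x : perm f -> perm g -> act (pcomp f g) x = act f (act g x).
Proof.
move=> Hf Hg; have Hc := perm_comp Hf Hg.
move: x; apply: eps_ind => [|x IH]; first by dfn.
case: (pselect (atom M x)) => ax.
  rewrite !act_atom //; first by rewrite ap_pcomp // in_atoms.
  by rewrite -act_atom //; exact: act_isatom.
have sg := act_isset Hg ax.
apply: set_ext => [||z]; [exact: act_isset|exact: act_isset|].
rewrite !in_act //; split=> [[y yx ->]|[y]].
  by rewrite IH //; exists (act g y) => //; exact: act_mem.
by rewrite in_act // => -[w wx ->] ->; exists w => //; rewrite IH.
Qed.
Lemma actK f x : perm f -> act (pinv f) (act f x) = x.
Proof.
move=> Hf; have Hi := perm_inv Hf; rewrite -act_comp //.
apply: act_fix_atoms => [|a aA]; first exact: perm_comp.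
by rewrite ap_pcomp // ap_pinv.
Qed.
Lemma actVK f x : perm f -> act f (act (pinv f) x) = x.
Proof.
move=> Hf; have Hi := perm_inv Hf; rewrite -act_comp //.
apply: act_fix_atoms => [|a aA]; first exact: perm_comp.
by rewrite ap_pcomp // ap_pinvK.
Qed.
Lemma act_inj f x y : perm f -> act f x = act f y -> x = y.
Proof. by move=> Hf E; rewrite -(actK x Hf) E actK. Qed.
Lemma act_memE f x y : perm f -> (act f x ∊ act f y) = (x ∊ y).
Proof.
move=> Hf; apply: propext; split; last exact: act_mem.
by move/(act_mem (perm_inv Hf)); rewrite !actK.
Qed.
Lemma act_atomE f x : perm f -> atom M (act f x) = atom M x.
Proof.
move=> Hf; apply: propext; split; last exact: act_isatom.
by move/(act_isatom (perm_inv Hf)); rewrite actK.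
Qed.

(** The action of [f] is an automorphism of the structure: it is inverted by the action of [pinv f]
    and preserves membership and atoms, so satisfaction is preserved by induction on the formula. *)
Lemma sat_act f (phi : form) (e : nat -> M) : perm f ->
  sat M (embed phi e) <-> sat M (embed phi (fun i => act f (e i))).
Proof.
move=> Hf; have sc (x : M) (e' : nat -> M) :
   (fun i => act f (scons x e' i)) = scons (act f x) (fun i => act f (e' i)).
  by apply: funext => -[].
elim: phi e => /= [i j|i j|i||p IHp q IHq|p IHp q IHq|p IHp q IHq|p IH|p IH] e.
- by rewrite act_memE.
- by split=> [->//|/(act_inj Hf)].
- by rewrite act_atomE.
- by [].
- by rewrite IHp IHq.
- by rewrite IHp IHq.
- by rewrite IHp IHq.
- split=> H x; last by apply/IH; rewrite sc.
  have : sat M (embed p (scons (act (pinv f) x) e)) by exact: H.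
  by move/(proj1 (IH (scons _ _))); rewrite sc actVK.
- split=> -[x]; first by move/(proj1 (IH (scons _ _))); rewrite sc => H; exists (act f x).
  by move=> H; exists (act (pinv f) x); apply/IH; rewrite sc actVK.
Qed.

(** Transfers definability from parameters fixed by [f] into invariance under [f]; most symmetry
    proofs for sets go through this lemma, which leaves a goal for [dfn]. *)
Lemma Df_act f (P : (nat -> M) -> Prop) e : perm f -> Df (fun m => act f m = m) P ->
  P e <-> P (fun i => act f (e i)).
Proof.
move=> Hf [phi [s [sB H]]]; apply: iff_trans (H e) _.
apply: iff_trans (sat_act _ _ Hf) _; apply: iff_trans (iff_sym (H _)).
by apply: sat_embed_ext => i; case E: (s i) => [k|m] //=; rewrite (sB _ _ E).
Qed.
Lemma Tm_actE f (t : (nat -> M) -> M) e : perm f -> Tm (fun m => act f m = m) t ->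
  act f (t e) = t (fun i => act f (e i)).
Proof. by move=> Hf dt; have [/(_ erefl)] := Df_act (scons (t e) e) Hf dt. Qed.
Lemma Tm_fix f x : perm f -> Tm (fun m => act f m = m) (fun=> x) -> act f x = x.
Proof. by move=> Hf /(Tm_actE (fun=> x) Hf). Qed.
Lemma act_opair f x y : perm f -> act f (opair x y) = opair (act f x) (act f y).
Proof.
move=> Hf; apply: (@Tm_actE f (fun e => opair (e 0) (e 1)) (scons x (fun=> y)) Hf).
by dfn.
Qed.

End Group.

(** * Permutation models satisfy ZFA *)

Notation fixedby f := (fun m => act f m = m).

(** The clause [pg_def] plays the part of normality of the filter: the group is definable from
    parameters that each of its members fixes, which makes the notions of support and symmetry
    invariant under the group. *)
Record perm_group {M : structure} {HM : zfa M} (G : M -> fm M) : Prop := PermGroup {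
  pg_perm : forall f, sat M (G f) -> perm f;
  pg_id : sat M (G (lam atoms id));
  pg_comp : forall f g, sat M (G f) -> sat M (G g) -> sat M (G (pcomp f g));
  pg_inv : forall f, sat M (G f) -> sat M (G (pinv f));
  pg_def : forall f, sat M (G f) -> Df (fixedby f) (fun e => sat M (G (e 0))) }.

Section PermutationModel.
Context {M : structure} {HM : zfa M}.
Variable G : M -> fm M.
Hypothesis HG : perm_group G.
Implicit Types (x y z a b c f g h u v w : M).

Notation Gp f := (sat M (G f)).

Definition supp E : Prop := sub E atoms /\ fin E.
Definition fixes E f : Prop := forall a, a ∊ E -> act f a = a.
Definition supports E x : Prop := forall f, Gp f -> fixes E f -> act f x = x.
Definition symm x : Prop := exists E, supp E /\ supports E x.
Definition HS x : Prop := forall y, y ∊ tc x -> symm y.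

Let Gdef : Df anyp (fun e => Gp (e 0)).
Proof. exact: Df_mono (pg_def HG (pg_id HG)). Qed.

Lemma Df_symm (B : M -> Prop) t : Df B (fun e => Gp (e 0)) -> Tm B t ->
  Df B (fun e => symm (t e)).
Proof. by move=> ? ?; rewrite /symm /supp /supports /fixes; dfn. Qed.
Lemma Df_HS (B : M -> Prop) t : Df B (fun e => Gp (e 0)) -> Tm B t ->
  Df B (fun e => HS (t e)).
Proof. by move=> ? ?; rewrite /HS; dfn; apply: Df_symm; dfn. Qed.
Lemma dHS : Df anyp (fun e => HS (e 0)).
Proof. by apply: Df_HS; dfn. Qed.
Lemma dHSf f : Gp f -> Df (fixedby f) (fun e => HS (e 0)).
Proof. by move=> Gf; apply: Df_HS; [exact: (pg_def HG)|dfn]. Qed.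

Lemma supp_cup E F : supp E -> supp F -> supp (cup E F).
Proof.
move=> [[_ sE] fE] [[_ sF] fF]; split; last exact: fin_cup.
by split=> // x; ins => -[/sE|/sF].
Qed.
Lemma supp_emp : supp emp.
Proof. by split; [split=> // x; ins|exact: fin_emp]. Qed.
Lemma supp_sing a : atom M a -> supp (sing a).
Proof. by move=> aa; split; [split=> // x; ins => ->; rewrite in_atoms|exact: fin_sing]. Qed.
Lemma supp_atom E a : supp E -> a ∊ E -> atom M a.
Proof. by move=> [[_ H] _] /H; rewrite in_atoms. Qed.
Lemma supports_sub E F x : (forall a, a ∊ E -> a ∊ F) -> supports E x -> supports F x.
Proof. by move=> H S f Gf Hf; apply: S => // a /H/Hf. Qed.
Lemma supports_cupl E F x : supports E x -> supports (cup E F) x.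
Proof. by apply: supports_sub => a; ins; left. Qed.
Lemma supports_cupr E F x : supports F x -> supports (cup E F) x.
Proof. by apply: supports_sub => a; ins; right. Qed.
Lemma supports_atom E a : a ∊ E -> supports E a.
Proof. by move=> aE f _; apply. Qed.

Lemma sat_symmetric x : sat M (symmetric G x) <-> symm x.
Proof.
split=> [[E [sE [aE [fE H]]]]|[E [HE H]]].
  have HE : supp E.
    by split; [split=> // a aE'; rewrite in_atoms; exact: aE|exact/sat_finite].
  exists E; split=> // f Gf Hf; apply: esym.
  apply/(sat_acts (pg_perm HG Gf)); apply: H => // a aE'.
  apply/sat_app; rewrite -{2}(Hf a aE') act_atom //; [|exact: (pg_perm HG)|exact: aE].
  have [[Hff _] _] := pg_perm HG Gf; apply: (ap_mem Hff).
  by rewrite in_atoms; exact: aE.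
have [[sE aE] fE] := HE.
exists E; split=> //; split; first by move=> a /(supp_atom HE).
split; first by apply/sat_finite.
move=> f Gf Hf; apply/(sat_acts (pg_perm HG Gf)); apply: esym.
apply: H => // a aE'; rewrite act_atom; [|exact: (pg_perm HG)|exact: (supp_atom HE aE')].
have [[Hff _] _] := pg_perm HG Gf; have /sat_app := Hf a aE'.
by case/(ap_eq Hff).
Qed.
Lemma sat_HS x : sat M (hereditarily_symmetric G x) <-> HS x.
Proof.
split=> H y.
  by rewrite in_tc => yx; apply/sat_symmetric; apply: H.
by move=> yx; apply/sat_symmetric; apply: H; rewrite in_tc.
Qed.

Lemma HS_symm x : HS x -> symm x.
Proof. by apply. Qed.
Lemma HS_mem x y : HS x -> y ∊ x -> HS y.
Proof. by move=> Hx yx z zy; apply: Hx; exact: (tc_sub yx zy). Qed.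
Lemma HS_intro x : symm x -> (forall y, y ∊ x -> HS y) -> HS x.
Proof. by move=> Sx H y /tc_inv [->//|[z zx yz]]; exact: (H z zx). Qed.
Lemma HS_atom a : atom M a -> HS a.
Proof.
move=> aa; apply: HS_intro => [|y /isset_mem //].
by exists (sing a); split; [exact: supp_sing|apply: supports_atom; ins].
Qed.
(** The usual conjugation of supports is replaced by definability: by [pg_def], the class [HS] is
    definable from parameters that [f] fixes. *)
Lemma HS_act f x : Gp f -> HS x -> HS (act f x).
Proof.
move=> Gf Hx; apply/(@Df_act _ _ f (fun e => HS (e 0)) (fun=> x)) => //.
- exact: (pg_perm HG).
- exact: dHSf.
Qed.
(** The last hypothesis says that [b] is definable from parameters which [f] fixes. It is the form
    in which [dfn] supplies supports. *)
Lemma HS_def b E : supp E -> (forall y, y ∊ b -> HS y) ->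
  (forall f, Gp f -> fixes E f -> Tm (fixedby f) (fun=> b)) -> HS b.
Proof.
move=> sE Hb H; apply: HS_intro => //; exists E; split=> // f Gf Hf.
by apply: Tm_fix; [exact: (pg_perm HG)|exact: H].
Qed.

Definition N : structure := permutation_model M G.
Definition val (x : N) : M := proj1_sig x.
Lemma valP (x : N) : HS (val x).
Proof. by apply/sat_HS; case: x. Qed.
Arguments valP : clear implicits.
Definition mkN x (Hx : HS x) : N := exist _ x (proj2 (sat_HS x) Hx).
Lemma mkN_ex x : HS x -> exists y : N, val y = x.
Proof. by move=> Hx; exists (mkN Hx). Qed.
Lemma val_inj (x y : N) : val x = val y -> x = y.
Proof. by case: x y => [x p] [y q] /= E; apply: eq_exist. Qed.
Lemma mem_val x (y : N) : x ∊ val y -> exists z : N, val z = x.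
Proof. by move=> xy; apply: mkN_ex; exact: (HS_mem (valP y) xy). Qed.

(** Satisfaction in the permutation model, rewritten with quantifiers relativized to [HS], becomes a
    definable predicate of the ground model. That is what the two schemata need. *)
Fixpoint rsat (p : form) (e : nat -> M) : Prop :=
  match p with
  | Mem i j => e i ∊ e j
  | Eq i j => e i = e j
  | Atom i => atom M (e i)
  | Fal => False
  | Imp p q => rsat p e -> rsat q e
  | And p q => rsat p e /\ rsat q e
  | Or p q => rsat p e \/ rsat q e
  | All p => forall x, HS x -> rsat p (scons x e)
  | Ex p => exists2 x, HS x & rsat p (scons x e)
  end.

Lemma rsatP (p : form) (e : nat -> N) :
  sat N (embed p e) <-> rsat p (fun i => val (e i)).
Proof.
have sc (x : N) (e' : nat -> N) :
   (fun i => val (scons x e' i)) = scons (val x) (fun i => val (e' i)).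
  by apply: funext => -[].
elim: p e => /= [i j|i j|i||p IHp q IHq|p IHp q IHq|p IHp q IHq|p IH|p IH] e.
1,3,4: by [].
- by split=> [->//|/val_inj].
- by rewrite IHp IHq.
- by rewrite IHp IHq.
- by rewrite IHp IHq.
- split=> H x; first by move=> Hx; move: (H (mkN Hx)); rewrite IH sc.
  by rewrite IH sc; apply: H; exact: valP.
- split=> -[x]; first by rewrite IH sc => H; exists (val x) => //; exact: valP.
  by move=> Hx H; exists (mkN Hx); rewrite IH sc.
Qed.

Lemma Df_rsat (B : M -> Prop) p : Df B (fun e => HS (e 0)) -> Df B (rsat p).
Proof.
move=> dH; elim: p => /= [i j|i j|i||p IHp q IHq|p IHp q IHq|p IHp q IHq|p IH|p IH].
1-4: by dfn.
- exact: Df_imp.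
- exact: Df_and.
- exact: Df_or.
- apply: Df_all; apply: Df_imp; first by dfn.
  by apply: Df_ext IH => e; rewrite (_ : scons _ _ = e) //; apply: funext => -[].
- apply: Df_ex2; first by dfn.
  by apply: Df_ext IH => e; rewrite (_ : scons _ _ = e) //; apply: funext => -[].
Qed.

(** Only finitely many parameters of a formula matter, and finitely many hereditarily symmetric sets
    have a common finite support, namely the one of [supp_env]. *)
Lemma rsat_bound p : exists k, forall e e', (forall i, (i < k)%N -> e i = e' i) ->
  rsat p e <-> rsat p e'.
Proof.
have bin (r q : form) (op : Prop -> Prop -> Prop) :
   (exists k, forall e e', (forall i, (i < k)%N -> e i = e' i) -> rsat r e <-> rsat r e') ->
   (exists k, forall e e', (forall i, (i < k)%N -> e i = e' i) -> rsat q e <-> rsat q e') ->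
   exists k, forall e e', (forall i, (i < k)%N -> e i = e' i) ->
     op (rsat r e) (rsat q e) <-> op (rsat r e') (rsat q e').
  move=> [k1 H1] [k2 H2]; exists (maxn k1 k2) => e e' E.
  rewrite (propext (H1 e e' _)) ?(propext (H2 e e' _)) // => i ik; apply: E;
    by rewrite leq_max ik ?orbT.
have sc k (x : M) (e e' : nat -> M) : (forall i, (i < k)%N -> e i = e' i) ->
  forall i, (i < k)%N -> scons x e i = scons x e' i.
  by move=> E [//|i] /= ik; apply: E; exact: ltnW.
elim: p => /= [i j|i j|i||p IHp q IHq|p IHp q IHq|p IHp q IHq|p [k IH]|p [k IH]].
- by exists (maxn i j).+1 => e e' E; rewrite !E // ltnS leq_max leqnn ?orbT.
- by exists (maxn i j).+1 => e e' E; rewrite !E // ltnS leq_max leqnn ?orbT.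
- by exists i.+1 => e e' E; rewrite E.
- by exists 0.
- exact: (bin p q (fun P Q => P -> Q)).
- exact: bin.
- exact: bin.
- exists k => e e' E; split=> H x Hx; move: (H x Hx); apply: (proj1 (IH _ _ _));
    by apply: sc => // i /E.
- exists k => e e' E; split=> -[x Hx H]; exists x => //; move: H;
    apply: (proj1 (IH _ _ _)); by apply: sc => // i /E.
Qed.

Lemma supp_env (e : nat -> N) k :
  exists2 E, supp E & forall i, (i < k)%N -> supports E (val (e i)).
Proof.
elim: k => [|k [E sE HE]]; first by exists emp => //; exact: supp_emp.
have [F [sF HF]] := HS_symm (valP (e k)).
exists (cup E F) => [|i]; first exact: supp_cup.
rewrite ltnS leq_eqVlt => /orP[/eqP ->|/HE]; first exact: supports_cupr.
exact: supports_cupl.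
Qed.

Lemma Df_slots (B : M -> Prop) (P : (nat -> M) -> Prop) (s : nat -> nat + M) :
  (forall i m, s i = inr m -> B m) -> Df B P -> Df B (fun e => P (fun i => slot (s i) e)).
Proof.
move=> sB [phi [s' [sB' H]]].
exists phi, (fun i => match s' i with inl k => s k | inr m => inr m end); split.
  by move=> i m; case E: (s' i) => [k|m'] => [/sB//|[<-]]; exact: sB' E.
move=> e; apply: iff_trans (H _) _; apply: sat_embed_ext => i.
by case: (s' i).
Qed.

(** Formulas with parameters in the model define symmetric sets. *)
Lemma rsat_env (p : form) (n : nat) (env : nat -> N) :
  exists2 E, supp E & forall (B : M -> Prop), Df B (fun e => HS (e 0)) ->
   B emp ->
   (forall m, supports E m -> B m) ->
   Df B (fun e => rsat p (fun i => if (i < n)%N then e i else val (env (i - n)))).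
Proof.
have [k Hk] := rsat_bound p; have [E sE HE] := supp_env env k.
exists E => // B dH B0 HB.
(* Parameters beyond the bound [k], which the formula ignores, are replaced by [emp], since
   infinitely many parameters need not share a finite support. *)
pose (s i := if (i < n)%N then inl i else
   if (i - n < k)%N then inr (val (env (i - n))) else inr emp : nat + M).
apply: (@Df_ext _ _ (fun e => rsat p (fun i => slot (s i) e))).
  move=> e; apply: Hk => i ik; rewrite /s; case: (i < n)%N => //=.
  by rewrite (leq_ltn_trans (leq_subr _ _) ik).
apply: Df_slots; last exact: Df_rsat.
move=> i m; rewrite /s; case: (i < n)%N => //; case: ifP => // H [<-] //.
by apply: HB; apply: HE.
Qed.

Lemma HS_emp : HS emp.
Proof. by apply: (HS_def supp_emp) => [y|f _ _]; [ins|dfn]. Qed.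

Let fix0 f : Gp f -> act f emp = emp.
Proof. by move=> Gf; apply: Tm_fix; [exact: (pg_perm HG)|dfn]. Qed.

Lemma HS_upair x y : HS x -> HS y -> HS (upair x y).
Proof.
move=> Hx Hy; have [E [sE Ex]] := HS_symm Hx; have [F [sF Fy]] := HS_symm Hy.
apply: (HS_def (supp_cup sE sF)) => [z|f Gf Hf]; first by ins => -[->|->].
have ? : fixedby f x by exact: (supports_cupl Ex Gf Hf).
have ? : fixedby f y by exact: (supports_cupr Fy Gf Hf).
by dfn.
Qed.
Lemma HS_opair x y : HS x -> HS y -> HS (opair x y).
Proof.
move=> Hx Hy; apply: HS_upair; last exact: HS_upair.
have -> : sing x = upair x x; last exact: HS_upair.
by apply: set_eqP => // z; ins; apply: propext; tauto.
Qed.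
Lemma HS_adj x y : HS x -> HS y -> HS (adj x y).
Proof.
move=> Hx Hy; have [E [sE Ex]] := HS_symm Hx; have [F [sF Fy]] := HS_symm Hy.
apply: (HS_def (supp_cup sE sF)) => [z|f Gf Hf].
  by ins => -[/(HS_mem Hx)|->].
have ? : fixedby f x by exact: (supports_cupl Ex Gf Hf).
have ? : fixedby f y by exact: (supports_cupr Fy Gf Hf).
by dfn.
Qed.
Lemma HS_bigcup x : HS x -> HS (bigcup x).
Proof.
move=> Hx; have [E [sE Ex]] := HS_symm Hx.
apply: (HS_def sE) => [z|f Gf Hf].
  by ins => -[y yx zy]; exact: (HS_mem (HS_mem Hx yx) zy).
by have ? : fixedby f x; [exact: Ex|dfn].
Qed.
Lemma HS_sep_pow x : HS x -> HS (sep (pow x) HS).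
Proof.
move=> Hx; have [E [sE Ex]] := HS_symm Hx; have d := dHS.
apply: (HS_def sE) => [z|f Gf Hf]; first by rewrite in_sep // => -[].
by have ? := dHSf Gf; have ? : fixedby f x; [exact: Ex|dfn].
Qed.
Lemma HS_nat n : n ∊ omega -> HS n.
Proof.
move: n; apply: omega_ind => [||n no IH]; [exact: dHS|exact: HS_emp|exact: HS_adj].
Qed.
Lemma HS_omega : HS omega.
Proof. by apply: (HS_def supp_emp) => [y|f _ _]; [exact: HS_nat|dfn]. Qed.
Lemma HS_atoms : HS atoms.
Proof.
apply: (HS_def supp_emp) => [y|f _ _]; last by dfn.
by rewrite in_atoms; exact: HS_atom.
Qed.
Lemma HS_fin s : fin s -> (forall x, x ∊ s -> HS x) -> HS s.
Proof.
have d := dHS; move: s; apply: fin_ind => [|_|s a fs _ IH H]; [by dfn|exact: HS_emp|].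
apply: HS_adj; last by apply: H; ins; right.
by apply: IH => x xs; apply: H; ins; left.
Qed.

#[export] Instance zfa_permutation_model : zfa (permutation_model M G).
Proof.
change (zfa N); have dH := dHS.
have mv (x y : N) : (x ∊ y) = (val x ∊ val y) by [].
have N_set_ext (x y : N) : isset (val x) -> isset (val y) ->
   (forall z : N, z ∊ x <-> z ∊ y) -> x = y.
  move=> sx sy H; apply: val_inj; apply: set_ext => // z; split=> zz.
    by have [z' E] := mem_val zz; rewrite -E in zz *; exact/(H z').
  by have [z' E] := mem_val zz; rewrite -E in zz *; exact/(H z').
(* Existence axioms reduce to finding a hereditarily symmetric set of [M] whose members in [N] are
   the prescribed ones. *)
have mk x (Hx : HS x) (P : N -> Prop) :
   (forall z : N, val z ∊ x <-> P z) -> isset x ->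
   exists y : N, ~ atom N y /\ forall z : N, z ∊ y <-> P z.
  by move=> H sx; exists (mkN Hx).
split; first by exists; exact: (mkN HS_emp).
move=> q; case=> [env|env|env|env|env|env|env|env|env|phi env|phi env].
- exact: N_set_ext.
- by move=> a aa x; apply: (zfa_sentence (M := M) ZFA_atoms).
- by apply: (mk _ HS_atoms) => [z|]; [rewrite in_atoms|exact: isset_mkset].
- exists (mkN HS_emp); split=> [|y]; [exact: isset_emp|by move=> ye; rewrite -(in_emp (val y))].
- move=> x y; apply: (mk _ (HS_upair (valP x) (valP y))) => [z|//].
  by ins; split=> -[E|E]; [left|right|left|right]; rewrite ?E //; apply: val_inj.
- move=> s; apply: (mk _ (HS_bigcup (valP s))) => [z|//]; ins.
  split=> [[y ys zy]|[y [ys zy]]]; last by exists (val y).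
  by have [y' E] := mem_val ys; exists y'; rewrite !mv E.
- move=> x; apply: (mk _ (HS_sep_pow (valP x))) => [z|//]; rewrite in_sep // in_pow.
  split=> [[[sz H] _]|[sz H]]; first by split=> // w; exact: H.
  split; last exact: valP.
  by split=> // w wz; have [w' E] := mem_val wz; rewrite -E; apply: H; rewrite mv E.
- exists (mkN HS_omega); split.
    exists (mkN HS_emp); split; first exact: omega0.
    by split=> [|y ye]; [exact: isset_emp|rewrite -(in_emp (val y))].
  move=> n no; exists (mkN (HS_adj (valP n) (valP n))); split; first exact: omegaS.
  split=> [|z]; first exact: isset_adj.
  change (val z ∊ adj (val n) (val n) <-> (val z ∊ val n \/ z = n)).
  rewrite in_adj; split=> -[H|H]; [by left|right|by left|right].
    exact: val_inj.
  by rewrite H.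
- move=> x [y yx]; have [|z zx H] := @foundation _ _ (val x); first by exists (val y).
  have [z' E] := mem_val zx; exists z'; split; first by rewrite -E in zx.
  by move=> [w [wx wz]]; apply: (H (val w)) => //; rewrite -E.
- move=> a; have [E sE HE] := rsat_env phi 1 env.
  have [F [sF HF]] := HS_symm (valP a).
  pose (P x := rsat phi (fun i => if (i < 1)%N then x else val (env (i - 1)))).
  have dP (B : M -> Prop) : Df B (fun e => HS (e 0)) -> B emp ->
     (forall m, supports E m -> B m) -> Df B (fun e => P (e 0)).
    move=> b1 b2 b3; apply: Df_ext (HE B b1 b2 b3) => e; rewrite /P.
    by rewrite (_ : (fun i => _) = (fun i => if (i < 1)%N then e i else val (env (i - 1)))) //;
       apply: funext => -[].
  have dPa : Df anyp (fun e => P (e 0)) by exact: dP.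
  have Hb : HS (sep (val a) P).
    apply: (HS_def (supp_cup sE sF)) => [z|f Gf Hf].
      by rewrite in_sep // => -[/(HS_mem (valP a))].
    have ? : fixedby f (val a) by exact: (supports_cupr HF Gf Hf).
    have ? : Df (fixedby f) (fun e => P (e 0)).
      apply: dP; [exact: dHSf|exact: fix0|move=> m Hm; exact: (supports_cupl Hm Gf Hf)].
    by dfn.
  apply: (mk _ Hb) => [z|//]; rewrite in_sep //.
  have PE : P (val z) <-> sat N (embed phi (scons z env)).
    rewrite rsatP /P (_ : (fun i => _) = (fun i => val (scons z env i))) //.
    by apply: funext => -[|i] //=; rewrite subn1.
  by rewrite PE.
- move=> fn a; have [E sE HE] := rsat_env phi 2 env.
  have [F [sF HF]] := HS_symm (valP a).
  pose (R y x := rsat phi (fun i => if (i < 2)%N then (if i is 0 then y else x)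
     else val (env (i - 2)))).
  have dP (B : M -> Prop) : Df B (fun e => HS (e 0)) -> B emp ->
     (forall m, supports E m -> B m) -> Df B (fun e => R (e 0) (e 1)).
    move=> b1 b2 b3; apply: Df_ext (HE B b1 b2 b3) => e; rewrite /R.
    by rewrite (_ : (fun i => _) = (fun i => if (i < 2)%N then e i else val (env (i - 2)))) //;
       apply: funext => -[|[]].
  have RE (y x : N) : R (val y) (val x) <-> sat N (embed phi (scons y (scons x env))).
    rewrite rsatP /R (_ : (fun i => _) = (fun i => val (scons y (scons x env) i))) //.
    by apply: funext => -[|[|i]] //=; rewrite subn2.
  have dRa : Df anyp (fun e => R (e 0) (e 1)) by exact: dP.
  pose (Q y := HS y /\ exists2 x, x ∊ val a & R y x).
  have dQ : Df anyp (fun e => Q (e 0)) by rewrite /Q; dfn.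
  (* Values of the functional relation are described by [the], so that replacement in [M] bounds the
     image before it is shown to be symmetric. *)
  have sQ : small Q.
    have dF : Tm anyp (fun e : nat -> M => the (fun y => HS y /\ R y (e 0))) by dfn.
    have [b Hb] := @small_repl M HM (val a) (fun x => the (fun y => HS y /\ R y x)) dF.
    exists b => y [Hy [x xa Rxy]]; apply: Hb; exists x => //; apply: esym.
    apply: the_eq => // z [Hz Rxz].
    have [x' Ex] := mem_val xa; have [y' Ey] := mkN_ex Hy; have [z' Ez] := mkN_ex Hz.
    rewrite -Ex -Ey -Ez in Rxy Rxz *; congr val.
    by apply: (fn x'); apply/RE.
  have inQ z : z ∊ mkset Q <-> Q z by exact: in_mkset.
  have Hb : HS (mkset Q).
    apply: (HS_def (supp_cup sE sF)) => [z /inQ[]//|f Gf Hf].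
    have ? : fixedby f (val a) by exact: (supports_cupr HF Gf Hf).
    have ? := dHSf Gf.
    have ? : Df (fixedby f) (fun e => R (e 0) (e 1)).
      apply: dP; [exact: dHSf|exact: fix0|move=> m Hm; exact: (supports_cupl Hm Gf Hf)].
    by rewrite /Q; dfn.
  apply: (mk _ Hb) => [z|//]; apply: iff_trans (inQ _) _; split.
    move=> [_ [x xa Rxy]]; have [x' Ex] := mem_val xa; exists x'.
    by rewrite -Ex in xa Rxy; split=> //; apply/RE.
  move=> [x [xa /RE H]]; split; first exact: valP.
  by exists (val x).
Qed.

End PermutationModel.

(** * Orbits and homogeneous groups *)

Arguments valP {M HM G} HG x.

Section Transfer.
Context {M : structure} {HM : zfa M}.
Variable G : M -> fm M.
Hypothesis HG : perm_group G.
Notation N := (N G).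
Notation Gp f := (sat M (G f)).
Implicit Types (x y z a b f g : N).

Local Instance zfaN : zfa N := zfa_permutation_model HG.

Lemma val_set_eq x (b : M) : isset b -> isset x -> HS G b ->
  (forall z, (z ∊ x) = (val z ∊ b)) -> val x = b.
Proof.
move=> sb sx Hb H; apply: set_eqP => // w; apply: propext; split=> wx.
  by have [z E] := mem_val HG wx; rewrite -E in wx *; rewrite -H.
have [z E] := mkN_ex HG (HS_mem Hb wx); rewrite -E in wx *; rewrite -H in wx; exact: wx.
Qed.
Lemma val_eq x y : (val x = val y) = (x = y).
Proof. by apply: propext; split=> [/val_inj|->]. Qed.
Lemma val_upair x y : val (upair x y) = upair (val x) (val y).
Proof.
apply: val_set_eq => [//|||z]; [exact: isset_upair| |].
  exact: (HS_upair HG (valP HG x) (valP HG y)).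
by rewrite !in_upair !val_eq.
Qed.
Lemma upair_sing {U : structure} {HU : zfa U} (x : U) : sing x = upair x x.
Proof. by apply: set_eqP => // z; ins; apply: propext; tauto. Qed.
Lemma val_opair x y : val (opair x y) = opair (val x) (val y).
Proof. by rewrite /opair val_upair !upair_sing !val_upair. Qed.
Lemma val_emp : val (emp : N) = emp.
Proof.
by apply: val_set_eq => [//|||z]; [exact: isset_emp|exact: HS_emp|rewrite !in_emp].
Qed.
Lemma val_adj x y : val (adj x y) = adj (val x) (val y).
Proof.
apply: val_set_eq => [//|||z]; [exact: isset_adj| |by rewrite !in_adj !val_eq].
exact: (HS_adj HG (valP HG x) (valP HG y)).
Qed.
(** Natural numbers are moved by no permutation, so [omega] of the ground model lies in [N] and is
    inductive there. Conversely an inductive set of [N] contains all natural numbers of [M] by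
    induction in [M]. *)
Lemma val_omega : val (omega : N) = omega.
Proof.
have io : inductive (mkN HG (HS_omega HG)).
  split=> [|n no].
    by change (val (emp : N) ∊ omega); rewrite val_emp.
  by change (val (adj n n) ∊ omega); rewrite val_adj; apply: omegaS.
apply: val_set_eq => [//|||z]; [exact: isset_omega|exact: HS_omega|].
apply: propext; split; first by rewrite in_omega => /(_ _ io).
move=> zo.
have d : Df anyp (fun e => HS G (e 0)) by exact: dHS.
have Q (w : N) : inductive w -> forall n : M, n ∊ omega -> n ∊ val w.
  move=> [w0 wS]; apply: omega_ind => [||n no nw]; first by dfn.
    by rewrite -val_emp.
  by have [n' E] := mem_val HG nw; rewrite -E -val_adj; apply: wS; rewrite -E in nw.
by rewrite in_omega => w iw; exact: (Q w iw).
Qed.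

Lemma isfun_val f a b : isfun f a b -> isfun (val f) (val a) (val b).
Proof.
move=> Hf; case: (Hf) => sf _; split=> //; split=> [p pf|x xa].
  have [p' E] := mem_val HG pf; rewrite -E in pf *.
  have [x xa Ep] := in_fun Hf pf; exists (val x), (val (ap f x)); rewrite Ep val_opair.
  by split=> //; split=> //; exact: (ap_in Hf).
have [x' E] := mem_val HG xa; rewrite -E in xa *.
exists (val (ap f x')); rewrite -val_opair; split; first exact: (ap_mem Hf).
move=> z zf; have Hz : HS G z.
  have H := HS_mem (valP HG f) zf.
  have H1 : upair (val x') z ∊ opair (val x') z by rewrite /opair in_upair; right.
  by apply: (HS_mem (HS_mem H H1)); rewrite in_upair; right.
have [z' Ez] := mkN_ex HG Hz; rewrite -Ez -val_opair in zf *.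
by case: (ap_eq Hf zf) => _ ->.
Qed.
Lemma ap_val f a b x : isfun f a b -> x ∊ a -> val (ap f x) = ap (val f) (val x).
Proof.
move=> Hf xa; have := ap_mem Hf xa.
change (val (opair x (ap f x)) ∊ val f -> val (ap f x) = ap (val f) (val x)).
by rewrite val_opair => /(ap_eq (isfun_val Hf)) [].
Qed.
Lemma isinj_val f a b : isinj f a b -> isinj (val f) (val a) (val b).
Proof.
move=> [Hf I]; split=> [|x y xa ya]; first exact: isfun_val.
have [x' Ex] := mem_val HG xa; have [y' Ey] := mem_val HG ya.
rewrite -Ex -Ey in xa ya *; rewrite -(ap_val Hf xa) -(ap_val Hf ya) val_eq => E.
by congr val; exact: I.
Qed.
Lemma isbij_val f a b : isbij f a b -> isbij (val f) (val a) (val b).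
Proof.
move=> [Hf S]; split=> [|y yb]; first exact: isinj_val.
have [y' Ey] := mem_val HG yb; rewrite -Ey in yb *; have [x xa <-] := S y' yb.
by exists (val x) => //; case: Hf => Hf _; rewrite (ap_val Hf).
Qed.
Lemma isfun_lift f a b : isfun (val f) (val a) (val b) -> isfun f a b.
Proof.
move=> Hf; case: (Hf) => sf _; split=> //; split=> [p pf|x xa].
  have [x xa E] := in_fun Hf (pf : val p ∊ val f).
  have [x' Ex] := mem_val HG xa; have [y' Ey] := mem_val HG (ap_in Hf xa).
  exists x', y'; split; first by rewrite -Ex in xa.
  split; first by have := ap_in Hf xa; rewrite -Ey.
  by apply: val_inj; rewrite val_opair Ey Ex.
have [y Ey] := mem_val HG (ap_in Hf (xa : val x ∊ val a)).
exists y; split.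
  by change (val (opair x y) ∊ val f); rewrite val_opair Ey; exact: (ap_mem Hf).
move=> z zf; have : val (opair x z) ∊ val f by [].
by rewrite val_opair => /(ap_eq Hf) [_ E]; apply: val_inj; rewrite E.
Qed.
Lemma isinj_lift f a b : isinj (val f) (val a) (val b) -> isinj f a b.
Proof.
move=> [Hf I]; have Hf' := isfun_lift Hf; split=> // x y xa ya E.
by apply: val_inj; apply: I => //; rewrite -!(ap_val Hf') // E.
Qed.
Lemma isbij_lift f a b : isbij (val f) (val a) (val b) -> isbij f a b.
Proof.
move=> [Hf S]; have Hf' := isinj_lift Hf; split=> // y yb.
have [x xa E] := S (val y) yb; have [x' Ex] := mem_val HG xa.
rewrite -Ex in xa E; exists x' => //; apply: val_inj.
by case: Hf' => Hf' _; rewrite (ap_val Hf').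
Qed.
Lemma fin_val x : fin x -> fin (val x).
Proof.
move=> [sx [n no [f Hf]]]; split=> //; exists (val n); first by rewrite -val_omega.
by exists (val f); exact: isbij_val.
Qed.
(** A bijection in [M] between the set and a natural number is itself a finite set of pairs from
    [N], and finite sets of hereditarily symmetric elements belong to [N]. *)
Lemma fin_lift x : fin (val x) -> fin x.
Proof.
move=> fx; case: (fx) => sx [n no [f Hf]]; split=> //.
have [n' En] := mkN_ex HG (HS_nat HG no); rewrite -En in no Hf.
have Hff : isfun f (val x) (val n') by case: Hf => -[].
have Hf' : HS G f.
  apply: (HS_fin HG).
    have d : Tm anyp (fun e : nat -> M => opair (e 0) (ap f (e 0))) by dfn.
    have fr := @fin_repl M HM (val x) (fun y : M => opair y (ap f y)) d fx.
    refine (fin_sub fr _); split; first by case: Hff.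
    by move=> p /(in_fun Hff) [y yx ->]; rewrite in_repl //; exists y.
  move=> p /(in_fun Hff) [y yx ->]; apply: HS_opair => //.
    exact: (HS_mem (valP HG x) yx).
  exact: (HS_mem (valP HG n') (ap_in Hff yx)).
have [f' Ef] := mkN_ex HG Hf'; rewrite -Ef in Hf.
exists n'; first by change (val n' ∊ val (omega : N)); rewrite val_omega.
by exists f'; exact: isbij_lift.
Qed.
End Transfer.

Section Orbits.
Context {M : structure} {HM : zfa M}.
Variable G : M -> fm M.
Hypothesis HG : perm_group G.
Notation Gp f := (sat M (G f)).
Implicit Types (x y z a b c f g E F : M).

Let Gdef : Df anyp (fun e => Gp (e 0)).
Proof. exact: Df_mono (pg_def HG (pg_id HG)). Qed.

Lemma fixes_comp E f g : Gp f -> Gp g -> fixes E f -> fixes E g -> fixes E (pcomp f g).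
Proof.
move=> Gf Gg Ef Eg a aE; rewrite act_comp; try exact: (pg_perm HG).
by rewrite Eg // Ef.
Qed.
Lemma fixes_inv E f : Gp f -> fixes E f -> fixes E (pinv f).
Proof.
by move=> Gf Ef a aE; rewrite -{1}(Ef a aE) actK //; exact: (pg_perm HG).
Qed.
Lemma fixes_sub E F f : (forall a, a ∊ E -> a ∊ F) -> fixes F f -> fixes E f.
Proof. by move=> H Ff a /H/Ff. Qed.
Lemma fixes_id E : fixes E (lam atoms id).
Proof.
move=> a _; apply: act_fix_atoms => [|b bA]; first exact: (pg_perm HG (pg_id HG)).
by rewrite ap_lam //; dfn.
Qed.
Lemma act_id x : act (lam atoms id) x = x.
Proof. by apply: (act_fix_atoms _ (pg_perm HG (pg_id HG))) => b bA; rewrite ap_lam //; dfn. Qed.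

Definition orbit E x : M := mkset (fun y => exists f, (Gp f /\ fixes E f) /\ y = act f x).
Lemma in_orbit E x y : (y ∊ orbit E x) = (exists f, (Gp f /\ fixes E f) /\ y = act f x).
Proof.
rewrite /orbit /fixes; mk.
have d : Tm anyp (fun e => act (e 0) x) by dfn.
(* The group is contained in the power set of [prod atoms atoms], so the orbit is bounded by an
   image of a set. *)
have [b Hb] := @small_repl M HM (pow (prod atoms atoms)) (fun f => act f x) d.
exists b => z [f [[Gf _] ->]]; apply: Hb; exists f => //; ins.
have [[[sf [H _]] _] _] := pg_perm HG Gf; split=> // p /H [u [v [uA [vA ->]]]].
by rewrite opair_prod.
Qed.
Lemma isset_orbit E x : isset (orbit E x). Proof. exact: isset_mkset. Qed.
Lemma orbit_self E x : x ∊ orbit E x.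
Proof.
rewrite in_orbit; exists (lam atoms id); rewrite act_id; split=> //.
by split; [exact: pg_id|exact: fixes_id].
Qed.
Lemma orbit_supported E x : supports G E (orbit E x).
Proof.
move=> f Gf Ef; have pf := pg_perm HG Gf; apply: set_ext; [|exact: isset_orbit|].
  by apply: act_isset => //; exact: isset_orbit.
move=> z; rewrite in_act //; [|exact: isset_orbit]; split=> [[y]|].
  rewrite !in_orbit => -[g [[Gg Eg] ->] ->]; exists (pcomp f g).
  rewrite act_comp //; last exact: (pg_perm HG).
  by split=> //; split; [exact: pg_comp|exact: fixes_comp].
rewrite in_orbit => -[g [[Gg Eg] ->]]; have pg := pg_perm HG Gg.
exists (act (pcomp (pinv f) g) x).
  rewrite in_orbit; exists (pcomp (pinv f) g); split=> //.
  by split; [apply: pg_comp|apply: fixes_comp] => //;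
    [exact: (pg_inv HG)|exact: (pg_inv HG)|exact: fixes_inv].
by rewrite act_comp ?actVK //; exact: perm_inv.
Qed.
Lemma HS_orbit E x : supp E -> HS G x -> HS G (orbit E x).
Proof.
move=> sE Hx; apply: HS_intro; first by exists E; split=> //; exact: orbit_supported.
by move=> y; rewrite in_orbit => -[f [[Gf _] ->]]; exact: HS_act.
Qed.
Lemma orbit_closed E x (Y : M) : isset Y -> supports G E Y -> x ∊ Y -> sub (orbit E x) Y.
Proof.
move=> sY SY xY; split=> [|z]; first exact: isset_orbit.
rewrite in_orbit => -[f [[Gf Ef] ->]]; rewrite -(SY f Gf Ef); exact: (act_mem (pg_perm HG Gf)).
Qed.

Lemma Tm_orbit E t : Tm anyp t -> Tm anyp (fun e => orbit E (t e)).
Proof. by move=> ?; rewrite /orbit /fixes; dfn. Qed.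

Lemma supp_adj E a : supp E -> atom M a -> supp (adj E a).
Proof.
move=> [[sE EA] fE] aa; split; last exact: fin_adj.
by split=> // x; ins => -[/EA//|->]; rewrite in_atoms.
Qed.

(** The atoms of a support of [x] are added to [E] one at a time; [a] is the atom whose addition
    first makes [x] supported. From here on [x] depends on exactly one atom over [F]. *)
Lemma minimal_support E x : supp E -> HS G x -> ~ supports G E x ->
  exists F a, (supp F /\ (forall e, e ∊ E -> e ∊ F)) /\ (atom M a /\ ~ a ∊ F) /\
    (~ supports G F x /\ supports G (adj F a) x).
Proof.
move=> sE Hx nE; have [F [[[_ FA] fF] SF]] := HS_symm Hx.
(* The set [E] is quantified inside the induction statement because it grows at each step. *)
pose (P F := (forall a, a ∊ F -> a ∊ atoms) ->
  forall E, supp E -> ~ supports G E x -> supports G (cup E F) x ->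
  exists F a, (supp F /\ (forall e, e ∊ E -> e ∊ F)) /\ (atom M a /\ ~ a ∊ F) /\
    (~ supports G F x /\ supports G (adj F a) x)).
have H : forall F, fin F -> P F; last first.
  by apply: (H F fF FA E sE nE); exact: supports_cupr.
apply: fin_ind; first by rewrite /P /supp /supports /fixes; dfn.
  move=> _ E' sE' nE' S; case: nE'; apply: (supports_sub _ S) => b.
  by ins => -[].
move=> {fF SF FA}F b fF nb IH FA E' sE' nE' S.
have ab : atom M b by rewrite -in_atoms; apply: FA; ins; right.
case: (pselect (supports G (adj E' b) x)) => [S'|nS'].
  exists E', b; split; [by []|split; [split=> // bE|by []]].
  apply: nE'; apply: (supports_sub _ S') => c; by ins => -[|->].
have [||||F' [a [[sF' H1] H2]]] := IH _ (adj E' b).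
- by move=> c cF; apply: FA; ins; left.
- exact: supp_adj.
- by [].
- by apply: (supports_sub _ S) => c; ins => -[|[|->]]; auto.
exists F', a; split=> //; split=> // e eE; apply: H1; ins; by left.
Qed.
End Orbits.

Section Homogeneous.
Context {M : structure} {HM : zfa M}.
Variables (G : M -> fm M) (lt : M -> M -> Prop).
Notation Gp f := (sat M (G f)).
Implicit Types (x y z a b c f g h k u v E F I J : M).

(** Equality of quantifier-free types over [E]: in a linear order, [e = a] and [lt e a] decide on
    which side of [e] the atom [a] lies. *)
Definition same_type E a b : Prop :=
  forall e, e ∊ E -> (e = a <-> e = b) /\ (lt e a <-> lt e b).

(** [lt] is the empty relation for N1 and the given order of the atoms for N3. *)
Record homogeneous : Prop := Homogeneous {
  hm_def : Df anyp (fun e => lt (e 0) (e 1));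
  hm_inv : forall f a b, Gp f -> atom M a -> atom M b ->
    lt (act f a) (act f b) <-> lt a b;
  hm_lin : (forall a b, ~ lt a b) \/
    (forall a b, atom M a -> atom M b -> a <> b -> (lt b a <-> ~ lt a b));
  hm_move : forall E a b, supp E -> atom M a -> atom M b -> same_type E a b ->
    exists f, (Gp f /\ fixes E f) /\ act f a = b;
  hm_dense : forall E a, supp E -> atom M a -> ~ a ∊ E ->
    exists c, [/\ atom M c, ~ c ∊ E, c <> a & same_type E a c] }.

Hypotheses (HG : perm_group G) (HH : homogeneous).
Let Gdef : Df anyp (fun e => Gp (e 0)).
Proof. exact: Df_mono (pg_def HG (pg_id HG)). Qed.

Lemma same_type_act E a f : supp E -> atom M a -> Gp f -> fixes E f ->
  same_type E a (act f a).
Proof.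
move=> sE aa Gf Ef e eE; have ae := supp_atom sE eE; rewrite -{2 4}(Ef e eE).
by split; [split=> [->//|/(act_inj (pg_perm HG Gf))]|apply: iff_sym; exact: (hm_inv HH)].
Qed.

Section MoveAtom.
Variables F a x : M.
Hypotheses (sF : supp F) (aa : atom M a) (aF : ~ a ∊ F).
Hypotheses (nS : ~ supports G F x) (S : supports G (adj F a) x).

Let fixes_adj f : fixes F f -> act f a = a -> fixes (adj F a) f.
Proof. by move=> Ff fa e; ins => -[/Ff|->]. Qed.

(** The permutation [pcomp (pinv g) f] fixes [adj F a] pointwise, and [adj F a] supports [x]. Hence
    the images of [x] are indexed by the images of [a]. *)
Lemma act_determined f g : Gp f -> Gp g -> fixes F f -> fixes F g ->
  act f a = act g a -> act f x = act g x.
Proof.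
move=> Gf Gg Ff Fg E; have [pf pg] := (pg_perm HG Gf, pg_perm HG Gg).
have pi := perm_inv pg; have Gi := pg_inv HG Gg.
have : act (pcomp (pinv g) f) x = x.
  apply: S; first exact: pg_comp.
  apply: fixes_adj; last by rewrite act_comp // E actK.
  by apply: (fixes_comp HG) => //; exact: (fixes_inv HG).
by rewrite act_comp // => E2; rewrite -{2}E2 actVK.
Qed.

(** Some [m] fixing [adj F a] carries [act h a] to [act k a], since both lie on the same side of
    [a]. Then [m] after [h] agrees with [k] on [a], hence on [x], while it fixes [x]. *)
Let stab_move h k : Gp h -> Gp k -> fixes F h -> fixes F k -> act h x = x ->
  act h a <> a -> act k a <> a -> (lt a (act k a) <-> lt a (act h a)) -> act k x = x.
Proof.
move=> Gh Gk Fh Fk hx ha ka L; have [ph pk] := (pg_perm HG Gh, pg_perm HG Gk).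
have [] := hm_move HH (E := adj F a) (a := act h a) (b := act k a).
- exact: supp_adj.
- exact: act_isatom.
- exact: act_isatom.
- move=> e; ins => -[eF|->]; last first.
    by split; [split=> E; [case: ha|case: ka]|exact: iff_sym].
  have [h1 h2] := same_type_act sF aa Gh Fh eF.
  by have [k1 k2] := same_type_act sF aa Gk Fk eF; rewrite -h1 -h2.
move=> m [[Gm Fm] Em]; rewrite -Em in L *.
rewrite (@act_determined k (pcomp m h)) //.
- by rewrite act_comp ?hx //; [exact: S|exact: (pg_perm HG)].
- exact: pg_comp.
- by apply: (fixes_comp HG) => //; apply: (fixes_sub _ Fm) => e; ins; left.
- by rewrite act_comp //; exact: (pg_perm HG).
Qed.

(** If two images of [a] gave the same image of [x], some [h] over [F] would fix [x] and move [a].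
    By [stab_move], applied to [h] or to its inverse, every member of the group fixing [F] would
    then fix [x], against [nS]. *)
Lemma act_injective f g : Gp f -> Gp g -> fixes F f -> fixes F g ->
  act f x = act g x -> act f a = act g a.
Proof.
move=> Gf Gg Ff Fg E; apply: contrapT => ne; apply: nS => k Gk Fk.
have [pf pg] := (pg_perm HG Gf, pg_perm HG Gg).
have pi := perm_inv pg; have Gi := pg_inv HG Gg.
set h := pcomp (pinv g) f.
have Gh : Gp h by exact: pg_comp.
have ph := pg_perm HG Gh.
have Fh : fixes F h by apply: (fixes_comp HG) => //; exact: (fixes_inv HG).
have hx : act h x = x by rewrite act_comp // E actK.
have ha : act h a <> a by rewrite act_comp // => E2; apply: ne; rewrite -{2}E2 actVK.
case: (pselect (act k a = a)) => ka; first by apply: S => //; exact: fixes_adj.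
have ah := act_isatom ph aa; have ak := act_isatom (pg_perm HG Gk) aa.
case: (pselect (lt a (act k a) <-> lt a (act h a))) => L; first exact: (stab_move Gh).
(* Here [k] moves [a] to the other side than [h] does, and the inverse of [h] moves [a] to that side
   too. *)
have Ghi := pg_inv HG Gh; have phi := perm_inv ph.
apply: (stab_move Ghi) => //; first exact: (fixes_inv HG).
- by rewrite -{1}hx actK.
- by move=> E2; apply: ha; rewrite -{1}E2 actVK.
case: (hm_lin HH) => [n|lin]; first by case: L; split=> /n.
have L1 : lt a (act (pinv h) a) <-> lt (act h a) a.
  apply: iff_trans (iff_sym (hm_inv HH Gh aa (act_isatom phi aa))) _.
  by rewrite actVK.
have L2 := lin _ _ aa ah (nesym ha).
move: L L1 L2; case: (pselect (lt a (act k a))); case: (pselect (lt a (act h a))); tauto.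
Qed.

(** If the orbit of [x] were finite, so would be that of [a], by [act_injective]. Adding the other
    members of the latter to [F] leaves, by density, a further atom of the same type as [a], and
    this atom is in the orbit of [a] as well. *)
Lemma orbit_infinite : ~ fin (orbit G F x).
Proof.
move=> fY.
have fZ : fin (orbit G F a).
  pose (R y b := exists f, (Gp f /\ fixes F f) /\ y = act f x /\ b = act f a).
  apply: (@fin_rel M HM (orbit G F x) _ R) => //.
  - by rewrite /R /fixes; dfn.
  - exact: isset_orbit.
  - move=> b; rewrite in_orbit // => -[f [Gf ->]]; exists (act f x).
      by rewrite in_orbit //; exists f.
    by exists f.
  - move=> y b c _ _ _ [f [[Gf Ff] [-> ->]]] [g [[Gg Fg] [E ->]]].
    exact: act_injective.
pose (E := cup F (diff (orbit G F a) (sing a))).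
have sE : supp E.
  apply: supp_cup => //; split; last first.
    by apply: (fin_sub fZ); split=> // b; ins => -[].
  split=> // b; ins => -[]; rewrite in_orbit // => -[f [[Gf _] ->]] _.
  by rewrite in_atoms; apply: act_isatom => //; exact: (pg_perm HG).
have [|c [ac cE ca T]] := hm_dense HH sE aa; first by rewrite /E; ins => -[|[]].
apply: cE; rewrite /E; ins; right; split=> //; rewrite in_orbit //.
have [|f [Gf <-]] := hm_move HH sF aa ac; last by exists f.
by move=> e eF; apply: T; rewrite /E; ins; left.
Qed.

Section Topology.
Variables X T y B E2 : M.
Hypotheses (capT : forall u v, u ∊ T -> v ∊ T -> cap u v ∊ T) (XT : X ∊ T) (yX : y ∊ X).
Hypotheses (BT : forall u, u ∊ B -> u ∊ T /\ y ∊ u).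
Hypothesis B1 : forall z, z ∊ X -> (forall u, u ∊ B -> z ∊ u) -> z = y.
Hypotheses (sE2 : supp E2) (SB : forall u, u ∊ B -> supports G E2 u).
Hypotheses (FE : forall a, a ∊ F -> a ∊ E2) (YX : forall z, z ∊ orbit G F x -> z ∊ X).

(** A set [I] of atoms is good when some neighbourhood of [y] meets the part of the orbit of [x]
    indexed by [I] at most in [y]. *)
Let ok I := exists u, (u ∊ T /\ y ∊ u) /\
  forall f, Gp f /\ fixes F f -> act f a ∊ I -> act f x ∊ u -> act f x = y.
Let hom E J := forall b c, b ∊ J -> c ∊ J -> same_type E b c.

(** If a member of the base misses one point of a homogeneous piece, it misses them all, because
    permutations fixing [E2] fix that member and act transitively on the piece. Otherwise all points
    of the piece lie in every member of the base and equal [y]. *)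
Let ok_hom J : hom E2 J -> ok J.
Proof.
move=> hJ.
case: (pselect (exists f u, (Gp f /\ fixes F f) /\ act f a ∊ J /\ u ∊ B /\ ~ act f x ∊ u)).
  case=> f [u [[Gf Ff] [fJ [uB nu]]]]; exists u; split; first exact: BT.
  move=> g [Gg Fg] gJ gu; case: nu.
  have [pf pg] := (pg_perm HG Gf, pg_perm HG Gg).
  have [||s [[Gs Es] Eg]] := hm_move HH sE2 _ _ (hJ _ _ gJ fJ); try exact: act_isatom.
  have ps := pg_perm HG Gs.
  rewrite (@act_determined f (pcomp s g)) //.
  - by rewrite act_comp // -(SB uB Gs Es); exact: act_mem.
  - exact: pg_comp.
  - by apply: (fixes_comp HG) => //; exact: (fixes_sub _ Es).
  - by rewrite act_comp.
move=> H; exists X; split=> // f Gf fJ _; apply: B1.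
  by apply: YX; rewrite in_orbit //; exists f.
by move=> u uB; apply: contrapT => nu; apply: H; exists f, u.
Qed.

Let ok_cup I1 I2 I : (forall b, b ∊ I -> b ∊ I1 \/ b ∊ I2) -> ok I1 -> ok I2 -> ok I.
Proof.
move=> H [u [[uT yu] Hu]] [v [[vT yv] Hv]]; exists (cap u v); split.
  by split; [exact: capT|ins].
by move=> f Gf /H [/(Hu f Gf) K|/(Hv f Gf) K]; ins => -[] *; exact: K.
Qed.

Lemma orbit_not_accumulating :
  exists2 u, u ∊ T /\ y ∊ u & forall z, z ∊ orbit G F x -> z ∊ u -> z = y.
Proof.
have dl := hm_def HH.
(* A set of atoms is good as soon as its pieces homogeneous over [E] are. Each new [e] in [E] cuts a
   set into the atoms equal to [e], those above it and the rest, and three neighbourhoods are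
   intersected. *)
pose (P E := forall I, (forall J, (forall b, b ∊ J -> b ∊ I) -> hom E J -> ok J) -> ok I).
have H : forall E, fin E -> P E; last first.
  have [|u [uT Hu]] := H E2 (proj2 sE2) (orbit G F a); first by move=> J _; exact: ok_hom.
  exists u => // z; rewrite in_orbit // => -[f [Gf ->]] fu; apply: (Hu f Gf) => //.
  by rewrite in_orbit //; exists f.
apply: fin_ind; first by rewrite /P /hom /ok /same_type /fixes; dfn.
  by move=> I; apply=> // b c _ _ e; ins.
move=> E e fE _ IH I HI.
have dq : Df anyp (fun e' => lt e (e' 0)) by dfn.
have sub_ok I' : (forall b, b ∊ I' -> b ∊ I) ->
  (forall b c, b ∊ I' -> c ∊ I' -> (e = b <-> e = c) /\ (lt e b <-> lt e c)) -> ok I'.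
  move=> H1 H2; apply: IH => J JI hJ; apply: HI => [b /JI/H1 //|b c bJ cJ e'].
  by ins => -[/(hJ b c bJ cJ)//|->]; apply: H2; exact: JI.
have d0 : Df anyp (fun e' => e = e' 0) by dfn.
have d1 : Df anyp (fun e' => ~ e = e' 0 /\ lt e (e' 0)) by dfn.
have d2 : Df anyp (fun e' => ~ e = e' 0 /\ ~ lt e (e' 0)) by dfn.
pose (I1 := sep I (fun b => e = b)).
pose (I2 := sep I (fun b => ~ e = b /\ lt e b)).
pose (I3 := sep I (fun b => ~ e = b /\ ~ lt e b)).
apply: (@ok_cup I1 (cup I2 I3)).
- move=> b bI; rewrite /I1 /I2 /I3; ins; rewrite !in_sep //.
  by case: (pselect (e = b)); case: (pselect (lt e b)); tauto.
- by apply: sub_ok => [b|b c]; rewrite /I1 !in_sep //; [case|move=> [? <-] [? <-]].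
apply: (@ok_cup I2 I3) => [b||]; first by ins.
- by apply: sub_ok => [b|b c]; rewrite /I2 !in_sep //; tauto.
- by apply: sub_ok => [b|b c]; rewrite /I3 !in_sep //; tauto.
Qed.
End Topology.
End MoveAtom.
End Homogeneous.

(** * Convergence to a point *)

Section Topology.
Context {M : structure} {HM : zfa M}.
Implicit Types (x y z u v w p r S X Y K n m k : M).

Definition topo X T : Prop :=
  ((isset X /\ isset T) /\ (forall u, u ∊ T -> sub u X)) /\
  (X ∊ T /\ (forall s, sub s T -> bigcup s ∊ T)) /\
  (forall u v, u ∊ T -> v ∊ T -> cap u v ∊ T).

Lemma sat_union u s : sat M (is_union u s) <-> u = bigcup s.
Proof.
split=> [[su H]|->].
  apply: set_eqP => // z; ins; apply: propext; split=> [/H [y [ys zy]]|[y ys zy]].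
    by exists y.
  by apply/H; exists y.
split=> [|z]; first exact: isset_bigcup.
by rewrite /= in_bigcup; split=> [[y ys zy]|[y [ys zy]]]; exists y.
Qed.
Lemma sat_inter w u v : sat M (is_inter w u v) <-> w = cap u v.
Proof.
split=> [[su H]|->].
  by apply: set_eqP => // z; ins; apply: propext; apply: H.
by split=> [|z]; [exact: isset_cap|rewrite /= in_cap].
Qed.
Lemma sat_diff w u v : sat M (is_diff w u v) <-> w = diff u v.
Proof.
split=> [[su H]|->].
  by apply: set_eqP => // z; ins; apply: propext; apply: H.
by split=> [|z]; [exact: isset_diff|rewrite /= in_diff].
Qed.
Lemma sat_power w u : sat M (is_power w u) <-> w = pow u.
Proof.
split=> [[su H]|->].
  by apply: set_eqP => // z; ins; apply: propext; apply: H.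
by split=> [|z]; [exact: isset_pow|rewrite /= in_pow].
Qed.

Lemma sat_topology X T : sat M (is_topology X T) -> topo X T.
Proof.
move=> [sX [sT [TX [XT [H1 H2]]]]]; split; first by [].
split; last by move=> u v uT vT; apply: (H2 u uT v vT); apply/sat_inter.
by split=> // s sT'; apply: (H1 s) => //; apply/sat_union.
Qed.

Lemma cap_sub x y : isset x -> (forall z, z ∊ x -> z ∊ y) -> cap x y = x.
Proof.
by move=> sx H; apply: set_eqP => // z; ins; apply: propext; split=> [[]//|zx]; auto.
Qed.

(** Without an accumulation point, the open sets meeting [Y] in at most one point cover [X], and a
    finite subcover makes [Y] finite. Taking all such sets avoids choosing one for each point. *)
Lemma compact_accumulation X T Y : topo X T -> sat M (compact X T) -> sub Y X -> ~ fin Y ->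
  exists2 x, x ∊ X & forall u, u ∊ T -> x ∊ u -> exists2 y, y ∊ Y & y ∊ u /\ y <> x.
Proof.
move=> [[[sX sT] TX] [[XT TU] TI]] C [sY YX] nY; apply: contrapT => H.
pose (Q u := exists x, forall y, y ∊ Y -> y ∊ u -> y = x).
have dQ : Df anyp (fun e => Q (e 0)) by rewrite /Q; dfn.
case: (C (sep T Q)) => [|x xX|t [[st tT] [/(sat_finite st) ft tX]]].
- by change (sub (sep T Q) T); split=> // u; rewrite in_sep // => -[].
- have [u [[uT xu] Hu]] : exists u, (u ∊ T /\ x ∊ u) /\ forall y, y ∊ Y -> y ∊ u -> y = x.
    apply: contrapT => nu; apply: H; exists x => // u uT xu; apply: contrapT => nv.
    apply: nu; exists u; split=> // y yY yu; apply: contrapT => ne; apply: nv.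
    by exists y.
  exists u; split=> //; rewrite /= in_sep //; split=> //; by exists x.
apply: nY; have fb : fin (bigcup (repl t (fun u => cap Y u))).
  have d : Tm anyp (fun e => cap Y (e 0)) by dfn.
  apply: fin_bigcup => [|w]; first exact: fin_repl.
  rewrite in_repl // => -[u /tT]; rewrite in_sep // => -[uT [x Hx]] ->.
  by apply: (fin_sub (fin_sing x)); split=> // z; ins => -[]; exact: Hx.
apply: (fin_sub fb); split=> // y yY; have [u [ut yu]] := tX y (YX _ yY).
by ins; exists (cap Y u); [rewrite in_repl; [exists u|dfn]|ins].
Qed.

(** Finitely many covering sets can be selected by induction, without any choice principle. *)
Lemma finite_subcover s b : isset s -> fin b ->
  (forall x, x ∊ b -> exists v, v ∊ s /\ x ∊ v) ->
  exists t, sub t s /\ (fin t /\ forall x, x ∊ b -> exists2 v, v ∊ t & x ∊ v).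
Proof.
move=> ss; move: b; apply: fin_ind => [|_|b a fb _ IH H]; first by dfn.
  by exists emp; split; [split=> // x; ins|split=> [|x]; [exact: fin_emp|ins]].
have [|t [[st ts] [ft tb]]] := IH; first by move=> x xb; apply: H; ins; left.
have [|v [vs av]] := H a; first by ins; right.
exists (adj t v); split; first by split=> // x; ins => -[/ts|->].
split=> [|x]; first exact: fin_adj.
by ins => -[/tb[w wt xw]|->]; [exists w|exists v]; ins; auto.
Qed.

Lemma hausdorff_T1 X T : sat M (hausdorff X T) -> sat M (T1_space X T).
Proof.
move=> H x xX y yX ne; have [u [uT [v [vT [xu [yv D]]]]]] := H x xX y yX ne.
by exists u; split=> //; split=> // yu; apply: D; exists y.
Qed.

Lemma avoid_finite X T K x : topo X T -> sat M (T1_space X T) -> fin K -> sub K X ->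
  x ∊ X -> ~ x ∊ K -> exists2 u, u ∊ T & x ∊ u /\ forall y, y ∊ K -> ~ y ∊ u.
Proof.
move=> [_ [[XT _] TI]] HT fK [_ KX] xX; move: K fK KX.
apply: fin_ind => [|_ _|K a fK _ IH KX xK]; first by dfn.
  by exists X => //; split=> // y; ins.
have [||u uT [xu Hu]] := IH.
- by move=> y yK; apply: KX; ins; left.
- by move=> H; apply: xK; ins; left.
have [||v [vT [xv av]]] := HT x xX a.
- by apply: KX; ins; right.
- by move=> E; apply: xK; ins; right.
exists (cap u v); first exact: TI.
by split=> [|y]; [ins|ins => -[/Hu H|->] [] //].
Qed.

Definition subspace X T Y : M := repl T (fun u => cap u Y).
Lemma Tm_cap_right Y : Tm anyp (fun e => cap (e 0) Y).
Proof. by dfn. Qed.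
Lemma sat_subspace X T Y : sub Y X -> sat M (is_subspace Y (subspace X T Y) X T).
Proof.
have d := Tm_cap_right Y.
move=> YX; split=> //; split=> [|v]; first exact: isset_repl.
rewrite /= /subspace in_repl //; split=> [[u uT ->]|[u [uT /sat_inter ->]]].
  by exists u; split=> //; apply/sat_inter.
by exists u.
Qed.

(** For natural numbers [~ ap r x ∊ n] reads n <= r(x), so [v] contains all points of [W] other than
    [p] whose rate is at least [n]. *)
Definition tail W p r n v : Prop := forall x, x ∊ W -> x <> p -> ~ ap r x ∊ n -> x ∊ v.

(** A space all of whose points converge to [p], at the rate measured by [r]. *)
Section ConvergingSpace.
Variables X T p W r : M.
Hypotheses (HT : topo X T) (HH : sat M (hausdorff X T)).
Hypotheses (WX : sub W X) (pW : p ∊ W).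
Hypothesis Hr : forall x, x ∊ W -> x <> p -> ap r x ∊ omega.
Hypothesis Hlim : forall u, u ∊ T -> p ∊ u -> exists2 n, n ∊ omega & tail W p r n u.
Hypothesis Hfin : forall n, n ∊ omega -> fin (sep W (fun x => x <> p /\ ap r x ∊ n)).

Let pX : p ∊ X. Proof. by case: WX => _; apply. Qed.

Let below n := sep W (fun x => x <> p /\ ap r x ∊ n).
Let in_below n x : (x ∊ below n) = (x ∊ W /\ (x <> p /\ ap r x ∊ n)).
Proof. by rewrite /below in_sep //; dfn. Qed.

(** A neighbourhood of [x] disjoint from one of [p] avoids a tail, so it contains only finitely many
    points of [W], and the T1 property removes all of these except [x]. *)
Lemma W_isolated x : x ∊ W -> x <> p ->
  exists2 u, u ∊ T & x ∊ u /\ forall y, y ∊ W -> y ∊ u -> y = x.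
Proof.
move=> xW xp; have [[_ TX] [_ TI]] := HT; have xX : x ∊ X by case: WX => _; apply.
have [u [uT [v [vT [xu [pv D]]]]]] := HH xX pX xp.
have [n no Hn] := Hlim vT pv.
have fK : fin (diff (below n) (sing x)).
  by apply: (fin_sub (Hfin no)); split=> // y; ins => -[].
have KX : sub (diff (below n) (sing x)) X.
  by split=> // y; ins => -[]; rewrite in_below => -[yW _] _; case: WX => _; apply.
have xK : ~ x ∊ diff (below n) (sing x) by ins => -[_]; apply.
have [u' u'T [xu' Hu']] := avoid_finite HT (hausdorff_T1 HH) fK KX xX xK.
exists (cap u u'); first exact: TI.
split=> [|y yW]; ins => // -[yu yu']; apply: contrapT => ne; apply: (Hu' y) => //.
ins; split=> //; rewrite in_below; split=> //.
have yp : y <> p by move=> E; apply: D; exists y; rewrite {2}E.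
split=> //; apply: contrapT => yn; apply: D; exists y; split=> //; exact: Hn.
Qed.

(** Points other than [p] are isolated in [W], so openness is a condition at [p] alone. All later
    topological statements about [W] use this description. *)
Lemma subspace_open v : (v ∊ subspace X T W) =
  (sub v W /\ (p ∊ v -> exists2 n, n ∊ omega & tail W p r n v)).
Proof.
have d := Tm_cap_right W; have [[_ TX] [[XT TU] TI]] := HT.
rewrite /subspace in_repl //; apply: propext; split=> [[u uT ->]|[[sv vW] Hv]].
  split=> [|]; ins; first by split=> // z; ins => -[].
  move=> [pu _]; have [n no Hn] := Hlim uT pu; exists n => // x xW xp xn; ins.
  by split=> //; exact: Hn.
(* The union of all open sets whose trace on [W] lies in [v] is used; selecting a neighbourhood for
   each point of [v] would require choice. *)
pose (Q u := forall x, x ∊ u -> x ∊ W -> x ∊ v).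
have dQ : Df anyp (fun e => Q (e 0)) by rewrite /Q; dfn.
exists (bigcup (sep T Q)); first by apply: TU; split=> // u; rewrite in_sep // => -[].
have inQ x u : u ∊ T -> x ∊ u -> Q u -> x ∊ v -> x ∊ cap (bigcup (sep T Q)) W.
  by move=> uT xu Qu xv; ins; split; [exists u => //; rewrite in_sep|exact: vW].
apply: set_eqP => // x; apply: propext; split=> [xv|]; last first.
  by ins => -[[u]]; rewrite in_sep // => -[_ Qu] xu; exact: Qu.
case: (pselect (x = p)) => [E|xp].
  rewrite {}E in xv *; have [n no Hn] := Hv xv.
  have KX : sub (below n) X.
    by split=> [|y]; [exact: isset_sep|rewrite in_below => -[yW _]; case: WX => _; apply].
  have pK : ~ p ∊ below n by rewrite in_below => -[_ []].
  have [u uT [pu Hu]] := avoid_finite HT (hausdorff_T1 HH) (Hfin no) KX pX pK.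
  apply: (inQ p u) => // y yu yW; case: (pselect (y = p)) => [->//|yp].
  by apply: Hn => // yn; apply: (Hu y) => //; rewrite in_below.
have [u uT [xu Hu]] := W_isolated (vW _ xv) xp.
by apply: (inQ x u) => // y yu yW; rewrite (Hu y).
Qed.

(** The member of the cover that contains [p] contains a tail and leaves only finitely many points
    to be covered. *)
Lemma W_compact : sat M (compact W (subspace X T W)).
Proof.
move=> s [ss sS] cs; have [u [us pu]] := cs p pW.
have [_ /(_ pu) [n no Hn]] : sub u W /\ (p ∊ u -> exists2 n, n ∊ omega & tail W p r n u).
  by rewrite -subspace_open; exact: sS.
have fB := Hfin no; rewrite -/(below n) in fB.
have [t [[st ts] [ft tB]]] : exists t, sub t s /\ (fin t /\
    forall x, x ∊ below n -> exists2 v, v ∊ t & x ∊ v).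
  by apply: finite_subcover => // x; rewrite in_below => -[/cs].
exists (adj t u); split.
  by change (sub (adj t u) s); split=> // x; ins => -[/ts|->].
split; first by apply/sat_finite => //; exact: fin_adj.
move=> x xW; case: (pselect (x = p)) => [->|xp].
  by exists u; split=> //; rewrite /= in_adj; right.
case: (pselect (ap r x ∊ n)) => xn.
  have [|v vt xv] := tB x; first by rewrite in_below.
  by exists v; split=> //; rewrite /= in_adj; left.
by exists u; split; [rewrite /= in_adj; right|exact: Hn].
Qed.

(** Any point other than [p] is isolated in [W], and a non-empty set without such points is the
    singleton of [p]. *)
Lemma W_scattered : sat M (scattered W (subspace X T W)).
Proof.
move=> Z [sZ ZW] [z0 z0Z].
have singO x : x ∊ W -> x <> p -> sing x ∊ subspace X T W.
  move=> xW xp; rewrite subspace_open; split; first by split=> // y; ins => ->.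
  by ins => E; case: xp.
have iso x : x ∊ Z -> x <> p -> sat M (∃' z ∈ Z, ∃' u ∈ (subspace X T W), z ∈ u ∧ ∀' y ∈ Z, y ∈ u → y ≐ z)%fo.
  move=> xZ xp; exists x; split=> //; exists (sing x).
  split; first by apply: singO => //; exact: ZW.
  by split=> [|y yZ]; rewrite /= in_sing.
case: (pselect (exists2 z, z ∊ Z & z <> p)) => [[z zZ zp]|H]; first exact: (iso z).
have Zp y : y ∊ Z -> y = p.
  by move=> yZ; apply: contrapT => yp; apply: H; exists y.
exists z0; split=> //; exists W; split.
  by rewrite /= subspace_open; split; [split=> //; case: WX|exists emp].
split; first exact: ZW.
by move=> y yZ _; rewrite (Zp y) // (Zp z0).
Qed.

Hypothesis Hinf : ~ fin W.
Hypothesis Hinj : forall x y, x ∊ W -> y ∊ W -> x <> p -> y <> p ->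
  ap r x = ap r y -> x = y.

Let D := diff W (sing p).
Let inD x : (x ∊ D) = (x ∊ W /\ x <> p).
Proof. by rewrite /D; ins. Qed.
Let S := repl D (ap r).
Let dr : Tm anyp (fun e => ap r (e 0)). Proof. by dfn. Qed.
Let inS n : (n ∊ S) = (exists2 x, x ∊ D & n = ap r x).
Proof. by rewrite /S in_repl. Qed.
Let So n : n ∊ S -> n ∊ omega.
Proof. by rewrite inS => -[x]; rewrite inD => -[xW xp] ->; exact: Hr. Qed.

Let step k c := the (fun d => (k ∊ S /\ d = succ c) \/ (~ k ∊ S /\ d = c)).
Let dstep : Tm anyp (fun e => step (e 0) (e 1)).
Proof. by rewrite /step; dfn. Qed.
(** The number of attained rates below [n]. It collapses the infinite set [S] of rates onto [omega],
    since [W] need not have a point of every rate. *)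
Let cnt n := nrec emp step n.
Let dcnt : Tm anyp (fun e => cnt (e 0)). Proof. by rewrite /cnt; dfn. Qed.
Let cnt0 : cnt emp = emp. Proof. by rewrite /cnt nrec0. Qed.
Let cntS n : n ∊ omega -> n ∊ S -> cnt (succ n) = succ (cnt n).
Proof.
by move=> no nS; rewrite /cnt nrecS //; apply: the_eq; [left|move=> z [[]|[]]].
Qed.
Let cntN n : n ∊ omega -> ~ n ∊ S -> cnt (succ n) = cnt n.
Proof.
by move=> no nS; rewrite /cnt nrecS //; apply: the_eq; [right|move=> z [[]|[]]].
Qed.
Let cnt_omega n : n ∊ omega -> cnt n ∊ omega.
Proof.
move: n; apply: omega_ind => [||n no IH]; [by dfn|by rewrite cnt0|].
by case: (pselect (n ∊ S)) => nS; [rewrite cntS //; exact: omegaS|rewrite cntN].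
Qed.
Let cnt_lt n : n ∊ omega -> forall m, m ∊ n -> m ∊ S -> cnt m ∊ cnt n.
Proof.
move: n; apply: omega_ind => [|m|n no IH m]; [by dfn|by ins|].
ins => mn mS; case: (pselect (n ∊ S)) => nS.
  by rewrite cntS //; ins; case: mn => [/IH H|->]; [left; exact: H|right].
by rewrite cntN //; case: mn => [/IH H|E]; [exact: H|rewrite -E in nS].
Qed.
Let cnt_surj n : n ∊ omega -> forall k, k ∊ cnt n -> exists2 s, s ∊ S & cnt s = k.
Proof.
move: n; apply: omega_ind => [|k|n no IH k]; [by dfn|by rewrite cnt0; ins|].
case: (pselect (n ∊ S)) => nS; last by rewrite cntN //; exact: IH.
by rewrite cntS //; ins => -[/IH//|->]; exists n.
Qed.
Let S_unbounded n : n ∊ omega -> exists2 s, s ∊ S & ~ s ∊ n.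
Proof.
move=> no; apply: contrapT => H; apply: Hinf.
apply: (@fin_sub _ _ (adj (below n) p)); first by apply: fin_adj; exact: Hfin.
split=> [|x xW]; first by case: WX => _ _; exact: isset_mem pW.
ins; case: (pselect (x = p)) => xp; [by right|left]; rewrite in_below; split=> //.
split=> //; apply: contrapT => xn; apply: H; exists (ap r x) => //.
by rewrite inS; exists x => //; rewrite inD.
Qed.
Let cnt_mono n : n ∊ omega -> forall m, m ∊ n -> cnt m ∊ succ (cnt n).
Proof.
move: n; apply: omega_ind => [|m|n no IH m]; [by dfn|by ins|].
have E : cnt n ∊ succ (cnt n) by ins; right.
rewrite in_adj; case: (pselect (n ∊ S)) => nS.
  by rewrite cntS // => -[/IH|->]; ins; [left|left; right].
by rewrite cntN // => -[/IH|->].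
Qed.
Let cnt_unbounded k : k ∊ omega -> exists2 n, n ∊ omega & k ∊ cnt n.
Proof.
move: k; apply: omega_ind => [||k ko [n no kn]]; first by dfn.
  have [s sS _] := S_unbounded omega0; exists (succ s); first exact: (omegaS (So sS)).
  by rewrite cntS //; [exact: (lt0S (cnt_omega (So sS)))|exact: So].
have [s sS sn] := S_unbounded no; have so := So sS.
exists (succ s); first exact: omegaS.
rewrite cntS //; apply: ltSS; first exact: cnt_omega.
case: (nat_lt_total so no) => [//|[->//|ns]].
have := cnt_mono so ns; ins => -[H|<-//].
exact: (nat_trans (cnt_omega so) H).
Qed.
Let cnt_inj m n : m ∊ S -> n ∊ S -> cnt m = cnt n -> m = n.
Proof.
move=> mS nS E; case: (nat_lt_total (So mS) (So nS)) => [mn|[//|nm]].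
  by have := cnt_lt (So nS) mn mS; rewrite E => /mem_irrefl.
by have := cnt_lt (So mS) nm nS; rewrite E => /mem_irrefl.
Qed.

(** The underlying set of the copy of N(oo) is the ordinal [succ omega], with the element [omega] as
    the point at infinity; [p] is sent there. *)
Let F x := the (fun y => (x = p /\ y = omega) \/ (x <> p /\ y = cnt (ap r x))).
Let dF : Tm anyp (fun e => F (e 0)). Proof. by rewrite /F; dfn. Qed.
Let Fp : F p = omega.
Proof. by apply: the_eq; [left|move=> z [[]|[]]]. Qed.
Let Fx x : x <> p -> F x = cnt (ap r x).
Proof. by move=> xp; apply: the_eq; [right|move=> z [[]|[]]]. Qed.
Let Fx_omega x : x ∊ W -> x <> p -> F x ∊ omega.
Proof. by move=> xW xp; rewrite Fx //; apply: cnt_omega; exact: Hr. Qed.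
Let apS x : x ∊ W -> x <> p -> ap r x ∊ S.
Proof. by move=> xW xp; rewrite inS; exists x => //; rewrite inD. Qed.
Let F_inj x y : x ∊ W -> y ∊ W -> F x = F y -> x = y.
Proof.
move=> xW yW; case: (pselect (x = p)) => [->|xp]; case: (pselect (y = p)) => [->|yp] //.
- by rewrite Fp => E; have := Fx_omega yW yp; rewrite -E => /mem_irrefl.
- by rewrite Fp => E; have := Fx_omega xW xp; rewrite E => /mem_irrefl.
by rewrite !Fx // => E; apply: Hinj => //; apply: cnt_inj => //; exact: apS.
Qed.
Let F_surj k : k ∊ omega -> exists2 x, x ∊ W /\ x <> p & F x = k.
Proof.
move=> ko; have [n no kn] := cnt_unbounded ko.
have [s] := cnt_surj no kn; rewrite inS => -[x]; rewrite inD => -[xW xp] -> E.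
by exists x; rewrite ?Fx.
Qed.
Let h := lam W F.
Let Hh : isbij h W (succ omega).
Proof.
apply: isbij_lam => //.
- move=> x xW; ins; case: (pselect (x = p)) => [->|xp]; first by right.
  by left; exact: Fx_omega.
- by move=> y; ins => -[/F_surj[x [xW _] <-]|->]; [exists x|exists p].
Qed.

(** The order topology of the ordinal omega + 1. *)
Definition omega_infty_open v : Prop :=
  sub v (succ omega) /\
  (omega ∊ v -> exists2 n, n ∊ omega & forall k, k ∊ omega -> ~ k ∊ n -> k ∊ v).
Let U := sep (pow (succ omega)) omega_infty_open.
Let dU : Df anyp (fun e => omega_infty_open (e 0)).
Proof. by rewrite /omega_infty_open; dfn. Qed.
Let inU v : (v ∊ U) = omega_infty_open v.
Proof.
by rewrite /U in_sep // in_pow; apply: propext; split=> [[]//|H]; split=> //; case: H.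
Qed.

Let U_N_infty : sat M (is_N_infty (succ omega) U).
Proof.
exists omega, (pow omega); split; first exact/sat_is_omega.
split; first exact/sat_power.
exists omega; split; first exact: mem_irrefl.
split; first exact: isset_adj.
split; first by move=> x; rewrite /= in_adj.
split; first exact: isset_sep.
move=> u; change (u ∊ U <-> (u ∊ pow omega \/ sat M (∃ K R v, is_subspace K R omega (pow omega) ∧ compact K R ∧ is_diff v omega K ∧ v ∈ (pow omega) ∧ is_diff u (succ omega) K)%fo)).
rewrite inU in_pow; split.
  move=> [[su uU] Hu]; case: (pselect (omega ∊ u)) => ou; [right|left].
    have [n no Hn] := Hu ou.
    (* The complement of a neighbourhood of the point at infinity is contained in a natural number,
       hence finite and therefore compact. *)
    pose (K := diff omega u).
    have Kn : sub K n.
      split=> [|k]; first exact: isset_diff.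
      by rewrite /K; ins => -[ko ku]; apply: contrapT => kn; apply: ku; exact: Hn.
    have Ko : sub K omega.
      by split=> [|k]; [exact: isset_diff|rewrite /K; ins => -[]].
    exists K, (subspace omega (pow omega) K), (diff omega K).
    split; first exact: sat_subspace.
    split; last first.
      split; first exact/sat_diff.
      split; first by rewrite /= in_pow; split=> [|k]; [exact: isset_diff|ins => -[]].
      apply/sat_diff; apply: set_eqP => // z; rewrite /K; ins; apply: propext; split.
        by move=> zu; move: (uU z zu); ins => zz; split=> // -[].
      move=> [[zo|->//] nz]; apply: contrapT => zu; exact: nz.
    have fK : fin K by apply: (fin_sub (fin_nat no)).
    move=> s [ss sS] cs.
    have [t [[st ts] [ft tB]]] := finite_subcover ss fK cs.
    exists t; split; first by split.
    split; first exact/sat_finite.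
    by move=> x /tB [v vt xv]; exists v.
  by split=> // z zu; move: (uU z zu); ins => -[//|E]; rewrite E in zu.
case.
  move=> [su uo]; split; first by split=> // z /uo; ins; left.
  by move/uo/mem_irrefl.
move=> [K [R [v [[[sK Ko] [sR HR]] [C [/sat_diff -> [_ /sat_diff ->]]]]]]].
split; first by split=> // z; ins => -[].
move=> _; have inR w : sub w K -> w ∊ R.
  move=> [sw wK]; apply/HR; exists w; split; last first.
    by apply/sat_inter; rewrite cap_sub.
  by rewrite /= in_pow; split=> // z /wK/Ko.
(* Covering [K] by its singletons shows that compact subsets of the discrete space are finite, hence
   bounded in [omega]. *)
have ds : Tm anyp (fun e : nat -> M => sing (e 0)) by dfn.
have fK : fin K.
  case: (C (repl K sing)) => [|x xK|t [[st tT] [/(sat_finite st) ft tK]]].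
  - change (sub (repl K sing) R); split=> [|w]; first exact: isset_repl.
    rewrite in_repl // => -[x xK ->]; apply: inR; split=> // z; by ins => ->.
  - by exists (sing x); split; rewrite /= ?in_sing // in_repl //; exists x.
  have fb : fin (bigcup t).
    apply: fin_bigcup => // w /tT; rewrite /= in_repl // => -[x _ ->]; exact: fin_sing.
  by apply: (fin_sub fb); split=> // x /tK [w [wt xw]]; ins; exists w.
have [|n no Hn] := fin_bounded fK; first exact: Ko.
exists n => // k ko kn; ins; split; [by left|by move/Hn].
Qed.

(** Both topologies are determined by the neighbourhoods of one point, so the bijection [h] only has
    to match tails. As [cnt] is monotone and unbounded, a bound on rates becomes a bound on
    positions and conversely. *)
Lemma W_N_infty : sat M (contains_copy_of_N_infty X T).
Proof.
have apH x : x ∊ W -> ap h x = F x by move=> xW; rewrite ap_lam.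
exists W, (subspace X T W), (succ omega), U.
split; first exact: sat_subspace.
split; first exact: U_N_infty.
exists h; split; first exact/sat_is_bij.
move=> u v [su uW] [sv Hv].
have inv y : y ∊ v <-> exists2 x, x ∊ u & y = F x.
  split=> [/Hv [x [xu /sat_app]]|[x xu ->]].
    by rewrite opair_lam // => -[_ ->]; exists x.
  apply/Hv; exists x; split=> //; apply/sat_app; rewrite opair_lam //.
  by split=> //; exact: uW.
have Fv x : x ∊ W -> F x ∊ v -> x ∊ u.
  move=> xW /inv [y yu E]; rewrite (F_inj xW _ E) //; exact: uW.
change (u ∊ subspace X T W <-> v ∊ U); rewrite subspace_open inU.
have vU : sub v (succ omega).
  split=> // y /inv [x xu ->]; ins; case: (pselect (x = p)) => [->|xp]; first by right.
  by left; apply: Fx_omega => //; exact: uW.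
split=> [[_ Hu]|[_ H]]; split=> //.
  move=> /inv [x xu E]; have Ep : x = p.
    by apply: F_inj => //; [exact: uW|rewrite Fp].
  rewrite Ep in xu; have [n no Hn] := Hu xu; exists (cnt n); first exact: cnt_omega.
  move=> k ko kn; have [y [yW yp] Ey] := F_surj ko; apply/inv; exists y => //.
  apply: Hn => // yn; apply: kn; rewrite -Ey Fx //.
  by apply: cnt_lt => //; exact: apS.
move=> pu; have [|n no Hn] := H; first by apply/inv; exists p; rewrite ?Fp.
have [m mo nm] := cnt_unbounded no; exists m => // x xW xp xm; apply: Fv => //.
apply: Hn; first exact: Fx_omega.
rewrite Fx // => xn; have rxo := Hr xW xp.
have xcm : cnt (ap r x) ∊ cnt m := nat_trans (cnt_omega mo) nm xn.
case: (nat_lt_total rxo mo) => [//|[E|mx]]; first by rewrite E in xcm; exact: mem_irrefl xcm.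
have := cnt_mono rxo mx; ins => -[H1|H1]; first exact: mem_asym H1 xcm.
by rewrite H1 in xcm; exact: mem_irrefl xcm.
Qed.
End ConvergingSpace.
End Topology.

(** * First-countable spaces in permutation models *)

Section WellOrder.
Context {M : structure} {HM : zfa M}.
Implicit Types (x y z u v w c m s C F K R S T X Y : M).

Definition wo R X : Prop :=
  ((forall x, x ∊ X -> ~ opair x x ∊ R) /\
   (forall x y z, x ∊ X -> y ∊ X -> z ∊ X -> opair x y ∊ R -> opair y z ∊ R ->
      opair x z ∊ R)) /\
  ((forall x y, x ∊ X -> y ∊ X -> x = y \/ opair x y ∊ R \/ opair y x ∊ R) /\
   (forall Y, sub Y X -> (exists y, y ∊ Y) ->
      exists2 m, m ∊ Y & forall y, y ∊ Y -> m = y \/ opair m y ∊ R)).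

Lemma sat_well_order R X : wo R X -> sat M (well_order R X).
Proof.
move=> [[H1 H2] [H3 H4]]; split.
  split; first by move=> x xX /sat_app; exact: H1.
  split=> [x xX y yX z zX /sat_app xy /sat_app yz|x xX y yX].
    by apply/sat_app; exact: (H2 x y z).
  by case: (H3 x y xX yX) => [->|[H|H]]; [left|right; left; apply/sat_app|right; right; apply/sat_app].
move=> Y YX nY; have [m mY Hm] := H4 Y YX nY; exists m; split=> // y yY.
by case: (Hm y yY) => [->|H]; [left|right; apply/sat_app].
Qed.

Hypothesis HAC : M ⊨ AC.

Lemma choice_fun F : isset F -> (forall x, x ∊ F -> exists y, y ∊ x) ->
  exists c, forall x, x ∊ F -> ap c x ∊ x.
Proof.
move=> sF nF; have [c [[b /sat_is_fun Hc] H]] := HAC sF nF.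
exists c => x xF; apply: (H x xF); apply/sat_app; exact: (ap_mem Hc).
Qed.

(** Zermelo's argument without ordinals. The tower [T] is the least family of subsets of [X] closed
    under unions and under adding the chosen point of the complement; it is a chain, and [x]
    precedes [y] when some member of the tower contains [x] but not [y]. *)
Lemma zermelo X : isset X -> exists2 R, sub R (prod X X) & wo R X.
Proof.
move=> sX.
have [||c Hc] := @choice_fun (sep (pow X) (fun u => exists y, y ∊ u)).
- exact: isset_sep.
- by move=> x; rewrite in_sep; [case|dfn].
pose (nxt S := adj S (ap c (diff X S))).
have dn : Tm anyp (fun e => nxt (e 0)) by rewrite /nxt; dfn.
have cX S : (exists2 x, x ∊ X & ~ x ∊ S) -> ap c (diff X S) ∊ X /\ ~ ap c (diff X S) ∊ S.
  move=> [x xX xS]; have : ap c (diff X S) ∊ diff X S; last by ins.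
  apply: Hc; rewrite in_sep; last by dfn.
  by ins; split; [split=> // y; ins => -[]|exists x; ins].
pose (proper S := exists2 x, x ∊ X & ~ x ∊ S).
(* The families [s] include the empty one, so [emp] belongs to every closed [K] and the tower starts
   there. *)
pose (closed K := (forall S, S ∊ K -> proper S -> nxt S ∊ K) /\
  (forall s, sub s K -> bigcup s ∊ K)).
pose (inT S := forall K, sub K (pow X) -> closed K -> S ∊ K).
have dT : Df anyp (fun e => inT (e 0)) by rewrite /inT /closed /proper; dfn.
pose (T := sep (pow X) inT).
have TE S : (S ∊ T) = (sub S X /\ inT S) by rewrite /T in_sep // in_pow.
have nX S : sub S X -> proper S -> sub (nxt S) X.
  by move=> [sS SX] /cX [H _]; split=> [|x]; [exact: isset_adj|rewrite /nxt; ins => -[/SX|->]].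
have Tn S : S ∊ T -> proper S -> nxt S ∊ T.
  rewrite !TE => -[SX iS] pS; split; first exact: nX.
  by move=> K KX cK; case: (cK) => H _; apply: H => //; exact: iS.
have TU s : sub s T -> bigcup s ∊ T.
  move=> [ss sT]; rewrite TE; split.
    by split=> // x; ins => -[y /sT]; rewrite TE => -[[_ H] _]; exact: H.
  move=> K KX cK; case: (cK) => _; apply; split=> // S /sT; rewrite TE => -[_]; exact.
have Tind (Q : M -> Prop) : Df anyp (fun e => Q (e 0)) ->
   (forall S, S ∊ T -> Q S -> proper S -> Q (nxt S)) ->
   (forall s, sub s T -> (forall S, S ∊ s -> Q S) -> Q (bigcup s)) ->
   forall S, S ∊ T -> Q S.
  move=> dQ Qn QU S; have TQ S' : (S' ∊ sep T Q) = (S' ∊ T /\ Q S') by exact: in_sep.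
  rewrite TE => -[SX /(_ (sep T Q))]; rewrite TQ => -[] //.
    by split=> [|x]; [exact: isset_sep|rewrite TQ TE in_pow => -[[]]].
  split=> [S'|s [ss sT]].
    by rewrite !TQ => -[ST QS] pS; split; [exact: Tn|exact: Qn].
  rewrite TQ; have sT' : sub s T by split=> // x /sT; rewrite TQ => -[].
  by split; [exact: TU|apply: QU => // S' /sT; rewrite TQ => -[]].
have lin : forall C, C ∊ T -> forall S, S ∊ T -> sub S C \/ sub C S.
  apply: (Tind); first by dfn.
    move=> C CT HC pC; have [c1 c2] := cX C pC.
    (* The inner induction shows that no member of the tower lies strictly between [C] and
       [nxt C]. *)
    have key : forall S, S ∊ T -> sub S C \/ sub (nxt C) S.
      apply: (Tind); first by dfn.
        move=> S ST HS pS; case: HS => [SC|[sn nS]]; last first.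
          by right; split=> // x /nS; rewrite /nxt; ins; left.
        have snS : isset (nxt S) by exact: isset_adj.
        case: (pselect (ap c (diff X S) ∊ C)) => aC.
          by left; split=> // x; rewrite /nxt; ins => -[|->] //; case: SC => _; apply.
        case: (HC _ (Tn S ST pS)) => [|[sC CS]]; first by left.
        have -> : C = S; last by right; split.
        apply: set_ext => // [|x]; first by case: SC.
        split=> [xC|]; last by case: SC => _; apply.
        by have := CS x xC; rewrite /nxt; ins => -[//|E]; rewrite E in xC.
      move=> s sT Hs; case: (pselect (exists2 S, S ∊ s & sub (nxt C) S)) => [[S Ss [sn nS]]|nH].
        by right; split=> // x /nS xS; ins; exists S.
      left; split=> // x; ins => -[S Ss xS]; case: (Hs S Ss) => [[_]|H]; first exact.
      by case: nH; exists S.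
    move=> S ST; case: (key S ST) => [[sS H]|]; [left|by right].
    by split=> // x /H; rewrite /nxt; ins; left.
  move=> s sT Hs S ST; case: (pselect (exists2 C, C ∊ s & sub S C)) => [[C Cs [sS SC]]|nH].
    by left; split=> // x /SC xC; ins; exists C.
  right; split=> // x; ins => -[C Cs xC]; case: (Hs C Cs S ST) => [H|[_]]; last exact.
  by case: nH; exists C.
pose (Q p := exists x y, p = opair x y /\ exists2 S, S ∊ T & x ∊ S /\ ~ y ∊ S).
have dQ : Df anyp (fun e => Q (e 0)) by rewrite /Q; dfn.
pose (R := sep (prod X X) Q).
have RE x y : (opair x y ∊ R) = ((x ∊ X /\ y ∊ X) /\ exists2 S, S ∊ T & x ∊ S /\ ~ y ∊ S).
  rewrite /R in_sep // opair_prod; apply: propext; split=> -[h1 h2]; split=> //.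
    by case: h2 => x' [y' [/opair_inj[-> ->]]].
  by exists x, y.
have minY Y : sub Y X -> (exists y, y ∊ Y) ->
   exists2 m, m ∊ Y & forall y, y ∊ Y -> m = y \/ opair m y ∊ R.
  move=> [sY YX] [y0 y0Y].
  pose (D S := forall y, y ∊ Y -> ~ y ∊ S).
  have dD : Df anyp (fun e => D (e 0)) by rewrite /D; dfn.
  (* The largest member of the tower disjoint from [Y]. The point added next must lie in [Y], by
     maximality, and is its least element. *)
  pose (S0 := bigcup (sep T D)).
  have S0T : S0 ∊ T by apply: TU; split=> // x; rewrite in_sep // => -[].
  have S0Y y : y ∊ Y -> ~ y ∊ S0.
    by move=> yY; rewrite /S0; ins => -[S]; rewrite in_sep // => -[_ /(_ y yY)].
  have pS : proper S0 by exists y0; [exact: YX|exact: S0Y].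
  have [m1 m2] := cX S0 pS; set m := ap c (diff X S0) in m1 m2 *.
  have mY : m ∊ Y.
    apply: contrapT => nm; apply: m2.
    have nD : D (nxt S0).
      move=> y yY; rewrite /nxt in_adj => -[H|E]; first exact: (S0Y y yY).
      by apply: nm; rewrite /m -E.
    rewrite {1}/S0 in_bigcup; exists (nxt S0); last by rewrite /nxt in_adj; right.
    by rewrite in_sep //; split=> //; exact: Tn.
  exists m => // y yY; case: (pselect (m = y)) => [|ne]; [by left|right].
  rewrite RE; split; first by split=> //; exact: YX.
  exists (nxt S0); first exact: Tn.
  rewrite /nxt !in_adj; split; first by right.
  by case=> [H|E]; [exact: (S0Y y yY)|apply: ne].
exists R; first by split=> [|p]; [exact: isset_sep|rewrite /R in_sep // => -[]].
split; split=> //.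
- by move=> x xX; rewrite RE => -[_ [S _ []]].
- move=> x y z xX yX zX; rewrite !RE => -[_ [S ST [xS yS]]] [_ [S' ST' [yS' zS']]].
  split=> //; exists S'; first by [].
  case: (lin S ST S' ST') => [[_ H]|[_ H]]; first by case: yS; exact: H.
  by split=> //; exact: H.
- move=> x y xX yX; have [||m] := minY (upair x y).
  + by split=> // z; ins => -[->|->].
  + by exists x; ins; left.
  by ins => -[->|->] H; [have := H y|have := H x]; ins => -[]; auto.
Qed.
End WellOrder.

(** * Points fixed over a support, and sets of points converging to an accumulation point *)

Section FirstCountableSpaces.
Context {M : structure} {HM : zfa M}.
Variable G : M -> fm M.
Hypothesis HG : perm_group G.
Notation N := (N G).
Notation Gp f := (sat M (G f)).
Implicit Types (E F a b c f g n m x y z u : M).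

Local Instance zfaN' : zfa N := zfaN HG.

Lemma act_nat f n : Gp f -> n ∊ omega -> act f n = n.
Proof.
move=> Gf; have pf := pg_perm HG Gf; move: n; apply: omega_ind => [||n no IH]; first by dfn.
  by apply: Tm_fix => //; dfn.
by apply: Tm_fix => //; dfn.
Qed.

(** One inclusion suffices, because the inverse permutation also fixes [E] pointwise. *)
Lemma supports_closed E (Y : M) : isset Y ->
  (forall f y, Gp f -> fixes E f -> y ∊ Y -> act f y ∊ Y) -> supports G E Y.
Proof.
move=> sY H f Gf Ef; have pf := pg_perm HG Gf.
apply: set_ext => // [|z]; first exact: act_isset.
rewrite in_act //; split=> [[y yY ->]|zY]; first exact: H.
exists (act (pinv f) z); last by rewrite actVK.
by apply: H => //; [exact: (pg_inv HG)|exact: (fixes_inv HG)].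
Qed.

Lemma topo_val (X T : N) : topo X T ->
  val X ∊ val T /\ forall u v, u ∊ val T -> v ∊ val T -> cap u v ∊ val T.
Proof.
move=> [_ [[XT _] TI]]; split=> // u v uT vT.
have [u' Eu] := mem_val HG uT; have [v' Ev] := mem_val HG vT.
rewrite -Eu -Ev in uT vT *; have := TI _ _ uT vT.
have -> // : cap (val u') (val v') = val (cap u' v').
apply: esym; apply: set_eqP => // [|w]; first exact: isset_cap.
apply: propext; ins; split=> [w1|[w1 w2]].
  have [w' Ew] := mem_val HG w1; rewrite -Ew in w1 *.
  by have : w' ∊ cap u' v' by []; ins.
have [w' Ew] := mem_val HG w1; rewrite -Ew in w1 w2 *.
by change (w' ∊ cap u' v'); ins.
Qed.

Lemma first_countable_base (X T y : N) : topo X T -> sat N (first_countable X T) ->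
  y ∊ X -> exists B g : N,
  isinj g B omega /\ (forall u : N, u ∊ B -> u ∊ T /\ y ∊ u) /\
  (forall u : N, u ∊ T -> y ∊ u -> exists2 v : N, v ∊ B & sub v u).
Proof.
move=> _ FC yX; have [B [[_ BT] [[w [g [/sat_is_omega -> /sat_is_inj Hg]]] [By Bb]]]] := FC y yX.
exists B, g; split=> //; split=> [u uB|u uT yu]; first by split; [exact: BT|exact: By].
by have [v [vB vu]] := Bb u uT yu; exists v.
Qed.

(** The enumeration [g] tags each member with a natural number, which no permutation moves. *)
Lemma base_supported (B g : N) E : isinj g B omega -> supports G E (val g) ->
  forall u, u ∊ val B -> supports G E u.
Proof.
move=> /(isinj_val (HG := HG)); rewrite val_omega => -[Hg I] Sg u uB f Gf Ef.
have H := act_mem (pg_perm HG Gf) (ap_mem Hg uB).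
rewrite Sg // act_opair ?(act_nat Gf (ap_in Hg uB)) in H; last exact: (pg_perm HG).
have [fuB E2] := ap_eq Hg H; exact: (I _ _ fuB uB (esym E2)).
Qed.

Lemma fixed_pointwise lt (X T : N) E : homogeneous G lt -> topo X T ->
  sat N (first_countable X T) -> sat N (limit_point_compact X T) -> sat N (T1_space X T) ->
  supp E -> supports G E (val X) -> forall x, x ∊ val X -> supports G E x.
Proof.
move=> HH HT FC LPC T1 sE EX x xX; apply: contrapT => nE.
have Hx : HS G x := HS_mem (valP HG X) xX.
have [F [a [[sF EF] [[aa aF] [nF Sa]]]]] := minimal_support HG sE Hx nE.
(* The orbit is supported by [F] and thus is a set of the permutation model, where limit point
   compactness can be applied to it. *)
have [Y EY] := mkN_ex HG (HS_orbit HG sF Hx).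
have sX : isset (val X) by case: HT => -[[]].
have YX : sub (orbit G F x) (val X).
  by apply: orbit_closed => //; exact: supports_sub EX.
have [||y [yX acc]] := LPC Y.
- split; first by change (isset (val Y)); rewrite EY; exact: isset_orbit.
  by move=> z zY; case: YX => _ H; apply: H; rewrite -EY.
- have sY : isset Y by change (isset (val Y)); rewrite EY; exact: isset_orbit.
  move/(sat_finite sY)/(fin_val (HG := HG)); rewrite EY.
  exact: (orbit_infinite HG HH sF aa aF nF Sa).
have [B [g [Hg [By Bb]]]] := first_countable_base HT FC yX.
have [Eg [sEg Sg]] := HS_symm (valP HG g).
have [XT TI] := topo_val HT.
(* The support [cup F Eg] works for all members of the base at once, by [base_supported]: it
   supports the enumeration [g]. *)
have [||||||u [uT yu] Hu] := @orbit_not_accumulating _ _ G lt HG HH F a x aa Sa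
  (val X) (val T) (val y) (val B) (cup F Eg) TI XT yX.
- move=> u uB; have [u' Eu] := mem_val HG uB; rewrite -Eu in uB *; exact: By.
- move=> z zX Hz; apply: contrapT => ne; have [z' Ez] := mem_val HG zX; subst z.
  have [|v [vT [yv zv]]] := T1 y yX z' zX; first by move=> E'; apply: ne; rewrite E'.
  have [w wB [_ wv]] := Bb v vT yv; apply: zv; apply: wv; exact: Hz.
- exact: supp_cup.
- apply: (base_supported Hg); exact: supports_cupr.
- by move=> b; ins; left.
- by case: YX.
have [u' Eu] := mem_val HG uT; subst u.
have [z [zY [zu ne]]] := acc u' uT yu; apply: ne; apply: val_inj; apply: Hu => //.
by rewrite -EY.
Qed.

Section Converging.
Variables X T p : N.
Hypotheses (HAC : M ⊨ AC) (HT : topo X T) (FC : sat N (first_countable X T)).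
Hypotheses (T1 : sat N (T1_space X T)) (pX : p ∊ X).
Hypothesis acc : forall u : N, u ∊ T -> p ∊ u -> exists2 y : N, y ∊ X & y ∊ u /\ y <> p.
Hypothesis finorb : forall E x, supp E -> supports G E (val X) -> x ∊ val X -> fin (orbit G E x).

(** The last clause serves the copies of N(oo): when the points of [X] are fixed over the supports
    of [X], each level contributes a single point and the rate is injective. *)
Lemma converging_subset : exists W r : N, ((sub W X /\ p ∊ W) /\
  ((forall x : N, x ∊ W -> x <> p -> ap r x ∊ omega) /\
   (forall u : N, u ∊ T -> p ∊ u -> exists2 n : N, n ∊ omega & tail W p r n u))) /\
  ((forall n : N, n ∊ omega -> fin (sep W (fun x : N => x <> p /\ ap r x ∊ n))) /\ ~ fin W) /\
  ((forall E x, supp E -> supports G E (val X) -> x ∊ val X -> supports G E x) ->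
   forall x y : N, x ∊ W -> y ∊ W -> x <> p -> y <> p -> ap r x = ap r y -> x = y).
Proof.
have [B [g [Hg [By Bb]]]] := first_countable_base HT FC pX.
have [Eg [sEg Sg]] := HS_symm (valP HG g).
have [EX [sEX SX]] := HS_symm (valP HG X).
have [EB [sEB SB]] := HS_symm (valP HG B).
have [Ep [sEp Sp]] := HS_symm (valP HG p).
pose (E := cup (cup Eg EX) (cup EB Ep)).
have sE : supp E by do 2 apply: supp_cup => //; exact: supp_cup.
have {}Sg : supports G E (val g) by do 2 apply: supports_cupl.
have {}SX : supports G E (val X) by apply: supports_cupl; apply: supports_cupr.
have {}SB : supports G E (val B) by apply: supports_cupr; apply: supports_cupl.
have {}Sp : supports G E (val p) by do 2 apply: supports_cupr.
have [XT TI] := topo_val HT.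
have sX : isset (val X) by case: HT => -[[]].
have [Hgf gI] : isinj (val g) (val B) omega by rewrite -(@val_omega _ _ _ HG); exact: isinj_val.
pose (D := diff (val X) (sing (val p))).
(* The natural number [n] is the code under [g] of a base member omitting [x]. The rate [rho x] is
   the least such code; one exists by the T1 property. The codes need not exhaust [omega], and the
   base need not be decreasing. *)
pose (Q x n := exists2 u, u ∊ val B & ~ x ∊ u /\ ap (val g) u = n).
pose (rho x := the (fun n => (n ∊ omega /\ Q x n) /\ forall m, m ∊ omega -> Q x m -> n ∊ succ m)).
have drho : Tm anyp (fun e => rho (e 0)) by rewrite /rho /Q; dfn.
have inD x : (x ∊ D) = (x ∊ val X /\ x <> val p) by rewrite /D; ins.
have rhoP x : x ∊ D -> (rho x ∊ omega /\ Q x (rho x)) /\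
    forall m, m ∊ omega -> Q x m -> rho x ∊ succ m.
  rewrite inD => -[xX xp]; apply: (theP (Q := fun n => (n ∊ omega /\ Q x n) /\ forall m, m ∊ omega -> Q x m -> n ∊ succ m)).
    have dQ : Df anyp (fun e => Q x (e 0)) by rewrite /Q; dfn.
    have [|n no [Qn Hn]] := nat_least dQ; last by exists n.
    have [x' Ex] := mem_val HG xX; subst x.
    have [|v [vT [pv xv]]] := T1 pX xX; first by move=> E'; apply: xp; rewrite E'.
    have [w wB [_ wv]] := Bb v vT pv.
    exists (ap (val g) (val w)); first exact: (ap_in Hgf).
    by exists (val w) => //; split=> // xw; apply: xv; apply: wv.
  move=> n m [[no Qn] Hn] [[mo Qm] Hm].
  have := Hn _ mo Qm; have := Hm _ no Qn; ins => -[h1|//] [h2|//].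
  by case: (mem_asym h1).
have Srho f x : Gp f -> fixes E f -> x ∊ D -> act f x ∊ D /\ rho (act f x) = rho x.
  move=> Gf Ef xD; have pf := pg_perm HG Gf.
  have fX : fixedby f (val X) by exact: SX.
  have fp : fixedby f (val p) by exact: Sp.
  have fg : fixedby f (val g) by exact: Sg.
  have fB : fixedby f (val B) by exact: SB.
  split.
    have fD : act f D = D by apply: Tm_fix => //; rewrite /D; dfn.
    by rewrite -fD; exact: act_mem.
  have dr : Tm (fixedby f) (fun e => rho (e 0)) by rewrite /rho /Q; dfn.
  rewrite -(Tm_actE (fun=> x) pf dr) act_nat //; by case: (rhoP x xD) => -[].
have Hr : HS G (lam D rho).
  apply: (HS_def HG sE) => [z|f Gf Ef].
    rewrite in_lam // => -[x xD ->]; apply: HS_opair => //.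
      by rewrite inD in xD; case: xD => xX _; exact: (HS_mem (valP HG X) xX).
    by apply: HS_nat => //; case: (rhoP x xD) => -[].
  have fX : fixedby f (val X) by exact: SX.
  have fp : fixedby f (val p) by exact: Sp.
  have fg : fixedby f (val g) by exact: Sg.
  have fB : fixedby f (val B) by exact: SB.
  by rewrite /rho /Q /D; dfn.
have [r Er] := mkN_ex HG Hr.
pose (L n := sep D (fun x => rho x = n)).
have inL n x : (x ∊ L n) = (x ∊ D /\ rho x = n) by rewrite /L in_sep //; dfn.
have dL : Tm anyp (fun e => L (e 0)) by rewrite /L; dfn.
(* The choice function [c] of the ground model need not be symmetric. Only the orbits over [E] of
   its values enter [W], so [E] supports [W]. *)
have [||c Hc] := choice_fun HAC (F := sep (repl omega L) (fun u => exists y, y ∊ u)).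
- exact: isset_sep.
- by move=> x; rewrite in_sep; [case|dfn].
have cL n : n ∊ omega -> (exists x, x ∊ L n) -> ap c (L n) ∊ D /\ rho (ap c (L n)) = n.
  move=> no nL; have : ap c (L n) ∊ L n; last by rewrite inL.
  by apply: Hc; rewrite in_sep; [split=> //; rewrite in_repl //; exists n|dfn].
pose (PW x := exists2 n, n ∊ omega & (exists x, x ∊ L n) /\ x ∊ orbit G E (ap c (L n))).
have dor : Tm anyp (fun e => orbit G E (e 0)) by apply: (Tm_orbit HG); dfn.
have dPW : Df anyp (fun e => PW (e 0)) by rewrite /PW; dfn.
pose (W := adj (sep D PW) (val p)).
have inW x : (x ∊ W) = ((x ∊ D /\ PW x) \/ x = val p) by rewrite /W in_adj in_sep.
have HW : HS G W.
  apply: HS_intro => [|x]; last first.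
    rewrite inW inD => -[[[xX _] _]|->]; [exact: (HS_mem (valP HG X) xX)|exact: (valP HG)].
  exists E; split=> //; apply: supports_closed; first exact: isset_adj.
  move=> f y Gf Ef; rewrite !inW => -[[yD [n no [nL yO]]]|->]; last by right; exact: Sp.
  left; split; first by case: (Srho f y Gf Ef yD).
  exists n => //; split=> //; rewrite -(@orbit_supported _ _ _ HG E (ap c (L n)) f Gf Ef).
  exact: (act_mem (pg_perm HG Gf)).
have [W' EW] := mkN_ex HG HW.
have rho_PW x : x ∊ D -> PW x -> x ∊ orbit G E (ap c (L (rho x))).
  move=> xD [n no [nL xO]]; have -> // : rho x = n.
  have [h1 h2] := cL n no nL; move: xO; rewrite in_orbit // => -[f [[Gf Ef] ->]].
  by case: (Srho f _ Gf Ef h1) => _ ->.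
have WD (x : N) : x ∊ W' -> x <> p -> val x ∊ D /\ PW (val x).
  move=> xW xp; have : val x ∊ W by rewrite -EW.
  by rewrite inW => -[//|E']; case: xp; exact: val_inj.
have aprho x : x ∊ D -> ap (val r) x = rho x by move=> xD; rewrite Er ap_lam.
have Hrf : isfun (val r) D omega.
  by rewrite Er; apply: isfun_lam => // x /rhoP [[]].
have [D' ED] : exists D' : N, val D' = D.
  apply: mkN_ex => //; apply: (HS_def HG sE) => [z|f Gf Ef].
    by rewrite inD => -[zX _]; exact: (HS_mem (valP HG X) zX).
  have fX : fixedby f (val X) by exact: SX.
  have fp : fixedby f (val p) by exact: Sp.
  by rewrite /D; dfn.
have Hrf' : isfun r D' omega by apply: isfun_lift; rewrite ED val_omega.
have apr (x : N) : val x ∊ D -> val (ap r x) = rho (val x).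
  move=> xD; rewrite (ap_val Hrf'); first exact: aprho.
  by change (val x ∊ val D'); rewrite ED.
(* Attained levels are unbounded: the base members with code below [n] contain a common
   neighbourhood of [p], built by induction on [n], and a point other than [p] in it has rate at
   least [n]. *)
have levels n : n ∊ omega -> exists2 x, x ∊ W & x <> val p /\ ~ rho x ∊ n.
  move=> no.
  have [u [uT pu] Hu] : exists2 u, u ∊ val T /\ val p ∊ u &
      forall v, v ∊ val B -> ap (val g) v ∊ n -> forall z, z ∊ u -> z ∊ v.
    move: n no; apply: omega_ind => [||n no [u [uT pu] Hu]]; first by dfn.
      by exists (val X) => // v _; ins.
    case: (pselect (exists2 v, v ∊ val B & ap (val g) v = n)) => [[v vB Ev]|nv].
      have [v' Ev'] := mem_val HG vB; subst v; have [vT pv] := By v' vB.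
      exists (cap u (val v')); first by split; [exact: TI|ins].
      move=> w wB; rewrite in_adj => -[wn|wn] z; ins => -[zu zv]; first exact: Hu wn _ zu.
      have -> // : w = val v'; by apply: gI => //; rewrite wn Ev.
    exists u => // v vB; rewrite in_adj => -[vn|vn]; first exact: Hu.
    by case: nv; exists v.
  have [u' Eu] := mem_val HG uT; subst u.
  have [y yX [yu yp]] := acc uT pu.
  have yD : val y ∊ D by rewrite inD; split=> //; move/val_inj.
  have [[ro [v vB [yv Ev]]] _] := rhoP _ yD.
  have nL : exists x, x ∊ L (rho (val y)) by exists (val y); rewrite inL.
  have [cD Ec] := cL _ ro nL.
  exists (ap c (L (rho (val y)))); last first.
    split; first by move: cD; rewrite inD => -[].
    by rewrite Ec => rn; apply: yv; apply: (Hu v vB) yu; rewrite Ev.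
  rewrite inW; left; split=> //; exists (rho (val y)) => //; split=> //.
  exact: (orbit_self HG).
have finb n : n ∊ omega -> fin (sep W (fun x => x <> val p /\ rho x ∊ n)).
  have d k : Df anyp (fun e => e 0 <> val p /\ rho (e 0) ∊ k) by dfn.
  move: n; apply: omega_ind => [||n no IH]; first by dfn.
    have -> : sep W (fun x => x <> val p /\ rho x ∊ emp) = emp; last exact: fin_emp.
    by apply: empP => // x; rewrite in_sep // => -[_ [_]]; ins.
  (* The orbit contributed by level [n], made empty when the level has no points, since [ap c (L n)]
     is then arbitrary. *)
  pose (O := sep (orbit G E (ap c (L n))) (fun x => exists y, y ∊ L n)).
  have inO x : (x ∊ O) = (x ∊ orbit G E (ap c (L n)) /\ exists y, y ∊ L n).
    by rewrite /O in_sep //; dfn.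
  have fO : fin O.
    case: (pselect (exists y, y ∊ L n)) => nL.
      have [cD _] := cL n no nL; rewrite inD in cD.
      have fo := finorb sE SX (proj1 cD).
      by apply: (fin_sub fo); split=> [|x]; [exact: isset_sep|rewrite inO => -[]].
    have -> : O = emp; last exact: fin_emp.
    by apply: empP => [|x]; [exact: isset_sep|rewrite inO => -[]].
  have inb k x : (x ∊ sep W (fun x => x <> val p /\ rho x ∊ k)) =
    (x ∊ W /\ (x <> val p /\ rho x ∊ k)) by exact: in_sep.
  apply: (fin_sub (fin_cup IH fO)); split=> // x; rewrite in_cup !inb => -[xW [xp]].
  rewrite [in X in X -> _]in_adj => -[xn|xn]; [by left; split|right].
  rewrite inO; move: xW; rewrite inW => -[[xD px]|E'//].
  have := rho_PW x xD px; rewrite xn => xO; split=> //; exists x; by rewrite inL.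
exists W', r; split; [split; split|split; [split|]].
- split; first by change (isset (val W')); rewrite EW; exact: isset_adj.
  move=> x xW; case: (pselect (x = p)) => [->//|xp].
  by have [] := WD x xW xp; rewrite inD => -[].
- by change (val p ∊ val W'); rewrite EW inW; right.
- move=> x xW xp; have [xD _] := WD x xW xp.
  by change (val (ap r x) ∊ val (omega : N)); rewrite val_omega apr //; case: (rhoP _ xD) => -[].
- move=> u uT pu; have [v vB [_ vu]] := Bb u uT pu.
  have vBM : val v ∊ val B by [].
  have [n En] := mkN_ex HG (HS_nat HG (ap_in Hgf vBM)).
  (* Here [n] is the code of a base member inside [u]. A point omitted by that member has rate at
     most [n], so membership is guaranteed from [succ n] on. *)
  exists (succ n).
    by change (val (succ n) ∊ val (omega : N)); rewrite val_omega val_adj En; apply: omegaS; exact: (ap_in Hgf).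
  move=> x xW xp xn; apply: vu; apply: contrapT => xv; apply: xn.
  have [xD _] := WD x xW xp.
  change (val (ap r x) ∊ val (succ n)); rewrite val_adj apr // En.
  have [_ H] := rhoP _ xD; apply: H; first exact: (ap_in Hgf).
  by exists (val v).
- move=> n no; apply: fin_lift.
  have no' : val n ∊ omega by rewrite -(@val_omega _ _ _ HG).
  have d k : Df anyp (fun e => e 0 <> val p /\ rho (e 0) ∊ k) by dfn.
  have dN : Df anyp (fun e : nat -> N => e 0 <> p /\ ap r (e 0) ∊ n) by dfn.
  apply: (fin_sub (finb _ no')); split; first exact: (isset_sep (M := N)).
  move=> x xs; have [x' Ex] := mem_val HG xs; subst x.
  have : x' ∊ sep W' (fun x : N => x <> p /\ ap r x ∊ n) by [].
  rewrite in_sep // => -[xW [xp xn]]; have [xD px] := WD x' xW xp.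
  rewrite in_sep //; split; first by rewrite inW; left.
  by split; [move/val_inj|rewrite -apr].
- move/(fin_val (HG := HG)); rewrite EW => fW.
  have fS : fin (repl (diff W (sing (val p))) rho).
    by apply: fin_repl => //; apply: (fin_sub fW); split=> // x; ins => -[].
  have [|n no Hn] := fin_bounded fS.
    move=> n; rewrite in_repl // => -[x]; rewrite in_diff in_sing inW => -[[[xD _]|//] _] ->.
    by case: (rhoP _ xD) => -[].
  have [x xW [xp xn]] := levels n no; apply: xn; apply: Hn.
  by rewrite in_repl //; exists x; rewrite ?in_diff ?in_sing.
- move=> fixX x y xW yW xp yp Exy.
  have [xD px] := WD x xW xp; have [yD py] := WD y yW yp.
  have Er2 : rho (val x) = rho (val y) by rewrite -!apr // Exy.
  apply: val_inj; have := rho_PW _ xD px; have := rho_PW _ yD py.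
  have [[ro _] _] := rhoP _ yD.
  have nL : exists z, z ∊ L (rho (val y)) by exists (val y); rewrite inL.
  have [cD _] := cL _ ro nL; rewrite inD in cD.
  have S0 := fixX E _ sE SX (proj1 cD); rewrite Er2 !in_orbit //.
  by move=> [f [[Gf Ef] Ey]] [f' [[Gf' Ef'] Ex]]; 
    rewrite Ex S0 // -(S0 f Gf Ef) -Ey.
Qed.

End Converging.
End FirstCountableSpaces.

(** * Ordered fields inside a model *)

Import GRing.Theory Num.Theory Order.TTheory.

(** Operations are functions of the metatheory on all of [M], with only the carrier a set of the
    model. Definability is added separately by [dops], and set-sized graphs are formed at the very
    end. *)
Record ops (M : structure) := Ops {
  od : M; oadd : M -> M -> M; omul : M -> M -> M; oopp : M -> M;
  olt : M -> M -> Prop; o0 : M; o1 : M }.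

Record oring {M : structure} (R : ops M) : Prop := ORing {
  o0P : o0 R ∊ od R; o1P : o1 R ∊ od R;
  oaddP : forall x y, x ∊ od R -> y ∊ od R -> oadd R x y ∊ od R;
  omulP : forall x y, x ∊ od R -> y ∊ od R -> omul R x y ∊ od R;
  ooppP : forall x, x ∊ od R -> oopp R x ∊ od R;
  oaddA : forall x y z, x ∊ od R -> y ∊ od R -> z ∊ od R ->
    oadd R x (oadd R y z) = oadd R (oadd R x y) z;
  oaddC : forall x y, x ∊ od R -> y ∊ od R -> oadd R x y = oadd R y x;
  oadd0 : forall x, x ∊ od R -> oadd R (o0 R) x = x;
  oaddN : forall x, x ∊ od R -> oadd R (oopp R x) x = o0 R;
  omulA : forall x y z, x ∊ od R -> y ∊ od R -> z ∊ od R ->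
    omul R x (omul R y z) = omul R (omul R x y) z;
  omulC : forall x y, x ∊ od R -> y ∊ od R -> omul R x y = omul R y x;
  omul1 : forall x, x ∊ od R -> omul R (o1 R) x = x;
  omulD : forall x y z, x ∊ od R -> y ∊ od R -> z ∊ od R ->
    omul R (oadd R x y) z = oadd R (omul R x z) (omul R y z);
  o10 : o1 R <> o0 R;
  olt_irr : forall x, x ∊ od R -> ~ olt R x x;
  olt_tr : forall x y z, x ∊ od R -> y ∊ od R -> z ∊ od R ->
    olt R x y -> olt R y z -> olt R x z;
  olt_tot : forall x y, x ∊ od R -> y ∊ od R -> x = y \/ olt R x y \/ olt R y x;
  olt_add : forall x y z, x ∊ od R -> y ∊ od R -> z ∊ od R ->
    olt R x y -> olt R (oadd R x z) (oadd R y z);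
  olt_mul : forall x y, x ∊ od R -> y ∊ od R -> olt R (o0 R) x -> olt R (o0 R) y ->
    olt R (o0 R) (omul R x y) }.

Record ofield {M : structure} (R : ops M) : Prop := OField {
  ofield_oring : oring R;
  oinvP : forall x, x ∊ od R -> x <> o0 R -> exists2 y, y ∊ od R & omul R y x = o1 R }.

(** The elements of an internal ordered ring are given MathComp structures so that
    [ring], [field] and [lra] apply to calculations inside the model. *)
Section ElementType.
Context {M : structure}.
(** The proof [h] is an index of the type, so that the algebraic structures can be inferred from the
    type alone. *)
Definition orT (R : ops M) (h : oring R) : Type := {x : M | x ∊ od R}.
Variables (R : ops M) (h : oring R).
Local Notation T := (orT h).

HB.instance Definition _ := gen_eqMixin T.
HB.instance Definition _ := gen_choiceMixin T.

Definition orV (x : T) : M := proj1_sig x.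
Definition orK x (H : x ∊ od R) : T := exist _ x H.
Lemma orVP (x : T) : orV x ∊ od R. Proof. by case: x. Qed.
Lemma orV_inj (x y : T) : orV x = orV y -> x = y.
Proof. by case: x y => [x p] [y q] /= E; apply: eq_exist. Qed.

Let add (x y : T) : T := orK (oaddP h (orVP x) (orVP y)).
Let mul (x y : T) : T := orK (omulP h (orVP x) (orVP y)).
Let opp (x : T) : T := orK (ooppP h (orVP x)).
Let zero : T := orK (o0P h).
Let one : T := orK (o1P h).

Let addA : associative add.
Proof. by move=> x y z; apply: orV_inj; apply: (oaddA h); exact: orVP. Qed.
Let addC : commutative add.
Proof. by move=> x y; apply: orV_inj; apply: (oaddC h); exact: orVP. Qed.
Let add0 : left_id zero add.
Proof. by move=> x; apply: orV_inj; apply: (oadd0 h); exact: orVP. Qed.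
Let addN : left_inverse zero opp add.
Proof. by move=> x; apply: orV_inj; apply: (oaddN h); exact: orVP. Qed.
HB.instance Definition _ := GRing.isZmodule.Build T addA addC add0 addN.
Let mulA : associative mul.
Proof. by move=> x y z; apply: orV_inj; apply: (omulA h); exact: orVP. Qed.
Let mulC : commutative mul.
Proof. by move=> x y; apply: orV_inj; apply: (omulC h); exact: orVP. Qed.
Let mul1 : left_id one mul.
Proof. by move=> x; apply: orV_inj; apply: (omul1 h); exact: orVP. Qed.
Let mulD : left_distributive mul add.
Proof. by move=> x y z; apply: orV_inj; apply: (omulD h); exact: orVP. Qed.
Let one0 : one != zero.
Proof. by apply/eqP => /(congr1 orV) /(o10 h). Qed.
HB.instance Definition _ := GRing.Zmodule_isComNzRing.Build T mulA mulC mul1 mulD one0.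

Lemma orV_mul (x y : T) : orV (x * y)%R = omul R (orV x) (orV y). Proof. by []. Qed.

Definition orlt (x y : T) : bool := `[< olt R (orV x) (orV y) >].
Let ltirr x : ~ orlt x x. Proof. by move=> /asboolP /(olt_irr h); apply; exact: orVP. Qed.
Let lttr y x z : orlt x y -> orlt y z -> orlt x z.
Proof.
by move=> /asboolP xy /asboolP yz; apply/asboolP; apply: (olt_tr h) xy yz; exact: orVP.
Qed.
Let lttot x y : x = y \/ orlt x y \/ orlt y x.
Proof.
case: (olt_tot h (orVP x) (orVP y)) => [/orV_inj|[]]; [by left| |] => H; right;
  [left|right]; exact/asboolP.
Qed.
Let ltadd z x y : orlt x y -> orlt (x + z)%R (y + z)%R.
Proof. by move=> /asboolP xy; apply/asboolP; apply: (olt_add h) xy; exact: orVP. Qed.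
Let ltmul x y : orlt 0%R x -> orlt 0%R y -> orlt 0%R (x * y)%R.
Proof.
by move=> /asboolP xy /asboolP yz; apply/asboolP; apply: (olt_mul h) xy yz; exact: orVP.
Qed.
Let sub_gt0 x y : orlt 0%R (y - x)%R = orlt x y.
Proof.
apply/idP/idP => /ltadd H; first by have := H x; rewrite add0r subrK.
by have := H (- x)%R; rewrite subrr.
Qed.
Let ltN x : orlt x 0%R -> orlt 0%R (- x)%R.
Proof. by move=> H; rewrite -sub0r sub_gt0. Qed.

Let unit (x : T) : bool := `[< exists y : T, (y * x = 1)%R >].
Let inv (x : T) : T := if pselect (exists y : T, (y * x = 1)%R) is left H
  then projT1 (cid H) else x.
Let mulV : {in unit, left_inverse 1%R inv *%R}.
Proof.
move=> x /asboolP H; rewrite /inv; case: pselect => // H'; exact: (projT2 (cid H')).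
Qed.
Let unitP (x y : T) : (y * x = 1)%R -> unit x.
Proof. by move=> H; apply/asboolP; exists y. Qed.
Let invout : {in [predC unit], inv =1 id}.
Proof. by move=> x /asboolP H; rewrite /inv; case: pselect. Qed.
HB.instance Definition _ := GRing.ComNzRing_hasMulInverse.Build T mulV unitP invout.

Let idom : GRing.integral_domain_axiom T.
Proof.
have pos (x y : T) : orlt 0%R x -> (x * y)%R = 0%R -> y = 0%R.
  move=> x0 E; case: (lttot y 0%R) => [//|[]] y0.
    by have := ltmul x0 (ltN y0); rewrite mulrN E oppr0 => /ltirr.
  by have := ltmul x0 y0; rewrite E => /ltirr.
move=> x y E; apply/orP; case: (lttot x 0%R) => [x0|[x0|x0]]; first by left; apply/eqP.
  by right; apply/eqP; apply: (pos (- x)%R) => //; [exact: ltN|rewrite mulNr E oppr0].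
by right; apply/eqP; apply: (pos x).
Qed.
HB.instance Definition _ := GRing.ComUnitRing_isIntegral.Build T idom.

Let le (x y : T) : bool := (x == y) || orlt x y.
Let norm (x : T) : T := if orlt x 0%R then (- x)%R else x.
Let lt0_add x y : orlt 0%R x -> orlt 0%R y -> orlt 0%R (x + y)%R.
Proof. by move=> x0 y0; apply: (lttr y0); have := ltadd y x0; rewrite add0r. Qed.
Let lt0_ngt0 x : orlt 0%R x -> ~~ orlt x 0%R.
Proof. by move=> x0; apply/negP => /(lttr x0) /ltirr. Qed.
Let lt0_total x : x != 0%R -> orlt 0%R x || orlt x 0%R.
Proof. by move=> /eqP x0; apply/orP; case: (lttot x 0%R) => [//|[]]; auto. Qed.
Let normN x : norm (- x)%R = norm x.
Proof.
rewrite /norm; case: (lttot x 0%R) => [H|[H|H]]; first by rewrite H !oppr0 !if_same.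
  by rewrite H (negbTE (lt0_ngt0 (ltN H))).
have -> : orlt (- x)%R 0%R by rewrite -sub_gt0 sub0r opprK.
by rewrite (negbTE (lt0_ngt0 H)) opprK.
Qed.
Let ge0_norm x : le 0%R x -> norm x = x.
Proof.
rewrite /le /norm => /orP[/eqP <-|/lt0_ngt0/negbTE -> //].
by case: ifP => // /ltirr.
Qed.
Let le_def x y : le x y = (x == y) || orlt x y.
Proof. by []. Qed.
HB.instance Definition _ := Num.IntegralDomain_isLtReal.Build T
  lt0_add ltmul lt0_ngt0 sub_gt0 lt0_total normN ge0_norm le_def.

Lemma orV_lt (x y : T) : (x < y)%R <-> olt R (orV x) (orV y).
Proof. by split=> /asboolP. Qed.
End ElementType.

Section FieldType.
Context {M : structure}.
Definition ofT (R : ops M) (h : ofield R) : Type := orT (ofield_oring h).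
Variables (R : ops M) (h : ofield R).
Local Notation T := (ofT h).
HB.instance Definition _ := Num.RealDomain.on T.
Let fieldP : GRing.field_axiom T.
Proof.
move=> x /eqP x0; have x1 : orV (x : orT (ofield_oring h)) <> o0 R.
  by move=> E; apply: x0; apply: (@orV_inj _ _ (ofield_oring h)).
have [y yF E] := oinvP h (orVP (x : orT (ofield_oring h))) x1.
apply/unitrP; exists (orK (ofield_oring h) yF).
by rewrite [(x * _)%R]mulrC; split; apply: orV_inj.
Qed.
HB.instance Definition _ := GRing.UnitRing_isField.Build T fieldP.
End FieldType.

Section DefinableOps.
Context {M : structure} {HM : zfa M}.

Record dops (R : ops M) : Prop := DOps {
  dadd : Tm anyp (fun e => oadd R (e 0) (e 1));
  dmul : Tm anyp (fun e => omul R (e 0) (e 1));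
  dopp : Tm anyp (fun e => oopp R (e 0));
  dlt : Df anyp (fun e => olt R (e 0) (e 1)) }.

Definition pfst (p : M) : M := the (fun x => exists y, p = opair x y).
Definition psnd (p : M) : M := the (fun y => exists x, p = opair x y).
Lemma pfstE x y : pfst (opair x y) = x.
Proof. by apply: the_eq; [exists y|move=> z [w /opair_inj[]]]. Qed.
Lemma psndE x y : psnd (opair x y) = y.
Proof. by apply: the_eq; [exists x|move=> z [w /opair_inj[]]]. Qed.
Lemma Tm_pfst B t : Tm B t -> Tm B (fun e => pfst (t e)).
Proof. by move=> ?; rewrite /pfst; dfn. Qed.
Lemma Tm_psnd B t : Tm B t -> Tm B (fun e => psnd (t e)).
Proof. by move=> ?; rewrite /psnd; dfn. Qed.
End DefinableOps.
Ltac dfn_user9 := first [simple apply Tm_pfst | simple apply Tm_psnd | dfn_user8].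
Ltac dfn_user ::= dfn_user9.

(** An ordered ring up to the congruence [eqv]. Integers, fractions and Cauchy reals are each
    obtained by dividing such a structure by its congruence. *)
Record preoring {M : structure} (R : ops M) (eqv : M -> M -> Prop) : Prop := PreORing {
  p0P : o0 R ∊ od R; p1P : o1 R ∊ od R;
  paddP : forall x y, x ∊ od R -> y ∊ od R -> oadd R x y ∊ od R;
  pmulP : forall x y, x ∊ od R -> y ∊ od R -> omul R x y ∊ od R;
  poppP : forall x, x ∊ od R -> oopp R x ∊ od R;
  prefl : forall x, x ∊ od R -> eqv x x;
  psym : forall x y, x ∊ od R -> y ∊ od R -> eqv x y -> eqv y x;
  ptrans : forall x y z, x ∊ od R -> y ∊ od R -> z ∊ od R -> eqv x y -> eqv y z -> eqv x z;
  padd_eqv : forall x y z, x ∊ od R -> y ∊ od R -> z ∊ od R -> eqv x y ->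
    eqv (oadd R x z) (oadd R y z);
  pmul_eqv : forall x y z, x ∊ od R -> y ∊ od R -> z ∊ od R -> eqv x y ->
    eqv (omul R x z) (omul R y z);
  popp_eqv : forall x y, x ∊ od R -> y ∊ od R -> eqv x y -> eqv (oopp R x) (oopp R y);
  plt_eqv : forall x y x' y', x ∊ od R -> y ∊ od R -> x' ∊ od R -> y' ∊ od R ->
    eqv x x' -> eqv y y' -> olt R x y -> olt R x' y';
  paddA : forall x y z, x ∊ od R -> y ∊ od R -> z ∊ od R ->
    eqv (oadd R x (oadd R y z)) (oadd R (oadd R x y) z);
  paddC : forall x y, x ∊ od R -> y ∊ od R -> eqv (oadd R x y) (oadd R y x);
  padd0 : forall x, x ∊ od R -> eqv (oadd R (o0 R) x) x;
  paddN : forall x, x ∊ od R -> eqv (oadd R (oopp R x) x) (o0 R);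
  pmulA : forall x y z, x ∊ od R -> y ∊ od R -> z ∊ od R ->
    eqv (omul R x (omul R y z)) (omul R (omul R x y) z);
  pmulC : forall x y, x ∊ od R -> y ∊ od R -> eqv (omul R x y) (omul R y x);
  pmul1 : forall x, x ∊ od R -> eqv (omul R (o1 R) x) x;
  pmulD : forall x y z, x ∊ od R -> y ∊ od R -> z ∊ od R ->
    eqv (omul R (oadd R x y) z) (oadd R (omul R x z) (omul R y z));
  p10 : ~ eqv (o1 R) (o0 R);
  plt_irr : forall x, x ∊ od R -> ~ olt R x x;
  plt_tr : forall x y z, x ∊ od R -> y ∊ od R -> z ∊ od R ->
    olt R x y -> olt R y z -> olt R x z;
  plt_tot : forall x y, x ∊ od R -> y ∊ od R -> eqv x y \/ olt R x y \/ olt R y x;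
  plt_add : forall x y z, x ∊ od R -> y ∊ od R -> z ∊ od R ->
    olt R x y -> olt R (oadd R x z) (oadd R y z);
  plt_mul : forall x y, x ∊ od R -> y ∊ od R -> olt R (o0 R) x -> olt R (o0 R) y ->
    olt R (o0 R) (omul R x y) }.

Section Quotient.
Context {M : structure} {HM : zfa M}.
Variables (R : ops M) (eqv : M -> M -> Prop).
Hypotheses (P : preoring R eqv) (dR : dops R).
Hypothesis deqv : Df anyp (fun e => eqv (e 0) (e 1)).
Implicit Types (p q x y z : M).
Local Notation S := (od R).

Definition cls p : M := sep S (fun q => eqv p q).
Definition qlift1 (f : M -> M) x : M := the (fun z => exists2 p, p ∊ x & z = cls (f p)).
Definition qlift2 (f : M -> M -> M) x y : M :=
  the (fun z => exists p q, (p ∊ x /\ q ∊ y) /\ z = cls (f p q)).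
Definition qrel (r : M -> M -> Prop) x y : Prop := exists p q, (p ∊ x /\ q ∊ y) /\ r p q.
Definition qops : ops M := Ops (repl S cls) (qlift2 (oadd R)) (qlift2 (omul R))
  (qlift1 (oopp R)) (qrel (olt R)) (cls (o0 R)) (cls (o1 R)).

Lemma dcls : Tm anyp (fun e => cls (e 0)).
Proof. by rewrite /cls; dfn. Qed.
Lemma in_cls p q : (q ∊ cls p) = (q ∊ S /\ eqv p q).
Proof. by rewrite /cls in_sep //; dfn. Qed.
Lemma in_Q x : (x ∊ od qops) = (exists2 p, p ∊ S & x = cls p).
Proof. by rewrite /= in_repl //; exact: dcls. Qed.
Lemma cls_eq p q : p ∊ S -> q ∊ S -> (cls p = cls q) = (eqv p q).
Proof.
move=> pS qS; apply: propext; split=> [E|E].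
  by have : q ∊ cls p by [rewrite E in_cls; split=> //; exact: (prefl P)]; rewrite in_cls => -[].
apply: set_eqP => // [||z]; try exact: isset_mkset.
rewrite !in_cls; apply: propext; split=> -[zS H]; split=> //; apply: (ptrans P _ _ _ _ H) => //.
exact: (psym P).
Qed.
Lemma cls_Q p : p ∊ S -> cls p ∊ od qops.
Proof. by move=> pS; rewrite in_Q; exists p. Qed.
Lemma cls_self p : p ∊ S -> p ∊ cls p.
Proof. by move=> pS; rewrite in_cls; split=> //; exact: (prefl P). Qed.

Lemma qlift1E f p : (forall x, x ∊ S -> f x ∊ S) ->
  (forall x y, x ∊ S -> y ∊ S -> eqv x y -> eqv (f x) (f y)) -> p ∊ S ->
  qlift1 f (cls p) = cls (f p).
Proof.
move=> fS fe pS; apply: the_eq; first by exists p => //; exact: cls_self.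
move=> z [q]; rewrite in_cls => -[qS E] ->; rewrite cls_eq; auto.
by apply: fe => //; exact: (psym P).
Qed.
(** Compatibility is assumed in the first argument only; commutativity up to [eqv] transports it to
    the second. *)
Lemma qlift2E f p q : (forall x y, x ∊ S -> y ∊ S -> f x y ∊ S) ->
  (forall x y z, x ∊ S -> y ∊ S -> z ∊ S -> eqv x y -> eqv (f x z) (f y z)) ->
  (forall x y, x ∊ S -> y ∊ S -> eqv (f x y) (f y x)) -> p ∊ S -> q ∊ S ->
  qlift2 f (cls p) (cls q) = cls (f p q).
Proof.
move=> fS fe fC pS qS; apply: the_eq.
  by exists p, q; split=> //; split; exact: cls_self.
move=> z [p' [q' [[]]]]; rewrite !in_cls => -[p'S Ep] [q'S Eq] ->.
rewrite cls_eq; auto; apply: (ptrans P (y := f p q')); auto.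
  by apply: fe => //; exact: (psym P).
apply: (ptrans P (y := f q' p)); auto; apply: (ptrans P (y := f q p)); auto.
by apply: fe => //; exact: (psym P).
Qed.
Lemma qaddE p q : p ∊ S -> q ∊ S -> oadd qops (cls p) (cls q) = cls (oadd R p q).
Proof. by apply: qlift2E; [exact: (paddP P)|exact: (padd_eqv P)|exact: (paddC P)]. Qed.
Lemma qmulE p q : p ∊ S -> q ∊ S -> omul qops (cls p) (cls q) = cls (omul R p q).
Proof. by apply: qlift2E; [exact: (pmulP P)|exact: (pmul_eqv P)|exact: (pmulC P)]. Qed.
Lemma qoppE p : p ∊ S -> oopp qops (cls p) = cls (oopp R p).
Proof. by apply: qlift1E; [exact: (poppP P)|exact: (popp_eqv P)]. Qed.
Lemma qltE p q : p ∊ S -> q ∊ S -> olt qops (cls p) (cls q) = olt R p q.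
Proof.
move=> pS qS; apply: propext; split; last first.
  by exists p, q; split=> //; split; exact: cls_self.
move=> [p' [q' [[]]]]; rewrite !in_cls => -[p'S Ep] [q'S Eq].
by apply: (plt_eqv P) => //; exact: (psym P).
Qed.

Lemma qoring : oring qops.
Proof.
have A := paddP P; have Mu := pmulP P; have O := poppP P.
have z0 := p0P P; have z1 := p1P P.
split.
- by rewrite in_Q; exists (o0 R).
- by rewrite in_Q; exists (o1 R).
- by move=> x y; rewrite !in_Q => -[p pS ->] [q qS ->]; rewrite qaddE //; exists (oadd R p q); auto.
- by move=> x y; rewrite !in_Q => -[p pS ->] [q qS ->]; rewrite qmulE //; exists (omul R p q); auto.
- by move=> x; rewrite !in_Q => -[p pS ->]; rewrite qoppE //; exists (oopp R p); auto.
- move=> x y z; rewrite !in_Q => -[p pS ->] [q qS ->] [r rS ->].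
  by rewrite !qaddE ?cls_eq; auto; exact: (paddA P).
- move=> x y; rewrite !in_Q => -[p pS ->] [q qS ->].
  by rewrite !qaddE ?cls_eq; auto; exact: (paddC P).
- by move=> x; rewrite !in_Q => -[p pS ->]; rewrite !qaddE ?cls_eq; auto; exact: (padd0 P).
- by move=> x; rewrite !in_Q => -[p pS ->]; rewrite !qoppE ?qaddE ?cls_eq; auto; exact: (paddN P).
- move=> x y z; rewrite !in_Q => -[p pS ->] [q qS ->] [r rS ->].
  by rewrite !qmulE ?cls_eq; auto; exact: (pmulA P).
- move=> x y; rewrite !in_Q => -[p pS ->] [q qS ->].
  by rewrite !qmulE ?cls_eq; auto; exact: (pmulC P).
- by move=> x; rewrite !in_Q => -[p pS ->]; rewrite !qmulE ?cls_eq; auto; exact: (pmul1 P).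
- move=> x y z; rewrite !in_Q => -[p pS ->] [q qS ->] [r rS ->].
  by rewrite !qaddE ?qmulE ?qaddE ?cls_eq; auto; exact: (pmulD P).
- by rewrite /= cls_eq //; exact: (p10 P).
- by move=> x; rewrite in_Q => -[p pS ->]; rewrite qltE //; exact: (plt_irr P).
- move=> x y z; rewrite !in_Q => -[p pS ->] [q qS ->] [r rS ->].
  by rewrite !qltE //; exact: (plt_tr P).
- move=> x y; rewrite !in_Q => -[p pS ->] [q qS ->].
  by rewrite !qltE ?cls_eq //; exact: (plt_tot P).
- move=> x y z; rewrite !in_Q => -[p pS ->] [q qS ->] [r rS ->].
  by rewrite !qaddE ?qltE; auto; exact: (plt_add P).
- move=> x y; rewrite !in_Q => -[p pS ->] [q qS ->].
  by rewrite !qmulE ?qltE; auto; exact: (plt_mul P).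
Qed.

Lemma qofield : (forall p, p ∊ S -> ~ eqv p (o0 R) -> exists2 q, q ∊ S & eqv (omul R q p) (o1 R)) ->
  ofield qops.
Proof.
move=> H; split; first exact: qoring.
move=> x; rewrite in_Q => -[p pS ->]; rewrite /= cls_eq //; last exact: (p0P P).
move=> /(H p pS) [q qS E]; exists (cls q); first exact: cls_Q.
change (omul qops (cls q) (cls p) = cls (o1 R)).
by rewrite qmulE // cls_eq //; [exact: (pmulP P)|exact: (p1P P)].
Qed.

Lemma dqops : dops qops.
Proof.
have d := dcls; have [d1 d2 d3 d4] := dR.
by split; rewrite /= /qlift1 /qlift2 /qrel; dfn.
Qed.
End Quotient.

Section Naturals.
Context {M : structure} {HM : zfa M}.
Implicit Types (m n k : M).

Definition nadd m n : M := nrec m (fun _ x => succ x) n.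
Definition nmul m n : M := nrec emp (fun _ x => nadd x m) n.

(** The rule [Tm_nrec] covers recursions from a fixed start. Here the start varies with the first
    argument, so the recursion is unfolded. *)
Lemma Tm_nadd B s t : Tm B s -> Tm B t -> Tm B (fun e => nadd (s e) (t e)).
Proof. by move=> ? ?; rewrite /nadd /nrec /rec_approx; dfn. Qed.
Lemma Tm_nmul B s t : Tm B s -> Tm B t -> Tm B (fun e => nmul (s e) (t e)).
Proof. by move=> ? ?; rewrite /nmul /nrec /rec_approx; dfn; apply: Tm_nadd; dfn. Qed.

Ltac ndfn := dfn; repeat first [apply: Tm_nadd | apply: Tm_nmul | dfn_step].
Lemma nadd0 m : nadd m emp = m. Proof. by rewrite /nadd nrec0 //; dfn. Qed.
Lemma naddS m n : n ∊ omega -> nadd m (succ n) = succ (nadd m n).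
Proof. by move=> no; rewrite /nadd nrecS //; dfn. Qed.
Lemma nmul0 m : nmul m emp = emp. Proof. by rewrite /nmul nrec0 //; ndfn. Qed.
Lemma nmulS m n : n ∊ omega -> nmul m (succ n) = nadd (nmul m n) m.
Proof. by move=> no; rewrite /nmul nrecS //; ndfn. Qed.

Lemma nadd_omega m n : m ∊ omega -> n ∊ omega -> nadd m n ∊ omega.
Proof.
move=> mo; move: n; apply: omega_ind => [||n no IH]; [by ndfn|by rewrite nadd0|].
by rewrite naddS //; exact: omegaS.
Qed.
Lemma nmul_omega m n : m ∊ omega -> n ∊ omega -> nmul m n ∊ omega.
Proof.
move=> mo; move: n; apply: omega_ind => [||n no IH]; [by ndfn|by rewrite nmul0|].
by rewrite nmulS //; exact: nadd_omega.
Qed.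

Lemma nadd0l n : n ∊ omega -> nadd emp n = n.
Proof.
by move: n; apply: omega_ind => [||n no IH]; [ndfn|rewrite nadd0|rewrite naddS // IH].
Qed.
Lemma naddSl m n : n ∊ omega -> nadd (succ m) n = succ (nadd m n).
Proof.
by move: n; apply: omega_ind => [||n no IH]; [ndfn|rewrite !nadd0|rewrite !naddS // IH].
Qed.
Lemma naddC m n : m ∊ omega -> n ∊ omega -> nadd m n = nadd n m.
Proof.
move=> mo; move: n; apply: omega_ind => [||n no IH]; first by ndfn.
  by rewrite nadd0 nadd0l.
by rewrite naddS // naddSl // IH.
Qed.
Lemma naddA m n k : n ∊ omega -> k ∊ omega -> nadd m (nadd n k) = nadd (nadd m n) k.
Proof.
move=> no; move: k; apply: omega_ind => [||k ko IH]; first by ndfn.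
  by rewrite !nadd0.
by rewrite !naddS ?IH //; exact: nadd_omega.
Qed.
Lemma nmul0l n : n ∊ omega -> nmul emp n = emp.
Proof.
move: n; apply: omega_ind => [||n no IH]; [by ndfn|by rewrite nmul0|].
by rewrite nmulS // IH nadd0.
Qed.
Lemma nmulSl m n : m ∊ omega -> n ∊ omega -> nmul (succ m) n = nadd (nmul m n) n.
Proof.
move=> mo; move: n; apply: omega_ind => [||n no IH]; first by ndfn.
  by rewrite !nmul0 nadd0.
have mno := nmul_omega mo no.
by rewrite !nmulS // IH !naddS // -!naddA // (naddC no mo).
Qed.
Lemma nmulC m n : m ∊ omega -> n ∊ omega -> nmul m n = nmul n m.
Proof.
move=> mo; move: n; apply: omega_ind => [||n no IH]; first by ndfn.
  by rewrite nmul0 nmul0l.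
by rewrite nmulS // nmulSl // IH.
Qed.
Lemma nmulDl m n k : m ∊ omega -> n ∊ omega -> k ∊ omega ->
  nmul (nadd m n) k = nadd (nmul m k) (nmul n k).
Proof.
move=> mo no; move: k; apply: omega_ind => [||k ko IH]; first by ndfn.
  by rewrite !nmul0 nadd0.
have mk := nmul_omega mo ko; have nk := nmul_omega no ko.
have mnk := nadd_omega nk no.
rewrite !nmulS // IH -!naddA //; try exact: nadd_omega.
by congr nadd; rewrite !naddA // (naddC nk mo).
Qed.
Lemma nmulA m n k : m ∊ omega -> n ∊ omega -> k ∊ omega ->
  nmul m (nmul n k) = nmul (nmul m n) k.
Proof.
move=> mo no; move: k; apply: omega_ind => [||k ko IH]; first by ndfn.
  by rewrite !nmul0.
have nk := nmul_omega no ko; have mn := nmul_omega mo no.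
rewrite !nmulS // -IH nmulC //; last exact: nadd_omega.
by rewrite nmulDl // nmulC // (nmulC no mo).
Qed.
Lemma nadd_inj k m n : k ∊ omega -> nadd m k = nadd n k -> m = n.
Proof.
move: k; apply: omega_ind => [||k ko IH]; first by ndfn.
  by rewrite !nadd0.
by rewrite !naddS // => /succ_inj.
Qed.
Lemma nltP m n : m ∊ omega -> n ∊ omega ->
  (m ∊ n) <-> exists2 k, k ∊ omega & n = nadd m (succ k).
Proof.
move=> mo no; split; last first.
  move=> [k ko ->]; move: k ko; apply: omega_ind => [||k ko IH]; first by ndfn.
    by rewrite naddS // nadd0; ins; right.
  by rewrite naddS; [ins; left|exact: omegaS].
move: n no; apply: omega_ind => [||n no IH]; [by ndfn|by ins|].
ins => -[/IH[k ko ->]|->]; first by exists (succ k); rewrite ?(naddS _ (omegaS ko)); auto.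
by exists emp => //; rewrite naddS // nadd0.
Qed.

Definition NT : Type := {n : M | n ∊ omega}.
Definition nV (x : NT) : M := proj1_sig x.
Definition nK n (H : n ∊ omega) : NT := exist _ n H.
Lemma nVP (x : NT) : nV x ∊ omega. Proof. by case: x. Qed.
Lemma nV_inj (x y : NT) : nV x = nV y -> x = y.
Proof. by case: x y => [x p] [y q] /= E; apply: eq_exist. Qed.
Lemma NT_ex n : n ∊ omega -> exists x : NT, n = nV x.
Proof. by move=> no; exists (nK no). Qed.

HB.instance Definition _ := gen_eqMixin NT.
HB.instance Definition _ := gen_choiceMixin NT.
Let add (x y : NT) : NT := nK (nadd_omega (nVP x) (nVP y)).
Let mul (x y : NT) : NT := nK (nmul_omega (nVP x) (nVP y)).
Let zero : NT := nK omega0.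
Let one : NT := nK (omegaS omega0).

Let addA : associative add.
Proof. by move=> x y z; apply: nV_inj; apply: naddA; exact: nVP. Qed.
Let add0 : left_id zero add.
Proof. by move=> x; apply: nV_inj; apply: nadd0l; exact: nVP. Qed.
Let addC : commutative add.
Proof. by move=> x y; apply: nV_inj; apply: naddC; exact: nVP. Qed.
HB.instance Definition _ := GRing.isNmodule.Build NT addA addC add0.

Let mul_0 : left_zero zero mul.
Proof. by move=> x; apply: nV_inj; apply: nmul0l; exact: nVP. Qed.
Let mulDl : left_distributive mul add.
Proof. by move=> x y z; apply: nV_inj; apply: nmulDl; exact: nVP. Qed.
Let mulC : commutative mul.
Proof. by move=> x y; apply: nV_inj; apply: nmulC; exact: nVP. Qed.
Let mulA : associative mul.
Proof. by move=> x y z; apply: nV_inj; apply: nmulA; exact: nVP. Qed.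
Let mul_1 : left_id one mul.
Proof.
move=> x; apply: nV_inj; rewrite /= nmulSl //; last exact: nVP.
by rewrite nmul0l ?nadd0l //; exact: nVP.
Qed.
Let one0 : one != zero.
Proof. by apply/eqP => /(congr1 nV) /succ_neq0. Qed.
HB.instance Definition _ := GRing.Nmodule_isComNzSemiRing.Build NT mulA mulC mul_1 mulDl mul_0 one0.

Lemma nV_add (x y : NT) : nV (x + y)%R = nadd (nV x) (nV y). Proof. by []. Qed.
Lemma nV1 : nV 1%R = succ emp. Proof. by []. Qed.
Lemma nV_succ (x : NT) : nV (x + 1)%R = succ (nV x).
Proof. by rewrite nV_add nV1 naddS // nadd0. Qed.
Lemma nt_addI (z x y : NT) : (x + z)%R = (y + z)%R -> x = y.
Proof.
by move=> /(congr1 nV) E; apply: nV_inj; apply: nadd_inj E; exact: nVP.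
Qed.
(** A substitute for subtraction in a cancellative semiring: known equations are added to the goal
    one by one until [ring] closes it. *)
Lemma nt_cancel (l r x y : NT) : l = r -> (x + r)%R = (y + l)%R -> x = y.
Proof. by move=> -> /nt_addI. Qed.
Lemma nt_succ0 (x : NT) : (x + 1)%R <> 0%R.
Proof. by move=> /(congr1 nV); rewrite nV_succ => /succ_neq0. Qed.
Lemma NT_lt (x y : NT) : (nV x ∊ nV y) <-> exists k : NT, y = (x + (k + 1))%R.
Proof.
apply: iff_trans (nltP (nVP x) (nVP y)) _; split=> [[k ko E]|[k ->]].
  by exists (nK ko); apply: nV_inj; rewrite E nV_add nV_succ.
by exists (nV k); [exact: nVP|rewrite nV_add nV_succ].
Qed.
Lemma nt_total (x y : NT) : x = y \/ (exists k : NT, y = (x + (k + 1))%R) \/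
  exists k : NT, x = (y + (k + 1))%R.
Proof.
case: (nat_lt_total (nVP x) (nVP y)) => [/NT_lt|[/nV_inj|/NT_lt]]; auto.
Qed.
End Naturals.
Ltac dfn_user10 := first [simple apply Tm_nadd | simple apply Tm_nmul | dfn_user9].
Ltac dfn_user ::= dfn_user10.

Section Integers.
Context {M : structure} {HM : zfa M}.
Implicit Types (p q : M).

(** The pair with components a and b stands for the integer a - b. *)
Definition zadd p q : M := opair (nadd (pfst p) (pfst q)) (nadd (psnd p) (psnd q)).
Definition zmul p q : M :=
  opair (nadd (nmul (pfst p) (pfst q)) (nmul (psnd p) (psnd q)))
        (nadd (nmul (pfst p) (psnd q)) (nmul (psnd p) (pfst q))).
Definition zopp p : M := opair (psnd p) (pfst p).
Definition zlt p q : Prop := nadd (pfst p) (psnd q) ∊ nadd (pfst q) (psnd p).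
Definition zeqv p q : Prop := nadd (pfst p) (psnd q) = nadd (pfst q) (psnd p).
Definition preZ : ops M := Ops (prod omega omega) zadd zmul zopp zlt
  (opair emp emp) (opair (succ emp) emp).

Let zp (a b : NT) : M := opair (nV a) (nV b).
Let zpP a b : zp a b ∊ od preZ.
Proof. by rewrite /= opair_prod; split; exact: nVP. Qed.
Let zp_ex p : p ∊ od preZ -> exists a b, p = zp a b.
Proof.
by rewrite /= in_prod => -[x [y [/NT_ex[a ->] [/NT_ex[b ->] ->]]]]; exists a, b.
Qed.
Let zaddE a b c d : zadd (zp a b) (zp c d) = zp (a + c)%R (b + d)%R.
Proof. by rewrite /zadd /zp !pfstE !psndE. Qed.
Let zmulE a b c d : zmul (zp a b) (zp c d) = zp (a * c + b * d)%R (a * d + b * c)%R.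
Proof. by rewrite /zmul /zp !pfstE !psndE. Qed.
Let zoppE a b : zopp (zp a b) = zp b a.
Proof. by rewrite /zopp /zp !pfstE !psndE. Qed.
Let zltE a b c d : zlt (zp a b) (zp c d) <-> exists k, (c + b = a + d + (k + 1))%R.
Proof. by rewrite /zlt /zp !pfstE !psndE -!nV_add NT_lt. Qed.
Let zeqvE a b c d : zeqv (zp a b) (zp c d) <-> (a + d = c + b)%R.
Proof. by rewrite /zeqv /zp !pfstE !psndE -!nV_add; split=> [/nV_inj|->]. Qed.

Lemma preZ_preoring : preoring preZ zeqv.
Proof.
have z0 : o0 preZ = zp 0%R 0%R by []. have z1 : o1 preZ = zp 1%R 0%R by [].
split; rewrite ?z0 ?z1; try exact: zpP; cbn [oadd omul oopp olt preZ].
- by move=> x y /zp_ex[a [b ->]] /zp_ex[c [d ->]]; rewrite zaddE.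
- by move=> x y /zp_ex[a [b ->]] /zp_ex[c [d ->]]; rewrite zmulE.
- by move=> x /zp_ex[a [b ->]]; rewrite zoppE.
- by move=> x /zp_ex[a [b ->]]; apply/zeqvE.
- by move=> x y /zp_ex[a [b ->]] /zp_ex[c [d ->]] /zeqvE E; apply/zeqvE.
- move=> x y z /zp_ex[a [b ->]] /zp_ex[c [d ->]] /zp_ex[e [f ->]] /zeqvE E1 /zeqvE E2.
  by apply/zeqvE; apply: (nt_cancel E1); apply: (nt_cancel E2); ring.
- move=> x y z /zp_ex[a [b ->]] /zp_ex[c [d ->]] /zp_ex[e [f ->]] /zeqvE E.
  by rewrite !zaddE; apply/zeqvE; apply: (nt_cancel E); ring.
- move=> x y z /zp_ex[a [b ->]] /zp_ex[c [d ->]] /zp_ex[e [f ->]] /zeqvE E.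
  have E1 : ((a + d) * e = (c + b) * e)%R by rewrite E.
  have E2 : ((c + b) * f = (a + d) * f)%R by rewrite E.
  by rewrite !zmulE; apply/zeqvE; apply: (nt_cancel E1); apply: (nt_cancel E2); ring.
- move=> x y /zp_ex[a [b ->]] /zp_ex[c [d ->]] /zeqvE E.
  by rewrite !zoppE; apply/zeqvE; apply: (nt_cancel (esym E)); ring.
- move=> x y x' y' /zp_ex[a [b ->]] /zp_ex[c [d ->]] /zp_ex[a' [b' ->]] /zp_ex[c' [d' ->]].
  move=> /zeqvE E1 /zeqvE E2 /zltE[k L]; apply/zltE; exists k.
  by apply: (nt_cancel E1); apply: (nt_cancel (esym E2)); apply: (nt_cancel L); ring.
- move=> x y z /zp_ex[a [b ->]] /zp_ex[c [d ->]] /zp_ex[e [f ->]].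
  by rewrite !zaddE; apply/zeqvE; ring.
- by move=> x y /zp_ex[a [b ->]] /zp_ex[c [d ->]]; rewrite !zaddE; apply/zeqvE; ring.
- by move=> x /zp_ex[a [b ->]]; rewrite !zaddE; apply/zeqvE; ring.
- by move=> x /zp_ex[a [b ->]]; rewrite zoppE !zaddE; apply/zeqvE; ring.
- move=> x y z /zp_ex[a [b ->]] /zp_ex[c [d ->]] /zp_ex[e [f ->]].
  by rewrite !zmulE; apply/zeqvE; ring.
- by move=> x y /zp_ex[a [b ->]] /zp_ex[c [d ->]]; rewrite !zmulE; apply/zeqvE; ring.
- by move=> x /zp_ex[a [b ->]]; rewrite !zmulE; apply/zeqvE; ring.
- move=> x y z /zp_ex[a [b ->]] /zp_ex[c [d ->]] /zp_ex[e [f ->]].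
  by rewrite !zmulE !zaddE !zmulE; apply/zeqvE; ring.
- by move=> /zeqvE E; apply: (@nt_succ0 _ _ 0%R); rewrite -{2}(addr0 0%R) -E; ring.
- move=> x /zp_ex[a [b ->]] /zltE[k L]; apply: (@nt_succ0 _ _ k).
  by apply: (nt_cancel (esym L)); ring.
- move=> x y z /zp_ex[a [b ->]] /zp_ex[c [d ->]] /zp_ex[e [f ->]] /zltE[k L1] /zltE[l L2].
  apply/zltE; exists (k + l + 1)%R.
  by apply: (nt_cancel L1); apply: (nt_cancel L2); ring.
- move=> x y /zp_ex[a [b ->]] /zp_ex[c [d ->]].
  case: (nt_total (a + d)%R (c + b)%R) => [E|[H|H]]; [left|right; left|right; right].
  + exact/zeqvE.
  + exact/zltE.
  + exact/zltE.
- move=> x y z /zp_ex[a [b ->]] /zp_ex[c [d ->]] /zp_ex[e [f ->]] /zltE[k L].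
  by rewrite !zaddE; apply/zltE; exists k; apply: (nt_cancel L); ring.
- move=> x y /zp_ex[a [b ->]] /zp_ex[c [d ->]] /zltE[k L1] /zltE[l L2].
  rewrite zmulE; apply/zltE; exists (k * l + k + l)%R.
  have -> : a = (b + (k + 1))%R by rewrite -(addr0 a) L1; ring.
  have -> : c = (d + (l + 1))%R by rewrite -(addr0 c) L2; ring.
  by ring.
Qed.

Lemma preZ_dops : dops preZ.
Proof. by split; rewrite /= /zadd /zmul /zopp /zlt; dfn. Qed.
Lemma dzeqv : Df anyp (fun e => zeqv (e 0) (e 1)).
Proof. by rewrite /zeqv; dfn. Qed.

Definition Zops : ops M := qops preZ zeqv.
Lemma Zoring : oring Zops.
Proof. exact: (qoring preZ_preoring dzeqv). Qed.
Lemma Zdops : dops Zops.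
Proof. exact: (dqops preZ_dops dzeqv). Qed.
Local Notation K := (orT Zoring).

Definition zn (n : M) : M := cls preZ zeqv (opair n emp).
Lemma Tm_zn B t : Tm B t -> Tm B (fun e => zn (t e)).
Proof. by move=> ?; rewrite /zn /cls /zeqv /=; dfn. Qed.
Let znp (n : NT) : opair (nV n) emp = zp n 0%R. Proof. by []. Qed.
Lemma znS n : n ∊ omega -> zn (succ n) = oadd Zops (zn n) (o1 Zops).
Proof.
move=> /NT_ex[a ->]; rewrite -nV_succ /zn !znp; symmetry.
have z1 := p1P preZ_preoring.
rewrite (qaddE preZ_preoring dzeqv (zpP a 0%R) z1) /=.
by rewrite [opair (succ emp) emp](_ : _ = zp 1%R 0%R) // zaddE addr0.
Qed.
Lemma z_arch x : x ∊ od Zops -> exists2 n, n ∊ omega & olt Zops x (zn n).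
Proof.
rewrite (in_Q preZ dzeqv) => -[p pS ->]; have [a [b E]] := zp_ex pS; subst p.
exists (nV (a + 1)%R); first exact: nVP.
rewrite /zn znp (qltE preZ_preoring dzeqv (zpP _ _) (zpP _ _)).
by apply/zltE; exists b; ring.
Qed.
(** Needed for the archimedean property of fractions, where a positive denominator must be at least
    1. *)
Lemma z_discrete (x : K) : (0 < x)%R -> (1 <= x)%R.
Proof.
move=> /orV_lt x0; rewrite leNgt; apply/negP => /orV_lt; move: x0.
have := orVP x; rewrite (in_Q preZ dzeqv) => -[p pS ->]; have [a [b E]] := zp_ex pS; subst p.
rewrite !(qltE preZ_preoring dzeqv) //; try exact: zpP;
  try exact: (p0P preZ_preoring); try exact: (p1P preZ_preoring).
move=> /(proj1 (zltE 0%R 0%R a b)) [k L1] /(proj1 (zltE a b 1%R 0%R)) [l L2].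
by apply: (@nt_succ0 _ _ (k + l)%R); apply: (nt_cancel (esym L1)); apply: (nt_cancel (esym L2)); ring.
Qed.
End Integers.
Ltac dfn_user11 := first [simple apply Tm_zn | dfn_user10].
Ltac dfn_user ::= dfn_user11.

Section NaturalMultiples.
Context {M : structure} {HM : zfa M}.
Variables (R : ops M) (h : oring R).
Definition onat (n : M) : M := nrec (o0 R) (fun _ x => oadd R x (o1 R)) n.
Definition archimedean : Prop :=
  forall x, x ∊ od R -> exists2 n, n ∊ omega & olt R x (onat n).
Hypothesis d : dops R.
Lemma Tm_onat : Tm anyp (fun e => onat (e 0)).
Proof. by have [? ? ? ?] := d; rewrite /onat /nrec /rec_approx; dfn. Qed.
Let dstep : Tm anyp (fun e : nat -> M => oadd R (e 1) (o1 R)).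
Proof. by have [? ? ? ?] := d; dfn. Qed.
Lemma onat0 : onat emp = o0 R. Proof. exact: nrec0. Qed.
Lemma onatS n : n ∊ omega -> onat (succ n) = oadd R (onat n) (o1 R).
Proof. by move=> no; rewrite /onat nrecS. Qed.
Lemma onatP n : n ∊ omega -> onat n ∊ od R.
Proof.
have dn := Tm_onat; move: n; apply: omega_ind => [||n no IH]; first by dfn.
  by rewrite onat0; exact: (o0P h).
by rewrite onatS //; apply: (oaddP h) => //; exact: (o1P h).
Qed.
Definition natT n (no : n ∊ omega) : orT h := orK h (onatP no).
End NaturalMultiples.

Section Fractions.
Local Open Scope ring_scope.
Variable K : realDomainType.
Implicit Types x y d e : K.
Lemma frac_trans x d x' d' x'' d'' : 0 < d' -> x * d' = x' * d -> x' * d'' = x'' * d' ->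
  x * d'' = x'' * d.
Proof.
move=> d0 E1 E2; apply: (mulIf (lt0r_neq0 d0)).
by rewrite mulrAC E1 mulrAC E2 mulrAC.
Qed.
Lemma frac_lt x d y e x' d' y' e' : 0 < d -> 0 < e -> 0 < d' -> 0 < e' ->
  x * e = y * d -> x' * e' = y' * d' -> x * d' < x' * d -> y * e' < y' * e.
Proof.
move=> d0 e0 d0' e0' E1 E2 L; rewrite -(ltr_pM2r (mulr_gt0 d0 d0')).
have -> : y * e' * (d * d') = (x * d') * (e * e').
  by rewrite (_ : y * e' * (d * d') = (y * d) * (e' * d')); last (by ring); rewrite -E1; ring.
have -> : y' * e * (d * d') = (x' * d) * (e * e').
  by rewrite (_ : y' * e * (d * d') = (y' * d') * (e * d)); last (by ring); rewrite -E2; ring.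
by rewrite ltr_pM2r // mulr_gt0.
Qed.
End Fractions.

Section FractionField.
Context {M : structure} {HM : zfa M}.
Implicit Types (p q : M).
Variable Z : ops M.
Hypotheses (hZ : oring Z) (dZ : dops Z).
Local Notation K := (orT hZ).

Definition qadd p q : M := opair (oadd Z (omul Z (pfst p) (psnd q)) (omul Z (pfst q) (psnd p)))
  (omul Z (psnd p) (psnd q)).
Definition qmul p q : M := opair (omul Z (pfst p) (pfst q)) (omul Z (psnd p) (psnd q)).
Definition qopp p : M := opair (oopp Z (pfst p)) (psnd p).
Definition qlt p q : Prop := olt Z (omul Z (pfst p) (psnd q)) (omul Z (pfst q) (psnd p)).
Definition qeqv p q : Prop := omul Z (pfst p) (psnd q) = omul Z (pfst q) (psnd p).
(** Denominators are kept positive, so that cross multiplication preserves the order. *)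
Definition preQ : ops M := Ops (sep (prod (od Z) (od Z)) (fun p => olt Z (o0 Z) (psnd p)))
  qadd qmul qopp qlt (opair (o0 Z) (o1 Z)) (opair (o1 Z) (o1 Z)).

Definition qp (x d : K) : M := opair (orV x) (orV d).
Let dpos : Df anyp (fun e => olt Z (o0 Z) (psnd (e 0))).
Proof. by have [_ _ _ d] := dZ; dfn. Qed.
Lemma qpP x d : (0 < d)%R -> qp x d ∊ od preQ.
Proof.
move=> /orV_lt d0; rewrite /= in_sep // opair_prod psndE.
by split=> //; split; exact: orVP.
Qed.
Lemma qp_ex p : p ∊ od preQ -> exists x d, (0 < d)%R /\ p = qp x d.
Proof.
rewrite /= in_sep // in_prod => -[[x [y [xZ [yZ ->]]]]]; rewrite psndE => y0.
by exists (orK hZ xZ), (orK hZ yZ); split=> //; apply/orV_lt.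
Qed.
Lemma raddE x d y e : qadd (qp x d) (qp y e) = qp (x * e + y * d)%R (d * e)%R.
Proof. by rewrite /qadd /qp !pfstE !psndE. Qed.
Lemma rmulE x d y e : qmul (qp x d) (qp y e) = qp (x * y)%R (d * e)%R.
Proof. by rewrite /qmul /qp !pfstE !psndE. Qed.
Lemma roppE x d : qopp (qp x d) = qp (- x)%R d.
Proof. by rewrite /qopp /qp !pfstE !psndE. Qed.
Lemma rltE x d y e : qlt (qp x d) (qp y e) <-> (x * e < y * d)%R.
Proof. by rewrite /qlt /qp !pfstE !psndE -!orV_mul; exact: (iff_sym (orV_lt _ _)). Qed.
Lemma qeqvE x d y e : qeqv (qp x d) (qp y e) <-> (x * e = y * d)%R.
Proof. by rewrite /qeqv /qp !pfstE !psndE -!orV_mul; split=> [/orV_inj|->]. Qed.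

Lemma preQ_preoring : preoring preQ qeqv.
Proof.
have z0 : o0 preQ = qp 0%R 1%R by []. have z1 : o1 preQ = qp 1%R 1%R by [].
split; rewrite ?z0 ?z1; cbn [oadd omul oopp olt preQ].
- exact: qpP ltr01.
- exact: qpP ltr01.
- by move=> x y /qp_ex[a [b [b0 ->]]] /qp_ex[c [d [d0 ->]]]; rewrite raddE; apply: qpP; exact: mulr_gt0.
- by move=> x y /qp_ex[a [b [b0 ->]]] /qp_ex[c [d [d0 ->]]]; rewrite rmulE; apply: qpP; exact: mulr_gt0.
- by move=> x /qp_ex[a [b [b0 ->]]]; rewrite roppE; exact: qpP.
- by move=> x /qp_ex[a [b [b0 ->]]]; apply/qeqvE.
- by move=> x y /qp_ex[a [b [b0 ->]]] /qp_ex[c [d [d0 ->]]] /qeqvE E; apply/qeqvE.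
- move=> x y z /qp_ex[a [b [b0 ->]]] /qp_ex[c [d [d0 ->]]] /qp_ex[e [f [f0 ->]]] /qeqvE E1 /qeqvE E2.
  by apply/qeqvE; exact: (frac_trans d0 E1 E2).
- move=> x y z /qp_ex[a [b [b0 ->]]] /qp_ex[c [d [d0 ->]]] /qp_ex[e [f [f0 ->]]] /qeqvE E.
  rewrite !raddE; apply/qeqvE.
  rewrite (_ : ((a * f + e * b) * (d * f) = (a * d) * (f * f) + e * b * d * f)%R); last by ring.
  by rewrite E; ring.
- move=> x y z /qp_ex[a [b [b0 ->]]] /qp_ex[c [d [d0 ->]]] /qp_ex[e [f [f0 ->]]] /qeqvE E.
  rewrite !rmulE; apply/qeqvE.
  rewrite (_ : (a * e * (d * f) = (a * d) * (e * f))%R); last by ring.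
  by rewrite E; ring.
- move=> x y /qp_ex[a [b [b0 ->]]] /qp_ex[c [d [d0 ->]]] /qeqvE E.
  by rewrite !roppE; apply/qeqvE; rewrite !mulNr E.
- move=> x y x' y' /qp_ex[a [b [b0 ->]]] /qp_ex[c [d [d0 ->]]] /qp_ex[a' [b' [b0' ->]]] /qp_ex[c' [d' [d0' ->]]].
  move=> /qeqvE E1 /qeqvE E2 /rltE L; apply/rltE.
  exact: (frac_lt b0 b0' d0 d0' E1 E2 L).
- move=> x y z /qp_ex[a [b [b0 ->]]] /qp_ex[c [d [d0 ->]]] /qp_ex[e [f [f0 ->]]].
  by rewrite !raddE; apply/qeqvE; ring.
- by move=> x y /qp_ex[a [b [b0 ->]]] /qp_ex[c [d [d0 ->]]]; rewrite !raddE; apply/qeqvE; ring.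
- by move=> x /qp_ex[a [b [b0 ->]]]; rewrite !raddE; apply/qeqvE; ring.
- by move=> x /qp_ex[a [b [b0 ->]]]; rewrite roppE !raddE; apply/qeqvE; ring.
- move=> x y z /qp_ex[a [b [b0 ->]]] /qp_ex[c [d [d0 ->]]] /qp_ex[e [f [f0 ->]]].
  by rewrite !rmulE; apply/qeqvE; ring.
- by move=> x y /qp_ex[a [b [b0 ->]]] /qp_ex[c [d [d0 ->]]]; rewrite !rmulE; apply/qeqvE; ring.
- by move=> x /qp_ex[a [b [b0 ->]]]; rewrite !rmulE; apply/qeqvE; ring.
- move=> x y z /qp_ex[a [b [b0 ->]]] /qp_ex[c [d [d0 ->]]] /qp_ex[e [f [f0 ->]]].
  by rewrite !rmulE !raddE !rmulE; apply/qeqvE; ring.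
- by move=> /qeqvE /eqP; rewrite mulr1 mul0r oner_eq0.
- by move=> x /qp_ex[a [b [b0 ->]]] /rltE; rewrite ltxx.
- move=> x y z /qp_ex[a [b [b0 ->]]] /qp_ex[c [d [d0 ->]]] /qp_ex[e [f [f0 ->]]] /rltE L1 /rltE L2.
  apply/rltE; rewrite -(ltr_pM2r d0) mulrAC; apply: (@lt_trans _ _ (c * b * f)%R).
    by rewrite ltr_pM2r.
  by rewrite mulrAC [X in (_ < X)%R]mulrAC ltr_pM2r.
- move=> x y /qp_ex[a [b [b0 ->]]] /qp_ex[c [d [d0 ->]]].
  case: (ltgtP (a * d)%R (c * b)%R) => H; [right; left|right; right|left]; by [apply/rltE|apply/qeqvE].
- move=> x y z /qp_ex[a [b [b0 ->]]] /qp_ex[c [d [d0 ->]]] /qp_ex[e [f [f0 ->]]] /rltE L.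
  rewrite !raddE; apply/rltE.
  rewrite (_ : ((a * f + e * b) * (d * f) = (a * d) * (f * f) + e * b * d * f)%R); last by ring.
  rewrite (_ : ((c * f + e * d) * (b * f) = (c * b) * (f * f) + e * b * d * f)%R); last by ring.
  by rewrite ltrD2r ltr_pM2r // mulr_gt0.
- move=> x y /qp_ex[a [b [b0 ->]]] /qp_ex[c [d [d0 ->]]] /rltE L1 /rltE L2.
  by rewrite rmulE; apply/rltE; move: L1 L2; rewrite !mul0r !mulr1; exact: mulr_gt0.
Qed.

Lemma preQ_dops : dops preQ.
Proof. by have [? ? ? ?] := dZ; split; rewrite /= /qadd /qmul /qopp /qlt; dfn. Qed.
Lemma dqeqv : Df anyp (fun e => qeqv (e 0) (e 1)).
Proof. by have [? ? ? ?] := dZ; rewrite /qeqv; dfn. Qed.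

Definition Fops : ops M := qops preQ qeqv.
Lemma Fofield : ofield Fops.
Proof.
apply: (qofield preQ_preoring dqeqv) => p /qp_ex[a [b [b0 ->]]] na.
have one : (qp b b) ∊ od preQ by exact: qpP.
have a0 : a != 0%R.
  by apply/eqP => E; apply: na; apply/(qeqvE a b 0%R 1%R); rewrite E !mul0r.
case: (ltgtP a 0%R) => H; last by rewrite H eqxx in a0.
  exists (qp (- b) (- a))%R; first by apply: qpP; rewrite oppr_gt0.
  by rewrite /= rmulE; apply/(qeqvE _ _ 1%R 1%R); ring.
exists (qp b a)%R; first exact: qpP.
by rewrite /= rmulE; apply/(qeqvE _ _ 1%R 1%R); ring.
Qed.
Lemma Fdops : dops Fops.
Proof. exact: (dqops preQ_dops dqeqv). Qed.

Lemma onat_frac n : n ∊ omega -> onat Fops n = cls preQ qeqv (opair (onat Z n) (o1 Z)).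
Proof.
have dn := @Tm_onat M HM Z dZ; have dn' := @Tm_onat M HM Fops Fdops; have dc := @dcls M HM preQ qeqv dqeqv.
move: n; apply: omega_ind => [||n no IH]; [by dfn|by rewrite !(onat0 Fdops) (onat0 dZ)|].
rewrite (onatS Fdops no) (onatS dZ no) IH.
have nE : opair (onat Z n) (o1 Z) = qp (natT hZ dZ no) 1%R by [].
have z1 := p1P preQ_preoring; rewrite nE.
have nP := qpP (natT hZ dZ no) (ltr01 : (0 < 1 :> K)%R).
apply: etrans (qaddE preQ_preoring dqeqv nP z1) _.
by rewrite [oadd preQ _ _](raddE _ _ 1%R 1%R) !mulr1.
Qed.
Hypotheses (Zarch : archimedean Z) (Zdisc : forall x : K, (0 < x)%R -> (1 <= x)%R).
(** A natural number above both the numerator and 0 works, since the denominator is at least 1 by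
    discreteness. *)
Lemma frac_arch : archimedean Fops.
Proof.
move=> x; rewrite (in_Q preQ dqeqv) => -[p pS ->]; have [a [b [b0 E]]] := qp_ex pS; subst p.
have /Zarch[n no L] : orV (Num.max a 0)%R ∊ od Z by exact: orVP.
exists n => //; rewrite onat_frac //.
have nP := qpP (natT hZ dZ no) (ltr01 : (0 < 1 :> K)%R).
rewrite (qltE preQ_preoring dqeqv pS nP); apply/rltE; rewrite mulr1.
have L' : (Num.max a 0 < natT hZ dZ no)%R by apply/orV_lt.
move: L'; rewrite gt_max => /andP[L' n0]; apply: (lt_le_trans L').
by rewrite ler_peMr ?Zdisc // ltW.
Qed.
End FractionField.

Section Rationals.
Context {M : structure} {HM : zfa M}.
Definition Qops : ops M := Fops Zops.
Lemma Qofield : ofield Qops. Proof. exact: (Fofield Zoring Zdops). Qed.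
Lemma Qdops : dops Qops. Proof. exact: (Fdops Zdops). Qed.
Lemma onat_Z n : n ∊ omega -> onat Zops n = zn n.
Proof.
have dn := @Tm_onat M HM Zops Zdops.
move: n; apply: omega_ind => [||n no IH]; first by dfn.
  by rewrite (onat0 Zdops).
by rewrite (onatS Zdops) // znS // IH.
Qed.
Lemma Qarch : archimedean Qops.
Proof.
have arch : archimedean Zops by move=> x /z_arch[n no L]; exists n; rewrite ?onat_Z.
exact: (frac_arch Zdops arch z_discrete).
Qed.
End Rationals.

(** * Cauchy reals *)

Section Estimates.
Local Open Scope ring_scope.
Variable T : realFieldType.
Implicit Types x y c d e B D : T.

Lemma mul_near x y c d B D e : `|x| < B -> `|d| < D -> `|x - c| < e / (2 * D) ->
  `|y - d| < e / (2 * B) -> `|x * y - c * d| < e.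
Proof.
move=> xB dD xc yd; have B0 : 0 < B := le_lt_trans (normr_ge0 x) xB.
have D0 : 0 < D := le_lt_trans (normr_ge0 d) dD.
have -> : x * y - c * d = x * (y - d) + (x - c) * d by ring.
apply: le_lt_trans (ler_normD _ _) _; rewrite !normrM.
have -> : e = B * (e / (2 * B)) + e / (2 * D) * D by field; rewrite !lt0r_neq0.
apply: ltrD.
  apply: (@le_lt_trans _ _ (B * `|y - d|)); first by rewrite ler_wpM2r // ltW.
  by rewrite ltr_pM2l.
apply: (@le_lt_trans _ _ (`|x - c| * D)); first by rewrite ler_wpM2l // ltW.
by rewrite ltr_pM2r.
Qed.

(** The bound e / 2 on the distance gives e / 2 < |c|, so the denominator in
    [x^-1 - c^-1 = (c - x) / (x * c)] exceeds e * (e / 2) in absolute value. This explains the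
    constant in the last hypothesis. *)
Lemma inv_near x c e eta : 0 < e -> 0 < eta -> e < `|x| -> `|x - c| < e / 2 ->
  `|x - c| < eta * (e * (e / 2)) -> `|x^-1 - c^-1| < eta.
Proof.
move=> e0 eta0 ex xc1 xc2.
have x0 : 0 < `|x| := lt_trans e0 ex.
have ce : e / 2 < `|c|.
  have : `|x| <= `|x - c| + `|c| by rewrite -{1}(subrK c x); exact: ler_normD.
  by lra.
have e2 : 0 < e / 2 by rewrite divr_gt0.
have c0 : 0 < `|c| := lt_trans e2 ce.
have xn : x != 0 by rewrite -normr_gt0. have cn : c != 0 by rewrite -normr_gt0.
have -> : x^-1 - c^-1 = (c - x) / (x * c) by field; rewrite ?xn ?cn.
rewrite normrM normfV normrM ltr_pdivrMr ?mulr_gt0 // distrC; apply: (lt_trans xc2).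
rewrite ltr_pM2l //; apply: (@lt_trans _ _ (`|x| * (e / 2))); first by rewrite ltr_pM2r.
by rewrite ltr_pM2l.
Qed.
End Estimates.

Section Eventually.
Context {M : structure} {HM : zfa M}.
Definition Ev (P : M -> Prop) : Prop :=
  exists N, N ∊ omega /\ forall n, n ∊ omega -> ~ n ∊ N -> P n.
Lemma Ev_and P Q : Ev P -> Ev Q -> Ev (fun n => P n /\ Q n).
Proof.
move=> [N [No HP]] [K [Ko HQ]]; case: (nat_lt_total No Ko) => [NK|[E|KN]].
- exists K; split=> // n no nK; split; [|exact: HQ].
  by apply: HP => // nN; apply: nK; exact: (nat_trans Ko NK nN).
- by subst K; exists N; split=> // n no nN; split; [exact: HP|exact: HQ].
- exists N; split=> // n no nN; split; [exact: HP|].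
  by apply: HQ => // nK; apply: nN; exact: (nat_trans No KN nK).
Qed.
Lemma Ev_mono P Q : (forall n, n ∊ omega -> P n -> Q n) -> Ev P -> Ev Q.
Proof. by move=> H [N [No HP]]; exists N; split=> // n no nN; apply: H => //; exact: HP. Qed.
Lemma Ev_all (P : M -> Prop) : (forall n, n ∊ omega -> P n) -> Ev P.
Proof. by move=> H; exists emp; split=> [|n no _]; [exact: omega0|exact: H]. Qed.
Lemma Ev_ex P : Ev P -> exists2 n, n ∊ omega & P n.
Proof. by move=> [N [No HP]]; exists N => //; apply: HP => //; exact: mem_irrefl. Qed.
End Eventually.

Section FieldElements.
Context {M : structure} {HM : zfa M}.
Variables (K : ops M) (hK : ofield K) (dK : dops K).
Local Notation T := (ofT hK).
Local Notation hR := (ofield_oring hK).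
Local Open Scope ring_scope.
Implicit Types (x y c d e B : T).

(** Total on [M], with default 0 outside the carrier, so that sequences of the model are read as
    functions into [T] without carrying membership proofs. *)
Definition toT (x : M) : T := if pselect (x ∊ od K) is left H then orK hR H else 0.
Definition tV (x : T) : M := orV (x : orT hR).
Lemma tVP x : tV x ∊ od K. Proof. exact: orVP. Qed.
Lemma tVK x : toT (tV x) = x.
Proof.
by rewrite /toT; case: pselect => [H|/(_ (tVP x))] //; apply: (@orV_inj _ _ hR).
Qed.
Lemma toTK (a : M) : a ∊ od K -> tV (toT a) = a.
Proof. by move=> aK; rewrite /toT; case: pselect. Qed.
Lemma tV_inj x y : tV x = tV y -> x = y. Proof. exact: orV_inj. Qed.
Lemma tV_add x y : tV (x + y) = oadd K (tV x) (tV y). Proof. by []. Qed.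
Lemma tV_mul x y : tV (x * y) = omul K (tV x) (tV y). Proof. by []. Qed.
Lemma tV_opp x : tV (- x) = oopp K (tV x). Proof. by []. Qed.
Lemma toT_add (a b : M) : a ∊ od K -> b ∊ od K -> toT (oadd K a b) = toT a + toT b.
Proof. by move=> aK bK; apply: tV_inj; rewrite tV_add !toTK //; exact: (oaddP hR). Qed.
Lemma toT_mul (a b : M) : a ∊ od K -> b ∊ od K -> toT (omul K a b) = toT a * toT b.
Proof. by move=> aK bK; apply: tV_inj; rewrite tV_mul !toTK //; exact: (omulP hR). Qed.
Lemma toT_opp (a : M) : a ∊ od K -> toT (oopp K a) = - toT a.
Proof. by move=> aK; apply: tV_inj; rewrite tV_opp !toTK //; exact: (ooppP hR). Qed.
Lemma toT0 : toT (o0 K) = 0.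
Proof. by apply: tV_inj; rewrite toTK //; exact: (o0P hR). Qed.
Lemma toT1 : toT (o1 K) = 1.
Proof. by apply: tV_inj; rewrite toTK //; exact: (o1P hR). Qed.
Lemma toT_lt (a b : M) : a ∊ od K -> b ∊ od K -> olt K a b <-> toT a < toT b.
Proof.
by move=> aK bK; apply: iff_sym; apply: iff_trans (orV_lt _ _) _; rewrite -!/(tV _) !toTK.
Qed.

(** As in MathComp, the inverse of 0 is 0. *)
Definition oinv (x : M) : M :=
  the (fun y : M => y ∊ od K /\ (omul K y x = o1 K \/ (x = o0 K /\ y = o0 K))).
Lemma Tm_oinv : Tm anyp (fun e : nat -> M => oinv (e 0%N)).
Proof. by have [? ? ? ?] := dK; rewrite /oinv; dfn. Qed.
Lemma oinvE (a : M) : a ∊ od K -> oinv a = tV (toT a)^-1.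
Proof.
move=> aK; have o0 := o0P hR; have o1 := o1P hR; apply: the_eq.
  split; first exact: tVP.
  case: (eqVneq (toT a) 0) => [E|a0]; [right|left].
    by rewrite -{1}(toTK aK) E invr0.
  rewrite -(toTK (omulP hR (tVP _) aK)) -[RHS](toTK o1) toT1.
  by congr tV; rewrite toT_mul ?tVK ?mulVf //; exact: tVP.
move=> z [zK H]; rewrite -[LHS](toTK zK); congr tV; case: H => [E|[-> ->]].
  have E' : toT z * toT a = 1 by rewrite -toT_mul // E toT1.
  have a0 : toT a != 0 by apply/eqP => H; move: E'; rewrite H mulr0 => /esym /eqP; rewrite oner_eq0.
  by apply: (mulIf a0); rewrite E' mulVf.
by rewrite toT0 invr0.
Qed.
Lemma oinv_in (a : M) : a ∊ od K -> oinv a ∊ od K.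
Proof. by move=> aK; rewrite oinvE //; exact: tVP. Qed.
Lemma toT_inv (a : M) : a ∊ od K -> toT (oinv a) = (toT a)^-1.
Proof. by move=> aK; rewrite oinvE // tVK. Qed.

Definition near e x y : Prop := x < y + e /\ y < x + e.
Lemma nearP e x y : near e x y <-> `|x - y| < e.
Proof. by rewrite /near ltr_distl; split=> [[? ?]|/andP[? ?]]; [apply/andP|]; split; lra. Qed.
End FieldElements.

Section CauchySequences.
Context {M : structure} {HM : zfa M}.
Variables (K : ops M) (hK : ofield K) (dK : dops K).
Local Notation T := (ofT hK).
Local Notation hR := (ofield_oring hK).
Local Notation toT := (@toT M K hK).
Local Notation tV := (@tV M K hK).
Local Notation tVK := (@tVK M K hK).
Local Notation toTK := (@toTK M K hK).
Implicit Types (f g h a b n : M) (c d B x y : T).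

Definition mnear (e x y : M) : Prop := olt K x (oadd K y e) /\ olt K y (oadd K x e).
(** The Cauchy condition with a single index: for each [e] some [c] of the field approximates a
    whole tail within [e]. The element [c] depends on [e] and is not a limit. *)
Definition cauchy f : Prop := forall e : M, e ∊ od K -> olt K (o0 K) e ->
  exists c : M, c ∊ od K /\ Ev (fun n => mnear e (ap f n) c).
Definition ceqv f g : Prop := forall e : M, e ∊ od K -> olt K (o0 K) e ->
  Ev (fun n => mnear e (ap f n) (ap g n)).
(** The eventual gap [e] makes the relation depend only on the classes of the two sequences. *)
Definition clt f g : Prop := exists e : M, (e ∊ od K /\ olt K (o0 K) e) /\
  Ev (fun n => olt K (oadd K (ap f n) e) (ap g n)).
Definition cadd f g : M := lam omega (fun n => oadd K (ap f n) (ap g n)).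
Definition cmul f g : M := lam omega (fun n => omul K (ap f n) (ap g n)).
Definition copp f : M := lam omega (fun n => oopp K (ap f n)).
Definition cinv f : M := lam omega (fun n => oinv K (ap f n)).
Definition cst (a : M) : M := lam omega (fun=> a).
Definition preR : ops M := Ops
  (sep (pow (prod omega (od K))) (fun f => isfun f omega (od K) /\ cauchy f))
  cadd cmul copp clt (cst (o0 K)) (cst (o1 K)).

Lemma dcauchy : Df anyp (fun e : nat -> M => cauchy (e 0)).
Proof. by have [? ? ? ?] := dK; rewrite /cauchy /Ev /mnear; dfn. Qed.
Lemma dceqv : Df anyp (fun e => ceqv (e 0) (e 1)).
Proof. by have [? ? ? ?] := dK; rewrite /ceqv /Ev /mnear; dfn. Qed.
Lemma preR_dops : dops preR.
Proof.
have [? ? ? ?] := dK.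
by split; rewrite /= /cadd /cmul /copp /clt /Ev; dfn.
Qed.
Lemma Tm_cst : Tm anyp (fun e => cst (e 0)).
Proof. by rewrite /cst; dfn. Qed.

Definition seqc f : Prop := isfun f omega (od K).
Definition sq f n : T := toT (ap f n).
Lemma seqc_in f n : seqc f -> n ∊ omega -> ap f n ∊ od K.
Proof. by move=> F no; exact: (ap_in F no). Qed.
Lemma sqK f n : seqc f -> n ∊ omega -> tV (sq f n) = ap f n.
Proof. by move=> F no; rewrite /sq toTK //; exact: seqc_in. Qed.
Lemma seqc_sub f : seqc f -> sub f (prod omega (od K)).
Proof.
move=> F; split=> [|p pf]; first exact: (proj1 F).
by have [x xo ->] := in_fun F pf; rewrite opair_prod; split=> //; exact: seqc_in.
Qed.

Lemma Df_add f g : Tm anyp (fun e => oadd K (ap f (e 0)) (ap g (e 0))).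
Proof. by have [? ? ? ?] := dK; dfn. Qed.
Lemma Df_mul f g : Tm anyp (fun e => omul K (ap f (e 0)) (ap g (e 0))).
Proof. by have [? ? ? ?] := dK; dfn. Qed.
Lemma Df_opp f : Tm anyp (fun e => oopp K (ap f (e 0))).
Proof. by have [? ? ? ?] := dK; dfn. Qed.
Lemma Df_inv f : Tm anyp (fun e => oinv K (ap f (e 0))).
Proof. by have d := @Tm_oinv M HM K dK; dfn. Qed.
Lemma Df_cst a : Tm anyp (fun e : nat -> M => a). Proof. by dfn. Qed.

Lemma seqc_add f g : seqc f -> seqc g -> seqc (cadd f g).
Proof.
move=> F G; apply: (isfun_lam (Df_add f g)) => n no.
by apply: (oaddP hR); exact: seqc_in.
Qed.
Lemma seqc_mul f g : seqc f -> seqc g -> seqc (cmul f g).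
Proof.
move=> F G; apply: (isfun_lam (Df_mul f g)) => n no.
by apply: (omulP hR); exact: seqc_in.
Qed.
Lemma seqc_opp f : seqc f -> seqc (copp f).
Proof.
move=> F; apply: (isfun_lam (Df_opp f)) => n no.
by apply: (ooppP hR); exact: seqc_in.
Qed.
Lemma seqc_inv f : seqc f -> seqc (cinv f).
Proof.
move=> F; apply: (isfun_lam (Df_inv f)) => n no.
by apply: (oinv_in hK); exact: seqc_in.
Qed.
Lemma seqc_cst a : a ∊ od K -> seqc (cst a).
Proof. by move=> aK; apply: (isfun_lam (Df_cst a)). Qed.
Lemma sq_add f g n : seqc f -> seqc g -> n ∊ omega -> (sq (cadd f g) n = sq f n + sq g n)%R.
Proof.
move=> F G no; rewrite /sq (ap_lam (Df_add f g) no).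
by rewrite toT_add //; exact: seqc_in.
Qed.
Lemma sq_mul f g n : seqc f -> seqc g -> n ∊ omega -> (sq (cmul f g) n = sq f n * sq g n)%R.
Proof.
move=> F G no; rewrite /sq (ap_lam (Df_mul f g) no).
by rewrite toT_mul //; exact: seqc_in.
Qed.
Lemma sq_opp f n : seqc f -> n ∊ omega -> (sq (copp f) n = - sq f n)%R.
Proof.
move=> F no; rewrite /sq (ap_lam (Df_opp f) no).
by rewrite toT_opp //; exact: seqc_in.
Qed.
Lemma sq_inv f n : seqc f -> n ∊ omega -> (sq (cinv f) n = (sq f n)^-1)%R.
Proof.
move=> F no; rewrite /sq (ap_lam (Df_inv f) no).
by rewrite toT_inv //; exact: seqc_in.
Qed.
Lemma sq_cst a n : n ∊ omega -> sq (cst a) n = toT a.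
Proof. by move=> no; rewrite /sq (ap_lam (Df_cst a) no). Qed.

Local Open Scope ring_scope.
Lemma mnearE e x y : mnear (tV e) (tV x) (tV y) <-> near e x y.
Proof.
rewrite /mnear /near -!tV_add !(toT_lt hK) ?tVK; try exact: tVP.
by [].
Qed.
Lemma lt0E (a : M) : a ∊ od K -> olt K (o0 K) a <-> 0 < toT a.
Proof. by move=> aK; rewrite (toT_lt hK) ?toT0 //; exact: (o0P hR). Qed.
Lemma cauchyP f : seqc f -> cauchy f <-> forall e, 0 < e -> exists c, Ev (fun n => near e (sq f n) c).
Proof.
move=> F; split=> [H e e0|H a aK a0].
  have [|c [cK E]] := H (tV e) (tVP e); first by apply/lt0E; rewrite ?tVK //; exact: tVP.
  exists (toT c); apply: Ev_mono E => n no.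
  by rewrite -(sqK F no) -(toTK cK) mnearE toTK.
have [|c E] := H (toT a); first exact/lt0E.
exists (tV c); split; first exact: tVP.
by apply: Ev_mono E => n no; rewrite -(sqK F no) -(toTK aK) mnearE toTK.
Qed.
Lemma ceqvP f g : seqc f -> seqc g ->
  ceqv f g <-> forall e, 0 < e -> Ev (fun n => near e (sq f n) (sq g n)).
Proof.
move=> F G; split=> [H e e0|H a aK a0].
  have E : Ev (fun n => mnear (tV e) (ap f n) (ap g n)).
    by apply: H; [exact: tVP|apply/lt0E; rewrite ?tVK //; exact: tVP].
  by apply: Ev_mono E => n no; rewrite -(sqK F no) -(sqK G no) mnearE.
have E := H (toT a) (proj1 (lt0E aK) a0).
by apply: Ev_mono E => n no; rewrite -(sqK F no) -(sqK G no) -(toTK aK) mnearE toTK.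
Qed.
Lemma cltP f g : seqc f -> seqc g ->
  clt f g <-> exists2 e, 0 < e & Ev (fun n => sq f n + e < sq g n).
Proof.
move=> F G; split=> [[a [[aK a0] E]]|[e e0 E]].
  exists (toT a); first exact/lt0E.
  apply: Ev_mono E => n no; rewrite (toT_lt hK) ?toT_add //; try exact: seqc_in.
  by apply: (oaddP hR) => //; exact: seqc_in.
exists (tV e); split; first by split; [exact: tVP|apply/lt0E; rewrite ?tVK //; exact: tVP].
apply: Ev_mono E => n no; rewrite -(sqK F no) -(sqK G no) -tV_add (toT_lt hK) ?tVK //; exact: tVP.
Qed.
Lemma in_preR f : (f ∊ od preR) <->
  seqc f /\ forall e, 0 < e -> exists c, Ev (fun n => near e (sq f n) c).
Proof.
have d := dcauchy; rewrite /= in_sep; last by dfn.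
rewrite in_pow; split=> [[_ [F /(cauchyP F)]]|[F H]] //.
by split; [exact: seqc_sub|split=> //; exact/cauchyP].
Qed.

Lemma ceqv_ptw f g : seqc f -> seqc g -> (forall n, n ∊ omega -> sq f n = sq g n) -> ceqv f g.
Proof.
move=> F G H; apply/ceqvP => // e e0; apply: Ev_all => n no.
by rewrite H // /near; split; lra.
Qed.
Lemma cauchy_bounded f : f ∊ od preR -> exists2 B, 0 < B & Ev (fun n => `|sq f n| < B).
Proof.
move=> /in_preR[F H]; have [c E] := H 1 ltr01.
exists (`|c| + 1); first by have := normr_ge0 c; lra.
apply: Ev_mono E => n no /nearP L; rewrite -(subrK c (sq f n)).
by apply: le_lt_trans (ler_normD _ _) _; lra.
Qed.

Lemma cst_in a : a ∊ od K -> cst a ∊ od preR.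
Proof.
move=> aK; apply/in_preR; split=> [|e e0]; first exact: seqc_cst.
by exists (toT a); apply: Ev_all => n no; rewrite sq_cst // /near; split; lra.
Qed.
Lemma cadd_in f g : f ∊ od preR -> g ∊ od preR -> cadd f g ∊ od preR.
Proof.
move=> /in_preR[F Hf] /in_preR[G Hg]; apply/in_preR; split=> [|e e0]; first exact: seqc_add.
have e2 : 0 < e / 2 by rewrite divr_gt0.
have [c Ec] := Hf _ e2; have [d Ed] := Hg _ e2; exists (c + d).
apply: Ev_mono (Ev_and Ec Ed) => n no [[? ?] [? ?]].
by rewrite sq_add // /near; split; lra.
Qed.
Lemma copp_in f : f ∊ od preR -> copp f ∊ od preR.
Proof.
move=> /in_preR[F Hf]; apply/in_preR; split=> [|e e0]; first exact: seqc_opp.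
have [c Ec] := Hf _ e0; exists (- c).
by apply: Ev_mono Ec => n no [? ?]; rewrite sq_opp // /near; split; lra.
Qed.
Lemma cmul_in f g : f ∊ od preR -> g ∊ od preR -> cmul f g ∊ od preR.
Proof.
move=> fR /in_preR[G Hg]; have [B B0 EB] := cauchy_bounded fR.
move: fR => /in_preR[F Hf]; apply/in_preR; split=> [|e e0]; first exact: seqc_mul.
have eB : 0 < e / (2 * B) by rewrite divr_gt0 // mulr_gt0.
have [d Ed] := Hg _ eB.
have D0 : 0 < `|d| + 1 by have := normr_ge0 d; lra.
have dD : `|d| < `|d| + 1 by lra.
have eD : 0 < e / (2 * (`|d| + 1)) by rewrite divr_gt0 // mulr_gt0.
have [c Ec] := Hf _ eD; exists (c * d).
apply: Ev_mono (Ev_and EB (Ev_and Ec Ed)) => n no [L1 [/nearP L2 /nearP L3]].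
by rewrite sq_mul //; apply/nearP; exact: (mul_near L1 dD L2 L3).
Qed.
Lemma cinv_in f e : f ∊ od preR -> 0 < e -> Ev (fun n => e < `|sq f n|) -> cinv f ∊ od preR.
Proof.
move=> /in_preR[F Hf] e0 Ef; apply/in_preR; split=> [|eta eta0]; first exact: seqc_inv.
have e2 : 0 < e / 2 by rewrite divr_gt0.
have m0 : 0 < Num.min (e / 2) (eta * (e * (e / 2))).
  by rewrite lt_min; apply/andP; split=> //; apply: mulr_gt0 => //; exact: mulr_gt0.
have [c Ec] := Hf _ m0; exists c^-1.
apply: Ev_mono (Ev_and Ef Ec) => n no [L1 /nearP]; rewrite lt_min => /andP[L2 L3].
by rewrite sq_inv //; apply/nearP; exact: (inv_near e0).
Qed.

Lemma ceqv_trans f g h : seqc f -> seqc g -> seqc h -> ceqv f g -> ceqv g h -> ceqv f h.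
Proof.
move=> F G H /(ceqvP F G) E1 /(ceqvP G H) E2; apply/ceqvP => // e e0.
have e2 : 0 < e / 2 by rewrite divr_gt0.
by apply: Ev_mono (Ev_and (E1 _ e2) (E2 _ e2)) => n no [[? ?] [? ?]]; split; lra.
Qed.
Lemma clt_eqv f g f' g' : seqc f -> seqc g -> seqc f' -> seqc g' ->
  ceqv f f' -> ceqv g g' -> clt f g -> clt f' g'.
Proof.
move=> F G F' G' /(ceqvP F F') E1 /(ceqvP G G') E2 /(cltP F G)[e e0 L]; apply/cltP => //.
have e3 : 0 < e / 3%:R by rewrite divr_gt0 // ltr0n.
exists (e / 3%:R) => //.
apply: Ev_mono (Ev_and L (Ev_and (E1 _ e3) (E2 _ e3))) => n no [? [[? ?] [? ?]]]; lra.
Qed.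
Lemma clt_total f g : f ∊ od preR -> g ∊ od preR -> ceqv f g \/ clt f g \/ clt g f.
Proof.
move=> /in_preR[F Hf] /in_preR[G Hg]; case: (pselect (ceqv f g)) => [H|]; first by left.
move=> /(ceqvP F G) /existsNP[e /not_implyP[e0 NE]]; right.
(* With errors e / 6, centres more than e / 2 apart leave a gap of e / 6 between the sequences,
   while centres within e / 2 keep the sequences closer than e, which [NE] excludes. *)
have e6 : 0 < e / 6%:R by rewrite divr_gt0 // ltr0n.
have [c Ec] := Hf _ e6; have [d Ed] := Hg _ e6.
have [cd|dc] := ltP (c + e / 2) d.
  left; apply/cltP => //; exists (e / 6%:R) => //.
  by apply: Ev_mono (Ev_and Ec Ed) => n no [[? ?] [? ?]]; lra.
have [cd|cd] := ltP (d + e / 2) c.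
  right; apply/cltP => //; exists (e / 6%:R) => //.
  by apply: Ev_mono (Ev_and Ec Ed) => n no [[? ?] [? ?]]; lra.
case: NE; apply: Ev_mono (Ev_and Ec Ed) => n no [[? ?] [? ?]]; split; lra.
Qed.

Lemma preR_preoring : preoring preR ceqv.
Proof.
have o0K := o0P hR; have o1K := o1P hR.
have S0 := seqc_cst o0K; have S1 := seqc_cst o1K.
have sA := seqc_add; have sM := seqc_mul; have sN := seqc_opp.
have S f : f ∊ od preR -> seqc f by move=> /in_preR[].
split; cbn [o0 o1 oadd omul oopp olt].
- exact: cst_in.
- exact: cst_in.
- exact: cadd_in.
- exact: cmul_in.
- exact: copp_in.
- by move=> f /S F; apply: ceqv_ptw.
- move=> f g /S F /S G /(ceqvP F G) H; apply/ceqvP => // e /H.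
  by apply: Ev_mono => n no [].
- by move=> f g h /S F /S G /S H; exact: ceqv_trans.
- move=> f g h /S F /S G /S H /(ceqvP F G) E; apply/ceqvP; auto; move=> e /E.
  by apply: Ev_mono => n no [? ?]; rewrite !sq_add // /near; split; lra.
- move=> f g h /S F /S G hR' /(ceqvP F G) E; have H := S _ hR'.
  have [B B0 EB] := cauchy_bounded hR'.
  apply/ceqvP; auto; move=> e e0; have eB : 0 < e / B by rewrite divr_gt0.
  apply: Ev_mono (Ev_and EB (E _ eB)) => n no [L1 /nearP L2]; rewrite !sq_mul //; apply/nearP.
  rewrite -mulrBl normrM (_ : e = e / B * B); last by rewrite divfK // lt0r_neq0.
  by rewrite ltr_pM.
- move=> f g /S F /S G /(ceqvP F G) E; apply/ceqvP; auto; move=> e /E.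
  by apply: Ev_mono => n no [? ?]; rewrite !sq_opp // /near; split; lra.
- by move=> f g f' g' /S F /S G /S F' /S G'; exact: clt_eqv.
- by move=> f g h /S F /S G /S H; apply: ceqv_ptw; auto=> n no; rewrite !sq_add ?addrA; auto.
- by move=> f g /S F /S G; apply: ceqv_ptw; auto=> n no; rewrite !sq_add // addrC.
- by move=> f /S F; apply: ceqv_ptw; auto=> n no; rewrite sq_add // sq_cst // toT0 add0r.
- by move=> f /S F; apply: ceqv_ptw; auto=> n no; rewrite sq_add ?sq_opp ?sq_cst ?toT0 ?addNr; auto.
- by move=> f g h /S F /S G /S H; apply: ceqv_ptw; auto=> n no; rewrite !sq_mul ?mulrA; auto.
- by move=> f g /S F /S G; apply: ceqv_ptw; auto=> n no; rewrite !sq_mul // mulrC.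
- by move=> f /S F; apply: ceqv_ptw; auto=> n no; rewrite sq_mul // sq_cst // toT1 mul1r.
- move=> f g h /S F /S G /S H; apply: ceqv_ptw; auto=> n no.
  by rewrite sq_mul ?sq_add ?sq_mul ?mulrDl; auto.
- move=> /(ceqvP S1 S0) /(_ 1 ltr01) /Ev_ex[n no]; rewrite !sq_cst // toT0 toT1 => -[]; lra.
- by move=> f /S F /(cltP F F)[e e0 /Ev_ex[n no]]; lra.
- move=> f g h /S F /S G /S H /(cltP F G)[e e0 L1] /(cltP G H)[d d0 L2].
  by apply/cltP => //; exists e => //; apply: Ev_mono (Ev_and L1 L2) => n no []; lra.
- exact: clt_total.
- move=> f g h /S F /S G /S H /(cltP F G)[e e0 L]; apply/cltP; auto.
  by exists e => //; apply: Ev_mono L => n no; rewrite !sq_add //; lra.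
- move=> f g /S F /S G /(cltP S0 F)[e e0 L1] /(cltP S0 G)[d d0 L2]; apply/cltP; auto.
  exists (e * d); first exact: mulr_gt0.
  apply: Ev_mono (Ev_and L1 L2) => n no []; rewrite sq_mul // sq_cst // toT0 !add0r.
  by move=> ? ?; apply: ltr_pM => //; exact: ltW.
Qed.

Definition Rops : ops M := qops preR ceqv.
Lemma Rdops : dops Rops. Proof. exact: (dqops preR_dops dceqv). Qed.
(** By totality a sequence not equivalent to zero is eventually bounded away from zero, so the
    termwise inverse is Cauchy and eventually a genuine inverse. *)
Lemma Rofield : ofield Rops.
Proof.
apply: (qofield preR_preoring dceqv) => f fR nf.
have S0 := seqc_cst (o0P hR); have F : seqc f by move: fR => /in_preR[].
have [e e0 Ef] : exists2 e, 0 < e & Ev (fun n => e < `|sq f n|).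
  case: (clt_total fR (cst_in (o0P hR))) => [//|[/(cltP F S0)|/(cltP S0 F)]] [e e0 E];
    exists e => //; apply: Ev_mono E => n no; rewrite sq_cst // toT0 => L.
    by rewrite ltr_normr; apply/orP; right; lra.
  by rewrite ltr_normr; apply/orP; left; lra.
exists (cinv f); first exact: cinv_in Ef.
change (ceqv (cmul (cinv f) f) (cst (o1 K))).
have I := seqc_inv F; apply/ceqvP; [exact: seqc_mul|exact: seqc_cst (o1P hR)|].
move=> d d0; apply: Ev_mono Ef => n no L; rewrite sq_mul // sq_inv // sq_cst // toT1 mulVf.
  by split; lra.
by rewrite -normr_gt0; apply: lt_trans L.
Qed.
End CauchySequences.

Section Completeness.
Context {M : structure} {HM : zfa M}.
Variables (K : ops M) (hK : ofield K) (dK : dops K).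
Hypothesis arch : archimedean K.
Local Notation T := (ofT hK).
Local Notation hR := (ofield_oring hK).
Local Notation toT := (@toT M K hK).
Local Notation tV := (@tV M K hK).
Local Notation tVK := (@tVK M K hK).
Local Notation toTK := (@toTK M K hK).
Local Notation tVP := (@tVP M K hK).
Local Notation R := (Rops K).
Local Notation P := (preR_preoring hK dK).
Local Notation dE := (@dceqv M HM K dK).
Local Notation cl := (cls (preR K) (ceqv K)).
Implicit Types (f g h a b n k : M).
Local Open Scope ring_scope.

Definition eps (n : M) : M := oinv K (onat K (succ n)).
Let don : Tm anyp (fun e : nat -> M => onat K (e 0%N)).
Proof. exact: (@Tm_onat M HM K dK). Qed.
Let dinv : Tm anyp (fun e : nat -> M => oinv K (e 0%N)).
Proof. exact: (@Tm_oinv M HM K dK). Qed.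
Lemma Tm_eps : Tm anyp (fun e : nat -> M => eps (e 0%N)).
Proof. by rewrite /eps; dfn. Qed.
Definition nt n : T := toT (onat K n).
Definition ep n : T := toT (eps n).
Lemma onat_in n : n ∊ omega -> onat K n ∊ od K.
Proof. exact: (onatP hR dK). Qed.
Lemma ntS n : n ∊ omega -> nt (succ n) = nt n + 1.
Proof.
move=> no; rewrite /nt (onatS dK no) toT_add ?toT1 //; first exact: onat_in.
exact: (o1P hR).
Qed.
Lemma nt_ltE m n : m ∊ omega -> n ∊ omega -> olt K (onat K m) (onat K n) <-> nt m < nt n.
Proof. by move=> mo no; apply: toT_lt; exact: onat_in. Qed.
Lemma nt_lt m n : n ∊ omega -> m ∊ n -> nt m < nt n.
Proof.
have [_ _ _ dL] := dK => no.
have H : forall m, m ∊ n -> olt K (onat K m) (onat K n).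
  move: n no; apply: omega_ind => [||n no IH k]; [by dfn|by move=> k; rewrite in_emp|].
  have L : nt n < nt (succ n) by rewrite ntS //; lra.
  have So := omegaS no; rewrite in_adj => -[kn|->]; last by apply/nt_ltE.
  have ko := omega_trans no kn; apply/nt_ltE => //.
  by apply: lt_trans L; apply/nt_ltE => //; exact: IH.
by move=> mn; apply/nt_ltE => //; [exact: (omega_trans no mn)|exact: H].
Qed.
Lemma nt0 : nt emp = 0. Proof. by rewrite /nt (onat0 dK) toT0. Qed.
Lemma eps_in n : n ∊ omega -> eps n ∊ od K.
Proof. by move=> no; apply: (oinv_in hK); apply: onat_in; exact: omegaS. Qed.
Lemma epE n : n ∊ omega -> ep n = (nt (succ n))^-1.
Proof. by move=> no; rewrite /ep /eps toT_inv //; apply: onat_in; exact: omegaS. Qed.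
Lemma nt_gt0 n : n ∊ omega -> 0 < nt (succ n).
Proof. by move=> no; rewrite -nt0; apply: nt_lt; [exact: omegaS|exact: lt0S]. Qed.
Lemma ep_gt0 n : n ∊ omega -> 0 < ep n.
Proof. by move=> no; rewrite epE // invr_gt0; exact: nt_gt0. Qed.
Lemma ep_lt m n : n ∊ omega -> m ∊ n -> ep n < ep m.
Proof.
move=> no mn; have mo := omega_trans no mn.
rewrite !epE // ltf_pV2 ?posrE; try exact: nt_gt0.
by apply: nt_lt; [exact: omegaS|exact: ltSS].
Qed.
Lemma ep_small (e : T) : 0 < e -> Ev (fun n => ep n < e).
Proof.
move=> e0; have [N No] := arch (tVP e^-1).
rewrite (toT_lt hK); [rewrite tVK => L|exact: tVP|exact: onat_in].
exists N; split=> // n no nN; rewrite epE // -(invrK e) ltf_pV2 ?posrE ?invr_gt0 //; last exact: nt_gt0.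
apply: lt_trans L _; apply: nt_lt; first exact: omegaS.
by case: (nat_lt_total No no) => [|[->|]] //; rewrite in_adj; auto.
Qed.
Lemma ep_small_ex (e : T) : 0 < e -> exists2 n, n ∊ omega & ep n < e.
Proof. by move=> /ep_small /Ev_ex. Qed.

Definition rc a : M := cl (cst a).
Lemma Tm_rc : Tm anyp (fun e : nat -> M => rc (e 0%N)).
Proof.
have d1 := @Tm_cst M HM.
have d2 : Tm anyp (fun e : nat -> M => cl (e 0%N)) by exact: (dcls (preR K) dE).
by rewrite /rc; dfn.
Qed.
Lemma rc_in a : a ∊ od K -> rc a ∊ od R.
Proof. by move=> aK; apply: (cls_Q dE); exact: (cst_in hK dK aK). Qed.
Lemma R_ex x : x ∊ od R -> exists2 f, f ∊ od (preR K) & x = cl f.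
Proof. by rewrite (in_Q (preR K) dE). Qed.
Let S f : f ∊ od (preR K) -> seqc K f.
Proof. by move=> /(in_preR hK dK)[]. Qed.
Lemma rc_ltr a f : a ∊ od K -> f ∊ od (preR K) ->
  olt R (rc a) (cl f) <-> exists2 e : T, 0 < e & Ev (fun n => toT a + e < sq hK f n).
Proof.
move=> aK fR; rewrite /rc (qltE P dE (cst_in hK dK aK) fR).
apply: iff_trans (cltP hK (seqc_cst aK) (S fR)) _.
by split=> -[e e0 E]; exists e => //; apply: Ev_mono E => n no; rewrite sq_cst.
Qed.
Lemma rc_ltl a f : a ∊ od K -> f ∊ od (preR K) ->
  olt R (cl f) (rc a) <-> exists2 e : T, 0 < e & Ev (fun n => sq hK f n + e < toT a).
Proof.
move=> aK fR; rewrite /rc (qltE P dE fR (cst_in hK dK aK)).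
apply: iff_trans (cltP hK (S fR) (seqc_cst aK)) _.
by split=> -[e e0 E]; exists e => //; apply: Ev_mono E => n no; rewrite sq_cst.
Qed.
Lemma rc_lt a b : a ∊ od K -> b ∊ od K -> olt R (rc a) (rc b) <-> toT a < toT b.
Proof.
move=> aK bK; apply: iff_trans (rc_ltr aK (cst_in hK dK bK)) _; split=> [[e e0 /Ev_ex[n no]]|L].
  by rewrite sq_cst //; lra.
exists ((toT b - toT a) / 2); first by rewrite divr_gt0 // subr_gt0.
by apply: Ev_all => n no; rewrite sq_cst //; lra.
Qed.
Lemma eps_below x : x ∊ od R -> olt R (o0 R) x -> exists2 n, n ∊ omega & olt R (rc (eps n)) x.
Proof.
move=> /R_ex[f fR ->] /(rc_ltr (o0P hR) fR)[e e0 E].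
have e2 : 0 < e / 2 by rewrite divr_gt0.
have [n no L] := ep_small_ex e2; exists n => //; apply/(rc_ltr (eps_in no) fR).
by exists (e / 2) => //; apply: Ev_mono E => m mo; rewrite toT0 -/(ep n); lra.
Qed.
Lemma eps_pos n : n ∊ omega -> olt R (o0 R) (rc (eps n)).
Proof.
move=> no; apply/rc_lt; [exact: (o0P hR)|exact: eps_in|].
by rewrite toT0; exact: ep_gt0.
Qed.
Lemma eps_lt m n : n ∊ omega -> m ∊ n -> olt R (rc (eps n)) (rc (eps m)).
Proof.
move=> no mn; apply/rc_lt; try exact: eps_in; first exact: (eps_in (omega_trans no mn)).
exact: ep_lt.
Qed.

Section Supremum.
Variable A : M.
Hypothesis AR : sub A (od R).
Definition up a : Prop := forall x, x ∊ A -> ~ olt R (rc a) x.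
Lemma Df_up : Df anyp (fun e : nat -> M => up (e 0%N)).
Proof. by have d := Tm_rc; have [_ _ _ d'] := @Rdops M HM K dK; rewrite /up; dfn. Qed.
Lemma up_mono a b : a ∊ od K -> b ∊ od K -> toT a <= toT b -> up a -> up b.
Proof.
move=> aK bK ab ua x xA; have [f fR E] := R_ex (proj2 AR x xA); subst x.
move=> /(rc_ltr bK fR)[e e0 E]; apply: (ua _ xA); apply/(rc_ltr aK fR).
by exists e => //; apply: Ev_mono E => n no; lra.
Qed.
Variables (q0 q1 : M).
Hypotheses (q0K : q0 ∊ od K) (q1K : q1 ∊ od K) (nq0 : ~ up q0) (uq1 : up q1).
(** [ubs] is the sequence [q0 + k / (n + 1)] with [k = kk n] least such that this rational
    bounds [A] from above; its class is the supremum. *)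
Definition grid n k : M := oadd K q0 (omul K (onat K k) (eps n)).
Definition kk n : M :=
  the (fun k => k ∊ omega /\ up (grid n k) /\ forall j, j ∊ k -> ~ up (grid n j)).
Definition ubs : M := lam omega (fun n => grid n (kk n)).
Lemma Tm_grid : Tm anyp (fun e : nat -> M => grid (e 0%N) (e 1%N)).
Proof. by have [? ? ? ?] := dK; have d := Tm_eps; rewrite /grid; dfn. Qed.
Lemma Tm_kk : Tm anyp (fun e : nat -> M => kk (e 0%N)).
Proof.
rewrite /kk; apply: Tm_the; apply: Df_and; first by dfn.
have d i j : Df anyp (fun e : nat -> M => up (grid (e i) (e j))).
  exact: (Df_pred1 Df_up (Tm_comp2 Tm_grid (Tm_var _ i) (Tm_var _ j))).
apply: Df_and; first exact: d.
apply: Df_all; apply: Df_imp; first by dfn.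
by apply: Df_not; exact: d.
Qed.
Lemma grid_in n k : n ∊ omega -> k ∊ omega -> grid n k ∊ od K.
Proof.
move=> no ko; apply: (oaddP hR) => //; apply: (omulP hR); [exact: onat_in|exact: eps_in].
Qed.
Lemma gridE n k : n ∊ omega -> k ∊ omega -> toT (grid n k) = toT q0 + nt k * ep n.
Proof.
move=> no ko; have nK := onat_in ko; have eK := eps_in no.
by rewrite /grid toT_add ?toT_mul //; exact: (omulP hR).
Qed.
Lemma kkP n : n ∊ omega ->
  kk n ∊ omega /\ up (grid n (kk n)) /\ forall j, j ∊ kk n -> ~ up (grid n j).
Proof.
move=> no; have d1 := Tm_grid; have d2 := Df_up.
have [k ko [uk kmin]] : exists2 k, k ∊ omega & up (grid n k) /\ forall j, j ∊ k -> ~ up (grid n j).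
  (* For such [N], the number N / (n + 1) exceeds q1 - q0, so the grid point with index [N] lies
     above the upper bound [q1]. *)
  have [N No L] := arch (tVP ((toT q1 - toT q0) * nt (succ n))).
  move: L; rewrite (toT_lt hK); [rewrite tVK => L|exact: tVP|exact: onat_in].
  have uN : up (grid n N).
    apply: (up_mono q1K (grid_in no No)) uq1; rewrite gridE // epE //.
    rewrite -lerBlDl ler_pdivlMr; [exact: ltW|exact: nt_gt0].
  have dP : Df anyp (fun e : nat -> M => up (grid n (e 0%N))).
    exact: (Df_pred1 d2 (Tm_comp2 d1 (Tm_const (B := anyp) (m := n) Logic.I) (Tm_var _ 0))).
  have [k ko [uk H]] : exists2 k, k ∊ omega & up (grid n k) /\
    forall m, m ∊ omega -> up (grid n m) -> k ∊ succ m by apply: nat_least => //; exists N.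
  exists k; [exact: ko|split; first exact: uk]; move=> j jk uj; have jo := omega_trans ko jk.
  have := H j jo uj; rewrite in_adj => -[kj|E]; first by case: (mem_asym jk kj).
  by subst j; case: (mem_irrefl jk).
have E : kk n = k.
  apply: the_eq; first exact: conj ko (conj uk kmin).
  move=> z [zo [uz zmin]].
  case: (nat_lt_total ko zo) => [kz|[//|zk]]; first by case: (zmin k kz uk).
  by case: (kmin z zk uz).
by rewrite E.
Qed.
Lemma seqc_ubs : seqc K ubs.
Proof.
have d1 := Tm_grid; have d2 := Tm_kk; apply: isfun_lam; first by dfn.
by move=> n no; apply: grid_in => //; exact: (proj1 (kkP no)).
Qed.
Local Notation un := (sq hK ubs).
Lemma unE n : n ∊ omega -> un n = toT (grid n (kk n)).
Proof. by have d1 := Tm_grid; have d2 := Tm_kk => no; rewrite /sq ap_lam //; dfn. Qed.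
Lemma un_up n : n ∊ omega -> up (tV (un n)).
Proof.
move=> no; have [ko [uk _]] := kkP no; rewrite unE // toTK //; exact: grid_in.
Qed.
(** One step down from [un n] is the preceding grid point, excluded by minimality of [kk n]. The
    index 0 cannot occur, because its grid point is [q0], which is no upper bound. *)
Lemma un_low n : n ∊ omega -> ~ up (tV (un n - ep n)).
Proof.
move=> no; have [ko [uk kmin]] := kkP no; case: (nat_case ko) => [E|[j jo E]].
  case: nq0; move: uk; apply: up_mono => //; first exact: grid_in.
  by rewrite gridE // E nt0 mul0r addr0.
have jk : j ∊ kk n by rewrite E in_adj; right.
move=> H; apply: (kmin j jk); move: H; apply: up_mono; [exact: tVP|exact: grid_in|].
by rewrite tVK unE // !gridE // E ntS // mulrDl mul1r; lra.
Qed.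
(** An upper bound exceeds everything that is not one. Used in both directions, this single estimate
    makes [ubs] a Cauchy sequence and identifies its class as the supremum. *)
Lemma un_lt m n : m ∊ omega -> n ∊ omega -> un n - ep n < un m.
Proof.
move=> mo no; rewrite ltNge; apply/negP => H; apply: (un_low no); move: (un_up mo).
by apply: up_mono; rewrite ?tVK //; exact: tVP.
Qed.
Lemma ubs_in : ubs ∊ od (preR K).
Proof.
apply/(in_preR hK dK); split=> [|e e0]; first exact: seqc_ubs.
have [N No LN] := ep_small_ex e0; exists (un N).
apply: Ev_mono (ep_small e0) => n no L.
by have := un_lt No no; have := un_lt no No; split; lra.
Qed.
Lemma ubs_sup : (forall x, x ∊ A -> ~ olt R (cl ubs) x) /\
  forall c, c ∊ od R -> (forall x, x ∊ A -> ~ olt R c x) -> ~ olt R c (cl ubs).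
Proof.
have uR := ubs_in; have sU := seqc_ubs; split=> [x xA|c cR cub].
  have [f fR E] := R_ex (proj2 AR x xA); subst x.
  rewrite (qltE P dE uR fR) => /(cltP hK sU (S fR))[e e0 E].
  have e2 : 0 < e / 2 by rewrite divr_gt0.
  have [N No LN] := ep_small_ex e2; apply: (un_up No xA); apply/(rc_ltr (tVP _) fR).
  exists (e / 2) => //; apply: Ev_mono E => n no L; rewrite tVK.
  by have := un_lt no No; lra.
have [f fR E] := R_ex cR; subst c.
rewrite (qltE P dE fR uR) => /(cltP hK (S fR) sU)[e e0 E].
have e3 : 0 < e / 3%:R by rewrite divr_gt0 // ltr0n.
have [N No LN] := ep_small_ex e3; apply: (un_low No) => x xA L.
apply: (cub x xA); apply: (olt_tr (ofield_oring (Rofield hK dK))) L => //.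
- by apply: rc_in; exact: tVP.
- exact: (proj2 AR).
apply/(rc_ltl (tVP _) fR); exists (e / 3%:R) => //.
apply: Ev_mono (Ev_and E (ep_small e3)) => n no [L1 L2]; rewrite tVK.
by have := un_lt No no; lra.
Qed.
End Supremum.
End Completeness.

Definition complete {M : structure} (R : ops M) : Prop :=
  forall A, sub A (od R) -> (exists x, x ∊ A) ->
  (exists2 b, b ∊ od R & forall x, x ∊ A -> ~ olt R b x) ->
  exists2 b, b ∊ od R & (forall x, x ∊ A -> ~ olt R b x) /\
    forall c, c ∊ od R -> (forall x, x ∊ A -> ~ olt R c x) -> ~ olt R c b.

Section RealNumbers.
Context {M : structure} {HM : zfa M}.
Variables (K : ops M) (hK : ofield K) (dK : dops K).
Hypothesis arch : archimedean K.
Local Open Scope ring_scope.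
Lemma rc_bounds x : x ∊ od (Rops K) -> exists a b : M, (a ∊ od K /\ b ∊ od K) /\
  olt (Rops K) (rc K a) x /\ olt (Rops K) x (rc K b).
Proof.
move=> /(R_ex dK)[f fR ->]; have [B B0 E] := cauchy_bounded hK dK fR.
exists (tV (- (B + 1))), (tV (B + 1)); split; first by split; exact: tVP.
split; [apply/(rc_ltr hK dK (tVP _) fR)|apply/(rc_ltl hK dK (tVP _) fR)]; exists 1 => //;
  by apply: Ev_mono E => n no; rewrite tVK ltr_norml => /andP[? ?]; lra.
Qed.
Lemma Rcomplete : complete (Rops K).
Proof.
move=> A AR [s sA] [b bR bub].
have [q0 [_ [[q0K _] [L0 _]]]] := rc_bounds (proj2 AR s sA).
have [_ [q1 [[_ q1K] [_ L1]]]] := rc_bounds bR.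
have nq0 : ~ up K A q0 by move=> /(_ s sA).
have uq1 : up K A q1.
  move=> x xA L; apply: (bub x xA).
  apply: (olt_tr (ofield_oring (Rofield hK dK))) L1 L => //; last exact: (proj2 AR).
  exact: (rc_in hK dK).
have uR := ubs_in hK dK arch AR q0K q1K nq0 uq1.
exists (cls (preR K) (ceqv K) (ubs K A q0)); first exact: (cls_Q (dceqv dK) uR).
exact: (ubs_sup hK dK arch AR q0K q1K nq0 uq1).
Qed.
End RealNumbers.

(** * Metrizability *)

Section BinaryFunctions.
Context {M : structure} {HM : zfa M}.
Implicit Types (a b c x y z : M).
Lemma sat_prod q a b : sat M (is_prod q a b) <-> q = prod a b.
Proof.
have E z : sat M (∃' x ∈ a, ∃' y ∈ b, is_opair z x y)%fo <-> z ∊ prod a b.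
  rewrite in_prod; split=> [[x [xa [y [yb /sat_opair ->]]]]|[x [y [xa [yb ->]]]]].
    by exists x, y.
  by exists x; split=> //; exists y; split=> //; exact/sat_opair.
split=> [[qs H]|->].
  have ps : isset (prod a b) by exact: isset_prod.
  by apply: (@set_ext M HM q (prod a b) qs ps) => z; exact: iff_trans (H z) (E z).
by split=> [|z]; [exact: isset_prod|apply: iff_sym; exact: E].
Qed.

Definition lam2 a b (F : M -> M -> M) : M := lam (prod a b) (fun q => F (pfst q) (psnd q)).
Definition rel2 a (r : M -> M -> Prop) : M := sep (prod a a) (fun q => r (pfst q) (psnd q)).
Lemma sat_lam2 a b F x y z : Tm anyp (fun e : nat -> M => F (e 0) (e 1)) ->
  sat M (app2 (lam2 a b F) x y z) <-> (x ∊ a /\ y ∊ b) /\ z = F x y.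
Proof.
move=> dF; split=> [[q [/sat_opair -> /sat_app]]|[[xa yb] ->]].
  rewrite opair_lam; last by dfn.
  by rewrite opair_prod pfstE psndE.
exists (opair x y); split; first exact/sat_opair.
apply/sat_app; rewrite opair_lam; last by dfn.
by rewrite opair_prod pfstE psndE.
Qed.
Lemma sat_rel2 a r x y : Df anyp (fun e : nat -> M => r (e 0) (e 1)) ->
  sat M (app (rel2 a r) x y) <-> (x ∊ a /\ y ∊ a) /\ r x y.
Proof.
move=> dr; apply: iff_trans (sat_app _ _ _) _; rewrite /rel2 in_sep; last by dfn.
by rewrite opair_prod pfstE psndE.
Qed.
Lemma sat_fun2 a b c F : Tm anyp (fun e : nat -> M => F (e 0) (e 1)) ->
  (forall x y, x ∊ a -> y ∊ b -> F x y ∊ c) -> sat M (is_fun2 (lam2 a b F) a b c).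
Proof.
move=> dF H; exists (prod a b); split; first exact/sat_prod.
apply/sat_is_fun; apply: isfun_lam; first by dfn.
by move=> q; rewrite in_prod => -[x [y [xa [yb ->]]]]; rewrite pfstE psndE; exact: H.
Qed.
End BinaryFunctions.

Section InternalField.
Context {M : structure} {HM : zfa M}.
Variable R : ops M.
Hypotheses (hR : ofield R) (dR : dops R).
Local Notation F := (od R).
Local Notation h := (ofield_oring hR).
Definition addS : M := lam2 F F (oadd R).
Definition mulS : M := lam2 F F (omul R).
Definition ltS : M := rel2 F (olt R).
Implicit Types (x y z : M).

Lemma satA x y z : sat M (app2 addS x y z) <-> (x ∊ F /\ y ∊ F) /\ z = oadd R x y.
Proof. by apply: sat_lam2; have [] := dR. Qed.
Lemma satM x y z : sat M (app2 mulS x y z) <-> (x ∊ F /\ y ∊ F) /\ z = omul R x y.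
Proof. by apply: sat_lam2; have [] := dR. Qed.
Lemma satL x y : sat M (app ltS x y) <-> (x ∊ F /\ y ∊ F) /\ olt R x y.
Proof. by apply: sat_rel2; have [] := dR. Qed.

Lemma sat_field_axioms : sat M (field_axioms F addS mulS (o0 R) (o1 R)).
Proof.
have [? ? ? ?] := dR; have z0 := o0P h; have z1 := o1P h.
have AA := oaddP h; have MM := omulP h.
repeat apply: conj.
- exact: (sat_fun2 _ AA).
- exact: (sat_fun2 _ MM).
- exact: z0.
- exact: z1.
- by move=> E; apply: (o10 h).
- move=> x y z r s t /satA[[xF yF] ->] /satA[[_ zF] ->] /satA[_ ->]; apply/satA.
  by split; [split=> //; exact: AA|rewrite (oaddA h)].
- move=> x y r /satA[[xF yF] ->]; apply/satA; split=> //; exact: (oaddC h).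
- move=> x xF; apply/satA; split=> //; rewrite (oaddC h) //; symmetry; exact: (oadd0 h).
- move=> x xF; exists (oopp R x); split; first exact: (ooppP h).
  have NF := ooppP h xF.
  by apply/satA; split=> //; rewrite (oaddC h) //; symmetry; exact: (oaddN h).
- move=> x y z r s t /satM[[xF yF] ->] /satM[[_ zF] ->] /satM[_ ->]; apply/satM.
  by split; [split=> //; exact: MM|rewrite (omulA h)].
- move=> x y r /satM[[xF yF] ->]; apply/satM; split=> //; exact: (omulC h).
- move=> x xF; apply/satM; split=> //; rewrite (omulC h) //; symmetry; exact: (omul1 h).
- move=> x xF x0; have [y yF E] := oinvP hR xF x0; exists y; split=> //.
  by apply/satM; split=> //; rewrite (omulC h).
- move=> x y z s r t w /satA[[yF zF] ->] /satM[[xF _] ->] /satM[_ ->] /satM[_ ->]; apply/satA.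
  split; first by split; exact: MM.
  by rewrite (omulC h) // ?(omulD h) // ?(omulC h xF) //; exact: AA.
Qed.

Lemma sat_strict_order : sat M (strict_linear_order ltS F).
Proof.
split; [|split].
- by move=> x xF /satL[_ /(olt_irr h)]; apply.
- move=> x xF y yF z zF /satL[_ xy] /satL[_ yz]; apply/satL; split=> //.
  exact: (olt_tr h) xy yz.
- move=> x xF y yF; case: (olt_tot h xF yF) => [->|[L|L]]; first by left.
    by right; left; apply/satL.
  by right; right; apply/satL.
Qed.

Lemma sat_ordered_field : sat M (ordered_field F addS mulS ltS (o0 R) (o1 R)).
Proof.
split; first exact: sat_field_axioms.
split; first exact: sat_strict_order.
split=> [x xF y yF z zF r s /satL[_ L] /satA[_ ->] /satA[_ ->]|x xF y yF r /satL[_ x0] /satL[_ y0] /satM[_ ->]].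
  apply/satL; split; first by split; exact: (oaddP h).
  exact: (olt_add h).
apply/satL; split; first by split; [exact: (o0P h)|exact: (omulP h)].
exact: (olt_mul h).
Qed.

Lemma sat_upper s b : sub s F -> b ∊ F ->
  sat M (upper_bound ltS s b) <-> forall x, x ∊ s -> ~ olt R b x.
Proof.
move=> sF bF; split=> [H x xs bx|H x xs]; have xF := proj2 sF x xs.
  case: (H x xs) => [E|/satL[_ xb]]; first by move: bx; rewrite E; exact: (olt_irr h).
  exact: (olt_irr h xF (olt_tr h xF bF xF xb bx)).
case: (olt_tot h xF bF) => [->|[L|L]]; first by left.
  by right; apply/satL.
by case: (H x xs L).
Qed.

Lemma sat_is_reals : complete R -> sat M (is_reals F addS mulS ltS (o0 R) (o1 R)).
Proof.
move=> C; split=> [|s sF ne [b [bF /(sat_upper sF bF) ub]]]; first exact: sat_ordered_field.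
have [|b' b'F [ub' least]] := C s sF ne; first by exists b.
exists b'; split=> //; split; first exact/(sat_upper sF b'F).
move=> c cF /(sat_upper sF cF) /(least c cF) nl.
case: (olt_tot h b'F cF) => [->|[L|L]] //; first by left.
by right; apply/satL.
Qed.
End InternalField.

Section Metrizable.
Context {M : structure} {HM : zfa M}.
Variable R : ops M.
Hypotheses (hR : ofield R) (dR : dops R) (cR : complete R).
Variable ee : M -> M.
Hypothesis dee : Tm anyp (fun e : nat -> M => ee (e 0)).
Hypotheses (ee_in : forall n, n ∊ omega -> ee n ∊ od R)
  (ee_pos : forall n, n ∊ omega -> olt R (o0 R) (ee n))
  (ee_lt : forall m n, n ∊ omega -> m ∊ n -> olt R (ee n) (ee m))
  (ee_below : forall x, x ∊ od R -> olt R (o0 R) x -> exists2 n, n ∊ omega & olt R (ee n) x).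
Variables X T p W r : M.
Hypotheses (HT : topo X T) (HH : sat M (hausdorff X T)).
Hypotheses (WX : sub W X) (pW : p ∊ W).
Hypothesis Hr : forall x, x ∊ W -> x <> p -> ap r x ∊ omega.
Hypothesis Hlim : forall u, u ∊ T -> p ∊ u -> exists2 n, n ∊ omega & tail W p r n u.
Hypothesis Hfin : forall n, n ∊ omega -> fin (sep W (fun x => x <> p /\ ap r x ∊ n)).
Local Notation toT := (toT hR).
Local Notation F := (od R).
Implicit Types (x y z u v n : M).
Local Open Scope ring_scope.

(** The distance of distinct [x] and [y] is the larger of their heights, where [p] has
    height 0 and any other [x] has height [ee (ap r x)]. *)
Let hgt x : M := the (fun s : M => (x = p /\ s = o0 R) \/ (x <> p /\ s = ee (ap r x))).
Let dst x y : M := the (fun s : M => (x = y /\ s = o0 R) \/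
  (x <> y /\ ((olt R (hgt x) (hgt y) /\ s = hgt y) \/ (~ olt R (hgt x) (hgt y) /\ s = hgt x)))).
Let d_hgt : Tm anyp (fun e : nat -> M => hgt (e 0%N)).
Proof. by rewrite /hgt; dfn. Qed.
Let d_dst : Tm anyp (fun e : nat -> M => dst (e 0%N) (e 1%N)).
Proof. by have [? ? ? ?] := dR; rewrite /dst; dfn. Qed.
Let hgt_p : hgt p = o0 R.
Proof. by apply: the_eq => [|z [[]|[]]] //; left. Qed.
Let hgt_r x : x <> p -> hgt x = ee (ap r x).
Proof. by move=> xp; apply: the_eq => [|z [[]|[]]] //; right. Qed.
Let hgt_in x : x ∊ W -> hgt x ∊ F.
Proof.
move=> xW; case: (pselect (x = p)) => [->|xp]; first by rewrite hgt_p; exact: (o0P (ofield_oring hR)).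
by rewrite hgt_r //; apply: ee_in; exact: Hr.
Qed.
Let H x : orT (ofield_oring hR) := toT (hgt x).
Let H0 : H p = 0. Proof. by rewrite /H hgt_p toT0. Qed.
Let Hpos x : x ∊ W -> x <> p -> 0 < H x.
Proof.
move=> xW xp; apply/(lt0E hR); first exact: hgt_in.
by rewrite hgt_r //; apply: ee_pos; exact: Hr.
Qed.
Let Hge x : x ∊ W -> 0 <= H x.
Proof.
by move=> xW; case: (pselect (x = p)) => [->|/(Hpos xW)/ltW //]; rewrite H0.
Qed.
Let dst_xx x : dst x x = o0 R.
Proof. by apply: the_eq => [|z [[]|[]]] //; left. Qed.
Let dst_r x y : x <> y -> olt R (hgt x) (hgt y) -> dst x y = hgt y.
Proof. by move=> xy L; apply: the_eq => [|z [[]|[_ [[]|[]]]]] //; right; split=> //; left. Qed.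
Let dst_l x y : x <> y -> ~ olt R (hgt x) (hgt y) -> dst x y = hgt x.
Proof. by move=> xy L; apply: the_eq => [|z [[]|[_ [[]|[]]]]] //; right; split=> //; right. Qed.
Let dst_in x y : x ∊ W -> y ∊ W -> dst x y ∊ F.
Proof.
move=> xW yW; case: (pselect (x = y)) => [->|xy].
  by rewrite dst_xx; exact: (o0P (ofield_oring hR)).
by case: (pselect (olt R (hgt x) (hgt y))) => L; rewrite ?(dst_r xy L) ?(dst_l xy L) ?hgt_in //; exact: hgt_in.
Qed.
Let D x y : orT (ofield_oring hR) := toT (dst x y).
Let Dxx x : D x x = 0. Proof. by rewrite /D dst_xx toT0. Qed.
Let Dxy x y : x ∊ W -> y ∊ W -> x <> y -> D x y = Num.max (H x) (H y).
Proof.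
move=> xW yW xy; rewrite /D; case: (pselect (olt R (hgt x) (hgt y))) => L.
  rewrite (dst_r xy L) maxEle ltW //; apply/(toT_lt hR) => //; exact: hgt_in.
rewrite (dst_l xy L) maxElt; case: ifP => // /(toT_lt hR (hgt_in xW) (hgt_in yW)) //.
Qed.
Let D_sym x y : x ∊ W -> y ∊ W -> D x y = D y x.
Proof.
move=> xW yW; case: (pselect (x = y)) => [->//|xy].
have yx : y <> x by move=> E; apply: xy.
by rewrite (Dxy xW yW xy) (Dxy yW xW yx) maxC.
Qed.
Let D_pos x y : x ∊ W -> y ∊ W -> x <> y -> 0 < D x y.
Proof.
move=> xW yW xy; rewrite Dxy // lt_max; case: (pselect (x = p)) => [E|xp].
  by apply/orP; right; apply: Hpos => // yp; apply: xy; rewrite E yp.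
by apply/orP; left; exact: Hpos.
Qed.
Let D_ge x y : x ∊ W -> y ∊ W -> 0 <= D x y.
Proof.
by move=> xW yW; case: (pselect (x = y)) => [->|xy]; [rewrite Dxx|apply/ltW/D_pos].
Qed.
Let D_tri x y z : x ∊ W -> y ∊ W -> z ∊ W -> D x z <= D x y + D y z.
Proof.
move=> xW yW zW; case: (pselect (x = z)) => [->|xz].
  by rewrite Dxx addr_ge0 // D_ge.
case: (pselect (x = y)) => [<-|xy]; first by rewrite Dxx add0r.
case: (pselect (y = z)) => [<-|yz]; first by rewrite Dxx addr0.
rewrite (Dxy xW zW xz) (Dxy xW yW xy) (Dxy yW zW yz); have x0 := Hge xW; have z0 := Hge zW.
have L1 : H x <= Num.max (H x) (H y) by rewrite le_max lexx.
have L2 : H z <= Num.max (H y) (H z) by rewrite le_max lexx orbT.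
by rewrite ge_max; apply/andP; split; lra.
Qed.

Local Notation dS := (lam2 W W dst).
Let satD x y s : sat M (app2 dS x y s) <-> (x ∊ W /\ y ∊ W) /\ s = dst x y.
Proof. exact: sat_lam2. Qed.
Let le_sat (a b : M) : a ∊ F -> b ∊ F -> toT a <= toT b -> a = b \/ sat M (app (ltS R) a b).
Proof.
move=> aF bF; rewrite le_eqVlt => /orP[/eqP E|L]; [left|right].
  by rewrite -(toTK hR aF) E toTK.
by apply/satL => //; split=> //; exact/(toT_lt hR).
Qed.

Lemma W_metric : sat M (is_metric dS W F (addS R) (ltS R) (o0 R)).
Proof.
have z0 := o0P (ofield_oring hR).
split; [|split; [|split; [|split]]].
- by apply: sat_fun2.
- move=> x xW y yW s /satD[_ ->].
  have : toT (o0 R) <= D x y by rewrite toT0; exact: D_ge.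
  move=> /(le_sat z0 (dst_in xW yW))[->|L]; by [left|right].
- move=> x xW y yW; split=> [/satD[_ E]|->]; last by apply/satD; rewrite dst_xx.
  by apply: contrapT => /(D_pos xW yW); rewrite /D -E toT0 ltxx.
- move=> x xW y yW s /satD[_ ->]; apply/satD; split=> //.
  by rewrite -(toTK hR (dst_in xW yW)) -(toTK hR (dst_in yW xW)); congr tV; exact: D_sym.
- move=> x xW y yW z zW s t q w /satD[_ ->] /satD[_ ->] /satD[_ ->] /(satA dR)[[aF bF] ->].
  apply: le_sat; [exact: dst_in|exact: (oaddP (ofield_oring hR))|].
  by rewrite toT_add //; exact: D_tri.
Qed.

Lemma W_metric_topology : sat M (metric_topology dS W F (ltS R) (o0 R) (subspace X T W)).
Proof.
have z0 := o0P (ofield_oring hR).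
split=> [|u]; first exact: isset_repl.
change (u ∊ subspace X T W <-> (sub u W /\ forall x, x ∊ u -> exists e : M, e ∊ F /\
  sat M (app (ltS R) (o0 R) e) /\ forall y, y ∊ W -> forall s : M, sat M (app2 dS x y s) ->
    sat M (app (ltS R) s e) -> y ∊ u)).
rewrite (subspace_open HT HH WX pW Hlim Hfin); split=> -[uW Hu]; split=> //.
  move=> x xu; have xW := proj2 uW x xu; case: (pselect (x = p)) => [E|xp].
    (* Besides [p], the ball of radius [ee n] around [p] contains only points of rate at least
       [n]. *)
    subst x; have [n no Hn] := Hu xu; exists (ee n); split; first exact: ee_in.
    split; first by apply/satL => //; split; [split=> //; exact: ee_in|exact: ee_pos].
    move=> y yW s /satD[_ ->] /(satL dR)[_ L].
    case: (pselect (y = p)) => [->//|yp]; apply: Hn => // rn; have py := nesym yp.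
    have : D p y < toT (ee n) by apply/(toT_lt hR) => //; [exact: dst_in|exact: ee_in].
    rewrite (Dxy pW yW py) gt_max => /andP[_]; rewrite /H hgt_r // => L1.
    have ryo := Hr yW yp.
    have : toT (ee n) < toT (ee (ap r y)).
      by apply/(toT_lt hR); [exact: ee_in|exact: ee_in|exact: ee_lt].
    by move=> /(lt_trans L1); rewrite ltxx.
  (* Every other point is at distance at least [hgt x] from [x], so this ball is a singleton. *)
  have hF := hgt_in xW; exists (hgt x); split=> //.
  split; first by apply/satL => //; split=> //; apply/(lt0E hR) => //; exact: Hpos.
  move=> y yW s /satD[_ ->] /(satL dR)[_ /(toT_lt hR (dst_in xW yW) hF) L].
  case: (pselect (x = y)) => [<-//|xy]; exfalso; move: L.
  by rewrite -/(D x y) (Dxy xW yW xy) gt_max ltxx.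
move=> pu; have [e [eF [/(satL dR)[_ e0] He]]] := Hu p pu.
have [n no L] := ee_below eF e0; exists n => // x xW xp nr.
apply: (He x xW (dst p x)); first by apply/satD.
have rxo := Hr xW xp; apply/satL => //; split; first by split=> //; exact: dst_in.
apply/(toT_lt hR) => //; first exact: dst_in.
rewrite -/(D p x) (Dxy pW xW (nesym xp)).
have L' : toT (ee n) < toT e by apply/(toT_lt hR) => //; exact: ee_in.
rewrite gt_max; apply/andP; split.
  by rewrite H0 -(toT0 hR); apply/(toT_lt hR).
apply: le_lt_trans L'; rewrite /H hgt_r //.
case: (nat_lt_total rxo no) => [//|[->//|nl]]; apply: ltW.
by apply/(toT_lt hR); [exact: ee_in|exact: ee_in|exact: ee_lt].
Qed.

Lemma W_metrizable_over : sat M (metrizable W (subspace X T W)).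
Proof.
exists F, (addS R), (mulS R), (ltS R), (o0 R), (o1 R), dS.
split; first exact: sat_is_reals.
by split; [exact: W_metric|exact: W_metric_topology].
Qed.
End Metrizable.

(** The heights are the numbers 1 / (n + 1), taken as constant sequences in the Cauchy reals over
    the internal rationals. Since the field is built in the given structure, the lemma applies
    inside a permutation model. *)
Lemma W_metrizable (M : structure) (HM : zfa M) (X T p W r : M) : topo X T ->
  sat M (hausdorff X T) -> sub W X -> p ∊ W ->
  (forall x : M, x ∊ W -> x <> p -> ap r x ∊ omega) ->
  (forall u : M, u ∊ T -> p ∊ u -> exists2 n, n ∊ omega & tail W p r n u) ->
  (forall n : M, n ∊ omega -> fin (sep W (fun x => x <> p /\ ap r x ∊ n))) ->
  sat M (metrizable W (subspace X T W)).
Proof.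
have hQ := @Qofield M HM; have dQ := @Qdops M HM; have aQ := @Qarch M HM.
apply: (W_metrizable_over (Rofield hQ dQ) (Rdops dQ) (Rcomplete hQ dQ aQ)
  (ee := fun n => rc Qops (eps Qops n))).
- exact: (Tm_comp1 (Tm_rc dQ) (Tm_eps dQ)).
- by move=> n no; apply: (rc_in hQ dQ); exact: (eps_in hQ dQ).
- by move=> n no; exact: (eps_pos hQ dQ).
- by move=> m n no mn; exact: (eps_lt hQ dQ).
- by move=> x xR x0; exact: (eps_below hQ dQ aQ).
Qed.

(** * The groups of the three models *)

Section Transpositions.
Context {M : structure} {HM : zfa M}.
Implicit Types (a b c x y z f g E : M).

Definition swap a b x : M :=
  the (fun y => (x = a /\ y = b) \/ (x = b /\ y = a) \/ ((x <> a /\ x <> b) /\ y = x)).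
Lemma swapl a b : swap a b a = b.
Proof. by apply: the_eq => [|z [[]|[[-> ->]|[[]]]]]; auto. Qed.
Lemma swapr a b : swap a b b = a.
Proof. by apply: the_eq => [|z [[-> ->]|[[]|[[]]]]]; auto. Qed.
Lemma swap_out a b x : x <> a -> x <> b -> swap a b x = x.
Proof. by move=> xa xb; apply: the_eq => [|z [[]|[[]|[]]]]; auto. Qed.
Lemma swapK a b x : swap a b (swap a b x) = x.
Proof.
case: (pselect (x = a)) => [->|xa]; first by rewrite swapl swapr.
case: (pselect (x = b)) => [->|xb]; first by rewrite swapr swapl.
by rewrite !swap_out // swap_out.
Qed.
Definition transp a b : M := lam atoms (swap a b).
Let dswap a b : Tm anyp (fun e : nat -> M => swap a b (e 0)).
Proof. by rewrite /swap; dfn. Qed.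
Lemma swap_atoms a b x : atom M a -> atom M b -> x ∊ atoms -> swap a b x ∊ atoms.
Proof.
rewrite !in_atoms => aa ab ax.
case: (pselect (x = a)) => [->|xa]; first by rewrite swapl.
case: (pselect (x = b)) => [->|xb]; first by rewrite swapr.
by rewrite swap_out.
Qed.
Lemma perm_transp a b : atom M a -> atom M b -> perm (transp a b).
Proof.
move=> aa ab; apply: isbij_lam => // [x|x y _ _ E|y yA].
- exact: swap_atoms.
- by rewrite -(swapK a b x) E swapK.
- by exists (swap a b y); [exact: swap_atoms|exact: swapK].
Qed.
Lemma ap_transp a b x : x ∊ atoms -> ap (transp a b) x = swap a b x.
Proof. by move=> xA; rewrite ap_lam. Qed.
Lemma act_transp a b x : atom M a -> atom M b -> atom M x -> act (transp a b) x = swap a b x.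
Proof.
move=> aa ab ax; rewrite (act_atom (perm_transp aa ab) ax) ap_transp //.
by rewrite in_atoms.
Qed.
Lemma perm_id : perm (lam atoms id).
Proof. by apply: isbij_lam => //; [dfn|move=> y yA; exists y]. Qed.
End Transpositions.

(** * The group of N1 *)

Section FullGroup.
Context {M : structure} {HM : zfa M}.
Implicit Types (a b c x y z f g E : M).
Lemma full_group : perm_group (@atom_permutation M).
Proof.
split.
- by move=> f /sat_atom_permutation.
- exact/sat_atom_permutation/perm_id.
- by move=> f g /sat_atom_permutation F /sat_atom_permutation G; apply/sat_atom_permutation/perm_comp.
- by move=> f /sat_atom_permutation F; apply/sat_atom_permutation/perm_inv.
- move=> f _; apply: (@Df_ext _ _ (fun e => perm (e 0))).
    by move=> e; exact: sat_atom_permutation.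
  by apply: Df_perm; dfn.
Qed.

Lemma denumerable_infinite A : sat M (denumerable A) -> ~ fin A.
Proof.
move=> [w [/sat_is_omega -> [f /sat_is_bij [[F I] S]]]] fA; apply: omega_infinite.
have -> : omega = repl A (ap f).
  apply: set_eqP => [||n]; [exact: isset_omega|exact: isset_repl|].
  rewrite in_repl; last by dfn.
  by apply: propext; split=> [/S[x xA <-]|[x xA ->]]; [exists x|exact: (ap_in F)].
by apply: fin_repl => //; dfn.
Qed.

Lemma infinite_diff A K : isset A -> ~ fin A -> fin K -> exists2 c, c ∊ A & ~ c ∊ K.
Proof.
move=> sA nA fK; apply: contrapT => H; apply: nA; apply: (fin_sub fK).
by split=> // c cA; apply: contrapT => cK; apply: H; exists c.
Qed.

(** Distinct atoms of equal type over [E] both lie outside [E], so their transposition fixes [E];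
    and a finite set of atoms never exhausts all of them. *)
Lemma full_homogeneous : ~ fin atoms -> homogeneous (@atom_permutation M) (fun _ _ => False).
Proof.
move=> nA; split=> //.
- by dfn.
- by left=> a b [].
- move=> E a b sE aa ab H; case: (pselect (a = b)) => [<-|ne].
    exists (lam atoms id); split; last exact: (act_id full_group).
    by split; [exact/sat_atom_permutation/perm_id|exact: (fixes_id full_group)].
  exists (transp a b); split; last by rewrite act_transp // swapl.
  split; first exact/sat_atom_permutation/perm_transp.
  move=> e eE; rewrite act_transp //; last exact: (supp_atom sE eE).
  have [[Ha Hb] _] := H e eE.
  apply: swap_out => E'; apply: ne; first by rewrite -(Ha E').
  by rewrite -(Hb E').
- move=> E a sE aa aE.
  have sA : isset atoms by exact: isset_mkset.
  have [c cA cE] := infinite_diff sA nA (fin_adj a (proj2 sE)).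
  exists c; split; rewrite -?in_atoms //.
  + by move=> H; apply: cE; rewrite in_adj; left.
  + by move=> H; apply: cE; rewrite in_adj; right.
  + move=> e eE; split=> //; split=> E'; first by case: aE; rewrite -E'.
    by case: cE; rewrite in_adj -E'; left.
Qed.
End FullGroup.

(** * The group of N2 *)

Section PairGroup.
Context {M : structure} {HM : zfa M}.
Variable P : M.
Hypothesis HP : sat M (pair_partition P).
Implicit Types (a b c n m x y z f g u E F : M).
Local Notation G := (pair_preserving P).

Lemma pair_fun : exists b, isfun P omega b.
Proof. by have [w [A [/sat_is_omega -> [_ [[b /sat_is_fun H] _]]]]] := HP; exists b. Qed.
Lemma opairP n u : (opair n u ∊ P) <-> n ∊ omega /\ u = ap P n.
Proof.
have [b F] := pair_fun; split=> [/(ap_eq F)//|[no ->]]; exact: (ap_mem F).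
Qed.
Lemma pairE n : n ∊ omega ->
  exists a b, [/\ atom M a, atom M b, a <> b & ap P n = upair a b].
Proof.
move=> no; have [w [A [/sat_is_omega -> [/sat_atom_set -> [_ [H _]]]]]] := HP.
have [|a [aA [b [bA [ab /sat_upair E]]]]] := H n no (ap P n); first by apply/sat_app/opairP.
by exists a, b; split; rewrite -?in_atoms.
Qed.
Lemma pair_disj m n x : m ∊ omega -> n ∊ omega -> x ∊ ap P m -> x ∊ ap P n -> m = n.
Proof.
move=> mo no xm xn; have [w [A [_ [_ [_ [_ [H _]]]]]]] := HP.
by apply: (H m n (ap P m) (ap P n) x) => //; apply/sat_app/opairP.
Qed.
Lemma pair_cover a : atom M a -> exists2 n, n ∊ omega & a ∊ ap P n.
Proof.
rewrite -in_atoms => aA; have [w [A [_ [/sat_atom_set E [_ [_ [_ H]]]]]]] := HP; subst A.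
by have [n [u [/sat_app /opairP[no ->] au]]] := H a aA; exists n.
Qed.
Lemma pair_atom n a : n ∊ omega -> a ∊ ap P n -> atom M a.
Proof. by move=> /pairE[b [c [ab ac _ ->]]]; rewrite in_upair => -[->|->]. Qed.
Lemma pair_isset n : n ∊ omega -> isset (ap P n).
Proof. by move=> /pairE[b [c [_ _ _ ->]]]; exact: isset_upair. Qed.
Lemma fin_pair n : n ∊ omega -> fin (ap P n).
Proof. by move=> /pairE[b [c [_ _ _ ->]]]; exact: fin_upair. Qed.

Lemma sat_pair_preserving f :
  sat M (G f) <-> perm f /\ forall n, n ∊ omega -> act f (ap P n) = ap P n.
Proof.
have img : perm f -> forall n, n ∊ omega ->
    sat M (is_image f (ap P n) (ap P n)) <-> act f (ap P n) = ap P n.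
  move=> pf n no; have sn := pair_isset no.
  have E x y : x ∊ ap P n -> sat M (app f x y) <-> y = act f x.
    move=> xn; have ax := pair_atom no xn; have [[Ff _] _] := pf.
    rewrite (act_atom pf ax); apply: iff_trans (sat_app _ _ _) _.
    by rewrite (ap_iff Ff) // in_atoms.
  split=> [[_ H]|H].
    apply: set_ext => // [|y]; first exact: act_isset.
    rewrite in_act //; apply: iff_sym; apply: iff_trans (H y) _.
    split=> [[x [xn /(E x y xn) ->]]|[x xn ->]]; first by exists x.
    by exists x; split=> //; exact/E.
  split=> // y; split=> [|[x [xn /(E x y xn) ->]]]; last by rewrite -H; exact: act_mem.
  by rewrite -{1}H in_act // => -[x xn ->]; exists x; split=> //; exact/E.
split=> [[/sat_atom_permutation pf H]|[pf H]].
  split=> // n no; apply/img => //.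
  by apply: (H n (ap P n)); apply/sat_app/opairP.
split; first exact/sat_atom_permutation.
by move=> n u /sat_app /opairP[no ->]; apply/img => //; exact: H.
Qed.

Lemma act_omega f n : perm f -> n ∊ omega -> act f n = n.
Proof. by move=> pf; apply: (act_nat full_group); exact/sat_atom_permutation. Qed.

(** The enumeration [P] is the parameter in the definition of the group, and [pg_def] requires that
    the members of the group fix it. *)
Lemma act_P f : sat M (G f) -> act f P = P.
Proof.
move=> /sat_pair_preserving[pf H]; have [b F] := pair_fun.
have sP : isset P := proj1 F.
have H' n : n ∊ omega -> act f (opair n (ap P n)) = opair n (ap P n).
  by move=> no; rewrite act_opair // act_omega // H.
apply: set_ext => // [|y]; first exact: act_isset.
rewrite in_act //; split=> [[x /(in_fun F)[n no ->] ->]|/[dup] yP /(in_fun F)[n no E]].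
  by rewrite H' //; exact: (ap_mem F).
by exists y => //; rewrite E H'.
Qed.

Lemma pair_group : perm_group G.
Proof.
have id1 : perm (lam atoms (@id M)) := perm_id.
split.
- by move=> f /sat_pair_preserving[].
- by apply/sat_pair_preserving; split=> // n no; exact: (act_id full_group).
- move=> f g /sat_pair_preserving[pf Hf] /sat_pair_preserving[pg Hg].
  apply/sat_pair_preserving; split=> [|n no]; first exact: perm_comp.
  by rewrite act_comp // Hg // Hf.
- move=> f /sat_pair_preserving[pf Hf]; apply/sat_pair_preserving; split=> [|n no].
    exact: perm_inv.
  by rewrite -{1}(Hf n no) actK.
- move=> f /act_P fP; have fP' : fixedby f P by [].
  apply: (@Df_ext _ _ (fun e => perm (e 0) /\ forall n, n ∊ omega -> act (e 0) (ap P n) = ap P n)).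
    by move=> e; exact: sat_pair_preserving.
  apply: Df_and; [apply: Df_perm|]; dfn.
Qed.

Definition blk a : M := the (fun u => a ∊ u /\ exists2 n, n ∊ omega & u = ap P n).
Lemma blkE n a : n ∊ omega -> a ∊ ap P n -> blk a = ap P n.
Proof.
move=> no an; apply: the_eq; first by split=> //; exists n.
by move=> z [az [m mo E]]; rewrite E in az *; rewrite (pair_disj mo no az an).
Qed.
Lemma determined F f g x : supports G F x -> sat M (G f) -> sat M (G g) ->
  (forall a, a ∊ F -> act f a = act g a) -> act f x = act g x.
Proof.
move=> S Gf Gg H; have pf := pg_perm pair_group Gf; have pg := pg_perm pair_group Gg.
have Gi := pg_inv pair_group Gg; have Gc := pg_comp pair_group Gi Gf.
have : act (pcomp (pinv g) f) x = x.
  apply: S => // a aF; rewrite act_comp //; last exact: perm_inv.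
  by rewrite H // actK.
rewrite act_comp //; last exact: perm_inv.
by move=> {2}<-; rewrite actVK.
Qed.
(** What a group element does to [x] is determined by its restriction [s] to a support. *)
Definition motion F x s : M :=
  the (fun y => exists f, (sat M (G f) /\ forall a, a ∊ F -> ap s a = act f a) /\ y = act f x).
Lemma fin_orbit E x : HS G x -> fin (orbit G E x).
Proof.
move=> /HS_symm[F [[FA fF] S]].
have aF a : a ∊ F -> atom M a by move=> /(proj2 FA); rewrite in_atoms.
pose (F' := bigcup (repl F blk)).
have dblk : Tm anyp (fun e : nat -> M => blk (e 0)) by rewrite /blk; dfn.
have fF' : fin F'.
  apply: fin_bigcup => [|u]; first exact: fin_repl.
  rewrite in_repl // => -[a /aF/pair_cover[n no an] ->].
  by rewrite (blkE no an); exact: fin_pair.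
pose v s := the (fun y => exists f, (sat M (G f) /\ forall a, a ∊ F -> ap s a = act f a) /\ y = act f x).
have dG : Df anyp (fun e : nat -> M => sat M (G (e 0))).
  exact: Df_mono (pg_def pair_group (pg_id pair_group)).
have dv : Tm anyp (fun e : nat -> M => motion F x (e 0)) by rewrite /motion; dfn.
apply: (fin_sub (fin_repl dv (fin_pow (fin_prod fF fF')))).
split=> [|y]; first exact: isset_orbit.
rewrite (in_orbit pair_group) => -[f [[Gf _] ->]]; rewrite in_repl //.
have dl : Tm anyp (fun e : nat -> M => act f (e 0)) by dfn.
(* The restriction of [f] to the support is a subset of the finite product [prod F F'], because [f]
   keeps every pair; there are finitely many such restrictions. *)
exists (lam F (act f)).
  rewrite in_pow; split=> [|p]; first exact: isset_repl.
  rewrite in_lam // => -[a aF' ->]; rewrite opair_prod; split=> //.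
  have [n no an] := pair_cover (aF a aF').
  rewrite in_bigcup; exists (ap P n).
    by rewrite in_repl //; exists a => //; rewrite (blkE no an).
  have [pf Hf] := proj1 (sat_pair_preserving f) Gf.
  by rewrite -(Hf n no); exact: act_mem.
symmetry; apply: the_eq; first by exists f; split=> //; split=> // a aF'; rewrite ap_lam.
move=> z [g [[Gg Hg] ->]]; apply: (determined S) => // a aF'.
by rewrite -Hg // ap_lam.
Qed.
End PairGroup.

Section FieldOfModel.
Context {M : structure} {HM : zfa M}.
Variables (F add mul lt o i : M).
Hypothesis H : sat M (ordered_field F add mul lt o i).
Implicit Types (x y z r s t : M).

Definition plus x y : M := ap add (opair x y).
Definition times x y : M := ap mul (opair x y).
Definition negate x : M := the (fun y => y ∊ F /\ plus x y = o).
(** Brings a field given by sets of the model into the form [ops], so that its elements get the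
    algebraic structures used for linear arithmetic. *)
Definition fops : ops M :=
  Ops F plus times negate (fun x y => opair x y ∊ lt) o i.

Let fun2E g : sat M (is_fun2 g F F F) -> forall x y z,
  sat M (app2 g x y z) <-> (x ∊ F /\ y ∊ F) /\ z = ap g (opair x y).
Proof.
move=> [p [/sat_prod -> /sat_is_fun G]] x y z.
split=> [[q [/sat_opair -> /sat_app /(ap_eq G)]]|[[xF yF] ->]].
  by rewrite opair_prod.
exists (opair x y); split; first exact/sat_opair.
by apply/sat_app; apply: (ap_mem G); rewrite opair_prod.
Qed.
Let fun2P g x y : sat M (is_fun2 g F F F) -> x ∊ F -> y ∊ F -> ap g (opair x y) ∊ F.
Proof.
by move=> [p [/sat_prod -> /sat_is_fun G]] xF yF; apply: (ap_in G); rewrite opair_prod.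
Qed.

Lemma fops_field : ofield fops.
Proof.
have [[fA [fM [oF [iF [oi [AA [AC' [A0 [AN [MA [MC [M1 [MV MD]]]]]]]]]]]]] [[ltI [ltT ltL]] [ltA ltM]]] := H.
have EA := fun2E fA; have EM := fun2E fM.
have pF x y : x ∊ F -> y ∊ F -> plus x y ∊ F by exact: fun2P.
have tF x y : x ∊ F -> y ∊ F -> times x y ∊ F by exact: fun2P.
have pE x y : x ∊ F -> y ∊ F -> sat M (app2 add x y (plus x y)) by move=> ? ?; apply/EA.
have tE x y : x ∊ F -> y ∊ F -> sat M (app2 mul x y (times x y)) by move=> ? ?; apply/EM.
have pA x y z : x ∊ F -> y ∊ F -> z ∊ F -> plus x (plus y z) = plus (plus x y) z.
  move=> xF yF zF; symmetry.
  have := AA _ _ _ _ _ _ (pE x y xF yF) (pE y z yF zF) (pE (plus x y) z (pF x y xF yF) zF).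
  by move=> /EA[].
have pC x y : x ∊ F -> y ∊ F -> plus x y = plus y x.
  by move=> xF yF; have /EA[] := AC' _ _ _ (pE x y xF yF).
have p0 x : x ∊ F -> plus o x = x by move=> xF; rewrite pC //; have /EA[_] := A0 x xF.
have nP x : x ∊ F -> negate x ∊ F /\ plus x (negate x) = o.
  move=> xF; rewrite /negate; have [y [yF /EA[_ E]]] := AN x xF.
  have U z : z ∊ F /\ plus x z = o -> z = y.
    move=> [zF E']; rewrite -(p0 z zF) [o in LHS]E pC //; last exact: pF.
    by rewrite -/(plus x y) [plus x y]pC // pA // [plus z y]pC // -pA // [plus z x]pC // E' pC // p0.
  by rewrite (the_eq (y := y)).
have tA x y z : x ∊ F -> y ∊ F -> z ∊ F -> times x (times y z) = times (times x y) z.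
  move=> xF yF zF; symmetry.
  have := MA _ _ _ _ _ _ (tE x y xF yF) (tE y z yF zF) (tE (times x y) z (tF x y xF yF) zF).
  by move=> /EM[].
have tC x y : x ∊ F -> y ∊ F -> times x y = times y x.
  by move=> xF yF; have /EM[] := MC _ _ _ (tE x y xF yF).
split; first split=> //=.
- by move=> x /nP[].
- by move=> x xF; have [nF E] := nP x xF; rewrite pC.
- by move=> x xF; rewrite tC //; have /EM[_] := M1 x xF.
- move=> x y z xF yF zF; have pxy := pF x y xF yF.
  have txz := tF x z xF zF; have tyz := tF y z yF zF.
  rewrite tC //.
  have /EA[_ ->] := MD z x y _ _ _ _ (pE x y xF yF) (tE z x zF xF) (tE z y zF yF) (tE z _ zF pxy).
  by rewrite -/(plus (times z x) (times z y)) (tC z x) // (tC z y).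
- by move=> /esym.
- by move=> x xF L; apply: (ltI x xF); apply/sat_app.
- move=> x y z xF yF zF L1 L2; apply/sat_app.
  by apply: (ltT x xF y yF z zF); apply/sat_app.
- move=> x y xF yF; case: (ltL x xF y yF) => [->|[/sat_app|/sat_app]]; auto.
- move=> x y z xF yF zF L; apply/sat_app.
  by apply: (ltA x xF y yF z zF) (pE x z xF zF) (pE y z yF zF); apply/sat_app.
- move=> x y xF yF L1 L2; apply/sat_app.
  by apply: (ltM x xF y yF) (tE x y xF yF); apply/sat_app.
- move=> x xF x0; have [y [yF /EM[_ E]]] := MV x xF x0; exists y => //=.
  by rewrite tC.
Qed.
Lemma fops_dops : dops fops.
Proof. by split; rewrite /= /plus /times /negate /plus; dfn. Qed.
End FieldOfModel.

(** The piecewise linear map with vertices (p, p), (q, s), (r, r). *)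
Section PiecewiseLinear.
Local Open Scope ring_scope.
Variable T : realFieldType.
Variables p q s r : T.
Hypotheses (pq : p < q) (qr : q < r) (ps : p < s) (sr : s < r).
Let al := (s - p) / (q - p).
Let be := (r - s) / (r - q).
Definition bend (x : T) : T :=
  if x <= p then x else if x <= q then p + (x - p) * ((s - p) / (q - p))
  else if x < r then s + (x - q) * ((r - s) / (r - q)) else x.
Let al0 : 0 < al. Proof. by rewrite divr_gt0 ?subr_gt0. Qed.
Let be0 : 0 < be. Proof. by rewrite divr_gt0 ?subr_gt0. Qed.
Let alE : (q - p) * al = s - p.
Proof. by rewrite /al mulrC divfK // subr_eq0 gt_eqF. Qed.
Let beE : (r - q) * be = r - s.
Proof. by rewrite /be mulrC divfK // subr_eq0 gt_eqF. Qed.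

(** Each case records linear facts, with the product by a slope bounded separately, so that
    monotonicity is left to linear arithmetic case by case. *)
Let bend_cases z : [\/ z <= p /\ bend z = z,
  p < z <= q /\ bend z = p + (z - p) * al /\ 0 < (z - p) * al <= s - p,
  q < z < r /\ bend z = s + (z - q) * be /\ 0 < (z - q) * be < r - s |
  r <= z /\ bend z = z].
Proof.
rewrite /bend -/al -/be; case: (leP z p) => zp; first by apply: Or41.
case: (leP z q) => zq.
  apply: Or42; split=> //; split=> //.
  by rewrite mulr_gt0 ?subr_gt0 //= -alE ler_pM2r ?al0 // lerD2r.
case: (ltP z r) => zr; last by apply: Or44.
apply: Or43; split=> //; split=> //.
by rewrite mulr_gt0 ?subr_gt0 //= -beE ltr_pM2r ?be0 // ltrD2r.
Qed.
Lemma bend_mono x y : x < y -> bend x < bend y.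
Proof.
move=> xy; have xya : x * al < y * al by rewrite ltr_pM2r // al0.
have xyb : x * be < y * be by rewrite ltr_pM2r // be0.
have h1 := pq; have h2 := qr; have h3 := ps; have h4 := sr.
case: (bend_cases x) => [[? ->]|[/andP[? ?] [-> /andP[? ?]]]|[/andP[? ?] [-> /andP[? ?]]]|[? ->]];
case: (bend_cases y) => [[? ->]|[/andP[? ?] [-> /andP[? ?]]]|[/andP[? ?] [-> /andP[? ?]]]|[? ->]]; lra.
Qed.
Lemma bend_inj x y : bend x = bend y -> x = y.
Proof.
by move=> E; case: (ltgtP x y) => // /bend_mono; rewrite E ltxx.
Qed.
Lemma bend_surj y : exists x, bend x = y.
Proof.
have a0 := al0; have b0 := be0; have aE := alE; have bE := beE.
have an : al != 0 by rewrite gt_eqF. have bn : be != 0 by rewrite gt_eqF.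
rewrite /bend -/al -/be; case: (leP y p) => yp; first by exists y; rewrite yp.
case: (leP y s) => ys.
  have E : (y - p) / al * al = y - p by rewrite divfK.
  have c0 : 0 < (y - p) / al by rewrite divr_gt0 // subr_gt0.
  exists (p + (y - p) / al); rewrite (_ : p + _ - p = (y - p) / al); last by ring.
  rewrite E leNgt ltrDl c0 /= ifT; first by ring.
  by rewrite -lerBrDl ler_pdivrMr // alE; lra.
case: (ltP y r) => yr; last first.
  have qy : q < y := lt_le_trans qr yr.
  by exists y; rewrite leNgt yp /= leNgt qy /= ltNge yr.
have c0 : 0 < (y - s) / be by rewrite divr_gt0 // subr_gt0.
exists (q + (y - s) / be); rewrite (_ : q + _ - q = (y - s) / be); last by ring.
have px : p < q + (y - s) / be by apply: (lt_trans pq); rewrite ltrDl.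
rewrite divfK // leNgt px /=.
rewrite leNgt ltrDl c0 /= ifT; first by ring.
by rewrite -ltrBrDl ltr_pdivrMr // beE; lra.
Qed.
Lemma bend_q : bend q = s.
Proof. by rewrite /bend leNgt pq /= lexx -/al alE; ring. Qed.
Lemma bend_out x : x <= p \/ r <= x -> bend x = x.
Proof.
rewrite /bend => -[->//|rx]; have qx : q < x := lt_le_trans qr rx.
by rewrite leNgt (lt_trans pq qx) /= leNgt qx /= ltNge rx.
Qed.
End PiecewiseLinear.

Section Gaps.
Context {M : structure} {HM : zfa M}.
Variable lt : M -> M -> Prop.
Implicit Types (a b c d e E : M).
Hypothesis dlt : Df anyp (fun e : nat -> M => lt (e 0) (e 1)).
Hypothesis ltT : forall a b c, atom M a -> atom M b -> atom M c -> lt a b -> lt b c -> lt a c.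
Hypothesis ltL : forall a b, atom M a -> atom M b -> a = b \/ lt a b \/ lt b a.
Hypothesis ltU : forall a, atom M a -> exists2 b, atom M b & lt a b.
Hypothesis ltD : forall a b, atom M a -> atom M b -> lt a b ->
  exists c, [/\ atom M c, lt a c & lt c b].

(** The bound [d] is lowered whenever a new element of [E] lies above [a]. The order is abstract so
    that its reverse yields the gap below. *)
Lemma gap E a : fin E -> atom M a -> exists d, [/\ atom M d, lt a d &
  forall e, e ∊ E -> atom M e -> lt a e -> lt d e].
Proof.
move=> fE aa; have : exists d, (atom M d /\ lt a d) /\
    forall e, e ∊ E -> atom M e -> lt a e -> lt d e.
  move: E fE; apply: fin_ind => [||E e _ _ [d [[ad L] Hd]]]; first by dfn.
    by have [d ad L] := ltU aa; exists d; split=> // e; rewrite in_emp.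
  case: (pselect (atom M e /\ lt a e)) => [[ae Le]|ne]; last first.
    exists d; split=> // e'; rewrite in_adj => -[/Hd//|->] ? ?; by case: ne.
  have [m [am Lm md me]] : exists m, [/\ atom M m, lt a m, m = d \/ lt m d & lt m e].
    case: (ltL ad ae) => [E'|[de|ed]].
    - have [c [ac L1 L2]] := ltD aa ae Le; exists c; split=> //; right; by rewrite E'.
    - by exists d; split=> //; left.
    - have [c [ac L1 L2]] := ltD aa ae Le; exists c; split=> //; right.
      exact: (ltT ac ae ad L2 ed).
  exists m; split=> // e'; rewrite in_adj => -[e'E|->] // ae' L'.
  by case: md => [->|md]; [exact: Hd|apply: (ltT am ad ae' md); exact: Hd].
by move=> [d [[ad L] Hd]]; exists d.
Qed.
End Gaps.

(** * The group of N3 *)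

Section OrderGroup.
Context {M : structure} {HM : zfa M}.
Variable R : M.
Hypothesis HR : sat M (rational_order R).
Implicit Types (a b c d n m x y z f g u E F : M).
Local Notation G := (order_automorphism R).
Local Notation lt a b := (opair a b ∊ R).

Lemma sat_order_automorphism f : sat M (G f) <->
  perm f /\ forall a b, atom M a -> atom M b -> lt a b <-> lt (act f a) (act f b).
Proof.
split=> [[A [/sat_atom_set -> [/sat_is_bij pf H]]]|[pf H]].
  split=> // a b; rewrite -!in_atoms => aA bA; have [[F _] _] := pf.
  have appE x : x ∊ atoms -> sat M (app f x (act f x)).
    move=> xA; apply/sat_app; rewrite act_atom //; last by rewrite -in_atoms.
    exact: (ap_mem F).
  have [E1 E2] := H a aA b bA (act f a) (act f b) (appE a aA) (appE b bA).
  by split=> [L|L]; apply/sat_app; [apply: E1|apply: E2]; apply/sat_app.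
exists atoms; split; first exact/sat_atom_set.
split; first exact/sat_is_bij.
move=> x xA y yA u v /sat_app xu /sat_app yv; have [[F _] _] := pf.
have [_ Eu] := ap_eq F xu; have [_ Ev] := ap_eq F yv; rewrite Eu Ev.
have ax : atom M x by rewrite -in_atoms. have ay : atom M y by rewrite -in_atoms.
have [H1 H2] := H x y ax ay; rewrite -!act_atom //.
by split=> /sat_app L; apply/sat_app; auto.
Qed.

Lemma order_group : perm_group G.
Proof.
have id1 : perm (lam atoms (@id M)) by exact: perm_id.
have idE x : act (lam atoms id) x = x by exact: (act_id full_group).
split.
- by move=> f /sat_order_automorphism[].
- by apply/sat_order_automorphism; split=> // a b _ _; rewrite !idE.
- move=> f g /sat_order_automorphism[pf Hf] /sat_order_automorphism[pg Hg].
  apply/sat_order_automorphism; split=> [|a b aa ab]; first exact: perm_comp.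
  rewrite !act_comp // Hg // Hf //; exact: act_isatom.
- move=> f /sat_order_automorphism[pf Hf]; apply/sat_order_automorphism.
  have pi := perm_inv pf; split=> // a b aa ab.
  by rewrite [X in _ <-> X]Hf ?actVK //; exact: act_isatom.
- move=> f Gf; have [pf Hf] := proj1 (sat_order_automorphism f) Gf.
  (* The set [R] may have members other than pairs of atoms and so need not be fixed by the group.
     Its restriction to pairs of atoms is fixed and defines the same automorphisms. *)
  pose (S := sep (prod atoms atoms) (fun x => x ∊ R)).
  have inS a b : atom M a -> atom M b -> (opair a b ∊ S) = lt a b.
    move=> aa ab; rewrite /S in_sep; last by dfn.
    by rewrite opair_prod !in_atoms; apply: propext; split=> [[]|].
  have fS : fixedby f S.
    have sub z : z ∊ S -> exists a b, [/\ atom M a, atom M b & z = opair a b].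
      rewrite /S in_sep; last by dfn.
      by rewrite in_prod => -[[a [b [aA [bA ->]]]] _]; exists a, b; rewrite -!in_atoms.
    have sS : isset S by exact: isset_sep.
    have up z : z ∊ S -> act f z ∊ S.
      move=> /[dup] zS /sub[a [b [aa ab E]]]; subst z; move: zS.
      by rewrite act_opair // !inS; [move/Hf; apply| | | |] => //; exact: act_isatom.
    apply: set_ext => // [|z]; first exact: act_isset.
    rewrite in_act //; split=> [[y /up yS ->]//|/[dup] zS /sub[a [b [aa ab E]]]].
    exists (opair (act (pinv f) a) (act (pinv f) b)); last by rewrite act_opair // !actVK.
    have pi := perm_inv pf; have ia := act_isatom pi aa; have ib := act_isatom pi ab.
    rewrite inS //; apply/Hf => //; rewrite !actVK //.
    by move: zS; rewrite E inS.
  apply: (@Df_ext _ _ (fun e => perm (e 0) /\ forall a b, atom M a -> atom M b ->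
      opair a b ∊ S <-> opair (act (e 0) a) (act (e 0) b) ∊ S)).
    move=> e; apply: iff_trans (sat_order_automorphism _) _.
    by split=> -[pe He]; split=> // a b aa ab; have := He a b aa ab;
      rewrite !inS //; exact: act_isatom.
  by dfn.
Qed.

Section Homogeneity.
Variables (K : ops M) (hK : ofield K) (dK : dops K) (g : M).
Hypothesis Hg : isbij g atoms (od K).
Hypothesis Hlt : forall a b, atom M a -> atom M b -> lt a b <-> olt K (ap g a) (ap g b).
Local Notation T := (ofT hK).
Local Notation toT := (toT hK).
Local Notation tV := (@tV M K hK).
Local Open Scope ring_scope.
Let rk a : T := toT (ap g a).
Let rkP a : atom M a -> ap g a ∊ od K.
Proof. by rewrite -in_atoms; have [[F _] _] := Hg; exact: (ap_in F). Qed.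
Let rk_lt a b : atom M a -> atom M b -> lt a b <-> rk a < rk b.
Proof.
move=> aa ab; apply: iff_trans (Hlt aa ab) _.
by apply: toT_lt; exact: rkP.
Qed.
Let rk_inj a b : atom M a -> atom M b -> rk a = rk b -> a = b.
Proof.
move=> aa ab E; have [[F I] _] := Hg; apply: I; rewrite ?in_atoms //.
by rewrite -(toTK hK (rkP aa)) -/(rk a) E toTK //; exact: rkP.
Qed.
Let rk_surj (t : T) : exists2 a, atom M a & rk a = t.
Proof.
have [_ S] := Hg; have [a aA E] := S (tV t) (tVP t).
by exists a; rewrite -?in_atoms // /rk E tVK.
Qed.

Section Bend.
Variables p q s r al be : M.
(** The graph of [bend] in terms of the operations of the model, with the two slopes as parameters,
    so that it is definable there. *)
Definition bend_rel x y : Prop :=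
  (~ olt K p x /\ y = x) \/ (olt K p x /\
  ((~ olt K q x /\ y = oadd K p (omul K (oadd K x (oopp K p)) al)) \/ (olt K q x /\
  ((olt K x r /\ y = oadd K s (omul K (oadd K x (oopp K q)) be)) \/ (~ olt K x r /\ y = x))))).
End Bend.

Lemma bend_perm (p q s r : T) : p < q -> q < r -> p < s -> s < r ->
  exists f, sat M (G f) /\ forall a, atom M a -> rk (act f a) = bend p q s r (rk a).
Proof.
move=> pq qr ps sr.
pose (rel := bend_rel (tV p) (tV q) (tV s) (tV r) (tV ((s - p) / (q - p))) (tV ((r - s) / (r - q)))).
have drel : Df anyp (fun e : nat -> M => rel (e 0%N) (e 1%N)).
  by have [? ? ? ?] := dK; rewrite /rel /bend_rel; dfn.
have relE a b : atom M a -> atom M b -> rel (ap g a) (ap g b) <-> rk b = bend p q s r (rk a).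
  move=> aa ab; have aK := rkP aa; have bK := rkP ab.
  have E t : ap g b = tV t <-> rk b = t.
    by rewrite /rk; split=> [->|<-]; rewrite ?tVK ?toTK.
  have Ea : ap g a = tV (rk a) by rewrite toTK.
  have L (t t' : T) : olt K (tV t) (tV t') = (t < t') :> Prop.
    by apply: propext; rewrite (toT_lt hK) ?tVK //; exact: tVP.
  rewrite /rel /bend_rel Ea !L /bend -!tV_opp -!tV_add -!tV_mul -!tV_add !E.
  case: (leP (rk a) p) => ap'; case: (leP (rk a) q) => aq; case: (ltP (rk a) r) => ar;
    intuition (try lra).
pose (f := lam atoms (fun a => the (fun b => atom M b /\ rel (ap g a) (ap g b)))).
have fP a : atom M a -> exists b, [/\ atom M b, rk b = bend p q s r (rk a) &
    the (fun b => atom M b /\ rel (ap g a) (ap g b)) = b].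
  move=> aa; have [b ab E] := rk_surj (bend p q s r (rk a)); exists b; split=> //.
  apply: the_eq; first by split=> //; exact/relE.
  by move=> z [az /(relE _ _ aa az) Ez]; apply: rk_inj => //; rewrite Ez E.
have df : Tm anyp (fun e : nat -> M => the (fun b => atom M b /\ rel (ap g (e 0%N)) (ap g b))).
  by dfn.
have fE a : atom M a -> atom M (ap f a) /\ rk (ap f a) = bend p q s r (rk a).
  move=> aa; rewrite /f ap_lam // ?in_atoms //.
  by have [b [ab E ->]] := fP a aa.
have pf : perm f.
  apply: isbij_lam => //.
  - by move=> x; rewrite !in_atoms => /fP[b [ab _ ->]].
  - move=> x y; rewrite !in_atoms => ax ay.
    have [b [ab Eb ->]] := fP x ax; have [c [ac Ec ->]] := fP y ay => bc.
    by apply: rk_inj => //; apply: (bend_inj pq qr ps sr); rewrite -Eb -Ec bc.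
  - move=> y; rewrite in_atoms => ay; have [t Et] := bend_surj pq qr ps sr (rk y).
    have [a aa Ea] := rk_surj t; exists a; rewrite ?in_atoms //.
    by have [b [ab Eb ->]] := fP a aa; apply: rk_inj => //; rewrite Eb Ea.
exists f; split; last by move=> a aa; rewrite (act_atom pf aa); have [] := fE a aa.
apply/sat_order_automorphism; split=> // a b aa ab; rewrite !act_atom //.
have [fa Ea] := fE a aa; have [fb Eb] := fE b ab.
apply: iff_trans (rk_lt aa ab) _; apply: iff_trans (iff_sym (rk_lt fa fb)).
rewrite Ea Eb; split; first exact: bend_mono.
case: (ltgtP (rk a) (rk b)) => // [L|->]; last by rewrite ltxx.
by move=> /(lt_trans (bend_mono pq qr ps sr L)); rewrite ltxx.
Qed.

Let dlt : Df anyp (fun e : nat -> M => lt (e 0%N) (e 1%N)).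
Proof. by dfn. Qed.
Let gt a b := lt b a.
Let dgt : Df anyp (fun e : nat -> M => gt (e 0%N) (e 1%N)).
Proof. by rewrite /gt; dfn. Qed.
Let lt_trans' a b c : atom M a -> atom M b -> atom M c -> lt a b -> lt b c -> lt a c.
Proof.
move=> aa ab ac /(rk_lt aa ab) L1 /(rk_lt ab ac) L2.
by apply/rk_lt => //; exact: lt_trans L1 L2.
Qed.
Let lt_tot a b : atom M a -> atom M b -> a = b \/ lt a b \/ lt b a.
Proof.
move=> aa ab; case: (ltgtP (rk a) (rk b)) => [L|L|/(rk_inj aa ab)]; auto.
  by right; left; exact/rk_lt.
by right; right; exact/rk_lt.
Qed.
Let mid a b : atom M a -> atom M b -> lt a b -> exists c, [/\ atom M c, lt a c & lt c b].
Proof.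
move=> aa ab /(rk_lt aa ab) L; have [c ac E] := rk_surj ((rk a + rk b) / 2).
by exists c; split=> //; apply/rk_lt => //; rewrite E; lra.
Qed.
Lemma gap_above E a : fin E -> atom M a -> exists d, [/\ atom M d, lt a d &
  forall e : M, e ∊ E -> atom M e -> lt a e -> lt d e].
Proof.
apply: gap => // c ac; have [d ad E'] := rk_surj (rk c + 1).
by exists d => //; apply/rk_lt => //; rewrite E'; lra.
Qed.
Lemma gap_below E a : fin E -> atom M a -> exists d, [/\ atom M d, lt d a &
  forall e : M, e ∊ E -> atom M e -> lt e a -> lt e d].
Proof.
apply: (@gap M HM gt) => //.
- by move=> x y z ax ay az xy yz; exact: (lt_trans' az ay ax).
- by move=> x y ax ay; case: (lt_tot ax ay) => [|[|]]; rewrite /gt; auto.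
- move=> c ac; have [d ad E'] := rk_surj (rk c - 1).
  by exists d => //; apply/rk_lt => //; rewrite E'; lra.
- by move=> x y ax ay /(mid ay ax)[c [ac L1 L2]]; exists c.
Qed.

Lemma order_homogeneous_over : homogeneous G (fun a b => lt a b).
Proof.
split.
- by dfn.
- by move=> f a b /sat_order_automorphism[pf Hf] aa ab; apply: iff_sym; exact: Hf.
- right=> a b aa ab ne; split=> [/(rk_lt ab aa) L /(rk_lt aa ab) /(lt_trans L)|nL].
    by rewrite ltxx.
  by case: (lt_tot aa ab) => [|[|]].
- move=> E a b sE aa ab H; case: (pselect (a = b)) => [<-|ne].
    exists (lam atoms id); split; last exact: (act_id full_group).
    by split; [exact: (pg_id order_group)|exact: (fixes_id order_group)].
  (* The smaller and the larger of [a] and [b], specified by what lies below and above them so that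
     both orders are treated at once. *)
  have [m [m' [am am' Hm Hm']]] : exists m m', [/\ atom M m, atom M m',
      forall c, atom M c -> lt c m <-> lt c a /\ lt c b &
      forall c, atom M c -> lt m' c <-> lt a c /\ lt b c].
    case: (lt_tot aa ab) => [//|[L|L]].
      exists a, b; split=> // c ac; split=> [L'|[]] //; split=> //.
        exact: (lt_trans' ac aa ab L').
      exact: (lt_trans' aa ab ac L).
    exists b, a; split=> // c ac; split=> [L'|[]] //; split=> //.
      exact: (lt_trans' ac ab aa L').
    exact: (lt_trans' ab aa ac L).
  (* No member of [E] lies strictly between [p] and [m] or between [m'] and [r], and none lies from
     [m] to [m'] because [a] and [b] have the same type. A map moving only points between [p] and
     [r] hence fixes [E]. *)
  have [p [apm pm Hp]] := gap_below (proj2 sE) am.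
  have [r [ar rm Hr]] := gap_above (proj2 sE) am'.
  have [pa pb] := proj1 (Hm p apm) pm; have [ar' br] := proj1 (Hm' r ar) rm.
  have [f [Gf Hf]] := bend_perm (proj1 (rk_lt apm aa) pa) (proj1 (rk_lt aa ar) ar')
    (proj1 (rk_lt apm ab) pb) (proj1 (rk_lt ab ar) br).
  have [pf _] := proj1 (sat_order_automorphism f) Gf.
  exists f; split; last first.
    by apply: rk_inj => //; [exact: act_isatom|rewrite Hf // bend_q //; exact/rk_lt].
  split=> // e eE; have ae := supp_atom sE eE; have [[E1 E2] [L1 L2]] := H e eE.
  apply: rk_inj => //; first exact: act_isatom.
  rewrite Hf //; apply: bend_out; try exact/rk_lt.
  have ea : e <> a by move=> E'; apply: ne; rewrite -(E1 E').
  have eb : e <> b by move=> E'; apply: ne; rewrite -(E2 E').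
  case: (lt_tot ae aa) => [//|[La|La]].
    by left; apply/ltW/rk_lt => //; apply: Hp => //; apply/Hm => //; split=> //; exact: L1.
  right; apply/ltW/rk_lt => //; apply: Hr => //; apply/Hm' => //; split=> //.
  case: (lt_tot ae ab) => [//|[Lb|//]]; move/L2: Lb => /(rk_lt ae aa) K1.
  by move/(rk_lt aa ae): La => /(lt_trans K1); rewrite ltxx.
- move=> E a sE aa aE; have [c [ac L Hc]] := gap_above (proj2 sE) aa.
  have La := proj1 (rk_lt aa ac) L.
  exists c; split=> //.
  + by move=> cE; have /(rk_lt ac ac) := Hc c cE ac L; rewrite ltxx.
  + by move=> E'; move: La; rewrite E' ltxx.
  move=> e eE; have ae := supp_atom sE eE; split.
    split=> E'; first by case: aE; rewrite -E'.
    have L' : lt a e by rewrite E'.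
    by move/(rk_lt ac ae): (Hc e eE ae L'); rewrite E' ltxx.
  split=> [L'|L']; first exact: (lt_trans' ae aa ac L').
  case: (lt_tot ae aa) => [E'|[//|/(Hc e eE ae)]]; first by case: aE; rewrite -E'.
  move=> /(rk_lt ac ae) K1; move/(rk_lt ae ac): L' => /(lt_trans K1); by rewrite ltxx.
Qed.
End Homogeneity.

Lemma order_homogeneous : homogeneous G (fun a b => lt a b).
Proof.
have [A [/sat_atom_set -> [_ [_ [Q [add [mul [ltQ [o [i [g [[F _] [/sat_is_bij Hg H]]]]]]]]]]]]] := HR.
apply: (order_homogeneous_over (fops_field F) (fops_dops Q add mul ltQ o i) Hg) => a b.
rewrite -!in_atoms => aA bA; have [[Fg _] _] := Hg.
have [H1 H2] := H a aA b bA (ap g a) (ap g b)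
  (proj2 (sat_app _ _ _) (ap_mem Fg aA)) (proj2 (sat_app _ _ _) (ap_mem Fg bA)).
by split=> L; apply/sat_app; [apply: H1|apply: H2]; apply/sat_app.
Qed.
End OrderGroup.

(** * Spaces in the three models *)

Section Compactness.
Context {M : structure} {HM : zfa M}.
Implicit Types (X T Y x y u : M).
Lemma infinite_fin X : isset X -> sat M (infinite X) <-> ~ fin X.
Proof. by move=> sX; split=> H /(sat_finite sX). Qed.
Lemma compact_limit_point X T : topo X T -> sat M (compact X T) ->
  sat M (limit_point_compact X T).
Proof.
move=> HT C Y YX /infinite_fin nY.
have [|x xX H] := compact_accumulation HT C YX; first by apply: nY; exact: (proj1 YX).
by exists x; split=> // u uT xu; have [y yY [yu yx]] := H u uT xu; exists y.
Qed.
End Compactness.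

Lemma ground_zfa (M : structure) (m : M) : ground_model M -> zfa M.
Proof. by move=> [H _]; split=> //; exists. Qed.

Section Spaces.
Context {M : structure} {HM : zfa M}.
Hypothesis HAC : M ⊨ AC.
Variable G : M -> fm M.
Hypothesis HG : perm_group G.
Notation N := (N G).
Notation Gp f := (sat M (G f)).
Local Instance zfaN'' : zfa N := zfaN HG.

Section Homogeneous.
Variable lt : M -> M -> Prop.
Hypothesis HH : homogeneous G lt.

Lemma homogeneous_well_orderable : N ⊨ limit_point_compact_T1_well_orderable.
Proof.
move=> X T /sat_topology HT FC LP T1.
have [E [sE SX]] := HS_symm (valP HG X).
have fixX := @fixed_pointwise M HM G HG lt X T E HH HT FC LP T1 sE SX.
have sX : isset (val X) by exact: (proj1 (proj1 (proj1 HT))).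
have [R RX wR] := zermelo HAC sX.
have HSX x : x ∊ val X -> HS G x := HS_mem (valP HG X).
have RE z : z ∊ R -> exists x y, [/\ x ∊ val X, y ∊ val X & z = opair x y].
  by move/(proj2 RX); rewrite in_prod => -[x [y [xX [yX ->]]]]; exists x, y.
have HSR : HS G R.
  apply: HS_intro => [|z /RE[x [y [xX yX ->]]]]; last by apply: HS_opair => //; exact: HSX.
  exists E; split=> //; apply: (supports_closed HG); first exact: (proj1 RX).
  move=> f z Gf Ef zR; have [x [y [xX yX E']]] := RE z zR; subst z.
  by rewrite act_opair ?(fixX x xX f) ?(fixX y yX f) //; exact: (pg_perm HG).
have [R' ER] := mkN_ex HG HSR.
have inR (x y : N) : (opair x y ∊ R') = (opair (val x) (val y) ∊ R).
  by rewrite -(val_opair HG) -ER.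
have [[irr tr] [tot wf]] := wR.
exists R'; apply: sat_well_order; split; split.
- by move=> x xX; rewrite inR; exact: irr.
- by move=> x y z xX yX zX; rewrite !inR; exact: tr.
- move=> x y xX yX; rewrite !inR.
  by case: (tot (val x) (val y) xX yX) => [/val_inj|]; auto.
- move=> Y YX [y yY].
  have YX' : sub (val Y) (val X).
    split=> [|z zY]; first exact: (proj1 YX).
    by have [z' Ez] := mem_val HG zY; rewrite -Ez in zY *; exact: (proj2 YX).
  have [m mY Hm] := wf (val Y) YX' (ex_intro _ (val y) yY).
  have [m' Em] := mem_val HG mY; exists m'; first by rewrite -Em in mY.
  move=> z zY; rewrite inR Em; case: (Hm (val z) zY) => [E'|]; last by auto.
  by left; apply: val_inj; rewrite Em.
Qed.
End Homogeneous.

Lemma orbit_fixed E x : (forall f, Gp f -> fixes E f -> act f x = x) -> fin (orbit G E x).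
Proof.
move=> S; have -> : orbit G E x = sing x.
  apply: set_eqP => [||z]; [exact: isset_orbit|exact: isset_sing|].
  rewrite (in_orbit HG) in_sing; apply: propext; split=> [[f [[Gf Ef] ->]]|->]; first exact: S.
  exists (lam atoms id); split; last by rewrite (act_id HG).
  by split; [exact: (pg_id HG)|exact: (fixes_id HG)].
exact: fin_sing.
Qed.

(** What the construction of converging sets demands of the group. For homogeneous groups it follows
    from pointwise fixing, for N2 from the finiteness of the pairs. *)
Definition finite_orbits : Prop := forall (X T : N), topo X T ->
  sat N (first_countable X T) -> sat N (hausdorff X T) -> sat N (compact X T) ->
  forall E x, supp E -> supports G E (val X) -> x ∊ val X -> fin (orbit G E x).

Lemma homogeneous_finite_orbits lt : homogeneous G lt -> finite_orbits.
Proof.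
move=> HH X T HT FC H C E x sE SX xX; apply: orbit_fixed.
apply: (@fixed_pointwise M HM G HG lt X T E HH HT FC _ _ sE SX) => //.
  exact: compact_limit_point.
exact: hausdorff_T1.
Qed.

Lemma converging_space (X T : N) : finite_orbits -> topo X T -> sat N (infinite X) ->
  sat N (first_countable X T) -> sat N (hausdorff X T) -> sat N (compact X T) ->
  exists p W r : N, ((sub W X /\ p ∊ W) /\
  ((forall x : N, x ∊ W -> x <> p -> ap r x ∊ omega) /\
   (forall u : N, u ∊ T -> p ∊ u -> exists2 n : N, n ∊ omega & tail W p r n u))) /\
  ((forall n : N, n ∊ omega -> fin (sep W (fun x : N => x <> p /\ ap r x ∊ n))) /\ ~ fin W) /\
  ((forall E x, supp E -> supports G E (val X) -> x ∊ val X -> supports G E x) ->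
   forall x y : N, x ∊ W -> y ∊ W -> x <> p -> y <> p -> ap r x = ap r y -> x = y).
Proof.
move=> FO HT; have sX := proj1 (proj1 (proj1 HT)); move=> /(infinite_fin sX) nX FC H C.
have XX : sub X X by [].
have [p pX acc] := compact_accumulation HT C XX nX.
exists p; apply: (@converging_subset M HM G HG X T p HAC HT FC (hausdorff_T1 H) pX acc).
exact: (FO X T HT FC H C).
Qed.

Lemma contains_N_infty lt : homogeneous G lt -> N ⊨ compact_hausdorff_contains_N_infty.
Proof.
move=> HH X T /sat_topology HT nX FC H C.
have FO := homogeneous_finite_orbits HH.
have [p [W [r [[[WX pW] [Hr Hlim]] [[Hfin Hinf] Hinj]]]]] := converging_space FO HT nX FC H C.
apply: (W_N_infty HT H WX pW Hr Hlim Hfin Hinf); apply: Hinj => E x sE SX xX.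
apply: (@fixed_pointwise M HM G HG lt X T E HH HT FC _ _ sE SX) => //.
  exact: compact_limit_point.
exact: hausdorff_T1.
Qed.

Lemma contains_metrizable_scattered : finite_orbits ->
  N ⊨ compact_hausdorff_contains_metrizable_scattered.
Proof.
move=> FO X T /sat_topology HT nX FC H C.
have [p [W [r [[[WX pW] [Hr Hlim]] [[Hfin Hinf] _]]]]] := converging_space FO HT nX FC H C.
exists W, (subspace X T W); split; first exact: sat_subspace.
split; first by apply/infinite_fin => //; exact: (proj1 WX).
split; first exact: (W_metrizable HT H WX pW Hr Hlim Hfin).
split; first exact: (W_compact HT H WX pW Hlim Hfin).
exact: (W_scattered HT H WX pW Hlim Hfin).
Qed.
End Spaces.

Lemma denumerable_atoms (M : structure) (HM : zfa M) :
  M ⊨ denumerably_many_atoms -> ~ fin atoms.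
Proof. by move=> [A [/sat_atom_set -> /denumerable_infinite]]. Qed.

Theorem N1_well_orderable : true_in_N1 limit_point_compact_T1_well_orderable.
Proof.
move=> M HM D; have HZ : zfa M by case: D => A _; exact: (ground_zfa A).
apply: (homogeneous_well_orderable (proj2 HM) full_group).
exact: (full_homogeneous (denumerable_atoms D)).
Qed.
Theorem N1_N_infty : true_in_N1 compact_hausdorff_contains_N_infty.
Proof.
move=> M HM D; have HZ : zfa M by case: D => A _; exact: (ground_zfa A).
apply: (contains_N_infty (proj2 HM) full_group).
exact: (full_homogeneous (denumerable_atoms D)).
Qed.
Theorem N3_N_infty : true_in_N3 compact_hausdorff_contains_N_infty.
Proof.
move=> M HM R HR; have HZ : zfa M by exact: (ground_zfa R).
exact: (contains_N_infty (proj2 HM) (order_group R) (order_homogeneous HR)).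
Qed.
Theorem N2_metrizable : true_in_N2 compact_hausdorff_contains_metrizable_scattered.
Proof.
move=> M HM P HP; have HZ : zfa M by exact: (ground_zfa P).
apply: (contains_metrizable_scattered (proj2 HM) (HG := pair_group HP)).
move=> X T _ _ _ _ E x _ _ xX; apply: (fin_orbit HP).
exact: (HS_mem (valP (pair_group HP) X) xX).
Qed.
(** IQDI and CMC are refuted in N1, so the sentence on metrizable subspaces has to hold there
    too. *)
Theorem N1_metrizable : true_in_N1 compact_hausdorff_contains_metrizable_scattered.
Proof.
move=> M HM D; have HZ : zfa M by case: D => A _; exact: (ground_zfa A).
apply: (contains_metrizable_scattered (proj2 HM) (HG := full_group)).
apply: homogeneous_finite_orbits.
exact: (full_homogeneous (denumerable_atoms D)).
Qed.

(** * Soundness *)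

Section Soundness.
Implicit Types (p q : form).

Lemma sat_ren (M : structure) (p : form) (r : nat -> nat) (e e' : nat -> M) :
  (forall i, e (r i) = e' i) -> sat M (embed (ren r p) e) <-> sat M (embed p e').
Proof. by move=> H; rewrite embed_ren; apply: sat_embed_ext. Qed.

Lemma sat_inst (M : structure) p i (e : nat -> M) :
  sat M (embed (inst i p) e) <-> sat M (embed p (scons (e i) e)).
Proof. by apply: sat_ren => -[]. Qed.
Lemma sat_shift (M : structure) p x (e : nat -> M) :
  sat M (embed (shift p) (scons x e)) <-> sat M (embed p e).
Proof. exact: sat_ren. Qed.

Lemma sat_shift_hyps (M : structure) (G : list form) x (e : nat -> M) :
  (forall q, List.In q G -> sat M (embed q e)) ->
  forall q, List.In q (List.map shift G) -> sat M (embed q (scons x e)).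
Proof. by move=> H q /List.in_map_iff[p [<- /H]] /sat_shift. Qed.

Lemma sound (M : structure) (T : form -> Prop) (G : list form) p :
  (forall q, T q -> forall e : nat -> M, sat M (embed q e)) -> proves T G p ->
  forall e : nat -> M, (forall q, List.In q G -> sat M (embed q e)) -> sat M (embed p e).
Proof.
move=> HT; elim => {G p} /=.
- by move=> G p /HT.
- by move=> G p pG e; apply.
- by move=> G p q _ IH e H pe; apply: IH => r [<-//|/H].
- by move=> G p q _ IH1 _ IH2 e H; apply: (IH1 e H); exact: IH2.
- by move=> G p q _ IH1 _ IH2 e H; split; [exact: IH1|exact: IH2].
- by move=> G p q _ IH e /IH[].
- by move=> G p q _ IH e /IH[].
- by move=> G p q _ IH e /IH; left.
- by move=> G p q _ IH e /IH; right.
- move=> G p q r _ IH _ IHp _ IHq e H; case: (IH e H) => [pe|qe].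
    by apply: IHp => s [<-//|/H].
  by apply: IHq => s [<-//|/H].
- by move=> G p _ IH e /IH /contrapT.
- by move=> G p _ IH e H x; apply: IH; exact: sat_shift_hyps.
- by move=> G p i _ IH e /IH H; apply/sat_inst; exact: H.
- by move=> G p i _ IH e /IH /sat_inst H; exists (e i).
- move=> G p q _ IH _ IHq e H; have [x px] := IH e H.
  by apply/(sat_shift q x); apply: IHq => r [<-//|]; exact: sat_shift_hyps.
- by [].
- by move=> G i j p _ IH1 _ IH2 e H; apply/sat_inst; rewrite -(IH1 e H); exact/sat_inst/IH2.
Qed.

(** [r i d] is the de Bruijn index of the variable [i] at depth [d]. *)
Lemma compile_embed p (r : nat -> nat -> nat) d :
  (forall i k, (d <= k)%N -> r i k.+1 = (r i k).+1) ->
  compile d (embed p r) = ren (fun i => r i d) p.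
Proof.
have ext k (s : nat -> nat -> nat) : (forall i m, (k <= m)%N -> s i m.+1 = (s i m).+1) ->
    (forall i m, (k.+1 <= m)%N -> scons (fun m => m - k.+1) s i m.+1 = (scons (fun m => m - k.+1) s i m).+1) /\
    (fun i => scons (fun m => m - k.+1) s i k.+1) = scons 0 (fun i => (s i k).+1).
  move=> H; split=> [[|i] m km|]; [by rewrite /= -subSn|by apply: H; exact: ltnW|].
  by apply: funext => -[|i] /=; rewrite ?subnn // H.
elim: p r d => //= [p IHp q IHq|p IHp q IHq|p IHp q IHq|p IH|p IH] r d H; rewrite ?IHp ?IHq //;
  have [H1 H2] := ext d r H; by rewrite IH ?H2.
Qed.

Lemma sat_compile (M : structure) p (r : nat -> nat -> nat) d (e e' : nat -> M) :
  (forall i k, (d <= k)%N -> r i k.+1 = (r i k).+1) -> (forall i, e (r i d) = e' i) ->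
  sat M (embed (compile d (embed p r)) e) <-> sat M (embed p e').
Proof. by move=> Hr He; rewrite compile_embed //; exact: sat_ren. Qed.

(** Replacement binds the value and the argument of [phi] at two levels [a] and [b]; at depth [d]
    their indices are [d - a] and [d - b]. *)
Lemma sat_compile2 (M : structure) p a b d (e e' : nat -> M) : (a <= d)%N -> (b <= d)%N ->
  e (d - a)%N = e' 0 -> e (d - b)%N = e' 1 -> (forall i, e (d + i)%N = e' i.+2) ->
  sat M (embed (compile d (embed p (scons (Nat.sub^~ a) (scons (Nat.sub^~ b)
    (fun i m => (m + i)%coq_nat))))) e) <-> sat M (embed p e').
Proof.
move=> ad bd Ea Eb Ei; apply: sat_compile => [[|[|i]] k dk|[|[|i]]] //=.
  exact: subSn (leq_trans ad dk).
exact: subSn (leq_trans bd dk).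
Qed.

(** The single axioms evaluate to themselves by computation. In the two schemata [phi] passes
    through [compile], and its variables have to be followed under the new binders. *)
Lemma sat_quote_open (M : structure) (q : open_formula) (e : nat -> M) :
  ZFA q -> sat M (q M e) -> sat M (embed (quote_open q) e).
Proof.
case=> [|||||||||phi|phi] H; try exact: H; rewrite /quote_open /=.
  move=> a; have [b [bs Hb]] := H a; exists b; split=> // x.
  have E : sat M (embed (compile 3 (embed phi
      (scons (fun m : nat => m - 3) (fun i m => (m + i)%coq_nat)))) (scons x (scons b (scons a e))))
      <-> sat M (embed phi (scons x e)).
    apply: sat_compile => [[|i] k dk|[|i]] //=.
    by move: dk; case: k => [|[|[|[|k]]]].
  have [H1 H2] := Hb x; split; first by move=> /H1 [xa /E].
  by move=> [xa /E Hx]; apply: H2.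
move=> F a; have [|b [bs Hb]] := H _ a.
  move=> x y z Hy Hz; apply: (F x y z).
    by apply/(@sat_compile2 M phi 2 1 3 _ (scons y (scons x e))).
  by apply/(@sat_compile2 M phi 3 1 3 _ (scons z (scons x e))).
exists b; split=> // y.
have E x : sat M (embed (compile 4 (embed phi (scons (Nat.sub^~ 3) (scons (Nat.sub^~ 4)
    (fun i m => (m + i)%coq_nat))))) (scons x (scons y (scons b (scons a e)))))
    <-> sat M (embed phi (scons y (scons x e))) by exact: sat_compile2.
have [H1 H2] := Hb y; split=> [/H1|] [x [xa Hx]]; first by exists x; split=> //; exact/E.
by apply: H2; exists x; split=> //; exact/E.
Qed.

Lemma ZFA_sound (M : structure) (HM : zfa M) (p : sentence) (e : nat -> M) : ZFA_proves p ->
  sat M (embed (quote p) e).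
Proof.
move=> Hp; apply: (sound _ Hp) => // q [s [Hs ->]] e'.
by apply: sat_quote_open => //; exact: zfa_axiom.
Qed.

(** The hypothesis on [quote] is there because a [sentence] is an arbitrary family indexed by [V],
    whose instances at different types need not agree. For a concrete sentence it holds by
    computation. *)
Lemma not_implied (M : structure) (HM : zfa M) (p q : sentence) :
  (forall e : nat -> M, sat M (embed (quote (implies p q)) e) <-> (M ⊨ p -> M ⊨ q)) ->
  M ⊨ p -> ~ M ⊨ q -> ~ ZFA_proves (implies p q).
Proof.
move=> E Hp nq H; have [m] := @zfa_inhabited M HM; apply: nq.
by apply: (proj1 (E (fun=> m)) _ Hp); exact: ZFA_sound.
Qed.
End Soundness.

(** * Failure of the choice principles *)

Section Enumerations.
Context {M : structure} {HM : zfa M}.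
Implicit Types (a b c f g h m n x y z E D : M).

Lemma denumerable_bij h D : isbij h omega D -> sat M (denumerable D).
Proof.
move=> [[F I] S]; exists omega; split; first exact/sat_is_omega.
pose (inv y := the (fun n => n ∊ omega /\ ap h n = y)).
have invE n : n ∊ omega -> inv (ap h n) = n.
  by move=> no; apply: the_eq => // z [zo /I]; apply.
have dinv : Tm anyp (fun e : nat -> M => inv (e 0)) by rewrite /inv; dfn.
exists (lam D inv); apply/sat_is_bij; apply: isbij_lam => //.
- by move=> x /S[n no <-]; rewrite invE.
- by move=> x y /S[n no <-] /S[m mo <-]; rewrite !invE // => ->.
- by move=> n no; exists (ap h n); [exact: (ap_in F)|exact: invE].
Qed.

(** The internal pigeonhole principle: from an injection of [succ n] into [adj E a], replacing the
    value [a] by the value at [n] yields an injection of [n] into [E]. *)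
Lemma finite_no_injection E : fin E -> exists2 n, n ∊ omega & forall g, ~ isinj g n E.
Proof.
move: E; apply: fin_ind => [||E a _ _ [n no H]]; first by dfn.
  exists (succ emp); first exact: omegaS omega0.
  move=> g [F _]; have := ap_in F (lt0S omega0).
  by rewrite in_emp.
exists (succ n); first exact: omegaS.
move=> g [F I]; have nn : n ∊ succ n by rewrite in_adj; right.
have sub x : x ∊ n -> x ∊ succ n by rewrite in_adj; left.
pose (v x := the (fun y => (ap g x = a /\ y = ap g n) \/ (ap g x <> a /\ y = ap g x))).
have v1 x : ap g x = a -> v x = ap g n by move=> Ex; apply: the_eq => [|z [[]|[]]]; auto.
have v2 x : ap g x <> a -> v x = ap g x by move=> Ex; apply: the_eq => [|z [[]|[]]]; auto.
have dv : Tm anyp (fun e : nat -> M => v (e 0)) by rewrite /v; dfn.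
have gE x : x ∊ succ n -> ap g x <> a -> ap g x ∊ E.
  by move=> /(ap_in F); rewrite in_adj => -[].
have ne x y : x ∊ n -> ap g x = a -> ap g n <> a.
  by move=> xn E1 E2; apply: (@mem_irrefl M HM n); rewrite -{1}(I x n (sub x xn) nn) // E1.
apply: (H (lam n v)); apply: isinj_lam => //.
- move=> x xn; case: (pselect (ap g x = a)) => Ex; last by rewrite v2 //; apply: gE => //; exact: sub.
  by rewrite v1 //; apply: gE => //; exact: (ne x x).
have lt x : x ∊ n -> ap g n <> ap g x.
  move=> xn E'; apply: (@mem_irrefl M HM n).
  by rewrite -{1}(I x n (sub x xn) nn).
move=> x y xn yn; case: (pselect (ap g x = a)) => Ex; case: (pselect (ap g y = a)) => Ey.
- by move=> _; apply: I; rewrite ?Ex ?Ey //; exact: sub.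
- by rewrite v1 // v2 // => /(lt y yn).
- by rewrite v2 // v1 // => /esym /(lt x xn).
- by rewrite !v2 //; apply: I; exact: sub.
Qed.

Lemma injection_infinite h b : isinj h omega b -> ~ fin b.
Proof.
move=> [F I] fb; apply: omega_infinite.
pose (inv y := the (fun n => n ∊ omega /\ ap h n = y)).
have invE n : n ∊ omega -> inv (ap h n) = n.
  by move=> no; apply: the_eq => // z [zo /I]; apply.
have dinv : Tm anyp (fun e : nat -> M => inv (e 0)) by rewrite /inv; dfn.
have dr : Df anyp (fun e : nat -> M => exists2 n, n ∊ omega & ap h n = e 0) by dfn.
have -> : omega = repl (sep b (fun y => exists2 n, n ∊ omega & ap h n = y)) inv.
  apply: set_eqP => [||n]; [exact: isset_omega|exact: isset_repl|].
  rewrite in_repl //; apply: propext; split=> [no|[y]].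
    by exists (ap h n); rewrite ?invE // in_sep //; split; [exact: (ap_in F)|exists n].
  by rewrite in_sep // => -[_ [m mo <-]] ->; rewrite invE.
apply: fin_repl => //; apply: (fin_sub fb).
by split=> [|y]; [exact: isset_sep|rewrite in_sep // => -[]].
Qed.
End Enumerations.

Section SymmetricEnumerations.
Context {M : structure} {HM : zfa M}.
Variable G : M -> fm M.
Hypothesis HG : perm_group G.
Notation N := (N G).
Local Instance zfaN3 : zfa N := zfaN HG.
Implicit Types (h D : M).

Lemma denumerable_lift h D : isbij h omega D -> HS G h -> HS G D ->
  exists2 D' : N, val D' = D & sat N (denumerable D').
Proof.
move=> H /(mkN_ex HG)[h' Eh] /(mkN_ex HG)[D' ED]; exists D' => //.
apply: (denumerable_bij (h := h')); apply: (isbij_lift HG).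
by rewrite (val_omega HG) Eh ED.
Qed.

Lemma fun_on_val (f F : N) : sat N (is_fun_on f F) -> exists b, isfun (val f) (val F) b.
Proof.
by move=> [b /sat_is_fun H]; exists (val b); exact: (isfun_val (HG := HG) H).
Qed.

Lemma sat_app_val (f x y : N) : opair (val x) (val y) ∊ val f -> sat N (app f x y).
Proof. by rewrite -(val_opair HG) => H; apply/sat_app. Qed.
End SymmetricEnumerations.

Section RefuteCAC.
Context {M : structure} {HM : zfa M}.
Variable P : M.
Hypothesis HP : sat M (pair_partition P).
Local Notation G := (pair_preserving P).
Local Notation N := (N G).
Let HG : perm_group G := pair_group HP.
Local Instance zfaN4 : zfa N := zfaN HG.
Implicit Types (a b n x y E : M).

Let HSpair n : n ∊ omega -> HS G (ap P n).
Proof.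
move=> no; apply: (HS_fin HG (fin_pair HP no)) => a an.
exact: (HS_atom G (pair_atom HP no an)).
Qed.

(** A choice function on the family of pairs has a finite support. Transposing the two atoms of a
    pair that misses the support fixes the function and the pair but moves the chosen atom. *)
Lemma N2_refutes_CAC_fin : ~ N ⊨ CAC_fin.
Proof.
move=> C; have [b F] := pair_fun HP.
pose (D := repl omega (ap P)).
have inD x : (x ∊ D) = exists2 n, n ∊ omega & x = ap P n by rewrite /D in_repl //; dfn.
have bij : isbij P omega D.
  split; last by move=> y; rewrite inD => -[n no ->]; exists n.
  split=> [|m n mo no E].
    by apply: (isfun_cod F) => n no; rewrite inD; exists n.
  have [c [d [_ _ _ En]]] := pairE HP no; have cn : c ∊ ap P n by rewrite En in_upair; left.
  by apply: (pair_disj HP mo no _ cn); rewrite E.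
have HSP : HS G P.
  apply: HS_intro => [|y /(in_fun F)[n no ->]].
    by exists emp; split=> [|f Gf _]; [exact: supp_emp|exact: (act_P HP)].
  by apply: (HS_opair HG); [exact: (HS_nat HG)|exact: HSpair].
have HSD : HS G D.
  apply: HS_intro => [|y]; last by rewrite inD => -[n no ->]; exact: HSpair.
  exists emp; split=> [|f Gf _]; first exact: supp_emp.
  have [pf Hf] := proj1 (sat_pair_preserving HP f) Gf.
  apply: set_eqP => [||y]; [apply: act_isset => //; exact: isset_repl|exact: isset_repl|].
  rewrite in_act //; last exact: isset_repl.
  rewrite inD; apply: propext; split=> [[z]|[n no ->]].
    by rewrite inD => -[n no ->] ->; exists n => //; exact: Hf.
  by exists (ap P n); [rewrite inD; exists n|rewrite Hf].
have [D' ED denD] := denumerable_lift HG bij HSP HSD.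
have [x xD|f [Ff Hc]] := C D' denD.
  have : val x ∊ D by rewrite -ED.
  rewrite inD => -[n no Ex]; split.
    have [c [d [ac _ _ En]]] := pairE HP no.
    have [c' Ec] := mkN_ex HG (HS_atom G ac); exists c'.
    by change (val c' ∊ val x); rewrite Ec Ex En in_upair; left.
  have fx : fin x by apply: (fin_lift HG); rewrite Ex; exact: (fin_pair HP no).
  by apply/sat_finite => //; exact: isset_fin.
have [c Fv] := fun_on_val HG Ff; rewrite ED in Fv.
have [E [[EA fE] S]] := HS_symm (valP HG f).
pose (idx a := the (fun n => n ∊ omega /\ a ∊ ap P n)).
have didx : Tm anyp (fun e : nat -> M => idx (e 0)) by rewrite /idx; dfn.
(* An index different from those of all pairs met by the support [E]. *)
have [n no nE] := infinite_diff isset_omega omega_infinite (fin_repl didx fE).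
have nE' a : a ∊ ap P n -> ~ a ∊ E.
  move=> an aE; apply: nE; rewrite in_repl //; exists a => //; symmetry.
  by apply: the_eq => // m [mo am]; exact: (pair_disj HP mo no am an).
have [a [d [aa ad ne En]]] := pairE HP no.
have pt : perm (transp a d) by exact: perm_transp.
have Gt : sat M (G (transp a d)).
  apply/(sat_pair_preserving HP); split=> // m mo.
  case: (pselect (m = n)) => [->|mn].
    rewrite En; apply: set_eqP => [||y]; [apply: act_isset => //; exact: isset_upair|exact: isset_upair|].
    have su : isset (upair a d) by exact: isset_upair.
    rewrite in_act //.
    rewrite in_upair; apply: propext; split=> [[z]|[->|->]].
    - by rewrite in_upair => -[->|->] ->; rewrite act_transp // ?swapl ?swapr; auto.
    - by exists d; [rewrite in_upair; right|rewrite act_transp // swapr].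
    - by exists a; [rewrite in_upair; left|rewrite act_transp // swapl].
  have out y : y ∊ ap P m -> act (transp a d) y = y.
    move=> ym; rewrite act_transp //; last exact: (pair_atom HP mo ym).
    apply: swap_out => E'; apply: mn; apply: (pair_disj HP mo no ym);
      rewrite En in_upair E'; by [left|right].
  have sm := pair_isset HP mo.
  apply: set_ext => // [|y]; first exact: act_isset.
  rewrite in_act //; split=> [[z zm ->]|ym]; first by rewrite out.
  by exists y => //; rewrite out.
have tE : fixes E (transp a d).
  move=> e eE; rewrite act_transp //; last by rewrite -in_atoms; exact: (proj2 EA).
  by apply: swap_out => E'; apply: (nE' e) => //; rewrite En in_upair; auto.
have nD : ap P n ∊ D by rewrite inD; exists n.
pose (y := ap (val f) (ap P n)); have yf : opair (ap P n) y ∊ val f := ap_mem Fv nD.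
have yn : y ∊ ap P n.
  have [x' Ex] := mkN_ex HG (HSpair no).
  have HSy : HS G y.
    have := HS_mem (valP HG f) yf => Hp.
    have up : upair (ap P n) y ∊ opair (ap P n) y by rewrite /opair in_upair; right.
    by apply: (HS_mem (HS_mem Hp up)); rewrite in_upair; right.
  have [y' Ey] := mkN_ex HG HSy.
  rewrite -Ex -Ey; apply: (Hc x' _ y'); first by change (val x' ∊ val D'); rewrite Ex ED.
  by apply: (sat_app_val HG); rewrite Ex Ey.
have : opair (ap P n) (act (transp a d) y) ∊ val f.
  have [_ Ht] := proj1 (sat_pair_preserving HP (transp a d)) Gt.
  by rewrite -{1}(Ht n no) -act_opair // -(S _ Gt tE); exact: act_mem.
move=> /(ap_eq Fv)[_]; rewrite -/y act_transp //; last exact: (pair_atom HP no yn).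
by move: yn; rewrite En in_upair => -[->|->]; rewrite ?swapl ?swapr; auto.
Qed.
End RefuteCAC.

Section RefuteN1.
Context {M : structure} {HM : zfa M}.
Local Notation G := (@atom_permutation M).
Local Notation N := (N G).
Let HG : perm_group G := full_group.
Local Instance zfaN5 : zfa N := zfaN HG.
Hypothesis nA : ~ fin (atoms : M).
Implicit Types (a b c g m n x y u E : M).

(** An atom [a] of [u] outside [E] could be exchanged with a fresh atom outside both [u] and [E];
    the transposition fixes [E] but would bring the fresh atom into [u]. *)
Lemma finite_supported u E : supp E -> fin u -> sub u atoms -> supports G E u ->
  forall a, a ∊ u -> a ∊ E.
Proof.
move=> [[sE EA] fE] fu [su uA] S a au; apply: contrapT => aE.
have sA : isset (atoms : M) by exact: isset_mkset.
have [c cA cn] := infinite_diff sA nA (fin_cup fu fE).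
have aa : atom M a by rewrite -in_atoms; exact: uA.
have ac : atom M c by rewrite -in_atoms.
apply: (cn); rewrite in_cup; left.
have <- : act (transp a c) u = u.
  apply: S; first exact/sat_atom_permutation/perm_transp.
  move=> e eE; rewrite act_transp //; last by rewrite -in_atoms; exact: EA.
  apply: swap_out => E'; first by apply: aE; rewrite -E'.
  by apply: cn; rewrite in_cup -E'; right.
have pt : perm (transp a c) by exact: perm_transp.
by rewrite in_act //; exists a => //; rewrite act_transp // swapl.
Qed.

(** Let [E] support an injective sequence of finite sets of atoms. Since natural numbers do not
    move, [E] supports every term, which is thus a subset of [E], and [omega] would inject into the
    finite set [pow E]. *)
Lemma N1_refutes_IQDI : ~ N ⊨ IQDI.
Proof.
move=> Q; have [A EA] := mkN_ex HG (HS_atoms HG).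
have sA : isset A by change (isset (val A)); rewrite EA; exact: isset_mkset.
have [|w [P [f [/sat_is_omega -> [sP [HP /sat_is_inj If]]]]]] := Q A sA.
  by apply/infinite_fin => // /(fin_val (HG := HG)); rewrite EA.
have := isinj_val If (HG := HG); rewrite (val_omega HG) => Ifv.
have [E [sE S]] := HS_symm (valP HG f).
case: (Ifv) => Fv Iv.
apply: (@injection_infinite M HM (val f) (pow E)); last exact: (fin_pow (proj2 sE)).
split=> //; apply: (isfun_cod Fv) => n no; have yP := ap_in Fv no.
have [y Ey] := mem_val HG yP; rewrite -Ey in yP *.
have [/(_ yP) [[sy yA] /(sat_finite sy) fy] _] := HP y.
rewrite in_pow; split=> // a ay.
have sub : sub (val y) atoms.
  split=> // z zy; have [z' Ez] := mem_val HG zy; rewrite -Ez in zy *.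
  by rewrite -EA; exact: (yA z' zy).
apply: (finite_supported sE (fin_val (HG := HG) fy) sub) ay => g Gg Eg.
have pg := pg_perm HG Gg.
have : act g (opair n (val y)) ∊ val f.
  rewrite -(S g Gg Eg); apply: act_mem => //; rewrite Ey; exact: (ap_mem Fv).
by rewrite act_opair // (act_nat HG Gg no) => /(ap_eq Fv)[_ ->].
Qed.

(** Injections of [n] instead of subsets of size [n]: their domain shows that different
    [n] give different sets. *)
Definition injections n : M := sep (pow (prod n atoms)) (fun g => isinj g n atoms).
Lemma in_injections n g : (g ∊ injections n) <-> isinj g n atoms.
Proof.
rewrite /injections in_sep; last by dfn.
rewrite in_pow; split=> [[]//|I]; split=> //; have [F _] := I.
split=> [|p pg]; first exact: (proj1 F).
by have [x xn ->] := in_fun F pg; rewrite opair_prod; split=> //; exact: (ap_in F).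
Qed.
Lemma Tm_injections B t : Tm B t -> Tm B (fun e => injections (t e)).
Proof. by move=> ?; rewrite /injections; dfn. Qed.
Lemma injection_ex n : n ∊ omega -> exists g, g ∊ injections n.
Proof.
have sA : isset (atoms : M) by exact: isset_mkset.
have d := Tm_injections; move: n; apply: omega_ind => [||n no [g /in_injections[F I]]].
- by dfn; apply: d; dfn.
- exists (lam emp id); apply/in_injections; apply: isinj_lam; [by dfn| |] => x; by rewrite in_emp.
have dg : Tm anyp (fun e : nat -> M => ap g (e 0)) by dfn.
have [c cA cn] := infinite_diff sA nA (fin_repl dg (fin_nat no)).
pose (v x := the (fun y => (x = n /\ y = c) \/ (x <> n /\ y = ap g x))).
have v1 : v n = c by apply: the_eq => [|z [[]|[]]]; auto.
have v2 x : x <> n -> v x = ap g x by move=> xn; apply: the_eq => [|z [[]|[]]]; auto.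
have dv : Tm anyp (fun e : nat -> M => v (e 0)) by rewrite /v; dfn.
have nn x : x ∊ n -> x <> n by move=> xn E; apply: (@mem_irrefl M HM n); rewrite -{1}E.
have ne x : x ∊ n -> ap g x <> c.
  by move=> xn E; apply: cn; rewrite in_repl //; exists x.
exists (lam (succ n) v); apply/in_injections; apply: isinj_lam => // [x|x y].
  rewrite in_adj => -[xn|->]; last by rewrite v1.
  by rewrite v2; [exact: (ap_in F)|exact: nn].
rewrite !in_adj => -[xn|->] [yn|->] //.
- by rewrite !v2; [exact: I|exact: nn|exact: nn].
- by rewrite v1 v2; [move/(ne x xn)|exact: nn].
- by rewrite v1 v2; [move/esym/(ne y yn)|exact: nn].
Qed.
Lemma HS_injections n : n ∊ omega -> HS G (injections n).
Proof.
move=> no; apply: HS_intro => [|g /in_injections[F _]].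
  exists emp; split=> [|f Gf _]; first exact: supp_emp.
  have pf := pg_perm HG Gf; apply: Tm_fix => //; apply: Tm_injections.
  by apply: Tm_const; exact: (act_nat HG Gf no).
have dg : Tm anyp (fun e : nat -> M => opair (e 0) (ap g (e 0))) by dfn.
have gE : g = repl n (fun k => opair k (ap g k)).
  apply: set_eqP => [||p]; [exact: (proj1 F)|exact: isset_repl|].
  rewrite in_repl //; apply: propext; split=> [/(in_fun F)[x xn ->]|[x xn ->]]; first by exists x.
  exact: (ap_mem F).
apply: (HS_fin HG); first by rewrite gE; apply: fin_repl => //; exact: fin_nat.
move=> p /(in_fun F)[x xn ->]; apply: (HS_opair HG).
  exact: (HS_nat HG (omega_trans no xn)).
by apply: (HS_atom G); rewrite -in_atoms; exact: (ap_in F).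
Qed.

(** With [E] supporting the function, take [n] too large to inject into [E]. The finite set chosen
    from [injections n] is supported by [E], and so is the finite union [U] of the ranges. Hence [U]
    is contained in [E], and any chosen member injects [n] into [E]. *)
Lemma N1_refutes_CMC : ~ N ⊨ CMC.
Proof.
move=> C; have dI := Tm_injections.
have dI' : Tm anyp (fun e : nat -> M => injections (e 0)) by apply: dI; dfn.
pose (D := repl omega injections); pose (h := lam omega injections).
have inD x : (x ∊ D) = exists2 n, n ∊ omega & x = injections n by rewrite /D in_repl.
have bij : isbij h omega D.
  apply: isbij_lam => //.
  - by move=> n no; rewrite inD; exists n.
  - move=> m n mo no E; have [g gm] := injection_ex mo.
    have [F _] := proj1 (in_injections m g) gm.
    have [F' _] : isinj g n atoms by apply/in_injections; rewrite -E.
    apply: set_eqP => [||k]; [exact: isset_nat|exact: isset_nat|].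
    apply: propext; split=> [km|kn].
      by have [] := ap_eq F' (ap_mem F km).
    by have [] := ap_eq F (ap_mem F' kn).
  - by move=> y; rewrite inD => -[n no ->]; exists n.
have HSh : HS G h.
  apply: HS_intro => [|y]; last first.
    rewrite /h in_lam // => -[n no ->]; apply: (HS_opair HG); last exact: HS_injections.
    exact: (HS_nat HG).
  exists emp; split=> [|f Gf _]; first exact: supp_emp.
  apply: Tm_fix; first exact: (pg_perm HG Gf).
  by apply: Tm_lam; [dfn|apply: dI; dfn].
have HSD : HS G D.
  apply: HS_intro => [|y]; last by rewrite inD => -[n no ->]; exact: HS_injections.
  exists emp; split=> [|f Gf _]; first exact: supp_emp.
  apply: Tm_fix; first exact: (pg_perm HG Gf).
  by apply: Tm_repl; [dfn|apply: dI; dfn].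
have [D' ED denD] := denumerable_lift HG bij HSh HSD.
have [x xD|f [Ff Hc]] := C D' denD.
  have : val x ∊ D by rewrite -ED.
  rewrite inD => -[n no Ex]; have [g gn] := injection_ex no.
  have [g' Eg] := mkN_ex HG (HS_mem (HS_injections no) gn); exists g'.
  by change (val g' ∊ val x); rewrite Eg Ex.
have [c Fv] := fun_on_val HG Ff; rewrite ED in Fv.
have [E [sE S]] := HS_symm (valP HG f); have [[_ EA] fE] := sE.
have [n no noinj] := finite_no_injection fE.
have nD : injections n ∊ D by rewrite inD; exists n.
have yf := ap_mem Fv nD; set y := ap (val f) (injections n) in yf.
have [x Ex] := mkN_ex HG (HS_injections no).
have HSy : HS G y.
  have Hp := HS_mem (valP HG f) yf.
  have up : upair (injections n) y ∊ opair (injections n) y by rewrite /opair in_upair; right.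
  by apply: (HS_mem (HS_mem Hp up)); rewrite in_upair; right.
have [y' Ey] := mkN_ex HG HSy.
have [[sy yx] [[g gy] fy]] : sat N (subset y' x ∧ nonempty y' ∧ finite y')%fo.
  apply: (Hc x _ y'); first by change (val x ∊ val D'); rewrite Ex ED.
  by apply: (sat_app_val HG); rewrite Ex Ey.
have {}fy : fin y by rewrite -Ey; apply: (fin_val (HG := HG)); exact/sat_finite.
have yI g' : g' ∊ y -> isinj g' n atoms.
  rewrite -Ey => gy'; have [g2 Eg] := mem_val HG gy'; rewrite -Eg in gy' *.
  by apply/in_injections; rewrite -Ex; exact: yx.
have fixy s : sat M (G s) -> fixes E s -> act s y = y.
  move=> Gs Es; have ps := pg_perm HG Gs.
  have EI : act s (injections n) = injections n.
    by apply: Tm_fix => //; apply: dI; apply: Tm_const; exact: (act_nat HG Gs no).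
  have : act s (opair (injections n) y) ∊ val f.
    by rewrite -(S s Gs Es); exact: act_mem.
  by rewrite act_opair // EI => /(ap_eq Fv)[_ ->].
pose (ran g := repl n (ap g)).
have dran : Tm anyp (fun e : nat -> M => ran (e 0)) by rewrite /ran; dfn.
have inran g' a : (a ∊ ran g') = exists2 k, k ∊ n & a = ap g' k by rewrite /ran in_repl //; dfn.
pose (U := bigcup (repl y ran)).
have fU : fin U.
  apply: fin_bigcup => [|u]; first exact: fin_repl.
  rewrite in_repl // => -[g' _ ->]; apply: fin_repl; [by dfn|exact: fin_nat].
have inU a : (a ∊ U) = exists2 g', g' ∊ y & exists2 k, k ∊ n & a = ap g' k.
  rewrite /U in_bigcup; apply: propext; split=> [[u]|[g' gy' H]].
    by rewrite in_repl // => -[g' gy' ->]; rewrite inran; exists g'.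
  by exists (ran g'); rewrite ?inran // in_repl //; exists g'.
have UA : sub U atoms.
  split=> [|a]; first exact: isset_bigcup.
  by rewrite inU => -[g' /yI[F _] [k kn ->]]; exact: (ap_in F).
have SU : supports G E U.
  move=> s Gs Es; have ps := pg_perm HG Gs; apply: Tm_fix => //.
  rewrite /U /ran; apply: Tm_bigcup; apply: Tm_repl; first by apply: Tm_const; exact: fixy.
  by apply: Tm_repl; [apply: Tm_const; exact: (act_nat HG Gs no)|dfn].
have gy' : val g ∊ y by rewrite -Ey.
have [F I] := yI _ gy'; apply: (noinj (val g)); split=> //.
apply: (isfun_cod F) => k kn; apply: (finite_supported sE fU UA SU).
by rewrite inU; exists (val g) => //; exists k.
Qed.
End RefuteN1.

(** * A ground model *)

(** A model of ZFA + AC: Aczel trees with countably many atoms, modulo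
    bisimulation. *)
Inductive tree : Type := Leaf of nat | Node (A : Type) of (A -> tree).

Fixpoint bisim (x y : tree) : Prop :=
  match x, y with
  | Leaf m, Leaf n => m = n
  | Node A f, Node B g =>
      (forall a, exists b, bisim (f a) (g b)) /\ (forall b, exists a, bisim (f a) (g b))
  | _, _ => False
  end.
Lemma bisim_refl x : bisim x x.
Proof. by elim: x => //= A f IH; split=> a; exists a. Qed.
Lemma bisim_sym x y : bisim x y -> bisim y x.
Proof.
elim: x y => [m|A f IH] [n|B g] //= [H1 H2]; split=> [b|a].
  by have [a ab] := H2 b; exists a; exact: IH.
by have [b ab] := H1 a; exists b; exact: IH.
Qed.
Lemma bisim_trans x y z : bisim x y -> bisim y z -> bisim x z.
Proof.
elim: x y z => [m|A f IH] [n|B g] [k|D h] //=; first by move=> ->.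
move=> [H1 H2] [H3 H4]; split=> [a|d].
  by have [b ab] := H1 a; have [d bd] := H3 b; exists d; exact: IH bd.
by have [b bd] := H4 d; have [a ab] := H2 b; exists a; exact: IH bd.
Qed.

Lemma cid_ext (T : Type) (P Q : T -> Prop) (p : exists x, P x) (q : exists x, Q x) :
  P = Q -> projT1 (cid p) = projT1 (cid q).
Proof. by move=> E; case: _ / E q => q; rewrite (Prop_irrelevance p q). Qed.
(** The choice operator is applied to the predicate [bisim x]. Bisimilar trees have equal predicates
    by extensionality, hence the same representative, so the fixed points of [canon] serve as the
    quotient. *)
Definition canon (x : tree) : tree := projT1 (cid (ex_intro (bisim x) x (bisim_refl x))).
Lemma canonP x : bisim x (canon x).
Proof. exact: (projT2 (cid (ex_intro (bisim x) x (bisim_refl x)))). Qed.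
Lemma canon_eq x y : bisim x y -> canon x = canon y.
Proof.
move=> xy; have E : bisim x = bisim y.
  apply: funext => z; apply: propext; split; apply: bisim_trans => //.
  exact: bisim_sym.
exact: cid_ext E.
Qed.

Definition aset : Type := {x : tree | canon x = x}.
Definition aclass (x : tree) : aset := exist _ (canon x) (esym (canon_eq (canonP x))).
Definition arep (c : aset) : tree := proj1_sig c.
Lemma arepK c : aclass (arep c) = c.
Proof. by case: c => x E; apply: eq_exist. Qed.
Lemma aclass_eq x y : aclass x = aclass y <-> bisim x y.
Proof.
split=> [/(congr1 arep) E|/canon_eq E]; last exact: eq_exist.
by apply: bisim_trans (canonP x) _; rewrite [canon x]E; apply: bisim_sym; exact: canonP.
Qed.

Definition children (x : tree) : Type := if x is Node A _ then A else Empty_set.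
Definition child (x : tree) : children x -> tree :=
  match x with Leaf _ => fun e => match e with end | Node A f => f end.

Definition aczel : structure := {|
  carrier := aset;
  mem := fun x y => exists a, bisim (arep x) (@child (arep y) a);
  atom := fun x => if arep x is Leaf _ then True else False |}.
Local Notation C := aczel.
Implicit Types (c d u v x y z : C).

Definition leaf (n : nat) : C := aclass (Leaf n).
Definition coll (A : Type) (h : A -> C) : C := aclass (Node (fun a => arep (h a))).
Definition elt (c : C) : children (arep c) -> C := fun a => aclass (child a).

Lemma in_elt x c : (x ∊ c) <-> exists a, x = @elt c a.
Proof.
split=> -[a H]; exists a; first by rewrite -(arepK x); apply/aclass_eq.
by apply/aclass_eq; rewrite arepK.
Qed.
Lemma in_coll A (h : A -> C) x : (x ∊ coll h) <-> exists a, x = h a.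
Proof.
have := canonP (Node (fun a => arep (h a))).
rewrite /= /coll /arep /=; case: (canon _) => //= B g [H1 H2]; split=> -[a H].
  have [b E] := H2 a; exists b; rewrite -(arepK x) -(arepK (h b)); apply/aclass_eq.
  by apply: bisim_trans H _; exact: bisim_sym.
by have [b E] := H1 a; exists b; rewrite H.
Qed.
Lemma coll_set A (h : A -> C) : ~ atom C (coll h).
Proof.
have := canonP (Node (fun a => arep (h a))).
by rewrite /= /coll /arep /=; case: (canon _) => [n|B g] //=; auto.
Qed.
Lemma atom_leaf n : atom C (leaf n).
Proof. by rewrite /= /arep /=; have := canonP (Leaf n); case: (canon _). Qed.
Lemma leaf_ex x : atom C x -> exists n, x = leaf n.
Proof.
by rewrite -{2}(arepK x) /=; case: (arep x) => // n _; exists n.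
Qed.
Lemma leaf_inj m n : leaf m = leaf n -> m = n.
Proof. by move=> /aclass_eq. Qed.
Lemma aczel_ext x y : ~ atom C x -> ~ atom C y -> (forall z, z ∊ x <-> z ∊ y) -> x = y.
Proof.
rewrite -(arepK x) -(arepK y) => sx sy H; apply/aclass_eq; move: H sx sy.
rewrite !arepK => H /=; have Hx := in_elt^~ x; have Hy := in_elt^~ y; rewrite /elt in Hx Hy.
have H1 a : exists b, bisim (@child (arep x) a) (@child (arep y) b).
  have /H /Hy [b /aclass_eq E] : (aclass (@child (arep x) a) : C) ∊ x by apply/Hx; exists a.
  by exists b.
have H2 b : exists a, bisim (@child (arep x) a) (@child (arep y) b).
  have /H /Hx [a /aclass_eq E] : (aclass (@child (arep y) b) : C) ∊ y by apply/Hy; exists b.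
  by exists a; exact: bisim_sym.
by move: H1 H2; case: (arep x) => [m|A f] //; case: (arep y).
Qed.
Lemma atom_empty x y : atom C x -> ~ y ∊ x.
Proof. by move=> + /in_elt[a _]; rewrite /=; case: (arep x) a. Qed.
Lemma aczel_ind (P : C -> Prop) : (forall x, (forall y, y ∊ x -> P y) -> P x) -> forall x, P x.
Proof.
move=> H x; rewrite -(arepK x); elim: (arep x) => [n|A f IH]; apply: H => y.
  by move=> /(atom_empty (atom_leaf n)).
have -> : aclass (Node f) = coll (fun a => aclass (f a)).
  apply/aclass_eq; split=> a; exists a; exact: canonP.
by move=> /in_coll[a ->].
Qed.

Definition aemp : C := coll (fun e : Empty_set => match e with end).
Lemma in_aemp x : ~ x ∊ aemp. Proof. by move=> /in_coll[[]]. Qed.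
Definition asucc (x : C) : C :=
  coll (fun o => if o is Some a then @elt x a else x).
Lemma in_asucc x y : (y ∊ asucc x) <-> y ∊ x \/ y = x.
Proof.
split=> [/in_coll[[a|] ->]|[/in_elt[a ->]|->]].
- by left; apply/in_elt; exists a.
- by right.
- by apply/in_coll; exists (Some a).
- by apply/in_coll; exists None.
Qed.
Fixpoint num (n : nat) : C := if n is n.+1 then asucc (num n) else aemp.

Lemma aczel_zfa : zfa C.
Proof.
split; first by exists; exact: aemp.
move=> q; case=> [env|env|env|env|env|env|env|env|env|phi env|phi env].
- exact: aczel_ext.
- by move=> a aa x; exact: atom_empty.
- exists (coll leaf); split=> [|x]; first exact: coll_set.
  by split=> [/in_coll[n ->]|/leaf_ex[n ->]]; [exact: atom_leaf|apply/in_coll; exists n].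
- by exists aemp; split=> [|y]; [exact: coll_set|exact: in_aemp].
- move=> x y; exists (coll (fun b : bool => if b then x else y)); split=> [|z]; first exact: coll_set.
  split=> [/in_coll[[] ->]|[->|->]]; [by left|by right| |]; apply/in_coll.
    by exists true.
  by exists false.
- move=> s; exists (coll (fun p : {a : children (arep s) & children (arep (@elt s a))} =>
    @elt (@elt s (projT1 p)) (projT2 p))); split=> [|x]; first exact: coll_set.
  split=> [/in_coll[[a b] ->]|[y [/in_elt[a ->] /in_elt[b ->]]]]; last first.
    by apply/in_coll; exists (existT _ a b).
  by exists (@elt s a); split; apply/in_elt; [exists a|exists b].
(* Subsets of [x] are indexed by arbitrary predicates on its children; every set included in [x]
   arises from the predicate of being one of its members. *)
- move=> x; exists (coll (fun P : children (arep x) -> Prop =>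
    coll (fun a : {a | P a} => @elt x (proj1_sig a)))); split=> [|y]; first exact: coll_set.
  split=> [/in_coll[P ->]|[ys yx]].
    split=> [|z /in_coll[[a Pa] ->]]; first exact: coll_set.
    by apply/in_elt; exists a.
  apply/in_coll; exists (fun a => @elt x a ∊ y); apply: aczel_ext => // [|z]; first exact: coll_set.
  split=> [zy|/in_coll[[a Pa] ->]] //.
  have [a E] := proj1 (in_elt z x) (yx z zy); apply/in_coll.
  have Pa : @elt x a ∊ y by rewrite -E.
  by exists (exist _ a Pa).
- exists (coll num); split.
    exists aemp; split; first by apply/in_coll; exists 0.
    by split; [exact: coll_set|exact: in_aemp].
  move=> y /in_coll[n ->]; exists (num n.+1); split; first by apply/in_coll; exists n.+1.
  by split=> [|z]; [exact: coll_set|exact: in_asucc].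
- move=> x [y yx]; apply: contrapT => H.
  have: forall z, ~ z ∊ x; last by move/(_ y).
  apply: aczel_ind => z IH zx; apply: H; exists z; split=> // -[w [wx wz]].
  exact: (IH w wz wx).
- move=> a; exists (coll (fun i : {i : children (arep a) |
      sat C (embed phi (scons (@elt a i) env))} => @elt a (proj1_sig i))).
  split=> [|x]; first exact: coll_set.
  split=> [/in_coll[[i Hi] ->]|[/in_elt[i ->] Hi]]; first by split=> //; apply/in_elt; exists i.
  by apply/in_coll; exists (exist _ i Hi).
(* Only the children that have a value are kept as indices; the choice operator picks a value, and
   functionality makes it the right one. *)
- move=> F a; pose (Q i := exists y : C, sat C (embed phi (scons y (scons (@elt a i) env)))).
  exists (coll (fun i : {i : children (arep a) | Q i} => projT1 (cid (proj2_sig i)))).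
  split=> [|y]; first exact: coll_set.
  split=> [/in_coll[[i Hi] ->]|[x [/in_elt[i ->] Hy]]].
    exists (@elt a i); split; first by apply/in_elt; exists i.
    exact: (projT2 (cid Hi)).
  apply/in_coll; have Hi : Q i by exists y.
  by exists (exist _ i Hi); apply: (F _ _ _ Hy); exact: (projT2 (cid Hi)).
Qed.
#[local] Existing Instance aczel_zfa.

(** Any function of the metatheory on the children of a set becomes a set through [coll], so choice
    functions come from the choice operator. *)
Lemma aczel_AC : C ⊨ AC.
Proof.
move=> F sF ne.
pose (ch x := if pselect (exists y : C, y ∊ x) is left H then projT1 (cid H) else aemp).
have chP x : x ∊ F -> ch x ∊ x.
  move=> xF; rewrite /ch; case: pselect => [H|]; first exact: (projT2 (cid H)).
  by case; exact: (ne x xF).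
pose (f := coll (fun i => opair (@elt F i) (ch (@elt F i)))).
have inf x y : (opair x y ∊ f) <-> x ∊ F /\ y = ch x.
  split=> [/in_coll[i /opair_inj[-> ->]]|[/in_elt[i ->] ->]]; last by apply/in_coll; exists i.
  by split=> //; apply/in_elt; exists i.
exists f; split=> [|x xF y /sat_app /inf[_ ->]]; last exact: chP.
exists (bigcup F); apply/sat_is_fun; split; first exact: coll_set.
split=> [p /in_coll[i ->]|x xF].
  have iF : @elt F i ∊ F by apply/in_elt; exists i.
  exists (@elt F i), (ch (@elt F i)); split=> //; split=> //.
  by rewrite in_bigcup; exists (@elt F i) => //; exact: chP.
exists (ch x); split; first exact/inf.
by move=> z /inf[].
Qed.

Lemma aczel_ground : ground_model C.
Proof. by split; [exact: zfa_axiom|exact: aczel_AC]. Qed.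

Lemma num_succ n : num n.+1 = succ (num n).
Proof.
apply: set_ext => [||z]; [exact: coll_set|exact: isset_adj|].
by rewrite in_adj; exact: in_asucc.
Qed.
Lemma num0 : num 0 = emp.
Proof. by apply: empP; [exact: coll_set|exact: in_aemp]. Qed.
Lemma num_omega n : num n ∊ omega.
Proof. by elim: n => [|n IH]; [rewrite num0; exact: omega0|rewrite num_succ; exact: omegaS]. Qed.
(** Since [coll num] is inductive, [omega] has standard elements only. Sequences of the metatheory
    therefore become functions of the model, which is how atoms and pairs are enumerated. *)
Lemma omega_num x : x ∊ omega -> exists n, x = num n.
Proof.
rewrite in_omega => /(_ (coll num)) H; apply/in_coll; apply: H.
split; first by apply/in_coll; exists 0; rewrite num0.
by move=> y /in_coll[n ->]; apply/in_coll; exists n.+1; rewrite num_succ.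
Qed.
Lemma num_lt m n : (m < n)%N -> num m ∊ num n.
Proof.
elim: n => // n IH; rewrite ltnS leq_eqVlt => /orP[/eqP ->|/IH H]; apply/in_asucc; auto.
Qed.
Lemma num_inj m n : num m = num n -> m = n.
Proof.
move=> E; case: (ltngtP m n) => // /num_lt; rewrite E => /mem_irrefl //.
Qed.

Definition enum (h : nat -> C) : C := coll (fun n => opair (num n) (h n)).
Lemma in_enum h x y : (opair x y ∊ enum h) <-> exists n, x = num n /\ y = h n.
Proof.
split=> [/in_coll[n /opair_inj[-> ->]]|[n [-> ->]]]; first by exists n.
by apply/in_coll; exists n.
Qed.
Lemma isfun_enum h b : (forall n, h n ∊ b) -> isfun (enum h) omega b.
Proof.
move=> H; split; first exact: coll_set.
split=> [p /in_coll[n ->]|x /omega_num[n ->]].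
  by exists (num n), (h n); split; [exact: num_omega|].
exists (h n); split; first by apply/in_enum; exists n.
by move=> z /in_enum[m [/num_inj -> ->]].
Qed.
Lemma ap_enum h b n : (forall n, h n ∊ b) -> ap (enum h) (num n) = h n.
Proof.
move=> H; have F := isfun_enum H.
by have [] := ap_eq F (proj2 (in_enum h (num n) (h n)) (ex_intro _ n (conj erefl erefl))).
Qed.

Lemma aczel_atoms : C ⊨ denumerably_many_atoms.
Proof.
have L n : leaf n ∊ atoms by rewrite in_atoms; exact: atom_leaf.
exists atoms; split; first exact/sat_atom_set.
apply: (denumerable_bij (h := enum leaf)); split.
  split=> [|x y /omega_num[m ->] /omega_num[n ->]]; first exact: isfun_enum.
  by rewrite !(ap_enum _ L) => /leaf_inj ->.
move=> y; rewrite in_atoms => /leaf_ex[n ->]; exists (num n); first exact: num_omega.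
exact: (ap_enum _ L).
Qed.

Lemma aczel_pairs : exists P : C, sat C (pair_partition P).
Proof.
pose (h n := upair (leaf n.*2) (leaf n.*2.+1)).
have hP n : h n ∊ pow atoms.
  rewrite in_pow; split=> [|z]; first exact: isset_upair.
  by rewrite in_upair in_atoms => -[->|->]; exact: atom_leaf.
have inh n k : (leaf k ∊ h n) <-> k./2 = n.
  rewrite in_upair; split=> [[/leaf_inj ->|/leaf_inj ->]|<-].
  - exact: doubleK.
  - by rewrite -add1n halfD /= odd_double doubleK.
  - by rewrite -{1 3}(odd_double_half k); case: (odd k); [right|left].
exists (enum h), omega, atoms.
split; first exact/sat_is_omega.
split; first exact/sat_atom_set.
split; first by exists (pow atoms); apply/sat_is_fun; exact: isfun_enum.
split; [|split].
- move=> x _ u /sat_app /in_enum[n [_ ->]].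
  exists (leaf n.*2); split; first by rewrite in_atoms; exact: atom_leaf.
  exists (leaf n.*2.+1); split; first by rewrite in_atoms; exact: atom_leaf.
  by split; [move/leaf_inj/eqP; rewrite eqn_leq ltnn andbF|exact/sat_upair].
- move=> x y u v z /sat_app /in_enum[m [-> ->]] /sat_app /in_enum[n [-> ->]].
  move=> zm' zn; have zm := zm'; rewrite in_upair in zm.
  have [k E] : exists k, z = leaf k by case: zm => ->; eexists.
  by subst z; move: zm' zn => /inh <- /inh <-.
- move=> a aA; have : atom C a by rewrite -in_atoms.
  move=> /leaf_ex[k ->]; exists (num k./2), (h k./2).
  by split; [apply/sat_app/in_enum; exists k./2|exact/inh].
Qed.

Theorem theorem5p4 :
  true_in_N1 limit_point_compact_T1_well_orderable /\
  (true_in_N1 compact_hausdorff_contains_N_infty /\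
   true_in_N3 compact_hausdorff_contains_N_infty) /\
  true_in_N2 compact_hausdorff_contains_metrizable_scattered /\
  (ZFA_consistent ->
   ~ ZFA_proves (implies compact_hausdorff_contains_metrizable_scattered CAC_fin) /\
   ~ ZFA_proves (implies compact_hausdorff_contains_metrizable_scattered IQDI) /\
   ~ ZFA_proves (implies compact_hausdorff_contains_metrizable_scattered CMC)).
Proof.
split; first exact: N1_well_orderable.
split; first by split; [exact: N1_N_infty|exact: N3_N_infty].
split; first exact: N2_metrizable.
move=> _; have Z := aczel_zfa; have HG := aczel_ground.
have [P HP] := aczel_pairs; have D := aczel_atoms.
have nA : ~ fin (atoms : aczel) by exact: denumerable_atoms D.
have Z1 := zfaN (HM := Z) (@full_group aczel Z).
have Z2 := zfaN (HM := Z) (pair_group HP).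
split; [|split].
- apply: (not_implied Z2); last exact: (N2_refutes_CAC_fin HP).
    by move=> e; exact: (conj (fun H => H) (fun H => H)).
  exact: N2_metrizable.
- apply: (not_implied Z1); last exact: (N1_refutes_IQDI nA).
    by move=> e; exact: (conj (fun H => H) (fun H => H)).
  exact: N1_metrizable.
- apply: (not_implied Z1); last exact: (N1_refutes_CMC nA).
    by move=> e; exact: (conj (fun H => H) (fun H => H)).
  exact: N1_metrizable.
Qed.
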